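(* Let $H$ be a logarithmic neighborhood of $-\infty$ contained in $\{\mathrm{Re}(w)\le 0\}$, let $\beta_1<\beta_2$ be two real points, $r>0$ and $I=\,]\beta_1-r,\beta_1+r[\,\cup\,]\beta_2-r,\beta_2+r[$. Then the map $S_{[\beta_1,\beta_2]}:E_0^{(I)}(H)\to E_0^{(I)}(-1+H)$ is continuous. Similarly, if $\beta_3\in\mathbb R^+$ and $I=\,]\beta_3-r,\beta_3+r[$, the map $S_{[\beta_3,+\infty[}:E_0^{(I)}(H)\to E_0^{(I)}(-1+H)$ is continuous.
   Context: Notation. $\mathbb R^+=[0,\infty)$, $R(w_0,v)=\{w_0+tv:t\ge0\}$, $C_-(w_0,\theta)=w_0-\{w\in\mathbb C^*:|\mathrm{Arg}(w)|<\theta\}$, $C_+(\beta,\theta)=\beta+\{p\in\mathbb C^*:|\mathrm{Arg}(p)|<\theta\}$. A neighborhood of $-\infty$ is a set $H\subset\mathbb C$ such that for every $\theta\in[0,\pi/2[$ there is $w_0\in H$ with $C_-(w_0,\theta)\subset H$, and such that $H=\bigcup_{w_0\in H\cap\mathbb R}C_-(w_0,\theta(w_0))$, where $\theta(w_0)\le\pi/2$ is the biggest angle with $C_-(w_0,\theta(w_0))\subset H$. Its border has the form $\{x+iy: x=\rho(|y|)\}$ with $\rho$ convex on $\mathbb R^+$. It is called logarithmic if there are $c\in\mathbb R$, $k>0$ with $\rho(y)=c-k\log(y)$ for $y$ big enough. $-1+H$ is the translate of $H$ by $-1$. $E_0(H)$ is the space of bounded holomorphic functions on $H$ extending continuously to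 the border, with the norm $\|g\|_H=\sup_H|g|$. Laplace transform. For $g\in E_0(H)$ and $w_0\in H$, $\mathcal L_{w_0}g\in\mathcal O(\mathbb C\setminus\mathbb R^+)$ is defined by $\mathcal L_{w_0}g(p)=\int_{w_0}^{w_1}g(w)e^{-pw}dw+\int_{R(w_1,v)}g(w)e^{-pw}dw$ for any ray $R(w_1,v)\subset\overline H$ with $\mathrm{Re}(v)<0$, $\mathrm{Re}(pv)>0$ (independent of $w_1,v$). Changing $w_0$ adds an entire function of exponential type, and $\mathcal Lg$ denotes any of these functions modulo such entire functions. The support $\mathrm{supp}(\mathcal Lg)\subset\mathbb R^+$ is the set of $\beta\in\mathbb R^+$ such that $\mathcal L_{w_0}g$ does not extend holomorphically to a neighborhood of $\beta$ (independent of $w_0$). For an open set $I\subset\mathbb R$, $E_0^{(I)}(H)$ is the subspace of $E_0(H)$ of functions $g$ such that $\mathrm{supp}(\mathcal Lg)\cap I=\emptyset$, with the supremum norm. Partial sums. If $\beta_1<\beta_2$ belong to $I$ and $g\in E_0^{(I)}(H)$, then $S_{[\beta_1,\beta_2]}g(w)=\frac{1}{2i\pi}\int_\gamma\mathcal Lg(p)e^{pw}dp$, where $\gamma$ is a simple loop in $(\mathbb C\setminus\mathbb R^+)\cup I$ circling once around $[\beta_1,\beta_2]$ in the direct (counterclockwise) sense and meeting $\mathbb R$ exactly at $\beta_1$ and $\beta_2$. If $\beta_3\in I$, $S_{[\beta_3,+\infty[}g(w)$ is defined by the same integral along the path $\gamma$ which is the border of $C_+(0,\theta)\cap\{\mathrm{Re}(p)\ge\beta_3\}$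 for some $\theta\in\,]0,\pi/2[$ (chosen, depending on $w$, small enough for convergence; the value does not depend on $\theta$), oriented from the upper half-plane to the lower one, i.e. going counterclockwise around $[\beta_3,+\infty[$. *)

(* Defs.v *)
(* Stdlib reals with Coquelicot (complex numbers, limits, integrals). *)
From Stdlib Require Export Reals List.
From Coquelicot Require Export Coquelicot.
Open Scope R_scope.

Definition Cexp (z : C) : C := (exp (Re z) * cos (Im z), exp (Re z) * sin (Im z)).

(* Principal determination, in ]-PI, PI]; only meaningful for z <> 0. *)
Definition Carg (z : C) : R :=
  if Rle_dec 0 (Im z) then acos (Re z / Cmod z) else - acos (Re z / Cmod z).

Definition incl_set (A B : C -> Prop) : Prop := forall w, A w -> B w.

Definition closure (A : C -> Prop) (w : C) : Prop :=
  forall eps : posreal, exists z : C, ball w eps z /\ A z.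

Definition border (A : C -> Prop) (w : C) : Prop :=
  closure A w /\ closure (fun z => ~ A z) w.

(* C \ R^+ *)
Definition slit (p : C) : Prop := ~ (Im p = 0 /\ 0 <= Re p).

Definition holomorphic_at (f : C -> C) (w : C) : Prop :=
  ex_derive (K := C_AbsRing) (V := C_NormedModule) f w.

(** * Neighborhoods of -oo *)

Definition cone_minus (w0 : C) (theta : R) (w : C) : Prop :=
  (w0 - w)%C <> 0%C /\ Rabs (Carg (w0 - w)%C) < theta.

Definition biggest_angle (H : C -> Prop) (w0 : C) (theta : R) : Prop :=
  theta <= PI / 2 /\ incl_set (cone_minus w0 theta) H /\
  forall theta', theta' <= PI / 2 -> incl_set (cone_minus w0 theta') H ->
    theta' <= theta.

Definition neighborhood_minus_infty (H : C -> Prop) : Prop :=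
  (forall theta, 0 <= theta < PI / 2 ->
     exists w0, H w0 /\ incl_set (cone_minus w0 theta) H) /\
  (forall w, H w <->
     exists (x theta : R),
       H (RtoC x) /\ biggest_angle H (RtoC x) theta /\ cone_minus (RtoC x) theta w).

Definition convex_on_Rplus (rho : R -> R) : Prop :=
  forall x y t, 0 <= x -> 0 <= y -> 0 <= t <= 1 ->
    rho (t * x + (1 - t) * y) <= t * rho x + (1 - t) * rho y.

Definition border_profile (H : C -> Prop) (rho : R -> R) : Prop :=
  convex_on_Rplus rho /\
  forall w, border H w <-> Re w = rho (Rabs (Im w)).

Definition logarithmic_neighborhood (H : C -> Prop) : Prop :=
  neighborhood_minus_infty H /\
  exists rho, border_profile H rho /\
    exists c k : R, 0 < k /\
      Rbar_locally p_infty (fun y => rho y = c - k * ln y).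

Definition translate (a : R) (H : C -> Prop) (w : C) : Prop := H (w - RtoC a)%C.

(** * The spaces E_0 *)

(* An element of E_0(H) is represented by a function on C of which only the
   values on the closure of H matter: those on the border are the values of the
   continuous extension. *)
Definition E0 (H : C -> Prop) (g : C -> C) : Prop :=
  (forall w, H w -> holomorphic_at g w) /\
  (exists M, forall w, H w -> Cmod (g w) <= M) /\
  continuous_on (T := C_UniformSpace) (U := C_UniformSpace) (closure H) g.

Definition norm_sup (H : C -> Prop) (g : C -> C) : R :=
  real (Lub_Rbar (fun x => exists w, H w /\ x = Cmod (g w))).

(** * Paths *)

Definition path_derive (gam : R -> C) (t : R) : C :=
  (Derive (fun s => Re (gam s)) t, Derive (fun s => Im (gam s)) t).

(* Piecewise C^1 on [a,b], in terms of the values of gam on [a,b] only; l lists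
   the breakpoints. *)
Definition piecewise_C1 (gam : R -> C) (a b : R) : Prop :=
  continuous_on (T := R_UniformSpace) (U := C_UniformSpace)
    (fun t => a <= t <= b) gam /\
  exists l : list R,
    (forall t, a < t < b -> ~ In t l ->
       ex_derive (V := C_R_NormedModule) gam t /\
       continuous (U := C_UniformSpace) (path_derive gam) t) /\
    (forall t, a <= t < b -> exists d : C,
       filterlim (path_derive gam) (at_right t) (locally (T := C_UniformSpace) d)) /\
    (forall t, a < t <= b -> exists d : C,
       filterlim (path_derive gam) (at_left t) (locally (T := C_UniformSpace) d)).

Definition is_path_integral (f : C -> C) (gam : R -> C) (a b : R) (l : C) : Prop :=
  is_RInt (V := C_R_NormedModule)
    (fun t => (f (gam t) * path_derive gam t)%C) a b l.

(* Integral of f along the half-line w1 + t v, t >= 0. *)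
Definition is_ray_integral (f : C -> C) (w1 v l : C) : Prop :=
  is_RInt_gen (V := C_R_NormedModule)
    (fun t => (f (w1 + RtoC t * v) * v)%C) (at_point 0) (Rbar_locally p_infty) l.

(** * Laplace transform *)

Definition is_Laplace (H : C -> Prop) (g : C -> C) (w0 p l : C) : Prop :=
  exists (w1 v : C) (gam : R -> C) (l1 l2 : C),
    piecewise_C1 gam 0 1 /\ gam 0 = w0 /\ gam 1 = w1 /\
    (forall t, 0 <= t <= 1 -> closure H (gam t)) /\
    (forall t, 0 <= t -> closure H (w1 + RtoC t * v)%C) /\
    Re v < 0 /\ 0 < Re (p * v)%C /\
    is_path_integral (fun w => (g w * Cexp (- (p * w)))%C) gam 0 1 l1 /\
    is_ray_integral (fun w => (g w * Cexp (- (p * w)))%C) w1 v l2 /\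
    l = (l1 + l2)%C.

(* The function L_{w0} g on C \ R^+; its values on R^+ are meaningless. *)
Definition Laplace (H : C -> Prop) (g : C -> C) (w0 p : C) : C :=
  iota (T := C_R_CompleteNormedModule) (is_Laplace H g w0 p).

Definition Laplace_extends_at (H : C -> Prop) (g : C -> C) (w0 : C) (beta : R) : Prop :=
  exists (eps : posreal) (f : C -> C),
    (forall p, Cmod (p - RtoC beta)%C < eps -> holomorphic_at f p) /\
    (forall p, Cmod (p - RtoC beta)%C < eps -> slit p -> f p = Laplace H g w0 p).

Definition supp_Laplace (H : C -> Prop) (g : C -> C) (beta : R) : Prop :=
  0 <= beta /\ exists w0, H w0 /\ ~ Laplace_extends_at H g w0 beta.

Definition E0_I (I : R -> Prop) (H : C -> Prop) (g : C -> C) : Prop :=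
  E0 H g /\ forall beta, I beta -> ~ supp_Laplace H g beta.

(** * Partial sums *)

(* (C \ R^+) U I *)
Definition slit_with (I : R -> Prop) (p : C) : Prop :=
  slit p \/ exists x : R, I x /\ p = RtoC x.

(* f is L_{w0} g, extended holomorphically across I. *)
Definition is_Laplace_across (H : C -> Prop) (I : R -> Prop) (g : C -> C)
    (w0 : C) (f : C -> C) : Prop :=
  (forall p, slit_with I p -> holomorphic_at f p) /\
  (forall p, slit p -> f p = Laplace H g w0 p).

(* The last clause says that the winding number around each point of
   ]beta1, beta2[ is 1. *)
Definition simple_direct_loop (I : R -> Prop) (beta1 beta2 : R) (gam : R -> C) : Prop :=
  piecewise_C1 gam 0 1 /\ gam 0 = gam 1 /\
  (forall s t, 0 <= s < 1 -> 0 <= t < 1 -> gam s = gam t -> s = t) /\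
  (forall t, 0 <= t <= 1 -> slit_with I (gam t)) /\
  (forall x : R, (exists t, 0 <= t <= 1 /\ gam t = RtoC x) <-> x = beta1 \/ x = beta2) /\
  (forall x : R, beta1 < x < beta2 ->
     is_path_integral (fun z => / (z - RtoC x))%C gam 0 1 (2 * Ci * RtoC PI)%C).

Definition is_partial_sum (H : C -> Prop) (I : R -> Prop) (beta1 beta2 : R)
    (g : C -> C) (w s : C) : Prop :=
  exists (w0 : C) (f : C -> C) (gam : R -> C) (J : C),
    H w0 /\ is_Laplace_across H I g w0 f /\
    simple_direct_loop I beta1 beta2 gam /\
    is_path_integral (fun p => (f p * Cexp (p * w))%C) gam 0 1 J /\
    s = (J / (2 * Ci * RtoC PI))%C.

Definition partial_sum (H : C -> Prop) (I : R -> Prop) (beta1 beta2 : R)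
    (g : C -> C) (w : C) : C :=
  iota (T := C_R_CompleteNormedModule) (is_partial_sum H I beta1 beta2 g w).

(* Integral of F along the border of C_+(0,theta) /\ {Re p >= beta3}: the upper
   half-line travelled inwards, the vertical segment downwards (reduced to a
   point if beta3 = 0), the lower half-line outwards. *)
Definition is_wedge_integral (F : C -> C) (beta3 theta : R) (l : C) : Prop :=
  exists l1 l2 l3 : C,
    is_ray_integral F (beta3, beta3 * tan theta) (1, tan theta) l1 /\
    is_RInt (V := C_R_NormedModule) (fun t => (F (beta3, t) * Ci)%C)
      (beta3 * tan theta) (- (beta3 * tan theta)) l2 /\
    is_ray_integral F (beta3, - (beta3 * tan theta)) (1, - tan theta) l3 /\
    l = (- l1 + l2 + l3)%C.

(* Convergence depends on the representative L_{w0} g, on theta and on w; any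
   choice of w0 and theta for which the integral converges is allowed. *)
Definition is_partial_sum_infty (H : C -> Prop) (I : R -> Prop) (beta3 : R)
    (g : C -> C) (w s : C) : Prop :=
  exists (w0 : C) (f : C -> C) (theta : R) (J : C),
    H w0 /\ is_Laplace_across H I g w0 f /\ 0 < theta < PI / 2 /\
    is_wedge_integral (fun p => (f p * Cexp (p * w))%C) beta3 theta J /\
    s = (J / (2 * Ci * RtoC PI))%C.

Definition partial_sum_infty (H : C -> Prop) (I : R -> Prop) (beta3 : R)
    (g : C -> C) (w : C) : C :=
  iota (T := C_R_CompleteNormedModule) (is_partial_sum_infty H I beta3 g w).

Definition ball_set (x r : R) (y : R) : Prop := x - r < y < x + r.

(* S maps E_0^{(I)}(H) to E_0^{(I)}(H') and is continuous for the sup norms. *)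
Definition continuous_E0_I (I : R -> Prop) (H H' : C -> Prop)
    (S : (C -> C) -> (C -> C)) : Prop :=
  (forall g, E0_I I H g -> E0_I I H' (S g)) /\
  (forall g, E0_I I H g -> forall eps, 0 < eps -> exists delta, 0 < delta /\
     forall h, E0_I I H h ->
       norm_sup H (fun w => h w - g w)%C < delta ->
       norm_sup H' (fun w => S h w - S g w)%C < eps).

(* Main.v *)
(** Across the gaps of its support, [Lg] extends holomorphically, so that the partial sum over
    [[beta1, beta2]] is [1 / (2 i pi)] times the integral of [Lg(p) e^(pw)] over the border of a rectangle
    whose vertical sides can be moved inside the gaps.

    Sup norm.  On the horizontal sides, [Lg] is an integral of [g(w') e^(-pw')] over half of the curve
    [Re w' = c - (k/2) log(1 + y'^2) - s], which lies in [H] because [H] is logarithmic.  Exchanging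
    the integrals leaves the kernel [(e^(beta2 (w - w')) - e^(beta1 (w - w'))) / (w - w')].  Averaging it over
    the crossing points with a smooth bump makes it decay as fast as needed, which beats the power
    [(1 + y'^2)^O(1)] coming from [e^(-p w')] on the curve, uniformly for [w] in [-1 + H].

    Support.  The transform of the partial sum is a Cauchy integral of [Lg] over the rectangle,
    holomorphic outside of it; moving the sides shows that the gaps are kept.

    Half-lines.  Rotating rays and Cauchy's formula in a sector give the Laplace inversion formula
    [S_[beta3,+oo[ g = g - S_[-1,beta3] g], first for [w] far to the left, then for every [w] by analytic
    continuation in the translation of [w] and an Abel limit. *)
Require Import Defs.
From Stdlib Require Import Lra Lia Psatz ClassicalEpsilon FunctionalExtensionality PropExtensionality.

(** The obstacle is that the two half-curve integrals for [Lg] converge only for [Im p] of opposite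
    signs and degenerate on the real axis, while the bound must involve [g] through its sup norm
    alone. So the horizontal sides are put at a small height [eta], the curves are cut at a finite
    [Y], and the errors of both are made arbitrarily small after the averaging. The logarithmic
    shape is decisive here: for two points on such curves the real parts differ by at most a
    constant plus [k/2 ln (2 (1 + y^2))], [y] being the difference of the ordinates. Hence
    exponentials of [B |Re z|] are bounded by powers of [1 + y^2], and a bump of fixed order,
    depending on [k] and the crossing points but not on [w], wins. The gap around each crossing
    point is the room used by the averaging. For the half-line no such estimate is attempted:
    inversion trades the unbounded contour for a rectangle whose left side passes through [-1],
    where [Lg] is holomorphic whatever its support. Both operators then have the form
    [kap g + sig rect_sum] and are treated at once. *)

Notation ccont := (@continuous C_UniformSpace C_UniformSpace).
Notation rcont := (@continuous R_UniformSpace C_UniformSpace).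

(** * Elementary facts on complex numbers and the exponential *)

Lemma C_ext (a b : C) : Re a = Re b -> Im a = Im b -> a = b.
Proof. destruct a, b; unfold Re, Im; simpl; intros -> ->; reflexivity. Qed.

Ltac cring := apply C_ext; unfold Re, Im; simpl; ring.

Ltac tri := eapply Rle_trans; [apply Cmod_triangle|].
Ltac tri_lt := eapply Rle_lt_trans; [apply Cmod_triangle|].
Ltac rmul := apply Rmult_le_compat; auto using Cmod_ge_0.

Ltac ordered := rewrite Rmin_left, Rmax_right by lra.
Tactic Notation "ordered" "in" hyp(H) := rewrite Rmin_left, Rmax_right in H by lra.

Ltac pos := solve [repeat first
  [ assumption | lra | apply Rmult_lt_0_compat | apply Rmult_le_pos | apply Rdiv_lt_0_compat | apply Rinv_0_lt_compat
  | apply exp_pos | apply Cmod_ge_0 | apply Rabs_pos | apply pow2_ge_0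
  | apply Rlt_le, exp_pos | apply Rlt_le, Rinv_0_lt_compat ]].

Lemma im_le_Cmod (z : C) : Rabs (Im z) <= Cmod z.
Proof.
  eapply Rle_trans; [|apply Rmax_Cmod]. apply Rmax_r.
Qed.

Lemma Cmod_le_sum (z : C) : Cmod z <= Rabs (Re z) + Rabs (Im z).
Proof.
  unfold Cmod.
  rewrite <- (sqrt_pow2 (Rabs (Re z) + Rabs (Im z))).
  2: pose proof (Rabs_pos (Re z)); pose proof (Rabs_pos (Im z)); lra.
  apply sqrt_le_1_alt.
  pose proof (Rabs_pos (Re z)); pose proof (Rabs_pos (Im z)).
  pose proof (pow2_abs (Re z)); pose proof (pow2_abs (Im z)). unfold Re, Im in *.
  nra.
Qed.

Lemma Cmod_minus_sym (a b : C) : Cmod (a - b) = Cmod (b - a).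
Proof. rewrite <- Cmod_opp. f_equal. cring. Qed.

Lemma Cmod_rev_triangle (a b : C) : Cmod a - Cmod b <= Cmod (a - b).
Proof.
  pose proof (Cmod_triangle (a - b) b).
  replace (a - b + b)%C with a in H by cring. lra.
Qed.

Lemma Cmod_triangle_minus (a b : C) : Cmod (a - b) <= Cmod a + Cmod b.
Proof. unfold Cminus. tri. rewrite Cmod_opp. lra. Qed.

Lemma Re_minus (a b : C) : Re (a - b) = Re a - Re b. Proof. reflexivity. Qed.
Lemma Im_minus (a b : C) : Im (a - b) = Im a - Im b. Proof. reflexivity. Qed.
Lemma Re_mult (a b : C) : Re (a * b) = Re a * Re b - Im a * Im b. Proof. reflexivity. Qed.

Lemma Cexp_plus (a b : C) : Cexp (a + b) = (Cexp a * Cexp b)%C.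
Proof.
  unfold Cexp. apply C_ext; unfold Re, Im; simpl; rewrite exp_plus;
  [rewrite cos_plus | rewrite sin_plus]; ring.
Qed.

Lemma Cexp_0 : Cexp 0 = 1%C.
Proof. unfold Cexp. apply C_ext; unfold Re, Im; simpl; rewrite exp_0;
  [rewrite cos_0|rewrite sin_0]; ring. Qed.

Lemma Cmod_Cexp (z : C) : Cmod (Cexp z) = exp (Re z).
Proof.
  unfold Cexp, Cmod; simpl.
  match goal with |- sqrt ?x = _ => replace x with (exp (Re z) ^ 2) end.
  - apply sqrt_pow2. apply Rlt_le, exp_pos.
  - pose proof (sin2_cos2 (Im z)). unfold Rsqr in H. nra.
Qed.

Lemma exp_le_le (x y : R) : x <= y -> exp x <= exp y.
Proof. intros [H| ->]; [left; apply exp_increasing|right]; auto. Qed.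

(** * Continuity *)

Section Cont.
Context {T : UniformSpace}.

Lemma cont_fst (f : T -> C) x :
  continuous (U := C_UniformSpace) f x -> continuous (fun y => fst (f y)) x.
Proof. intro H. apply (continuous_comp f (fun z : C_UniformSpace => fst z)); auto. apply continuous_fst. Qed.

Lemma cont_snd (f : T -> C) x :
  continuous (U := C_UniformSpace) f x -> continuous (fun y => snd (f y)) x.
Proof. intro H. apply (continuous_comp f (fun z : C_UniformSpace => snd z)); auto. apply continuous_snd. Qed.

Lemma cont_pair (f : T -> C) x :
  continuous (fun y => fst (f y)) x -> continuous (fun y => snd (f y)) x ->
  continuous (U := C_UniformSpace) f x.
Proof.
  intros H1 H2. apply filterlim_locally. intro eps.
  apply filterlim_locally with (eps := eps) in H1.
  apply filterlim_locally with (eps := eps) in H2.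
  generalize (filter_and _ _ H1 H2). apply filter_imp. intros y [A B]. split; assumption.
Qed.

Lemma cont_Rplus (f g : T -> R) x :
  continuous f x -> continuous g x -> continuous (fun y => f y + g y) x.
Proof. intros; apply (continuous_plus (V := R_NormedModule)); auto. Qed.
Lemma cont_Rminus (f g : T -> R) x :
  continuous f x -> continuous g x -> continuous (fun y => f y - g y) x.
Proof. intros; apply (continuous_minus (V := R_NormedModule)); auto. Qed.
Lemma cont_Rmult (f g : T -> R) x :
  continuous f x -> continuous g x -> continuous (fun y => f y * g y) x.
Proof. intros; apply (continuous_mult (K := R_AbsRing)); auto. Qed.
Lemma cont_Ropp (f : T -> R) x :
  continuous f x -> continuous (fun y => - f y) x.
Proof. intros; apply (continuous_opp (V := R_NormedModule)); auto. Qed.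
Lemma cont_Rcomp (h : R -> R) (f : T -> R) x :
  continuity_pt h (f x) -> continuous f x -> continuous (fun y => h (f y)) x.
Proof.
  intros H1 H2. apply (continuous_comp f h); auto.
  apply continuity_pt_filterlim. exact H1.
Qed.

Lemma cont_Cplus (f g : T -> C) x :
  continuous (U := C_UniformSpace) f x -> continuous (U := C_UniformSpace) g x ->
  continuous (U := C_UniformSpace) (fun y => f y + g y)%C x.
Proof.
  intros Hf Hg. apply cont_pair; simpl; apply cont_Rplus; auto using cont_fst, cont_snd.
Qed.
Lemma cont_Copp (f : T -> C) x :
  continuous (U := C_UniformSpace) f x -> continuous (U := C_UniformSpace) (fun y => - f y)%C x.
Proof.
  intros Hf. apply cont_pair; simpl; apply cont_Ropp; auto using cont_fst, cont_snd.
Qed.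
Lemma cont_Cminus (f g : T -> C) x :
  continuous (U := C_UniformSpace) f x -> continuous (U := C_UniformSpace) g x ->
  continuous (U := C_UniformSpace) (fun y => f y - g y)%C x.
Proof. intros Hf Hg. apply cont_Cplus; auto. apply cont_Copp; auto. Qed.
Lemma cont_Cmult (f g : T -> C) x :
  continuous (U := C_UniformSpace) f x -> continuous (U := C_UniformSpace) g x ->
  continuous (U := C_UniformSpace) (fun y => f y * g y)%C x.
Proof.
  intros Hf Hg. apply cont_pair; simpl; [apply cont_Rminus|apply cont_Rplus];
  apply cont_Rmult; auto using cont_fst, cont_snd.
Qed.
Lemma cont_Cinv (f : T -> C) x :
  continuous (U := C_UniformSpace) f x -> f x <> 0%C ->
  continuous (U := C_UniformSpace) (fun y => / f y)%C x.
Proof.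
  intros Hf Hn.
  assert (Hd : fst (f x) ^ 2 + snd (f x) ^ 2 <> 0).
  { intro E. apply Hn. apply C_ext; unfold Re, Im; simpl;
    [assert (fst (f x) ^ 2 = 0) by nra | assert (snd (f x) ^ 2 = 0) by nra]; nra. }
  assert (Hc : continuous (fun y => / (fst (f y) ^ 2 + snd (f y) ^ 2)) x).
  { apply (cont_Rcomp Rinv (fun y => (fst (f y) ^ 2 + snd (f y) ^ 2))).
    - apply continuity_pt_inv; [apply derivable_continuous_pt, derivable_pt_id | exact Hd].
    - simpl. apply cont_Rplus; (apply cont_Rmult; [|apply cont_Rmult; [|apply continuous_const]]);
      auto using cont_fst, cont_snd. }
  apply cont_pair; simpl; apply cont_Rmult; auto using cont_fst.
  apply cont_Ropp; auto using cont_snd.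
Qed.
Lemma cont_Cdiv (f g : T -> C) x :
  continuous (U := C_UniformSpace) f x -> continuous (U := C_UniformSpace) g x -> g x <> 0%C ->
  continuous (U := C_UniformSpace) (fun y => f y / g y)%C x.
Proof. intros. apply cont_Cmult; auto. apply cont_Cinv; auto. Qed.
Lemma cont_RtoC (f : T -> R) x :
  continuous f x -> continuous (U := C_UniformSpace) (fun y => RtoC (f y)) x.
Proof. intros. apply cont_pair; simpl; auto. apply continuous_const. Qed.
Lemma cont_Cexp (f : T -> C) x :
  continuous (U := C_UniformSpace) f x -> continuous (U := C_UniformSpace) (fun y => Cexp (f y)) x.
Proof.
  intros Hf. apply cont_pair; simpl; apply cont_Rmult.
  1,3: apply (cont_Rcomp exp); [apply derivable_continuous_pt, derivable_pt_exp|apply cont_fst, Hf].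
  apply (cont_Rcomp cos); [apply continuity_cos|apply cont_snd, Hf].
  apply (cont_Rcomp sin); [apply continuity_sin|apply cont_snd, Hf].
Qed.
Lemma cont_Cmod (f : T -> C) x :
  continuous (U := C_UniformSpace) f x -> continuous (fun y => Cmod (f y)) x.
Proof.
  intro Hf. unfold Cmod. apply (cont_Rcomp sqrt (fun y => fst (f y) ^ 2 + snd (f y) ^ 2)).
  - apply continuity_pt_sqrt. nra.
  - simpl. apply cont_Rplus; (apply cont_Rmult; [|apply cont_Rmult; [|apply continuous_const]]);
      auto using cont_fst, cont_snd.
Qed.
Lemma cont_mkC (f g : T -> R) x :
  continuous f x -> continuous g x -> continuous (U := C_UniformSpace) (fun y => (f y, g y)) x.
Proof. intros. apply cont_pair; simpl; auto. Qed.
Lemma cont_Re (f : T -> C) x :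
  continuous (U := C_UniformSpace) f x -> continuous (fun y => Re (f y)) x.
Proof. apply cont_fst. Qed.
Lemma cont_Im (f : T -> C) x :
  continuous (U := C_UniformSpace) f x -> continuous (fun y => Im (f y)) x.
Proof. apply cont_snd. Qed.
Lemma cont_Cconst (c : C) (x : T) : continuous (U := C_UniformSpace) (fun _ : T => c) x.
Proof. apply continuous_const. Qed.
Lemma cont_comp_C (f : T -> C) (g : C -> C) x :
  continuous (U := C_UniformSpace) f x -> ccont g (f x) ->
  continuous (U := C_UniformSpace) (fun y => g (f y)) x.
Proof. intros. apply (continuous_comp f g); auto. Qed.
Lemma cont_comp_R (f : T -> R) (g : R -> C) x :
  continuous f x -> rcont g (f x) ->
  continuous (U := C_UniformSpace) (fun y => g (f y)) x.
Proof. intros. apply (continuous_comp f g); auto. Qed.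
End Cont.

Lemma cont_Cid (z : C) : ccont (fun w => w) z.
Proof. apply continuous_id. Qed.
Lemma cont_Rid (t : R) : continuous (fun s : R => s) t.
Proof. apply continuous_id. Qed.

Lemma rcont_RtoC (t : R) : rcont RtoC t.
Proof. apply (cont_RtoC (fun s : R => s)), cont_Rid. Qed.

Ltac csolve :=
  repeat first
  [ assumption | apply rcont_RtoC
  | apply cont_Cid | apply cont_Rid
  | apply cont_Cconst
  | apply (@continuous_const _ R_UniformSpace)
  | match goal with
    | |- continuous (Cmult ?p) _ => apply (cont_Cmult (fun _ => p) (fun y => y))
    | |- continuous (Cplus ?p) _ => apply (cont_Cplus (fun _ => p) (fun y => y))
    | |- continuous (Cminus ?p) _ => apply (cont_Cminus (fun _ => p) (fun y => y))
    | |- continuous Copp _ => apply (cont_Copp (fun y => y))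
    | |- continuous Cexp _ => apply (cont_Cexp (fun y => y))
    | |- continuous (Rmult ?p) _ => apply (cont_Rmult (fun _ => p) (fun y => y))
    | |- continuous (Rplus ?p) _ => apply (cont_Rplus (fun _ => p) (fun y => y))
    | |- continuous Re _ => apply (cont_Re (fun y => y))
    | |- continuous Im _ => apply (cont_Im (fun y => y))
    | |- continuous (pair ?p) _ => apply (cont_mkC (fun _ => p) (fun y => y))
    | |- continuous (Rminus ?p) _ => apply (cont_Rminus (fun _ => p) (fun y => y))
    | |- continuous (fun y => (_ + _)%C) _ => apply cont_Cplus
    | |- continuous (fun y => (_ - _)%C) _ => apply cont_Cminus
    | |- continuous (fun y => (- _)%C) _ => apply cont_Copp
    | |- continuous (fun y => (_ * _)%C) _ => apply cont_Cmult
    | |- continuous (fun y => (_ / _)%C) _ => apply cont_Cdiv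
    | |- continuous (fun y => (/ _)%C) _ => apply cont_Cinv
    | |- continuous (fun y => Cexp _) _ => apply cont_Cexp
    | |- continuous (fun y => RtoC _) _ => apply cont_RtoC
    | |- continuous (fun y => (_, _)) _ => apply cont_mkC
    | |- continuous (fun y => Cmod _) _ => apply cont_Cmod
    | |- continuous (fun y => Re _) _ => apply cont_Re
    | |- continuous (fun y => Im _) _ => apply cont_Im
    | |- continuous (fun y => fst _) _ => apply cont_fst
    | |- continuous (fun y => snd _) _ => apply cont_snd
    | |- continuous (fun y => _ + _) _ => apply cont_Rplus
    | |- continuous (fun y => _ - _) _ => apply cont_Rminus
    | |- continuous (fun y => _ * _) _ => apply cont_Rmult
    | |- continuous (fun y => - _) _ => apply cont_Ropp
    end ].

(** The uniform structure on [C] is that of a product, whose balls are squares; comparing them with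
    discs of the modulus costs a factor two. *)
Lemma ccont_eps (f : C -> C) z :
  ccont f z <-> forall eps, 0 < eps -> exists d, 0 < d /\
    forall w, Cmod (w - z) < d -> Cmod (f w - f z) < eps.
Proof.
  split.
  - intros H eps He.
    assert (He2 : 0 < eps / 2) by lra.
    pose proof (proj1 (filterlim_locally _ _) H (mkposreal _ He2)) as [d Hd].
    exists d; split; [apply cond_pos|]. intros w Hw.
    assert (B : ball z d w).
    { split; [pose proof (re_le_Cmod (w - z))|pose proof (im_le_Cmod (w - z))];
      unfold ball; simpl; unfold AbsRing_ball, abs, minus, plus, opp; simpl;
      unfold Re, Im in *; simpl in *; unfold Rminus in *; lra. }
    destruct (Hd w B) as [B1 B2]. unfold ball in B1, B2; simpl in B1, B2.
    unfold AbsRing_ball, abs, minus, plus, opp in B1, B2; simpl in B1, B2.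
    eapply Rle_lt_trans; [apply Cmod_le_sum|]. unfold Re, Im; simpl. lra.
  - intros H. apply filterlim_locally. intros eps.
    destruct (H eps (cond_pos eps)) as [d [Hd Hw]].
    assert (Hd2 : 0 < d / 2) by lra.
    exists (mkposreal _ Hd2). intros w [B1 B2].
    unfold ball in B1, B2; simpl in B1, B2.
    unfold AbsRing_ball, abs, minus, plus, opp in B1, B2; simpl in B1, B2.
    assert (L : Cmod (w - z) < d).
    { eapply Rle_lt_trans; [apply Cmod_le_sum|]. unfold Re, Im; simpl. lra. }
    specialize (Hw w L).
    split; [pose proof (re_le_Cmod (f w - f z))|pose proof (im_le_Cmod (f w - f z))];
      unfold ball; simpl; unfold AbsRing_ball, abs, minus, plus, opp; simpl;
      unfold Re, Im in *; simpl in *; unfold Rminus in *; lra.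
Qed.

Lemma rcont_eps (f : R -> C) t :
  rcont f t <-> forall eps, 0 < eps -> exists d, 0 < d /\
    forall s, Rabs (s - t) < d -> Cmod (f s - f t) < eps.
Proof.
  split.
  - intros H eps He.
    assert (He2 : 0 < eps / 2) by lra.
    pose proof (proj1 (filterlim_locally _ _) H (mkposreal _ He2)) as [d Hd].
    exists d; split; [apply cond_pos|]. intros w Hw.
    destruct (Hd w Hw) as [B1 B2]. unfold ball in B1, B2; simpl in B1, B2.
    unfold AbsRing_ball, abs, minus, plus, opp in B1, B2; simpl in B1, B2.
    eapply Rle_lt_trans; [apply Cmod_le_sum|]. unfold Re, Im; simpl. lra.
  - intros H. apply filterlim_locally. intros eps.
    destruct (H eps (cond_pos eps)) as [d [Hd Hw]].
    exists (mkposreal _ Hd). intros w B.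
    specialize (Hw w B).
    split; [pose proof (re_le_Cmod (f w - f t))|pose proof (im_le_Cmod (f w - f t))];
      unfold ball; simpl; unfold AbsRing_ball, abs, minus, plus, opp; simpl;
      unfold Re, Im in *; simpl in *; unfold Rminus in *; lra.
Qed.

(** * Complex derivative *)

Definition cder (f : C -> C) (z l : C) : Prop :=
  forall eps, 0 < eps -> exists d, 0 < d /\
    forall w, Cmod (w - z) < d -> Cmod (f w - f z - l * (w - z)) <= eps * Cmod (w - z).

Lemma is_derive_cder (f : C -> C) z l :
  is_derive (K := C_AbsRing) (V := C_NormedModule) f z l <-> cder f z l.
Proof.
  split.
  - intros [_ H] eps He.
    assert (Hz : is_filter_lim (locally (T := AbsRing_UniformSpace C_AbsRing) z) z) by (intros P HP; exact HP).
    specialize (H z Hz (mkposreal _ He)). destruct H as [d Hd].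
    exists d; split; [apply cond_pos|]. intros w Hw.
    specialize (Hd w Hw). simpl in Hd.
    change (norm (minus (minus (f w) (f z)) (scal (minus w z) l)) <= eps * norm (minus w z)) in Hd.
    replace (f w - f z - l * (w - z))%C with (minus (minus (f w) (f z)) (scal (minus w z) l)).
    2: { unfold scal, minus, plus, opp; simpl; unfold mult; simpl. cring. }
    eapply Rle_trans; [|eapply Rle_trans; [apply Hd|]].
    + right. reflexivity.
    + right. reflexivity.
  - intros H. split.
    + apply is_linear_scal_l.
    + intros x Hx. apply (@is_filter_lim_locally_unique C_AbsRing (AbsRing_NormedModule C_AbsRing)) in Hx. subst x.
      intros eps. destruct (H eps (cond_pos eps)) as [d [Hd Hw]].
      exists (mkposreal _ Hd). intros w B. specialize (Hw w B).
      change (norm (minus (minus (f w) (f z)) (scal (minus w z) l)) <= eps * norm (minus w z)).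
      replace (minus (minus (f w) (f z)) (scal (minus w z) l)) with (f w - f z - l * (w - z))%C.
      2: { unfold scal, minus, plus, opp; simpl; unfold mult; simpl. cring. }
      exact Hw.
Qed.

Lemma holomorphic_at_cder f z : holomorphic_at f z <-> exists l, cder f z l.
Proof.
  split; intros [l H]; exists l; apply is_derive_cder; exact H.
Qed.

Lemma cder_cont f z l : cder f z l -> ccont f z.
Proof.
  intros H. apply ccont_eps. intros eps He.
  destruct (H 1 Rlt_0_1) as [d [Hd Hw]].
  pose proof (Cmod_ge_0 l) as Hl.
  exists (Rmin d (eps / (Cmod l + 2))). split.
  - apply Rmin_pos; auto. apply Rdiv_lt_0_compat; lra.
  - intros w Hw'. assert (H1 : Cmod (w - z) < d) by (eapply Rlt_le_trans; [exact Hw'|apply Rmin_l]).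
    assert (H2 : Cmod (w - z) < eps / (Cmod l + 2)) by (eapply Rlt_le_trans; [exact Hw'|apply Rmin_r]).
    specialize (Hw w H1).
    replace (f w - f z)%C with ((f w - f z - l * (w - z)) + l * (w - z))%C by cring.
    tri_lt. rewrite Cmod_mult.
    apply Rmult_lt_compat_r with (r := Cmod l + 2) in H2; [|lra].
    replace (eps / (Cmod l + 2) * (Cmod l + 2)) with eps in H2 by (field; lra).
    pose proof (Cmod_ge_0 (w - z)). nra.
Qed.

Lemma cder_ext_loc f g z l d : 0 < d -> (forall w, Cmod (w - z) < d -> f w = g w) ->
  cder f z l -> cder g z l.
Proof.
  intros Hd E H eps He. destruct (H eps He) as [d' [Hd' Hw]].
  exists (Rmin d d'). split; [apply Rmin_pos; auto|].
  intros w Hw'. rewrite <- !E.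
  - apply Hw. eapply Rlt_le_trans; [exact Hw'|apply Rmin_r].
  - replace (z - z)%C with (RtoC 0) by cring. rewrite Cmod_0; auto.
  - eapply Rlt_le_trans; [exact Hw'|apply Rmin_l].
Qed.

Lemma cder_ext f g z l : (forall w, f w = g w) -> cder f z l -> cder g z l.
Proof. intros E. apply cder_ext_loc with (d := 1); [lra|auto]. Qed.

Lemma cder_const c z : cder (fun _ => c) z 0.
Proof. apply is_derive_cder, (is_derive_const (K := C_AbsRing) (V := C_NormedModule)). Qed.

Lemma cder_id z : cder (fun w => w) z 1.
Proof.
  intros eps He. exists 1; split; [lra|]. intros w _.
  replace (w - z - 1 * (w - z))%C with (RtoC 0) by cring.
  rewrite Cmod_0. pose proof (Cmod_ge_0 (w - z)). nra.
Qed.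

Lemma cder_plus f g z l m : cder f z l -> cder g z m -> cder (fun w => f w + g w)%C z (l + m)%C.
Proof. rewrite <- !is_derive_cder. apply (is_derive_plus (K := C_AbsRing) (V := C_NormedModule)). Qed.

Lemma cder_scal c f z l : cder f z l -> cder (fun w => c * f w)%C z (c * l)%C.
Proof.
  intros Hf eps He. pose proof (Cmod_ge_0 c) as Hc.
  destruct (Hf (eps / (Cmod c + 1)) ltac:(apply Rdiv_lt_0_compat; lra)) as [d [P W]].
  exists d; split; auto. intros w Hw. specialize (W w Hw).
  replace (c * f w - c * f z - c * l * (w - z))%C
    with (c * (f w - f z - l * (w - z)))%C by cring.
  rewrite Cmod_mult. pose proof (Cmod_ge_0 (w - z)) as Hz.
  pose proof (Cmod_ge_0 (f w - f z - l * (w - z))) as Hz2.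
  assert (E : eps = eps / (Cmod c + 1) * (Cmod c + 1)) by (field; lra).
  assert (0 < eps / (Cmod c + 1)) by (apply Rdiv_lt_0_compat; lra).
  rewrite E. set (e := eps / (Cmod c + 1)) in *.
  apply Rle_trans with (Cmod c * (e * Cmod (w - z))); [apply Rmult_le_compat_l; auto|].
  assert (0 <= e * Cmod (w - z)) by (apply Rmult_le_pos; lra). nra.
Qed.

Lemma cder_opp f z l : cder f z l -> cder (fun w => - f w)%C z (- l)%C.
Proof. rewrite <- !is_derive_cder. apply (is_derive_opp (K := C_AbsRing) (V := C_NormedModule)). Qed.

Lemma cder_minus f g z l m : cder f z l -> cder g z m -> cder (fun w => f w - g w)%C z (l - m)%C.
Proof. rewrite <- !is_derive_cder. apply (is_derive_minus (K := C_AbsRing) (V := C_NormedModule)). Qed.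

(** The parameter space is abstract so that one estimate gives the chain rule both for a complex
    variable ([cder_comp]) and for a real one ([rderive_comp]). [D] is the linear part of [gam] and
    [N] bounds its slope. *)
Lemma chain_estimate {T : Type} (dist : T -> R) (gam D : T -> C) F (c l : C) N :
  (forall s, 0 <= dist s) -> 0 <= N -> (forall s, Cmod (D s) <= N * dist s) ->
  (forall eps, 0 < eps -> exists d, 0 < d /\ forall s, dist s < d -> Cmod (gam s - c - D s) <= eps * dist s) ->
  cder F c l ->
  forall eps, 0 < eps -> exists d, 0 < d /\ forall s, dist s < d -> Cmod (F (gam s) - F c - l * D s) <= eps * dist s.
Proof.
  intros Hdist HN HD Hg HF eps He. pose proof (Cmod_ge_0 l) as Hl.
  set (e2 := eps / (2 * (N + 1))). assert (He2 : 0 < e2) by (apply Rdiv_lt_0_compat; lra).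
  (* The cap at 1 gives the Lipschitz bound [(N + 1) * dist s] for [gam]; the other term is the
     actual error budget. *)
  set (e1 := Rmin 1 (eps / (2 * (Cmod l + 1)))).
  assert (He1 : 0 < e1) by (apply Rmin_pos; [lra|apply Rdiv_lt_0_compat; lra]).
  destruct (HF e2 He2) as [d2 [P2 W2]]. destruct (Hg e1 He1) as [d1 [P1 W1]].
  exists (Rmin d1 (d2 / (N + 1))). split; [apply Rmin_pos; auto; apply Rdiv_lt_0_compat; lra|]. intros s Hs.
  specialize (W1 s (Rlt_le_trans _ _ _ Hs (Rmin_l _ _))). specialize (Hdist s). specialize (HD s).
  assert (Hs2 : (N + 1) * dist s < d2).
  { apply Rlt_le_trans with ((N + 1) * (d2 / (N + 1))); [|right; field; lra].
    apply Rmult_lt_compat_l; [lra|]. apply (Rlt_le_trans _ _ _ Hs (Rmin_r _ _)). }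
  assert (B : Cmod (gam s - c) <= (N + 1) * dist s).
  { replace (gam s - c)%C with ((gam s - c - D s) + D s)%C by cring. tri.
    assert (e1 <= 1) by apply Rmin_l. nra. }
  specialize (W2 (gam s) ltac:(lra)).
  replace (F (gam s) - F c - l * D s)%C with ((F (gam s) - F c - l * (gam s - c)) + l * (gam s - c - D s))%C by cring.
  tri. rewrite Cmod_mult.
  assert (A1 : e2 * Cmod (gam s - c) <= eps / 2 * dist s).
  { apply Rle_trans with (e2 * ((N + 1) * dist s)); [apply Rmult_le_compat_l; lra|]. right. unfold e2. field. lra. }
  assert (A2 : Cmod l * (e1 * dist s) <= eps / 2 * dist s).
  { assert (Cmod l * e1 <= eps / 2).
    { apply Rle_trans with ((Cmod l + 1) * (eps / (2 * (Cmod l + 1)))); [apply Rmult_le_compat; try lra; apply Rmin_r|right; field; lra]. }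
    rewrite <- Rmult_assoc. apply Rmult_le_compat_r; auto. }
  assert (A3 : Cmod l * Cmod (gam s - c - D s) <= Cmod l * (e1 * dist s)) by (apply Rmult_le_compat_l; auto).
  lra.
Qed.

Lemma cder_comp f g z l m : cder f z l -> cder g (f z) m -> cder (fun w => g (f w)) z (m * l)%C.
Proof.
  intros Hf Hg eps He.
  destruct (chain_estimate (fun w => Cmod (w - z)) f (fun w => l * (w - z))%C g (f z) m (Cmod l)) with (eps := eps) as [d [Hd B]]; auto using Cmod_ge_0.
  - intros w. rewrite Cmod_mult. lra.
  - exists d. split; auto. intros w Hw. rewrite <- Cmult_assoc. apply B; auto.
Qed.

Lemma cder_sqr z : cder (fun w => w * w)%C z (2 * z)%C.
Proof.
  intros eps He. exists eps; split; auto. intros w Hw.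
  replace (w * w - z * z - 2 * z * (w - z))%C with ((w - z) * (w - z))%C by cring.
  rewrite Cmod_mult. pose proof (Cmod_ge_0 (w - z)). nra.
Qed.

(** Polarization: [f g = ((f + g)^2 - (f - g)^2) / 4] reduces the product rule to the chain rule and
    the square. *)
Lemma cder_mult f g z l m : cder f z l -> cder g z m ->
  cder (fun w => f w * g w)%C z (l * g z + f z * m)%C.
Proof.
  intros Hf Hg.
  assert (H1 := cder_comp _ _ _ _ _ (cder_plus _ _ _ _ _ Hf Hg) (cder_sqr _)).
  assert (H2 := cder_comp _ _ _ _ _ (cder_minus _ _ _ _ _ Hf Hg) (cder_sqr _)).
  assert (H3 := cder_scal (/4) _ _ _ (cder_minus _ _ _ _ _ H1 H2)).
  cbv beta in H3.
  assert (E : forall a b : C, (/ 4 * ((a + b) * (a + b) - (a - b) * (a - b)))%C = (a * b)%C).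
  { intros a b. field. }
  eapply cder_ext in H3; [|intros w; apply E].
  match goal with H : cder _ _ ?x |- cder _ _ ?y => replace y with x; [exact H|] end.
  field.
Qed.

Lemma cder_inv (z : C) : z <> 0%C -> cder (fun w => / w)%C z (- (/ z * / z))%C.
Proof.
  intros Hz eps He. pose proof (proj1 (Cmod_gt_0 z) Hz) as Hm.
  assert (Hz3 : 0 < eps * Cmod z * Cmod z * Cmod z / 2).
  { apply Rdiv_lt_0_compat; [|lra]. repeat apply Rmult_lt_0_compat; auto. }
  exists (Rmin (Cmod z / 2) (eps * Cmod z * Cmod z * Cmod z / 2)).
  split; [apply Rmin_pos; lra|]. intros w Hw.
  assert (H1 := Rlt_le_trans _ _ _ Hw (Rmin_l _ _)).
  assert (H2 := Rlt_le_trans _ _ _ Hw (Rmin_r _ _)).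
  assert (Hwm : Cmod z / 2 < Cmod w).
  { pose proof (Cmod_rev_triangle z (z - w)). replace (z - (z - w))%C with w in H by cring.
    rewrite Cmod_minus_sym in H1. lra. }
  assert (Hw0 : w <> 0%C) by (intro E; subst; rewrite Cmod_0 in Hwm; lra).
  replace (/ w - / z - - (/ z * / z) * (w - z))%C with ((w - z) * (w - z) * (/ w * (/ z * / z)))%C by (field; auto).
  rewrite !Cmod_mult, !Cmod_inv; auto.
  pose proof (Cmod_ge_0 (w - z)) as P. set (d := Cmod (w - z)) in *.
  rewrite Rmult_assoc, (Rmult_comm d).
  apply Rmult_le_compat_r; auto.
  set (a := Cmod z) in *. set (b := Cmod w) in *.
  apply Rle_trans with ((eps * a * a * a / 2) * (/ (a / 2) * (/ a * / a))).
  - apply Rmult_le_compat; auto.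
    + left. repeat apply Rmult_lt_0_compat; apply Rinv_0_lt_compat; lra.
    + lra.
    + apply Rmult_le_compat_r; [left; apply Rmult_lt_0_compat; apply Rinv_0_lt_compat; lra|].
      apply Rinv_le_contravar; lra.
  - right. field. lra.
Qed.

(** * Complex-valued integrals over a real interval *)

Notation CInt := (@RInt C_R_CompleteNormedModule).
Notation is_CInt := (@is_RInt C_R_NormedModule).
Notation rderive := (@is_derive R_AbsRing C_R_NormedModule).

Lemma CInt_correct (h : R -> C) a b :
  (forall t, Rmin a b <= t <= Rmax a b -> rcont h t) -> is_CInt h a b (CInt h a b).
Proof.
  intros H. apply (RInt_correct (V := C_R_CompleteNormedModule)).
  apply (ex_RInt_continuous (V := C_R_CompleteNormedModule)). exact H.
Qed.

Lemma CInt_correct_all (h : R -> C) a b :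
  (forall t, rcont h t) -> is_CInt h a b (CInt h a b).
Proof. intros H; apply CInt_correct; auto. Qed.

Lemma is_CInt_unique (h : R -> C) a b (l : C) : is_CInt h a b l -> CInt h a b = l.
Proof. apply (is_RInt_unique (V := C_R_CompleteNormedModule)). Qed.

Lemma is_CInt_inj (h : R -> C) a b (l l' : C) : is_CInt h a b l -> is_CInt h a b l' -> l = l'.
Proof. intros H1 H2. rewrite <- (is_CInt_unique _ _ _ _ H1). apply is_CInt_unique, H2. Qed.

Lemma is_CInt_ext (h g : R -> C) a b (l : C) :
  (forall t, Rmin a b < t < Rmax a b -> h t = g t) -> is_CInt h a b l -> is_CInt g a b l.
Proof. apply (is_RInt_ext (V := C_R_NormedModule)). Qed.

Lemma is_CInt_plus (h g : R -> C) a b (l m : C) :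
  is_CInt h a b l -> is_CInt g a b m -> is_CInt (fun t => h t + g t)%C a b (l + m)%C.
Proof. apply (is_RInt_plus (V := C_R_NormedModule)). Qed.

Lemma is_CInt_minus (h g : R -> C) a b (l m : C) :
  is_CInt h a b l -> is_CInt g a b m -> is_CInt (fun t => h t - g t)%C a b (l - m)%C.
Proof. apply (is_RInt_minus (V := C_R_NormedModule)). Qed.

Lemma is_CInt_opp (h : R -> C) a b (l : C) :
  is_CInt h a b l -> is_CInt (fun t => - h t)%C a b (- l)%C.
Proof. apply (is_RInt_opp (V := C_R_NormedModule)). Qed.

Lemma is_CInt_swap (h : R -> C) a b (l : C) :
  is_CInt h a b l -> is_CInt h b a (- l)%C.
Proof. apply (is_RInt_swap (V := C_R_NormedModule)). Qed.

Lemma is_CInt_Chasles (h : R -> C) a b c (l m : C) :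
  is_CInt h a b l -> is_CInt h b c m -> is_CInt h a c (l + m)%C.
Proof. apply (is_RInt_Chasles (V := C_R_NormedModule)). Qed.

Lemma is_CInt_point (h : R -> C) a : is_CInt h a a (RtoC 0).
Proof. apply (is_RInt_point (V := C_R_NormedModule)). Qed.

Lemma is_CInt_const a b (c : C) : is_CInt (fun _ => c) a b (RtoC (b - a) * c)%C.
Proof.
  replace (RtoC (b - a) * c)%C with (scal (b - a) c : C_R_NormedModule).
  - apply (is_RInt_const (V := C_R_NormedModule)).
  - unfold scal; simpl; unfold prod_scal, scal; simpl; unfold mult; simpl. cring.
Qed.

Lemma is_CInt_pair (u v : R -> R) a b (x y : R) :
  is_RInt u a b x -> is_RInt v a b y -> is_CInt (fun t => (u t, v t)) a b (x, y).
Proof.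
  intros. apply (is_RInt_fct_extend_pair (U := R_NormedModule) (V := R_NormedModule)); auto.
Qed.

Lemma is_CInt_Re (h : R -> C) a b (l : C) : is_CInt h a b l -> is_RInt (fun t => Re (h t)) a b (Re l).
Proof. apply (is_RInt_fct_extend_fst (U := R_NormedModule) (V := R_NormedModule)). Qed.
Lemma is_CInt_Im (h : R -> C) a b (l : C) : is_CInt h a b l -> is_RInt (fun t => Im (h t)) a b (Im l).
Proof. apply (is_RInt_fct_extend_snd (U := R_NormedModule) (V := R_NormedModule)). Qed.

Lemma is_CInt_cmult (c : C) (h : R -> C) a b (l : C) :
  is_CInt h a b l -> is_CInt (fun t => c * h t)%C a b (c * l)%C.
Proof.
  intros H. pose proof (is_CInt_Re _ _ _ _ H) as H1. pose proof (is_CInt_Im _ _ _ _ H) as H2.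
  apply (is_CInt_ext (fun t => (Re c * Re (h t) - Im c * Im (h t), Re c * Im (h t) + Im c * Re (h t)))).
  { intros; cring. }
  apply is_CInt_pair.
  - apply (is_RInt_minus (V := R_NormedModule));
      [apply (is_RInt_scal (V := R_NormedModule) _ _ _ (Re c) _ H1)|apply (is_RInt_scal (V := R_NormedModule) _ _ _ (Im c) _ H2)].
  - apply (is_RInt_plus (V := R_NormedModule));
      [apply (is_RInt_scal (V := R_NormedModule) _ _ _ (Re c) _ H2)|apply (is_RInt_scal (V := R_NormedModule) _ _ _ (Im c) _ H1)].
Qed.

Lemma is_CInt_norm (h : R -> C) (g : R -> R) a b (l : C) lg :
  a <= b -> (forall t, a <= t <= b -> Cmod (h t) <= g t) ->
  is_CInt h a b l -> is_RInt g a b lg -> Cmod l <= lg.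
Proof.
  intros Hab H H1 H2. rewrite Cmod_norm.
  apply (norm_RInt_le (V := C_R_NormedModule) h g a b l lg); auto.
  intros t Ht. rewrite <- Cmod_norm. auto.
Qed.

Lemma is_CInt_norm_const (h : R -> C) a b (l : C) M :
  (forall t, Rmin a b <= t <= Rmax a b -> Cmod (h t) <= M) ->
  is_CInt h a b l -> Cmod l <= Rabs (b - a) * M.
Proof.
  intros H H1. destruct (Rle_dec a b) as [Hab|Hab].
  - rewrite Rabs_right by lra. ordered in H.
    rewrite Cmod_norm. apply (norm_RInt_le_const (V := C_R_NormedModule) h a b l M); auto.
    intros t Ht. rewrite <- Cmod_norm. auto.
  - rewrite Rmin_right, Rmax_left in H by lra. apply is_CInt_swap in H1.
    rewrite Rabs_left by lra. rewrite <- Cmod_opp, Cmod_norm.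
    replace (- (b - a)) with (a - b) by ring.
    apply (norm_RInt_le_const (V := C_R_NormedModule) h b a _ M); auto; [lra|].
    intros t Ht. rewrite <- Cmod_norm. auto.
Qed.

Lemma rderive_eps (h : R -> C) t (l : C) :
  rderive h t l <-> forall eps, 0 < eps -> exists d, 0 < d /\
    forall s, Rabs (s - t) < d -> Cmod (h s - h t - RtoC (s - t) * l) <= eps * Rabs (s - t).
Proof.
  assert (E : forall s, minus (minus (h s) (h t)) (scal (minus s t) l) = (h s - h t - RtoC (s - t) * l)%C).
  { intros s. unfold scal, minus, plus, opp; simpl; unfold prod_scal, prod_plus, prod_opp, scal; simpl;
    unfold mult, plus, opp; simpl. cring. }
  split.
  - intros [_ H] eps He.
    assert (Hz : is_filter_lim (locally (T := R_UniformSpace) t) t) by (intros P HP; exact HP).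
    specialize (H t Hz (mkposreal _ He)). destruct H as [d Hd].
    exists d; split; [apply cond_pos|]. intros s Hs. specialize (Hd s Hs). simpl in Hd.
    rewrite <- E, Cmod_norm. exact Hd.
  - intros H. split; [apply is_linear_scal_l|].
    intros x Hx. apply (@is_filter_lim_locally_unique R_AbsRing R_NormedModule) in Hx. subst x.
    intros eps. destruct (H eps (cond_pos eps)) as [d [Hd Hw]].
    exists (mkposreal _ Hd). intros s B. specialize (Hw s B).
    rewrite <- E, Cmod_norm in Hw. exact Hw.
Qed.

Lemma rderive_comp F (gam : R -> C) t (l d : C) :
  cder F (gam t) l -> rderive gam t d -> rderive (fun s => F (gam s)) t (l * d)%C.
Proof.
  intros HF Hg. apply rderive_eps. intros eps He.
  destruct (chain_estimate (fun s => Rabs (s - t)) gam (fun s => RtoC (s - t) * d)%C F (gam t) l (Cmod d)) with (eps := eps) as [d0 [Hd B]]; auto using Cmod_ge_0, Rabs_pos.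
  - intros s. rewrite Cmod_mult, Cmod_R. lra.
  - apply rderive_eps. exact Hg.
  - exists d0. split; auto. intros s Hs. replace (RtoC (s - t) * (l * d))%C with (l * (RtoC (s - t) * d))%C by cring. apply B; auto.
Qed.

Lemma rderive_affine (c v : C) t : rderive (fun s => c + RtoC s * v)%C t v.
Proof.
  apply rderive_eps. intros eps He. exists 1; split; [lra|]. intros s _.
  replace (c + RtoC s * v - (c + RtoC t * v) - RtoC (s - t) * v)%C with (RtoC 0) by cring.
  rewrite Cmod_0. pose proof (Rabs_pos (s - t)). nra.
Qed.

Lemma is_CInt_rderive (F f : R -> C) a b :
  (forall t, Rmin a b <= t <= Rmax a b -> rderive F t (f t)) ->
  (forall t, Rmin a b <= t <= Rmax a b -> rcont f t) ->
  is_CInt f a b (F b - F a)%C.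
Proof. intros H1 H2. apply (is_RInt_derive (V := C_R_CompleteNormedModule) F f); auto. Qed.

Lemma is_CInt_segment (F f : C -> C) (c v : C) a b :
  (forall t, Rmin a b <= t <= Rmax a b -> cder F (c + RtoC t * v)%C (f (c + RtoC t * v)%C)) ->
  (forall t, Rmin a b <= t <= Rmax a b -> ccont f (c + RtoC t * v)%C) ->
  is_CInt (fun t => f (c + RtoC t * v) * v)%C a b (F (c + RtoC b * v) - F (c + RtoC a * v))%C.
Proof.
  intros H1 H2.
  apply (is_CInt_rderive (fun t => F (c + RtoC t * v)%C)).
  - intros t Ht. apply rderive_comp; auto. apply rderive_affine.
  - intros t Ht. apply cont_Cmult; [|apply cont_Cconst].
    apply (cont_comp_C (fun t : R => (c + RtoC t * v)%C)); [csolve|auto].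
Qed.

Lemma rderive_pair (u v : R -> R) t (x y : R) :
  is_derive u t x -> is_derive v t y -> rderive (fun s => (u s, v s)) t (x, y).
Proof.
  intros D1 D2.
  assert (E : forall a b : R, ((a, b) : C) = plus (scal a (1, 0) : C_R_NormedModule) (scal b (0, 1) : C_R_NormedModule)).
  { intros. apply C_ext; unfold scal, plus, Re, Im; simpl; unfold prod_scal, scal, plus; simpl; unfold mult; simpl; ring. }
  rewrite E. eapply (is_derive_ext (V := C_R_NormedModule)); [intros s; symmetry; apply E|].
  apply (is_derive_plus (V := C_R_NormedModule)); apply (is_derive_scal_l (V := C_R_NormedModule)); auto.
Qed.

Lemma rderive_Cexp (z : C) t : rderive (fun s => Cexp (RtoC s * z)%C) t (z * Cexp (RtoC t * z))%C.
Proof.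
  apply (is_derive_ext (fun s => (exp (s * Re z) * cos (s * Im z), exp (s * Re z) * sin (s * Im z)))).
  { intros s. unfold Cexp. apply C_ext; unfold Re, Im; simpl;
    replace (s * fst z - 0 * snd z) with (s * fst z) by ring;
    replace (s * snd z + 0 * fst z) with (s * snd z) by ring; reflexivity. }
  replace (z * Cexp (RtoC t * z))%C with
    (Re (z * Cexp (RtoC t * z))%C, Im (z * Cexp (RtoC t * z))%C) by (apply C_ext; reflexivity).
  apply rderive_pair; unfold Cexp; auto_derive; auto; unfold Re, Im; simpl;
    replace (t * fst z - 0 * snd z) with (t * fst z) by ring;
    replace (t * snd z + 0 * fst z) with (t * snd z) by ring; ring.
Qed.

Lemma Cexp_integral (z : C) : is_CInt (fun t => z * Cexp (RtoC t * z))%C 0 1 (Cexp z - 1)%C.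
Proof.
  replace (Cexp z - 1)%C with (Cexp (RtoC 1 * z) - Cexp (RtoC 0 * z))%C.
  - apply (is_CInt_rderive (fun s => Cexp (RtoC s * z)%C)); intros; [apply rderive_Cexp|csolve].
  - replace (RtoC 1 * z)%C with z by cring. replace (RtoC 0 * z)%C with (RtoC 0) by cring.
    rewrite Cexp_0. reflexivity.
Qed.

Lemma Cmod_Cexp_minus_1 (z : C) : Cmod (Cexp z - 1) <= Cmod z * exp (Cmod z).
Proof.
  eapply Rle_trans; [apply (is_CInt_norm_const _ _ _ _ (Cmod z * exp (Cmod z))) with (2 := Cexp_integral z)|].
  - ordered. intros t Ht.
    rewrite Cmod_mult, Cmod_Cexp. apply Rmult_le_compat_l; [apply Cmod_ge_0|].
    apply exp_le_le. eapply Rle_trans; [apply Rle_abs|].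
    eapply Rle_trans; [apply re_le_Cmod|]. rewrite Cmod_mult, Cmod_R, Rabs_right by lra.
    pose proof (Cmod_ge_0 z). nra.
  - rewrite Rabs_right by lra. lra.
Qed.

Lemma Cmod_Cexp_minus_1_minus_id (z : C) : Cmod (Cexp z - 1 - z) <= Cmod z ^ 2 * exp (Cmod z).
Proof.
  assert (I : is_CInt (fun t => z * Cexp (RtoC t * z) - z)%C 0 1 (Cexp z - 1 - z)%C).
  { apply is_CInt_minus; [apply Cexp_integral|].
    pose proof (is_CInt_const 0 1 z) as K. replace (RtoC (1 - 0) * z)%C with z in K by cring. exact K. }
  eapply Rle_trans; [apply (is_CInt_norm_const _ _ _ _ (Cmod z ^ 2 * exp (Cmod z))) with (2 := I)|].
  - ordered. intros t Ht.
    replace (z * Cexp (RtoC t * z) - z)%C with (z * (Cexp (RtoC t * z) - 1))%C by cring.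
    rewrite Cmod_mult. simpl. rewrite Rmult_1_r, Rmult_assoc.
    apply Rmult_le_compat_l; [apply Cmod_ge_0|].
    eapply Rle_trans; [apply Cmod_Cexp_minus_1|].
    pose proof (Cmod_ge_0 z).
    assert (Cmod (RtoC t * z) <= Cmod z) by (rewrite Cmod_mult, Cmod_R, Rabs_right by lra; nra).
    apply Rmult_le_compat; [apply Cmod_ge_0|pos|auto|apply exp_le_le; auto].
  - rewrite Rabs_right by lra. lra.
Qed.

(** The remainder is [Cexp z] times [Cexp (w - z) - 1 - (w - z)], which is quadratic because
    [Cexp z - 1] is the integral of [z * Cexp (t z)] over [[0, 1]]. *)
Lemma cder_Cexp (z : C) : cder Cexp z (Cexp z).
Proof.
  intros eps He. pose proof (exp_pos (Re z)) as Hp. pose proof (exp_pos 1) as H1.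
  assert (Hq : 0 < exp (Re z) * exp 1) by pos.
  exists (Rmin 1 (eps / (exp (Re z) * exp 1))).
  split; [apply Rmin_pos; [lra|pos]|].
  intros w Hw. assert (W1 := Rlt_le_trans _ _ _ Hw (Rmin_l _ _)).
  assert (W2 := Rlt_le_trans _ _ _ Hw (Rmin_r _ _)).
  replace (Cexp w - Cexp z - Cexp z * (w - z))%C with (Cexp z * (Cexp (w - z) - 1 - (w - z)))%C.
  2: { pose proof (Cexp_plus z (w - z)) as K. replace (z + (w - z))%C with w in K by cring. rewrite K. cring. }
  rewrite Cmod_mult, Cmod_Cexp.
  set (d := Cmod (w - z)) in *. assert (Hd : 0 <= d) by apply Cmod_ge_0.
  pose proof (Cmod_Cexp_minus_1_minus_id (w - z)) as B. fold d in B.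
  assert (exp d <= exp 1) by (apply exp_le_le; lra).
  assert (d * (exp (Re z) * exp 1) <= eps).
  { apply Rmult_lt_compat_r with (r := exp (Re z) * exp 1) in W2; auto.
    replace (eps / (exp (Re z) * exp 1) * (exp (Re z) * exp 1)) with eps in W2 by (field; lra). lra. }
  apply Rle_trans with (exp (Re z) * (d ^ 2 * exp 1)).
  - apply Rmult_le_compat_l; [lra|]. eapply Rle_trans; [exact B|].
    apply Rmult_le_compat_l; auto. nra.
  - nra.
Qed.

(** * Rectangles *)

Definition on_rect (P : C -> Prop) (x1 x2 y1 y2 : R) : Prop :=
  forall x y, Rmin x1 x2 <= x <= Rmax x1 x2 -> Rmin y1 y2 <= y <= Rmax y1 y2 -> P (x, y).

Definition on_sides (P : C -> Prop) (x1 x2 y1 y2 : R) : Prop :=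
  forall x y, Rmin x1 x2 <= x <= Rmax x1 x2 -> Rmin y1 y2 <= y <= Rmax y1 y2 ->
    x = x1 \/ x = x2 \/ y = y1 \/ y = y2 -> P (x, y).

Lemma on_rect_sides P x1 x2 y1 y2 : on_rect P x1 x2 y1 y2 -> on_sides P x1 x2 y1 y2.
Proof. intros H x y Hx Hy _. apply H; auto. Qed.

Definition differentiable (f : C -> C) (z : C) : Prop := exists l, cder f z l.

Lemma differentiable_cont f z : differentiable f z -> ccont f z.
Proof. intros [l H]. apply cder_cont with l, H. Qed.

(** Integral over the border, counterclockwise when the corners are ordered. Unordered corners are
    allowed, with the signs of oriented integrals, so that rectangles can be cut and moved without
    case distinctions. *)
Definition rectint (f : C -> C) (x1 x2 y1 y2 : R) : C :=
  (CInt (fun t => f (t, y1)) x1 x2 + Ci * CInt (fun t => f (x2, t)) y1 y2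
   - CInt (fun t => f (t, y2)) x1 x2 - Ci * CInt (fun t => f (x1, t)) y1 y2)%C.

Lemma dyadic_small (w d : R) : 0 < d -> exists n : nat, forall m, (n <= m)%nat -> w / 2 ^ m < d.
Proof.
  intros Hd. destruct (archimed_cor1 (d / (Rabs w + 1))) as [N [HN HN0]].
  { apply Rdiv_lt_0_compat; auto. pose proof (Rabs_pos w); lra. }
  exists N. intros m Hm.
  assert (Hp : 0 < 2 ^ m) by (apply pow_lt; lra).
  assert (HI : INR N <= 2 ^ m).
  { assert (forall k, INR k <= 2 ^ k).
    { induction k; [simpl; lra|]. rewrite S_INR. simpl. assert (1 <= 2 ^ k) by (apply pow_R1_Rle; lra). lra. }
    eapply Rle_trans; [apply le_INR, Hm|apply H]. }
  assert (HNp : 0 < INR N) by (apply lt_0_INR; lia).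
  pose proof (Rle_abs w). pose proof (Rabs_pos w).
  apply Rmult_lt_reg_r with (2 ^ m); auto. unfold Rdiv. rewrite Rmult_assoc, Rinv_l, Rmult_1_r by lra.
  apply Rmult_lt_compat_r with (r := INR N * (Rabs w + 1)) in HN; [|pos].
  replace (/ INR N * (INR N * (Rabs w + 1))) with (Rabs w + 1) in HN by (field; lra).
  replace (d / (Rabs w + 1) * (INR N * (Rabs w + 1))) with (d * INR N) in HN by (field; lra).
  assert (d * INR N <= d * 2 ^ m) by (apply Rmult_le_compat_l; lra). lra.
Qed.

Section Bisection.
Variable P : R -> R -> R -> R -> Prop.
Variables x0 y0 w h : R.
Hypothesis Hw : 0 <= w.
Hypothesis Hh : 0 <= h.
Let inside x y a b := x0 <= x /\ x + a <= x0 + w /\ y0 <= y /\ y + b <= y0 + h.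
Hypothesis quarters : forall x y a b, 0 <= a -> 0 <= b -> inside x y (2 * a) (2 * b) ->
  P x y a b -> P (x + a) y a b -> P x (y + b) a b -> P (x + a) (y + b) a b ->
  P x y (2 * a) (2 * b).
Hypothesis local_case : forall x y, x0 <= x <= x0 + w -> y0 <= y <= y0 + h ->
  exists d, 0 < d /\ forall x' y' a b, inside x' y' a b -> 0 <= a < d -> 0 <= b < d ->
    x' <= x <= x' + a -> y' <= y <= y' + b -> P x' y' a b.

(** Chooses a quarter on which [P] fails. The fourth one is taken without a test: if the other three
    satisfy [P], it must fail, by [quarters]. *)
Let step (n : nat) (q : R * R) : R * R :=
  let a := w / 2 ^ S n in let b := h / 2 ^ S n in
  let (x, y) := q in
  if excluded_middle_informative (P x y a b) then
    if excluded_middle_informative (P (x + a) y a b) then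
      if excluded_middle_informative (P x (y + b) a b) then (x + a, y + b)
      else (x, y + b)
    else (x + a, y)
  else (x, y).

Let Fixpoint st (n : nat) : R * R :=
  match n with O => (x0, y0) | S m => step m (st m) end.

(** Bolzano-Weierstrass as an induction principle: a failure on the whole rectangle descends to
    nested quarters, which shrink to a point where [local_case] contradicts it. Goursat's theorem,
    compactness of rectangles and Fubini's theorem are all instances. *)
Lemma rect_induction : P x0 y0 w h.
Proof.
  destruct (classic (P x0 y0 w h)) as [|N]; auto. exfalso.
  assert (pw : forall n, 0 < 2 ^ n) by (intro; apply pow_lt; lra).
  assert (dw : forall n, w / 2 ^ n = 2 * (w / 2 ^ S n)).
  { intro n. simpl. field. pose proof (pw n); lra. }
  assert (dh : forall n, h / 2 ^ n = 2 * (h / 2 ^ S n)).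
  { intro n. simpl. field. pose proof (pw n); lra. }
  assert (pw' : forall n, 0 <= w / 2 ^ n).
  { intros n. apply Rmult_le_pos; auto. left. apply Rinv_0_lt_compat, pw. }
  assert (ph' : forall n, 0 <= h / 2 ^ n).
  { intros n. apply Rmult_le_pos; auto. left. apply Rinv_0_lt_compat, pw. }
  assert (I : forall n, inside (fst (st n)) (snd (st n)) (w / 2 ^ n) (h / 2 ^ n) /\
      ~ P (fst (st n)) (snd (st n)) (w / 2 ^ n) (h / 2 ^ n)).
  { induction n as [|n [IH1 IH2]].
    - simpl. unfold Rdiv. rewrite Rinv_1, !Rmult_1_r. split; auto. unfold inside; lra.
    - change (st (S n)) with (step n (st n)). destruct (st n) as [x y]. cbn [fst snd] in *.
      rewrite (dw n), (dh n) in IH1, IH2. specialize (pw' (S n)). specialize (ph' (S n)).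
      unfold step. set (a := w / 2 ^ S n) in *. set (b := h / 2 ^ S n) in *.
      destruct (excluded_middle_informative (P x y a b)); [|cbn; split; auto; unfold inside in *; lra].
      destruct (excluded_middle_informative (P (x + a) y a b)); [|cbn; split; auto; unfold inside in *; lra].
      destruct (excluded_middle_informative (P x (y + b) a b)); [|cbn; split; auto; unfold inside in *; lra].
      cbn; split; [unfold inside in *; lra|]. intro. apply IH2, quarters; auto. }
  assert (M : forall n, fst (st n) <= fst (st (S n)) /\ fst (st (S n)) + w / 2 ^ S n <= fst (st n) + w / 2 ^ n /\
     snd (st n) <= snd (st (S n)) /\ snd (st (S n)) + h / 2 ^ S n <= snd (st n) + h / 2 ^ n).
  { intros n. change (st (S n)) with (step n (st n)). destruct (st n) as [x y]. cbn [fst snd].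
    rewrite (dw n), (dh n). specialize (pw' (S n)). specialize (ph' (S n)).
      unfold step. set (a := w / 2 ^ S n) in *. set (b := h / 2 ^ S n) in *.
      destruct (excluded_middle_informative (P x y a b)); [|cbn; lra].
      destruct (excluded_middle_informative (P (x + a) y a b)); [|cbn; lra].
      destruct (excluded_middle_informative (P x (y + b) a b)); cbn; lra. }
  assert (M2 : forall n k, fst (st n) <= fst (st (n + k)) /\ fst (st (n + k)) + w / 2 ^ (n + k) <= fst (st n) + w / 2 ^ n /\
     snd (st n) <= snd (st (n + k)) /\ snd (st (n + k)) + h / 2 ^ (n + k) <= snd (st n) + h / 2 ^ n).
  { intros n; induction k.
    - rewrite Nat.add_0_r. lra.
    - rewrite Nat.add_succ_r. specialize (M (n + k)%nat). lra. }
  assert (M3 : forall n m, fst (st m) <= fst (st n) + w / 2 ^ n /\ snd (st m) <= snd (st n) + h / 2 ^ n).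
  { intros n m. pose proof (pw' n). pose proof (ph' n). destruct (Nat.le_ge_cases n m) as [L|L].
    - specialize (M2 n (m - n)%nat). replace (n + (m - n))%nat with m in M2 by lia.
      pose proof (pw' m). pose proof (ph' m). lra.
    - specialize (M2 m (n - m)%nat). replace (m + (n - m))%nat with n in M2 by lia. lra. }
  (* The lower left corners increase and stay below every upper right corner, so their suprema [X]
     and [Y] lie in all the nested rectangles. *)
  destruct (completeness (fun x => exists n, x = fst (st n))) as [X [X1 X2]].
  { exists (fst (st 0) + w / 2 ^ 0). intros x [n ->]. apply M3. }
  { exists (fst (st 0)). exists O; auto. }
  destruct (completeness (fun x => exists n, x = snd (st n))) as [Y [Y1 Y2]].
  { exists (snd (st 0) + h / 2 ^ 0). intros x [n ->]. apply M3. }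
  { exists (snd (st 0)). exists O; auto. }
  assert (BX : forall n, fst (st n) <= X <= fst (st n) + w / 2 ^ n).
  { intro n; split; [apply X1; exists n; auto|]. apply X2. intros x [m ->]. apply M3. }
  assert (BY : forall n, snd (st n) <= Y <= snd (st n) + h / 2 ^ n).
  { intro n; split; [apply Y1; exists n; auto|]. apply Y2. intros x [m ->]. apply M3. }
  destruct (local_case X Y) as [d [Hd L]].
  { pose proof (BX O) as B. destruct (I O) as [B2 _]. unfold inside in B2. lra. }
  { pose proof (BY O) as B. destruct (I O) as [B2 _]. unfold inside in B2. lra. }
  destruct (dyadic_small w d Hd) as [n1 N1]. destruct (dyadic_small h d Hd) as [n2 N2].
  set (n := (n1 + n2)%nat). specialize (N1 n ltac:(lia)). specialize (N2 n ltac:(lia)).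
  destruct (I n) as [I1 I2]. apply I2, L; auto.
Qed.
End Bisection.

Lemma CInt_Chasles (h : R -> C) a b c :
  (forall t, Rmin a b <= t <= Rmax a b -> rcont h t) ->
  (forall t, Rmin b c <= t <= Rmax b c -> rcont h t) ->
  (CInt h a b + CInt h b c = CInt h a c)%C.
Proof.
  intros H1 H2. symmetry. apply is_CInt_unique.
  apply is_CInt_Chasles with b; apply CInt_correct; auto.
Qed.

Lemma CInt_swap (h : R -> C) a b :
  (forall t, Rmin a b <= t <= Rmax a b -> rcont h t) -> CInt h b a = (- CInt h a b)%C.
Proof.
  intros H. apply is_CInt_unique, is_CInt_swap, CInt_correct, H.
Qed.

Lemma rcont_h (f : C -> C) x y : ccont f (x, y) -> rcont (fun t => f (t, y)) x.
Proof. intros H. apply (cont_comp_C (fun t : R => (t, y))); csolve. Qed.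
Lemma rcont_v (f : C -> C) x y : ccont f (x, y) -> rcont (fun t => f (x, t)) y.
Proof. intros H. apply (cont_comp_C (fun t : R => (x, t))); csolve. Qed.

Lemma Rmin_Rmax_l a b : Rmin a b <= a <= Rmax a b.
Proof. split; [apply Rmin_l|apply Rmax_l]. Qed.
Lemma Rmin_Rmax_r a b : Rmin a b <= b <= Rmax a b.
Proof. split; [apply Rmin_r|apply Rmax_r]. Qed.

Lemma h_correct (f : C -> C) x1 x2 y : (forall t, Rmin x1 x2 <= t <= Rmax x1 x2 -> ccont f (t, y)) ->
  is_CInt (fun t => f (t, y)) x1 x2 (CInt (fun t => f (t, y)) x1 x2).
Proof. intros H. apply CInt_correct. intros; apply rcont_h; auto. Qed.
Lemma v_correct (f : C -> C) x y1 y2 : (forall t, Rmin y1 y2 <= t <= Rmax y1 y2 -> ccont f (x, t)) ->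
  is_CInt (fun t => f (x, t)) y1 y2 (CInt (fun t => f (x, t)) y1 y2).
Proof. intros H. apply CInt_correct. intros; apply rcont_v; auto. Qed.

Lemma rectint_plus f g x1 x2 y1 y2 : on_sides (ccont f) x1 x2 y1 y2 -> on_sides (ccont g) x1 x2 y1 y2 ->
  rectint (fun z => f z + g z)%C x1 x2 y1 y2 = (rectint f x1 x2 y1 y2 + rectint g x1 x2 y1 y2)%C.
Proof.
  intros Hf Hg. unfold rectint.
  rewrite (is_CInt_unique _ _ _ _ (is_CInt_plus _ _ _ _ _ _ (h_correct f x1 x2 y1 ltac:(intros; apply Hf; auto using Rmin_Rmax_l)) (h_correct g x1 x2 y1 ltac:(intros; apply Hg; auto using Rmin_Rmax_l)))).
  rewrite (is_CInt_unique _ _ _ _ (is_CInt_plus _ _ _ _ _ _ (h_correct f x1 x2 y2 ltac:(intros; apply Hf; auto using Rmin_Rmax_r)) (h_correct g x1 x2 y2 ltac:(intros; apply Hg; auto using Rmin_Rmax_r)))).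
  rewrite (is_CInt_unique _ _ _ _ (is_CInt_plus _ _ _ _ _ _ (v_correct f x1 y1 y2 ltac:(intros; apply Hf; auto using Rmin_Rmax_l)) (v_correct g x1 y1 y2 ltac:(intros; apply Hg; auto using Rmin_Rmax_l)))).
  rewrite (is_CInt_unique _ _ _ _ (is_CInt_plus _ _ _ _ _ _ (v_correct f x2 y1 y2 ltac:(intros; apply Hf; auto using Rmin_Rmax_r)) (v_correct g x2 y1 y2 ltac:(intros; apply Hg; auto using Rmin_Rmax_r)))).
  cring.
Qed.

Lemma rectint_scal c (f : C -> C) x1 x2 y1 y2 : on_sides (ccont f) x1 x2 y1 y2 ->
  rectint (fun z => c * f z)%C x1 x2 y1 y2 = (c * rectint f x1 x2 y1 y2)%C.
Proof.
  intros Hf. unfold rectint.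
  rewrite (is_CInt_unique _ _ _ _ (is_CInt_cmult c _ _ _ _ (h_correct f x1 x2 y1 ltac:(intros; apply Hf; auto using Rmin_Rmax_l)))).
  rewrite (is_CInt_unique _ _ _ _ (is_CInt_cmult c _ _ _ _ (h_correct f x1 x2 y2 ltac:(intros; apply Hf; auto using Rmin_Rmax_r)))).
  rewrite (is_CInt_unique _ _ _ _ (is_CInt_cmult c _ _ _ _ (v_correct f x1 y1 y2 ltac:(intros; apply Hf; auto using Rmin_Rmax_l)))).
  rewrite (is_CInt_unique _ _ _ _ (is_CInt_cmult c _ _ _ _ (v_correct f x2 y1 y2 ltac:(intros; apply Hf; auto using Rmin_Rmax_r)))).
  cring.
Qed.

Lemma CInt_ext (h g : R -> C) a b : (forall t, Rmin a b <= t <= Rmax a b -> h t = g t) -> CInt h a b = CInt g a b.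
Proof. intros H. apply (RInt_ext (V := C_R_CompleteNormedModule)). intros t Ht; apply H; lra. Qed.

Lemma rectint_ext f g x1 x2 y1 y2 : on_sides (fun z => f z = g z) x1 x2 y1 y2 ->
  rectint f x1 x2 y1 y2 = rectint g x1 x2 y1 y2.
Proof.
  intros H. unfold rectint.
  rewrite (CInt_ext (fun t => f (t, y1)) (fun t => g (t, y1))) by (intros; apply H; auto using Rmin_Rmax_l).
  rewrite (CInt_ext (fun t => f (t, y2)) (fun t => g (t, y2))) by (intros; apply H; auto using Rmin_Rmax_r).
  rewrite (CInt_ext (fun t => f (x1, t)) (fun t => g (x1, t))) by (intros; apply H; auto using Rmin_Rmax_l).
  rewrite (CInt_ext (fun t => f (x2, t)) (fun t => g (x2, t))) by (intros; apply H; auto using Rmin_Rmax_r).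
  reflexivity.
Qed.

Lemma rectint_swap_h (f : C -> C) x1 x2 y1 y2 : on_rect (ccont f) x1 x2 y1 y2 ->
  rectint f x2 x1 y1 y2 = (- rectint f x1 x2 y1 y2)%C.
Proof.
  intros Hf. unfold rectint.
  rewrite (CInt_swap (fun t => f (t, y1)) x1 x2) by (intros; apply rcont_h, Hf; auto using Rmin_Rmax_l).
  rewrite (CInt_swap (fun t => f (t, y2)) x1 x2) by (intros; apply rcont_h, Hf; auto using Rmin_Rmax_r).
  cring.
Qed.

Lemma rectint_swap_v (f : C -> C) x1 x2 y1 y2 : on_rect (ccont f) x1 x2 y1 y2 ->
  rectint f x1 x2 y2 y1 = (- rectint f x1 x2 y1 y2)%C.
Proof.
  intros Hf. unfold rectint.
  rewrite (CInt_swap (fun t => f (x1, t)) y1 y2) by (intros; apply rcont_v, Hf; auto using Rmin_Rmax_l).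
  rewrite (CInt_swap (fun t => f (x2, t)) y1 y2) by (intros; apply rcont_v, Hf; auto using Rmin_Rmax_r).
  cring.
Qed.

Lemma rectint_Chasles_h (f : C -> C) x1 x2 x3 y1 y2 : on_sides (ccont f) x1 x2 y1 y2 -> on_sides (ccont f) x2 x3 y1 y2 ->
  (rectint f x1 x2 y1 y2 + rectint f x2 x3 y1 y2 = rectint f x1 x3 y1 y2)%C.
Proof.
  intros H1 H2. unfold rectint.
  rewrite <- (CInt_Chasles (fun t => f (t, y1)) x1 x2 x3) by (intros; apply rcont_h; (apply H1 + apply H2); auto using Rmin_Rmax_l).
  rewrite <- (CInt_Chasles (fun t => f (t, y2)) x1 x2 x3) by (intros; apply rcont_h; (apply H1 + apply H2); auto using Rmin_Rmax_r).
  cring.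
Qed.

Lemma rectint_Chasles_v (f : C -> C) x1 x2 y1 y2 y3 : on_sides (ccont f) x1 x2 y1 y2 -> on_sides (ccont f) x1 x2 y2 y3 ->
  (rectint f x1 x2 y1 y2 + rectint f x1 x2 y2 y3 = rectint f x1 x2 y1 y3)%C.
Proof.
  intros H1 H2. unfold rectint.
  rewrite <- (CInt_Chasles (fun t => f (x1, t)) y1 y2 y3) by (intros; apply rcont_v; (apply H1 + apply H2); auto using Rmin_Rmax_l).
  rewrite <- (CInt_Chasles (fun t => f (x2, t)) y1 y2 y3) by (intros; apply rcont_v; (apply H1 + apply H2); auto using Rmin_Rmax_r).
  cring.
Qed.

Lemma rectint_norm (f : C -> C) x1 x2 y1 y2 M : on_sides (ccont f) x1 x2 y1 y2 ->
  on_sides (fun z => Cmod (f z) <= M) x1 x2 y1 y2 ->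
  Cmod (rectint f x1 x2 y1 y2) <= 2 * (Rabs (x2 - x1) + Rabs (y2 - y1)) * M.
Proof.
  intros Hf HM. unfold rectint.
  pose proof (is_CInt_norm_const (fun t : R => f (t, y1)) x1 x2 _ M ltac:(intros t Ht; apply (HM t y1); auto using Rmin_Rmax_l) (h_correct f x1 x2 y1 ltac:(intros; apply Hf; auto using Rmin_Rmax_l))) as B1.
  pose proof (is_CInt_norm_const (fun t : R => f (t, y2)) x1 x2 _ M ltac:(intros t Ht; apply (HM t y2); auto using Rmin_Rmax_r) (h_correct f x1 x2 y2 ltac:(intros; apply Hf; auto using Rmin_Rmax_r))) as B2.
  pose proof (is_CInt_norm_const (fun t : R => f (x1, t)) y1 y2 _ M ltac:(intros t Ht; apply (HM x1 t); auto using Rmin_Rmax_l) (v_correct f x1 y1 y2 ltac:(intros; apply Hf; auto using Rmin_Rmax_l))) as B3.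
  pose proof (is_CInt_norm_const (fun t : R => f (x2, t)) y1 y2 _ M ltac:(intros t Ht; apply (HM x2 t); auto using Rmin_Rmax_r) (v_correct f x2 y1 y2 ltac:(intros; apply Hf; auto using Rmin_Rmax_r))) as B4.
  eapply Rle_trans; [apply Cmod_triangle_minus|]. rewrite Cmod_mult, Cmod_Ci.
  eapply Rle_trans; [apply Rplus_le_compat_r, Cmod_triangle_minus|].
  eapply Rle_trans; [apply Rplus_le_compat_r, Rplus_le_compat_r, Cmod_triangle|].
  rewrite Cmod_mult, Cmod_Ci. lra.
Qed.

Lemma is_CInt_h_primitive (F f : C -> C) x1 x2 y :
  (forall t, Rmin x1 x2 <= t <= Rmax x1 x2 -> cder F (t, y) (f (t, y))) ->
  (forall t, Rmin x1 x2 <= t <= Rmax x1 x2 -> ccont f (t, y)) ->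
  is_CInt (fun t => f (t, y)) x1 x2 (F (x2, y) - F (x1, y))%C.
Proof.
  intros H1 H2.
  assert (E : forall t, ((0, y) + RtoC t * 1)%C = (t, y)) by (intros; cring).
  pose proof (is_CInt_segment F f (0, y) 1 x1 x2) as K. rewrite !E in K.
  eapply is_CInt_ext; [|apply K; intros t Ht; rewrite E; auto].
  intros t _. simpl. rewrite E. cring.
Qed.

Lemma is_CInt_v_primitive (F f : C -> C) x y1 y2 :
  (forall t, Rmin y1 y2 <= t <= Rmax y1 y2 -> cder F (x, t) (f (x, t))) ->
  (forall t, Rmin y1 y2 <= t <= Rmax y1 y2 -> ccont f (x, t)) ->
  is_CInt (fun t => Ci * f (x, t))%C y1 y2 (F (x, y2) - F (x, y1))%C.
Proof.
  intros H1 H2.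
  assert (E : forall t, ((x, 0) + RtoC t * Ci)%C = (x, t)) by (intros; cring).
  pose proof (is_CInt_segment F f (x, 0) Ci y1 y2) as K. rewrite !E in K.
  eapply is_CInt_ext; [|apply K; intros t Ht; rewrite E; auto].
  intros t _. simpl. rewrite E. cring.
Qed.

Lemma CInt_v_primitive (F f : C -> C) x y1 y2 :
  (forall t, Rmin y1 y2 <= t <= Rmax y1 y2 -> cder F (x, t) (f (x, t))) ->
  (forall t, Rmin y1 y2 <= t <= Rmax y1 y2 -> ccont f (x, t)) ->
  (Ci * CInt (fun t => f (x, t)) y1 y2 = F (x, y2) - F (x, y1))%C.
Proof.
  intros H1 H2. eapply is_CInt_inj; [apply is_CInt_cmult, v_correct; auto|].
  apply is_CInt_v_primitive; auto.
Qed.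

Lemma CInt_h_primitive (F f : C -> C) x1 x2 y :
  (forall t, Rmin x1 x2 <= t <= Rmax x1 x2 -> cder F (t, y) (f (t, y))) ->
  (forall t, Rmin x1 x2 <= t <= Rmax x1 x2 -> ccont f (t, y)) ->
  (CInt (fun t => f (t, y)) x1 x2 = F (x2, y) - F (x1, y))%C.
Proof. intros; apply is_CInt_unique, is_CInt_h_primitive; auto. Qed.

Lemma rectint_primitive F (f : C -> C) x1 x2 y1 y2 : on_rect (fun z => cder F z (f z)) x1 x2 y1 y2 ->
  on_rect (ccont f) x1 x2 y1 y2 -> rectint f x1 x2 y1 y2 = RtoC 0.
Proof.
  intros HF Hf. unfold rectint.
  rewrite (CInt_h_primitive F f x1 x2 y1), (CInt_h_primitive F f x1 x2 y2), (CInt_v_primitive F f x1), (CInt_v_primitive F f x2).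
  all: try (intros; (apply HF + apply Hf); auto using Rmin_Rmax_l, Rmin_Rmax_r). cring.
Qed.

Lemma on_rect_sub (Q : C -> Prop) x1 x2 y1 y2 x1' x2' y1' y2' : on_rect Q x1 x2 y1 y2 ->
  x1 <= x1' <= x2 -> x1 <= x2' <= x2 -> y1 <= y1' <= y2 -> y1 <= y2' <= y2 -> on_rect Q x1' x2' y1' y2'.
Proof.
  intros H A B A' B' x y Hx Hy. apply H.
  - ordered. revert Hx. unfold Rmin, Rmax. destruct (Rle_dec x1' x2'); lra.
  - ordered. revert Hy. unfold Rmin, Rmax. destruct (Rle_dec y1' y2'); lra.
Qed.

Lemma Goursat_ordered (f : C -> C) x1 x2 y1 y2 : x1 <= x2 -> y1 <= y2 -> on_rect (differentiable f) x1 x2 y1 y2 ->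
  rectint f x1 x2 y1 y2 = RtoC 0.
Proof.
  intros Hx Hy Hf.
  assert (Hc : on_rect (ccont f) x1 x2 y1 y2) by (intros x y ? ?; apply differentiable_cont, Hf; auto).
  set (w := x2 - x1). set (h := y2 - y1).
  (* The square of the half-perimeter is multiplied by exactly four when the sides double, which
     matches the number of quarters. *)
  assert (B : forall eps, 0 < eps -> Cmod (rectint f x1 x2 y1 y2) <= eps * (w + h) ^ 2).
  { intros eps He.
    pose proof (rect_induction (fun x y a b => Cmod (rectint f x (x + a) y (y + b)) <= eps * (a + b) ^ 2) x1 y1 w h) as K.
    cbv beta in K. replace (x1 + w) with x2 in K by (unfold w; ring). replace (y1 + h) with y2 in K by (unfold h; ring).
    apply K; clear K; [unfold w; lra|unfold h; lra| |].
    - intros x y a b Ha Hb In K1 K2 K3 K4.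
      assert (E : rectint f x (x + 2 * a) y (y + 2 * b) =
        (rectint f x (x + a) y (y + b) + rectint f (x + a) (x + a + a) y (y + b)
        + (rectint f x (x + a) (y + b) (y + b + b) + rectint f (x + a) (x + a + a) (y + b) (y + b + b)))%C).
      { rewrite !rectint_Chasles_h, rectint_Chasles_v; try (apply on_rect_sides, on_rect_sub with (1 := Hc); lra).
        f_equal; ring. }
      rewrite E. tri.
      eapply Rle_trans; [apply Rplus_le_compat; apply Cmod_triangle|]. nra.
    - intros x y Ix Iy. destruct (Hf x y) as [l Hl]; [rewrite Rmin_left, Rmax_right; lra|rewrite Rmin_left, Rmax_right; lra|].
      destruct (Hl (eps / 2) ltac:(lra)) as [d [Hd Hw]].
      exists (d / 2). split; [lra|]. intros x' y' a b In Ha Hb Hxx Hyy.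
      set (z := (x, y)) in *.
      assert (Hc' : on_rect (ccont f) x' (x' + a) y' (y' + b)) by (apply on_rect_sub with (1 := Hc); lra).
      (* The first-order part of [f] at [z] has a quadratic primitive, so removing it leaves the
         integral unchanged, and the rest is at most [eps / 2 * (a + b)] on the sides. *)
      set (g := fun u : C => (f z + l * (u - z))%C).
      assert (Hg : forall u, cder (fun u => f z * u + l / 2 * ((u - z) * (u - z)))%C u (g u)).
      { intros u. replace (g u) with (f z * 1 + l / 2 * (2 * (u - z) * (1 - 0)))%C.
        2: { unfold g, Cdiv. field. }
        apply cder_plus; [apply cder_scal, cder_id|]. apply cder_scal.
        apply (cder_comp (fun u => u - z)%C (fun v => v * v)%C); [|apply cder_sqr].
        apply cder_minus; [apply cder_id|apply cder_const]. }
      assert (Cg : forall u, ccont g u) by (intros; unfold g; csolve).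
      replace (rectint f x' (x' + a) y' (y' + b)) with (rectint (fun u => f u + (-(1)) * g u)%C x' (x' + a) y' (y' + b)).
      2: { rewrite rectint_plus, rectint_scal; auto; try (intros ? ? _ _ _; csolve; apply Cg); [|apply on_rect_sides; auto].
           rewrite (rectint_primitive _ g x' (x' + a) y' (y' + b) ltac:(intros ? ? _ _; apply Hg)) by (intros ? ? _ _; apply Cg).
           cring. }
      eapply Rle_trans; [apply rectint_norm with (M := eps / 2 * (a + b))|].
      + intros u v Hu Hv _. csolve; [apply Hc'; auto|apply Cg].
      + intros u v Hu Hv _. ordered in Hu. ordered in Hv.
        unfold g. replace (f (u, v) + - (1) * (f z + l * ((u, v) - z)))%C with (f (u, v) - f z - l * ((u, v) - z))%C by cring.
        assert (Q : Cmod ((u, v) - z) <= a + b).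
        { eapply Rle_trans; [apply Cmod_le_sum|]. unfold Re, Im, z; simpl. apply Rplus_le_compat; apply Rabs_le; lra. }
        eapply Rle_trans; [apply Hw; lra|]. apply Rmult_le_compat_l; lra.
      + replace (x' + a - x') with a by ring. replace (y' + b - y') with b by ring.
        rewrite !Rabs_right by lra. right. field. }
  apply Cmod_eq_0. pose proof (Cmod_ge_0 (rectint f x1 x2 y1 y2)).
  destruct (Req_dec (Cmod (rectint f x1 x2 y1 y2)) 0) as [|N]; auto. exfalso.
  set (c := Cmod _) in *.
  assert (P : 0 <= (w + h) ^ 2) by apply pow2_ge_0.
  specialize (B (c / (2 * ((w + h) ^ 2 + 1))) ltac:(pos)).
  assert (c / (2 * ((w + h) ^ 2 + 1)) * (w + h) ^ 2 < c).
  { apply Rmult_lt_reg_r with (2 * ((w + h) ^ 2 + 1)); [lra|].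
    replace (c / (2 * ((w + h) ^ 2 + 1)) * (w + h) ^ 2 * (2 * ((w + h) ^ 2 + 1))) with (c * (w + h) ^ 2) by (field; lra).
    nra. }
  lra.
Qed.

Lemma on_rect_swap_h Q x1 x2 y1 y2 : on_rect Q x1 x2 y1 y2 -> on_rect Q x2 x1 y1 y2.
Proof. intros H x y. rewrite (Rmin_comm x2), (Rmax_comm x2). apply H. Qed.
Lemma on_rect_swap_v Q x1 x2 y1 y2 : on_rect Q x1 x2 y1 y2 -> on_rect Q x1 x2 y2 y1.
Proof. intros H x y. rewrite (Rmin_comm y2), (Rmax_comm y2). apply H. Qed.

Lemma on_rect_impl (P Q : C -> Prop) x1 x2 y1 y2 : (forall z, P z -> Q z) -> on_rect P x1 x2 y1 y2 -> on_rect Q x1 x2 y1 y2.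
Proof. intros I H x y Hx Hy. apply I, H; auto. Qed.

(* Reduces a statement on rectangles to those with ordered sides. *)
Lemma rectint_zero_unordered (Q : C -> Prop) (f : C -> C) :
  (forall z, Q z -> ccont f z) ->
  (forall x1 x2 y1 y2, x1 <= x2 -> y1 <= y2 -> on_rect Q x1 x2 y1 y2 -> rectint f x1 x2 y1 y2 = RtoC 0) ->
  forall x1 x2 y1 y2, on_rect Q x1 x2 y1 y2 -> rectint f x1 x2 y1 y2 = RtoC 0.
Proof.
  intros Hc H.
  assert (H' : forall x1 x2 y1 y2, x1 <= x2 -> on_rect Q x1 x2 y1 y2 -> rectint f x1 x2 y1 y2 = RtoC 0).
  { intros x1 x2 y1 y2 Hx HQ. destruct (Rle_dec y1 y2); [apply H; auto|].
    rewrite rectint_swap_v, H; auto; try lra; [cring|apply on_rect_swap_v; auto|].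
    apply on_rect_impl with Q; auto. apply on_rect_swap_v; auto. }
  intros x1 x2 y1 y2 HQ. destruct (Rle_dec x1 x2); [apply H'; auto|].
  rewrite rectint_swap_h, H'; auto; try lra; [cring|apply on_rect_swap_h; auto|].
  apply on_rect_impl with Q; auto. apply on_rect_swap_h; auto.
Qed.

Lemma Goursat (f : C -> C) x1 x2 y1 y2 : on_rect (differentiable f) x1 x2 y1 y2 ->
  rectint f x1 x2 y1 y2 = RtoC 0.
Proof.
  apply (rectint_zero_unordered (differentiable f)).
  - apply differentiable_cont.
  - apply Goursat_ordered.
Qed.

(** Heine-Borel with a quality parameter: since [Q] gets weaker as [m] decreases, the minimum of the
    four values obtained on the quarters serves for their union. *)
Lemma rect_compact (Q : R -> C -> Prop) x1 x2 y1 y2 : (forall m m' z, 0 < m' <= m -> Q m z -> Q m' z) ->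
  on_rect (fun z => exists d m, 0 < d /\ 0 < m /\ forall w, Cmod (w - z) < d -> Q m w) x1 x2 y1 y2 ->
  exists m, 0 < m /\ on_rect (Q m) x1 x2 y1 y2.
Proof.
  intros Mono Loc.
  set (a1 := Rmin x1 x2). set (w := Rmax x1 x2 - a1). set (b1 := Rmin y1 y2). set (h := Rmax y1 y2 - b1).
  destruct (rect_induction (fun x y a b => exists m, 0 < m /\ forall u v, x <= u <= x + a -> y <= v <= y + b -> Q m (u, v)) a1 b1 w h) as [m [Hm HQ]].
  - unfold w, a1. generalize (Rmin_Rmax_l x1 x2); lra.
  - unfold h, b1. generalize (Rmin_Rmax_l y1 y2); lra.
  - intros x y a b Ha Hb _ [m1 [P1 K1]] [m2 [P2 K2]] [m3 [P3 K3]] [m4 [P4 K4]].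
    exists (Rmin (Rmin m1 m2) (Rmin m3 m4)). split; [repeat apply Rmin_pos; auto|]. intros u v Hu Hv.
    assert (Hp : 0 < Rmin (Rmin m1 m2) (Rmin m3 m4)) by (repeat apply Rmin_pos; auto).
    pose proof (Rmin_l (Rmin m1 m2) (Rmin m3 m4)). pose proof (Rmin_r (Rmin m1 m2) (Rmin m3 m4)).
    pose proof (Rmin_l m1 m2). pose proof (Rmin_r m1 m2). pose proof (Rmin_l m3 m4). pose proof (Rmin_r m3 m4).
    destruct (Rle_dec u (x + a)); destruct (Rle_dec v (y + b)); [apply Mono with m1|apply Mono with m3|apply Mono with m2|apply Mono with m4]; try lra;
      [apply K1|apply K3|apply K2|apply K4]; lra.
  - intros x y Hx Hy. destruct (Loc x y ltac:(fold a1; unfold w in *; lra) ltac:(fold b1; unfold h in *; lra)) as [d [m [Hd [Hm W]]]].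
    exists (d / 2). split; [lra|]. intros x' y' a b _ Ha Hb Hx' Hy'. exists m. split; auto. intros u v Hu Hv. apply W.
    eapply Rle_lt_trans; [apply Cmod_le_sum|]. unfold Re, Im; simpl.
    apply Rle_lt_trans with (a + b); [|lra]. apply Rplus_le_compat; apply Rabs_le; lra.
  - exists m. split; auto. intros x y Hx Hy. apply HQ; fold a1 in Hx; fold b1 in Hy; unfold w, h; lra.
Qed.

Lemma bounded_on_rect (f : C -> C) x1 x2 y1 y2 : on_rect (ccont f) x1 x2 y1 y2 ->
  exists M, 0 <= M /\ on_rect (fun z => Cmod (f z) <= M) x1 x2 y1 y2.
Proof.
  (* A bound must get weaker as the parameter decreases, hence the inverse. *)
  intros Hc. destruct (rect_compact (fun m z => Cmod (f z) <= / m) x1 x2 y1 y2) as [m [Hm HQ]].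
  - intros m m' z Hm. assert (/ m <= / m') by (apply Rinv_le_contravar; lra). lra.
  - intros x y Hx Hy. destruct (proj1 (ccont_eps f (x, y)) (Hc x y Hx Hy) 1 Rlt_0_1) as [d [Hd W]].
    pose proof (Cmod_ge_0 (f (x, y))). exists d, (/ (1 + Cmod (f (x, y)))). split; [auto|split; [apply Rinv_0_lt_compat; lra|]].
    intros w Hw. rewrite Rinv_inv. specialize (W w Hw). pose proof (Cmod_rev_triangle (f w) (f (x, y))). lra.
  - exists (/ m). split; [left; apply Rinv_0_lt_compat; auto|exact HQ].
Qed.

(** * Primitives *)

Definition is_open (D : C -> Prop) : Prop :=
  forall z, D z -> exists e, 0 < e /\ forall w, Cmod (w - z) < e -> D w.

(* [D] retracts vertically onto an interval of the horizontal line of ordinate [y0]. *)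
Definition comb (D : C -> Prop) (x0 y0 : R) : Prop :=
  is_open D /\ D (x0, y0) /\
  (forall x y s, D (x, y) -> Rmin y0 y <= s <= Rmax y0 y -> D (x, s)) /\
  (forall x t, D (x, y0) -> Rmin x0 x <= t <= Rmax x0 x -> D (t, y0)).

Definition comb_integral (f : C -> C) (x0 y0 : R) (z : C) : C :=
  (CInt (fun t => f (t, y0)) x0 (Re z) + Ci * CInt (fun t => f (Re z, t)) y0 (Im z))%C.

Lemma Rmin_Rmax_between a b t s : Rmin a b <= t <= Rmax a b -> Rmin a t <= s <= Rmax a t -> Rmin a b <= s <= Rmax a b.
Proof.
  unfold Rmin, Rmax. destruct (Rle_dec a b), (Rle_dec a t); lra.
Qed.

Lemma Rabs_between a b t : Rmin a b <= t <= Rmax a b -> Rabs (t - a) <= Rabs (b - a).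
Proof.
  unfold Rmin, Rmax. intros H.
  destruct (Rle_dec a b).
  - rewrite !Rabs_right; lra.
  - rewrite !Rabs_left1; lra.
Qed.

(** The candidate integrates along the base line and then along a vertical tooth. Only the vanishing
    of rectangle integrals is required, so that functions which are merely continuous on a line are
    covered as well. *)
Lemma comb_primitive D x0 y0 f : comb D x0 y0 ->
  (forall z, D z -> ccont f z) ->
  (forall x1 x2 y1 y2, on_rect D x1 x2 y1 y2 -> rectint f x1 x2 y1 y2 = RtoC 0) ->
  forall z, D z -> cder (comb_integral f x0 y0) z (f z).
Proof.
  intros [Op [D0 [Vr Hr]]] Hc Hz z Dz eps He.
  destruct (Op z Dz) as [e [He0 Be]].
  destruct (proj1 (ccont_eps f z) (Hc z Dz) (eps / 2) ltac:(lra)) as [d [Hd Bd]].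
  exists (Rmin e d). split; [apply Rmin_pos; auto|]. intros w Hw.
  assert (He1 := Rlt_le_trans _ _ _ Hw (Rmin_l _ _)).
  assert (Hd1 := Rlt_le_trans _ _ _ Hw (Rmin_r _ _)).
  destruct z as [x y]. destruct w as [x' y'].
  assert (Nx : Rabs (x' - x) <= Cmod ((x', y') - (x, y))).
  { apply (re_le_Cmod ((x', y') - (x, y))%C). }
  assert (Ny : Rabs (y' - y) <= Cmod ((x', y') - (x, y))).
  { apply (im_le_Cmod ((x', y') - (x, y))%C). }
  set (N := Cmod ((x', y') - (x, y))) in *.
  assert (Ph : forall t, Rmin x x' <= t <= Rmax x x' -> Cmod ((t, y) - (x, y)) <= N).
  { intros t Ht. eapply Rle_trans; [apply Cmod_le_sum|]. unfold Re, Im; simpl.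
    replace (y + - y) with 0 by ring. rewrite Rabs_R0.
    pose proof (Rabs_between _ _ _ Ht). unfold Rminus in *. lra. }
  assert (Pv : forall s, Rmin y y' <= s <= Rmax y y' -> Cmod ((x', s) - (x, y)) <= N).
  { intros s Hs. pose proof (Rabs_between _ _ _ Hs) as B. unfold N, Cmod. apply sqrt_le_1_alt. simpl.
    apply Rplus_le_compat_l. rewrite !Rmult_1_r. apply Rsqr_le_abs_1. unfold Rminus in *. auto. }
  assert (Dh : forall t, Rmin x x' <= t <= Rmax x x' -> D (t, y)).
  { intros t Ht. apply Be. eapply Rle_lt_trans; [apply Ph; auto|auto]. }
  assert (Dv : forall s, Rmin y y' <= s <= Rmax y y' -> D (x', s)).
  { intros s Hs. apply Be. eapply Rle_lt_trans; [apply Pv; auto|auto]. }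
  assert (Dr : on_rect D x x' y0 y).
  { intros t s Ht Hs. apply Vr with y; auto. }
  (* The teeth over [x] and [x'] up to the ordinate [y] bound a rectangle inside [D]; its vanishing
     integral replaces the base segment by the segment at height [y], so the increment becomes an
     integral over a short path near [z]. *)
  specialize (Hz _ _ _ _ Dr). unfold rectint in Hz.
  assert (E1 : (CInt (fun t => f (t, y0)) x0 x + CInt (fun t => f (t, y0)) x x' = CInt (fun t => f (t, y0)) x0 x')%C).
  { apply CInt_Chasles; intros t Ht; apply rcont_h, Hc.
    - apply Hr with x; auto. apply Dr; auto using Rmin_Rmax_l.
    - apply Dr; auto using Rmin_Rmax_l. }
  assert (E2 : (CInt (fun t => f (x', t)) y0 y + CInt (fun t => f (x', t)) y y' = CInt (fun t => f (x', t)) y0 y')%C).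
  { apply CInt_Chasles; intros t Ht; apply rcont_v, Hc.
    - apply Dr; auto using Rmin_Rmax_r.
    - apply Dv; auto. }
  assert (E : (comb_integral f x0 y0 (x', y') - comb_integral f x0 y0 (x, y) - f (x, y) * ((x', y') - (x, y)) =
     CInt (fun t => f (t, y) - f (x, y)) x x' + Ci * CInt (fun t => f (x', t) - f (x, y)) y y')%C).
  { pose proof (is_CInt_minus _ _ _ _ _ _ (h_correct f x x' y ltac:(intros; apply Hc; auto)) (is_CInt_const x x' (f (x, y)))) as K1.
    pose proof (is_CInt_minus _ _ _ _ _ _ (v_correct f x' y y' ltac:(intros; apply Hc; auto)) (is_CInt_const y y' (f (x, y)))) as K2.
    rewrite (is_CInt_unique _ _ _ _ K1), (is_CInt_unique _ _ _ _ K2).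
    unfold comb_integral. simpl Re. simpl Im. rewrite <- E1, <- E2.
    match type of Hz with (?A + Ci * ?B - ?C' - Ci * ?D')%C = _ =>
      assert (Hz' : @eq C A (C' + Ci * D' - Ci * B)%C);
      [replace A with ((A + Ci * B - C' - Ci * D') + (C' + Ci * D' - Ci * B))%C by ring; rewrite Hz; ring|] end.
    rewrite Hz'.
    replace (((x', y') - (x, y)))%C with (RtoC (x' - x) + Ci * RtoC (y' - y))%C by cring.
    ring. }
  rewrite E. tri. rewrite Cmod_mult, Cmod_Ci, Rmult_1_l.
  assert (B1 : Cmod (CInt (fun t => f (t, y) - f (x, y))%C x x') <= Rabs (x' - x) * (eps / 2)).
  { apply is_CInt_norm_const with (h := fun t => (f (t, y) - f (x, y))%C).
    - intros t Ht. left. apply Bd. eapply Rle_lt_trans; [apply Ph; auto|auto].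
    - apply CInt_correct. intros t Ht. csolve. apply rcont_h, Hc; auto. }
  assert (B2 : Cmod (CInt (fun t => f (x', t) - f (x, y))%C y y') <= Rabs (y' - y) * (eps / 2)).
  { apply is_CInt_norm_const with (h := fun t => (f (x', t) - f (x, y))%C).
    - intros t Ht. left. apply Bd. eapply Rle_lt_trans; [apply Pv; auto|auto].
    - apply CInt_correct. intros t Ht. csolve. apply rcont_v, Hc; auto. }
  assert (Rabs (x' - x) * (eps / 2) <= N * (eps / 2)) by (apply Rmult_le_compat_r; lra).
  assert (Rabs (y' - y) * (eps / 2) <= N * (eps / 2)) by (apply Rmult_le_compat_r; lra).
  lra.
Qed.

Lemma comb_primitive_ex D x0 y0 f : comb D x0 y0 -> (forall z, D z -> differentiable f z) ->
  exists F, forall z, D z -> cder F z (f z).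
Proof.
  intros HD Hf. exists (comb_integral f x0 y0). apply comb_primitive; auto.
  - intros z Dz. apply differentiable_cont; auto.
  - intros. apply Goursat. eapply on_rect_impl; eauto.
Qed.

Lemma primitive_unique_segment (F G f : C -> C) (a b : C) :
  (forall t, 0 <= t <= 1 -> cder F (a + RtoC t * (b - a))%C (f (a + RtoC t * (b - a))%C) /\
     cder G (a + RtoC t * (b - a))%C (f (a + RtoC t * (b - a))%C)) ->
  (F b - F a = G b - G a)%C.
Proof.
  intros H.
  pose proof (is_CInt_segment (fun z => F z - G z)%C (fun _ => 0%C) a (b - a) 0 1) as K.
  ordered in K.
  specialize (K ltac:(intros t Ht; destruct (H t Ht) as [H1 H2]; pose proof (cder_minus _ _ _ _ _ H1 H2) as H3;
    match type of H3 with cder _ _ ?x => replace x with (RtoC 0) in H3 by cring end; exact H3) ltac:(intros; csolve)).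
  pose proof (is_CInt_const 0 1 (0 * (b - a))%C) as K2.
  pose proof (is_CInt_inj _ _ _ _ _ K K2) as E. cbv beta in E.
  replace (a + RtoC 1 * (b - a))%C with b in E by cring.
  replace (a + RtoC 0 * (b - a))%C with a in E by cring.
  replace (F b - F a)%C with ((F b - G b - (F a - G a)) + (G b - G a))%C by ring. rewrite E. ring.
Qed.

Lemma Cminus_neq_0 (a b : C) : a <> b -> (a - b)%C <> 0%C.
Proof. intros H E. apply H. replace a with (a - b + b)%C by ring. rewrite E. ring. Qed.

Lemma cder_inv_minus (a z : C) : z <> a -> cder (fun z => / (z - a))%C z (- (/ (z - a) * / (z - a)))%C.
Proof.
  intros H. pose proof (cder_comp (fun z => z - a)%C (fun z => / z)%C z (1 - 0) _ (cder_minus _ _ _ _ _ (cder_id z) (cder_const a z)) (cder_inv _ (Cminus_neq_0 _ _ H))) as K.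
  replace (- (/ (z - a) * / (z - a)))%C with (- (/ (z - a) * / (z - a)) * (1 - 0))%C by ring. exact K.
Qed.

Lemma Cmod_lt_parts (z w : C) e : Cmod (w - z) < e -> Rabs (Re w - Re z) < e /\ Rabs (Im w - Im z) < e.
Proof.
  intros H. split; eapply Rle_lt_trans; try exact H.
  - apply (re_le_Cmod (w - z)%C).
  - apply (im_le_Cmod (w - z)%C).
Qed.

(** This is the plane cut along the vertical half-line from [a], downwards for [s = 1] and upwards
    for [s = -1]. *)
Lemma cut_plane_comb (a : C) (s : R) : s = 1 \/ s = -1 ->
  comb (fun z => Re z <> Re a \/ 0 < s * (Im z - Im a)) (Re a) (Im a + s).
Proof.
  intros Hs. repeat split.
  - intros z [H|H].
    + exists (Rabs (Re z - Re a)). split; [apply Rabs_pos_lt; lra|]. intros w Hw.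
      apply Cmod_lt_parts in Hw. destruct Hw as [Hw _]. left. intro E. rewrite E in Hw.
      rewrite Rabs_minus_sym in Hw. lra.
    + exists (s * (Im z - Im a)). split; auto. intros w Hw. apply Cmod_lt_parts in Hw. destruct Hw as [_ Hw]. right.
      apply Rabs_def2 in Hw. destruct Hs; subst; lra.
  - right. simpl. destruct Hs; subst; lra.
  - intros x y t [H|H] Ht; [left; exact H|right]. simpl in *. revert Ht. unfold Rmin, Rmax.
    destruct (Rle_dec (Im a + s) y); destruct Hs; subst; lra.
  - intros x t _ _. right. simpl. destruct Hs; subst; lra.
Qed.

Lemma rcont_ext (f g : R -> C) t : (forall s, f s = g s) -> rcont f t -> rcont g t.
Proof. intros E. apply continuous_ext; auto. Qed.

(** On the unit half circle [a + (cos t, s sin t)] the form [dz / (z - a)] is constantly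
    [s i dt]. *)
Lemma semicircle_integral (P : C -> C) (a : C) (s : R) : s = 1 \/ s = -1 ->
  (forall z, Re z <> Re a \/ 0 <= s * (Im z - Im a) -> z <> a -> cder P z (/ (z - a))%C) ->
  (P (a - 1) - P (a + 1) = RtoC (s * PI) * Ci)%C.
Proof.
  intros Hs HP.
  set (g := fun t : R => (a + (cos t, (s * sin t)%R))%C).
  assert (Dg : forall t, rderive g t ((- sin t)%R, (s * cos t)%R)).
  { intros t. apply (is_derive_ext (fun t => ((Re a + cos t)%R, (Im a + s * sin t)%R))).
    - intros u. unfold g. cring.
    - apply rderive_pair; auto_derive; auto; ring. }
  assert (Hn : forall t, @eq C (cos t, (s * sin t)%R) (RtoC 0) -> False).
  { intros t E. injection E; intros E1 E2. pose proof (sin2_cos2 t) as K. unfold Rsqr in K.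
    assert (sin t = 0) by (destruct Hs; subst; lra). nra. }
  assert (K : is_CInt (fun _ => (RtoC s * Ci)%C) 0 PI (P (g PI) - P (g 0))%C).
  { pose proof PI_RGT_0.
    apply (is_CInt_rderive (fun t => P (g t))).
    - ordered. intros t Ht.
      replace (RtoC s * Ci)%C with (/ (g t - a) * ((- sin t)%R, (s * cos t)%R))%C.
      + apply rderive_comp; auto. apply HP.
        * right. unfold g. simpl. pose proof (sin_ge_0 t ltac:(lra) ltac:(lra)). unfold Im; destruct Hs; subst; lra.
        * intro E. apply (Hn t). assert (E2 : @eq C (cos t, (s * sin t)%R) (g t - a)%C) by (unfold g; cring). rewrite E2, E. cring.
      + assert (E1 : (g t - a)%C = (cos t, (s * sin t)%R)) by (unfold g; cring).
        assert (E2 : @eq C ((- sin t)%R, (s * cos t)%R) (RtoC s * Ci * (g t - a))%C).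
        { assert (s * s = 1) by (destruct Hs; subst; lra). rewrite E1.
          apply C_ext; unfold Re, Im; simpl; [|ring]. transitivity (- ((s * s) * sin t)); [rewrite H0|]; ring. }
        rewrite E2. field. rewrite E1. intro Q; apply (Hn t); exact Q.
    - intros; csolve. }
  replace (g PI) with (a - 1)%C in K by (unfold g; rewrite cos_PI, sin_PI; cring).
  replace (g 0) with (a + 1)%C in K by (unfold g; rewrite cos_0, sin_0; cring).
  rewrite (is_CInt_inj _ _ _ _ _ K (is_CInt_const 0 PI _)). cring.
Qed.

(** Two branches of [log (z - a)], with the cut going down for [Pu] and up for [Pd]. They differ by
    a constant on each side of the vertical line through [a]; the two half circles show that these
    constants differ by [2 i pi]. This pair replaces any general theory of winding numbers. *)
Lemma log_branches (a : C) : exists Pu Pd : C -> C,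
  (forall z, Re z <> Re a \/ Im a < Im z -> cder Pu z (/ (z - a))%C) /\
  (forall z, Re z <> Re a \/ Im z < Im a -> cder Pd z (/ (z - a))%C) /\
  (forall u v, Re u < Re a < Re v -> (Pu u - Pu v - (Pd u - Pd v) = 2 * Ci * RtoC PI)%C).
Proof.
  assert (Ex : forall s, s = 1 \/ s = -1 -> exists P, forall z, Re z <> Re a \/ 0 < s * (Im z - Im a) -> cder P z (/ (z - a))%C).
  { intros s Hs. apply (comb_primitive_ex _ _ _ _ (cut_plane_comb a s Hs)).
    intros z Hz. eexists. apply cder_inv_minus. intros ->. lra. }
  destruct (Ex 1 ltac:(auto)) as [Pu Hu]. destruct (Ex (-1) ltac:(auto)) as [Pd Hd].
  exists Pu, Pd.
  assert (Hu' : forall z, Re z <> Re a \/ Im a < Im z -> cder Pu z (/ (z - a))%C) by (intros z Hz; apply Hu; lra).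
  assert (Hd' : forall z, Re z <> Re a \/ Im z < Im a -> cder Pd z (/ (z - a))%C) by (intros z Hz; apply Hd; lra).
  repeat split; auto. intros u v Huv.
  assert (S1 : (Pu (a - 1) - Pu (a + 1) = RtoC (1 * PI) * Ci)%C).
  { apply semicircle_integral; auto. intros z Hz Hza. apply Hu'.
    destruct (Req_dec (Re z) (Re a)); auto. destruct (Req_dec (Im z) (Im a)); [|lra].
    exfalso; apply Hza, C_ext; auto. }
  assert (S2 : (Pd (a - 1) - Pd (a + 1) = RtoC (-1 * PI) * Ci)%C).
  { apply semicircle_integral; auto. intros z Hz Hza. apply Hd'.
    destruct (Req_dec (Re z) (Re a)); auto. destruct (Req_dec (Im z) (Im a)); [|lra].
    exfalso; apply Hza, C_ext; auto. }
  assert (T1 : (Pu u - Pu (a - 1) = Pd u - Pd (a - 1))%C).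
  { apply primitive_unique_segment with (f := fun z => (/ (z - a))%C). intros t Ht.
    assert (Re (a - 1 + RtoC t * (u - (a - 1))) < Re a).
    { simpl. unfold Re in *. destruct (Rlt_dec t 1) as [T|T]; [|replace t with 1 by lra; nra]. destruct (Rlt_dec 0 t) as [T0|T0]; [|replace t with 0 by lra; nra]. nra. }
    split; [apply Hu'|apply Hd']; lra. }
  assert (T2 : (Pu (a + 1) - Pu v = Pd (a + 1) - Pd v)%C).
  { apply primitive_unique_segment with (f := fun z => (/ (z - a))%C). intros t Ht.
    assert (Re a < Re (v + RtoC t * (a + 1 - v))).
    { simpl. unfold Re in *. destruct (Rlt_dec t 1) as [T|T]; [|replace t with 1 by lra; nra]. destruct (Rlt_dec 0 t) as [T0|T0]; [|replace t with 0 by lra; nra]. nra. }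
    split; [apply Hu'|apply Hd']; lra. }
  replace (Pu u - Pu v - (Pd u - Pd v))%C with ((Pu u - Pu (a - 1)) - (Pd u - Pd (a - 1)) + (Pu (a - 1) - Pu (a + 1)) - (Pd (a - 1) - Pd (a + 1)) + (Pu (a + 1) - Pu v) - (Pd (a + 1) - Pd v))%C by ring.
  rewrite T1, T2, S1, S2. cring.
Qed.

(** Only the bottom side meets the cut of [Pu]. With [Pd] on it and [Pu] on the other sides, all
    that survives is the jump between the branches. *)
Lemma rectint_inv (a : C) x1 x2 y1 y2 : x1 < Re a < x2 -> y1 < Im a < y2 ->
  rectint (fun z => / (z - a))%C x1 x2 y1 y2 = (2 * Ci * RtoC PI)%C.
Proof.
  intros Hx Hy. destruct (log_branches a) as [Pu [Pd [Hu [Hd HL]]]].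
  assert (Hc : forall z, z <> a -> ccont (fun z => / (z - a))%C z).
  { intros z Hz. eapply cder_cont, cder_inv_minus; auto. }
  unfold rectint.
  rewrite (CInt_h_primitive Pd (fun z => / (z - a))%C x1 x2 y1).
  rewrite (CInt_h_primitive Pu (fun z => / (z - a))%C x1 x2 y2).
  rewrite (CInt_v_primitive Pu (fun z => / (z - a))%C x1 y1 y2).
  rewrite (CInt_v_primitive Pu (fun z => / (z - a))%C x2 y1 y2).
  2-9: intros t Ht; (apply Hu || apply Hd || (apply Hc; intros E; rewrite <- E in *; simpl in *; lra)); simpl; lra.
  rewrite <- (HL (x1, y1) (x2, y1)); [ring|simpl; lra].
Qed.

(** * Cauchy's theorem across a horizontal line *)

Lemma uniform_continuity_rect f x1 x2 y1 y2 : on_rect (ccont f) x1 x2 y1 y2 ->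
  forall eps, 0 < eps -> exists d, 0 < d /\ on_rect (fun z => forall w, Cmod (w - z) < d -> Cmod (f w - f z) < eps) x1 x2 y1 y2.
Proof.
  intros Hc eps He.
  apply (rect_compact (fun d z => forall w, Cmod (w - z) < d -> Cmod (f w - f z) < eps)).
  { intros m m' z Hm H w Hw. apply H. lra. }
  intros x y Hx Hy. destruct (proj1 (ccont_eps f (x, y)) (Hc x y Hx Hy) (eps / 2) ltac:(lra)) as [d [Hd W]].
  exists (d / 2), (d / 2). split; [lra|split; [lra|]]. intros z Hz w Hw.
  assert (Hw2 : Cmod (w - (x, y)) < d).
  { replace (w - (x, y))%C with ((w - z) + (z - (x, y)))%C by ring. tri_lt. lra. }
  replace (f w - f z)%C with ((f w - f (x, y)) - (f z - f (x, y)))%C by ring.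
  eapply Rle_lt_trans; [apply Cmod_triangle_minus|]. pose proof (W w Hw2). pose proof (W z ltac:(lra)). lra.
Qed.

Lemma Cmod_small_0 (z : C) : (forall eps, 0 < eps -> Cmod z <= eps) -> z = RtoC 0.
Proof.
  intros H. apply Cmod_eq_0. destruct (Req_dec (Cmod z) 0); auto. exfalso.
  pose proof (Cmod_ge_0 z). specialize (H (Cmod z / 2) ltac:(lra)). lra.
Qed.

Lemma rectint_thin f x1 x2 c y' : on_rect (ccont f) x1 x2 c y' ->
  forall eps, 0 < eps -> exists d, 0 < d /\ forall y, Rmin c y' <= y <= Rmax c y' -> Rabs (y - c) < d ->
    Cmod (rectint f x1 x2 c y) <= eps.
Proof.
  intros Hc eps He.
  destruct (bounded_on_rect f x1 x2 c y' Hc) as [M [HM BM]].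
  pose proof (Rabs_pos (x2 - x1)) as Hx.
  destruct (uniform_continuity_rect f x1 x2 c y' Hc (eps / (2 * (Rabs (x2 - x1) + 1))) ltac:(pos)) as [d [Hd Bd]].
  exists (Rmin d (eps / (4 * (M + 1)))). split; [apply Rmin_pos; auto; pos|].
  intros y Hy Hyc. assert (Y1 := Rlt_le_trans _ _ _ Hyc (Rmin_l _ _)). assert (Y2 := Rlt_le_trans _ _ _ Hyc (Rmin_r _ _)).
  unfold rectint.
  assert (B1 : Cmod (CInt (fun t => f (t, c)) x1 x2 - CInt (fun t => f (t, y)) x1 x2) <= Rabs (x2 - x1) * (eps / (2 * (Rabs (x2 - x1) + 1)))).
  { apply is_CInt_norm_const with (h := fun t => (f (t, c) - f (t, y))%C).
    - intros t Ht. rewrite Cmod_minus_sym. left. apply (Bd t c); auto using Rmin_Rmax_l.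
      eapply Rle_lt_trans; [apply Cmod_le_sum|]. unfold Re, Im; simpl. replace (t + - t) with 0 by ring. rewrite Rabs_R0. unfold Rminus in Y1. lra.
    - apply is_CInt_minus; apply h_correct; intros t Ht; apply Hc; auto using Rmin_Rmax_l. }
  assert (BV : forall x, Rmin x1 x2 <= x <= Rmax x1 x2 -> Cmod (CInt (fun t => f (x, t)) c y) <= Rabs (y - c) * M).
  { intros x Hxx. apply is_CInt_norm_const with (h := fun t => f (x, t)).
    - intros t Ht. apply (BM x t); auto. eapply Rmin_Rmax_between; eauto.
    - apply v_correct. intros t Ht. apply Hc; auto. eapply Rmin_Rmax_between; eauto. }
  pose proof (BV x1 (Rmin_Rmax_l _ _)) as V1. pose proof (BV x2 (Rmin_Rmax_r _ _)) as V2.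
  match goal with |- Cmod (?A + Ci * ?B - ?C' - Ci * ?D')%C <= _ =>
    replace (A + Ci * B - C' - Ci * D')%C with ((A - C') + Ci * (B - D'))%C by ring end.
  tri. rewrite Cmod_mult, Cmod_Ci, Rmult_1_l.
  pose proof (Cmod_triangle_minus (CInt (fun t => f (x2, t)) c y) (CInt (fun t => f (x1, t)) c y)) as T.
  assert (Rabs (x2 - x1) * (eps / (2 * (Rabs (x2 - x1) + 1))) <= eps / 2).
  { apply Rmult_le_reg_r with (2 * (Rabs (x2 - x1) + 1)); [lra|].
    replace (Rabs (x2 - x1) * (eps / (2 * (Rabs (x2 - x1) + 1))) * (2 * (Rabs (x2 - x1) + 1))) with (Rabs (x2 - x1) * eps) by (field; lra). nra. }
  assert (Rabs (y - c) * M <= eps / 4).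
  { apply Rle_trans with (eps / (4 * (M + 1)) * (M + 1)).
    - apply Rmult_le_compat; try lra; apply Rabs_pos.
    - right. field. lra. }
  lra.
Qed.

(** A horizontal line is removable for continuous functions: rectangles away from it give 0, and a
    thin rectangle along it contributes arbitrarily little by [rectint_thin]. *)
Lemma Goursat_off_line f c x1 x2 y1 y2 : on_rect (ccont f) x1 x2 y1 y2 ->
  on_rect (fun z => Im z <> c -> differentiable f z) x1 x2 y1 y2 -> rectint f x1 x2 y1 y2 = RtoC 0.
Proof.
  intros H1 H2.
  apply (rectint_zero_unordered (fun z => ccont f z /\ (Im z <> c -> differentiable f z))).
  3: { intros x y Hx Hy; split; [apply H1|apply H2]; auto. }
  { tauto. }
  clear. intros x1 x2 y1 y2 Hx Hy HQ.
  assert (Hc : on_rect (ccont f) x1 x2 y1 y2) by (apply on_rect_impl with (2 := HQ); tauto).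
  assert (G : forall y y', y1 <= y <= y2 -> y1 <= y' <= y2 -> (Rmin y y' > c \/ Rmax y y' < c) -> rectint f x1 x2 y y' = RtoC 0).
  { intros y y' A B Hcc. apply Goursat. intros u v Hu Hv. apply (HQ u v); auto.
    - rewrite (Rmin_left y1 y2), Rmax_right by lra. revert Hv; unfold Rmin, Rmax; destruct (Rle_dec y y'); lra.
    - simpl. lra. }
  assert (K : forall y', y1 <= y' <= y2 -> y1 <= c <= y2 -> rectint f x1 x2 c y' = RtoC 0).
  { intros y' Hy' Hcc. destruct (Req_dec y' c) as [->|Ne].
    { unfold rectint. rewrite !(is_CInt_unique _ _ _ _ (is_CInt_point _ c)). ring. }
    assert (Hc' : on_rect (ccont f) x1 x2 c y') by (apply on_rect_sub with (1 := Hc); lra).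
    apply Cmod_small_0. intros eps He.
    destruct (rectint_thin f x1 x2 c y' Hc' eps He) as [d [Hd Kd]].
    set (m := Rmin (d / 2) (Rabs (y' - c))).
    assert (0 < m) by (apply Rmin_pos; [lra|apply Rabs_pos_lt; lra]).
    assert (m <= d / 2) by apply Rmin_l. assert (m <= Rabs (y' - c)) by apply Rmin_r.
    set (y := if Rle_dec c y' then c + m else c - m).
    assert (Hyy : Rmin c y' <= y <= Rmax c y' /\ Rabs (y - c) < d /\ (Rmin y y' > c \/ Rmax y y' < c)).
    { unfold y. unfold Rmin at 1, Rmax at 1. destruct (Rle_dec c y').
      - rewrite Rabs_right in H1 by lra. repeat split; try lra.
        + rewrite Rabs_right; lra.
        + left. apply Rmin_glb_lt; lra.
      - rewrite Rabs_left in H1 by lra. repeat split; try lra.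
        + rewrite Rabs_left; lra.
        + right. apply Rmax_lub_lt; lra. }
    destruct Hyy as [Y1 [Y2 Y3]].
    assert (Yb : y1 <= y <= y2) by (revert Y1; unfold Rmin, Rmax; destruct (Rle_dec c y'); lra).
    rewrite <- (rectint_Chasles_v f x1 x2 c y y').
    - rewrite (G y y') by auto. replace (rectint f x1 x2 c y + 0)%C with (rectint f x1 x2 c y) by ring. auto.
    - apply on_rect_sides, on_rect_sub with (1 := Hc); lra.
    - apply on_rect_sides, on_rect_sub with (1 := Hc); lra. }
  destruct (Rlt_dec c y1) as [|N1]; [apply G; try lra; left; rewrite Rmin_left; lra|].
  destruct (Rlt_dec y2 c) as [|N2]; [apply G; try lra; right; rewrite Rmax_right; lra|].
  rewrite <- (rectint_Chasles_v f x1 x2 y1 c y2); try (apply on_rect_sides, on_rect_sub with (1 := Hc); lra).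
  rewrite (rectint_swap_v f x1 x2 c y1) by (apply on_rect_sub with (1 := Hc); lra).
  rewrite !K by lra. ring.
Qed.

(** The quotient takes the value [f'(a)] at [a], where only its continuity is known at this stage.
    This is why Cauchy's theorem is wanted in the form [Goursat_off_line], applied to the horizontal
    line through [a]. *)
Lemma difference_quotient (f : C -> C) (a : C) : differentiable f a -> exists q : C -> C,
  (forall z, f z = f a + (z - a) * q z)%C /\ ccont q a /\
  (forall z, z <> a -> ccont f z -> ccont q z) /\
  (forall z, z <> a -> differentiable f z -> differentiable q z).
Proof.
  intros [l Hl].
  exists (fun z => if excluded_middle_informative (z = a) then l else ((f z - f a) * / (z - a))%C).
  split; [|split].
  - intros z. destruct (excluded_middle_informative (z = a)) as [->|N]; [ring|]. field. apply Cminus_neq_0; auto.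
  - apply ccont_eps. intros eps He. destruct (Hl (eps / 2) ltac:(lra)) as [d [Hd W]]. exists d; split; auto.
    intros w Hw. destruct (excluded_middle_informative (a = a)) as [_|N]; [|congruence].
    destruct (excluded_middle_informative (w = a)) as [->|N].
    { replace (l - l)%C with (RtoC 0) by ring. rewrite Cmod_0; auto. }
    specialize (W w Hw).
    pose proof (proj1 (Cmod_gt_0 _) (Cminus_neq_0 _ _ N)) as P.
    replace ((f w - f a) * / (w - a) - l)%C with ((f w - f a - l * (w - a)) * / (w - a))%C by (field; apply Cminus_neq_0; auto).
    rewrite Cmod_mult, Cmod_inv by (apply Cminus_neq_0; auto).
    apply Rle_lt_trans with (eps / 2); [|lra].
    apply Rmult_le_reg_r with (Cmod (w - a)); auto. rewrite Rmult_assoc, Rinv_l by lra. lra.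
  - assert (Loc : forall z, z <> a -> forall w, Cmod (w - z) < Cmod (z - a) ->
      ((f w - f a) * / (w - a))%C = (if excluded_middle_informative (w = a) then l else ((f w - f a) * / (w - a))%C)).
    { intros z Hz w Hw. destruct (excluded_middle_informative (w = a)) as [->|]; auto.
      rewrite Cmod_minus_sym in Hw. lra. }
    split; intros z Hz Hf.
    + pose proof (proj1 (Cmod_gt_0 _) (Cminus_neq_0 _ _ Hz)) as P.
      assert (K : ccont (fun z => (f z - f a) * / (z - a))%C z) by (csolve; apply Cminus_neq_0; auto).
      apply ccont_eps. intros eps He. destruct (proj1 (ccont_eps _ _) K eps He) as [d [Hd W]].
      exists (Rmin d (Cmod (z - a))). split; [apply Rmin_pos; auto|]. intros w Hw.
      assert (W1 := Rlt_le_trans _ _ _ Hw (Rmin_l _ _)). assert (W2 := Rlt_le_trans _ _ _ Hw (Rmin_r _ _)).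
      rewrite <- !(Loc z Hz); auto. replace (z - z)%C with (RtoC 0) by ring. rewrite Cmod_0; auto.
    + destruct Hf as [m Hm]. pose proof (proj1 (Cmod_gt_0 _) (Cminus_neq_0 _ _ Hz)) as P.
      eexists. eapply cder_ext_loc; [exact P|apply Loc; auto|].
      apply (cder_mult (fun z => f z - f a)%C (fun z => / (z - a))%C); [|apply cder_inv_minus; auto].
      apply cder_minus; [exact Hm|apply cder_const].
Qed.

(** On the sides [f z / (z - a)] is the difference quotient plus [f a / (z - a)]: the first
    integrates to 0, the second is [rectint_inv]. Differentiability off the line of ordinate [Im a]
    suffices, so the formula applies to functions already divided by real roots. *)
Lemma Cauchy_formula f (a : C) x1 x2 y1 y2 : x1 < Re a < x2 -> y1 < Im a < y2 ->
  on_rect (ccont f) x1 x2 y1 y2 -> on_rect (fun z => Im z <> Im a -> differentiable f z) x1 x2 y1 y2 ->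
  differentiable f a -> rectint (fun z => f z / (z - a))%C x1 x2 y1 y2 = (2 * Ci * RtoC PI * f a)%C.
Proof.
  intros Hx Hy Hc Hd Ha. destruct (difference_quotient f a Ha) as [q [Q1 [Q2 [Q3 Q4]]]].
  assert (Cq : on_rect (ccont q) x1 x2 y1 y2).
  { intros x y A B. destruct (classic ((x, y) = a)) as [->|N]; auto. }
  assert (Z : rectint q x1 x2 y1 y2 = RtoC 0).
  { apply Goursat_off_line with (Im a); auto. intros x y A B N. apply Q4.
    - intros E. apply N. rewrite E. reflexivity.
    - apply Hd; auto. }
  assert (Ns : on_sides (fun z => z <> a) x1 x2 y1 y2).
  { intros x y _ _ S E. rewrite <- E in Hx, Hy. simpl in Hx, Hy. lra. }
  assert (Ci' : on_sides (ccont (fun z => / (z - a))%C) x1 x2 y1 y2).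
  { intros x y A B S. eapply cder_cont, cder_inv_minus. apply Ns; auto. }
  rewrite (rectint_ext _ (fun z => q z + f a * / (z - a))%C).
  - rewrite rectint_plus, rectint_scal, rectint_inv, Z; auto.
    + ring.
    + apply on_rect_sides; auto.
    + intros x y A B S. apply cont_Cmult; [csolve|apply Ci'; auto].
  - intros x y A B S. rewrite (Q1 (x, y)). field. apply Cminus_neq_0, Ns; auto.
Qed.

(** * Identity theorem on a half-line *)

Fixpoint root_prod (b : nat -> R) (n : nat) (z : C) : C :=
  match n with O => 1%C | S m => (root_prod b m z * (z - RtoC (b m)))%C end.

Lemma root_prod_neq_0 b n z : (forall j, (j < n)%nat -> z <> RtoC (b j)) -> root_prod b n z <> RtoC 0.
Proof.
  induction n; intros H; simpl.
  - intro E. injection E; lra.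
  - apply Cmult_neq_0; [apply IHn; intros; apply H; lia|apply Cminus_neq_0, H; lia].
Qed.

Lemma root_prod_ge b n z m : 0 <= m -> (forall j, (j < n)%nat -> m <= Cmod (z - RtoC (b j))) -> m ^ n <= Cmod (root_prod b n z).
Proof.
  intros Hm. induction n; intros H; simpl.
  - rewrite Cmod_1. lra.
  - rewrite Cmod_mult, Rmult_comm. apply Rmult_le_compat; auto. apply pow_le; auto.
Qed.

Lemma root_prod_le b n z m : 0 <= m -> (forall j, (j < n)%nat -> Cmod (z - RtoC (b j)) <= m) -> Cmod (root_prod b n z) <= m ^ n.
Proof.
  intros Hm. induction n; intros H; simpl.
  - rewrite Cmod_1. lra.
  - rewrite Cmod_mult, Rmult_comm. rmul.
Qed.

(** The quotient after [n] divisions is only known to be continuous at the roots already removed,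
    but the next root is a new point, where it is differentiable and must vanish. *)
Lemma divide_out_roots (Q : C -> Prop) f (b : nat -> R) :
  (forall z, Q z -> differentiable f z) ->
  (forall j, Q (RtoC (b j)) /\ f (RtoC (b j)) = RtoC 0) ->
  (forall i j, b i = b j -> i = j) ->
  forall n, exists g, (forall z, f z = root_prod b n z * g z)%C /\
    (forall z, Q z -> ccont g z) /\
    (forall z, Q z -> (forall j, (j < n)%nat -> z <> RtoC (b j)) -> differentiable g z).
Proof.
  intros Hd Hb Hi. induction n as [|n [g [G1 [G2 G3]]]].
  - exists f. split; [|split]; auto.
    + intros; simpl; ring.
    + intros; apply differentiable_cont; auto.
  - assert (Nb : forall j, (j < n)%nat -> RtoC (b n) <> RtoC (b j)).
    { intros j Hj E. injection E; intros E'. apply Hi in E'. lia. }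
    destruct (difference_quotient g (RtoC (b n)) (G3 _ (proj1 (Hb n)) Nb)) as [q [Q1 [Q2 [Q3 Q4]]]].
    assert (Z : g (RtoC (b n)) = RtoC 0).
    { pose proof (proj2 (Hb n)) as K. rewrite G1 in K. destruct (classic (g (RtoC (b n)) = RtoC 0)); auto.
      exfalso. revert K. apply Cmult_neq_0; auto. apply root_prod_neq_0; auto. }
    exists q. split; [|split].
    + intros z. rewrite G1, Q1, Z. simpl. ring.
    + intros z Hz. destruct (classic (z = RtoC (b n))) as [->|N]; auto.
    + intros z Hz Hj. apply Q4; [apply Hj; lia|]. apply G3; auto.
Qed.

Lemma pow_half_small (K eps : R) : 0 < eps -> 0 <= K -> exists n, K * (1 / 2) ^ n <= eps.
Proof.
  intros He HK. destruct (dyadic_small K eps He) as [n Hn]. exists n. specialize (Hn n (Nat.le_refl n)).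
  replace ((1 / 2) ^ n) with (/ 2 ^ n); [unfold Rdiv in Hn; lra|].
  unfold Rdiv. rewrite Rmult_1_l, pow_inv. reflexivity.
Qed.

(** A Schwarz-type argument in place of power series. After division by [n] zeros in []a, a + L/8]],
    Cauchy's formula bounds the quotient at [x] by a constant times [(7L/8)^(-n)], the sides being
    at distance at least [7L/8]; the product of roots at [x] is at most [(L/4)^n]. The ratio is
    below [1/2], so [f x] is at most [K / 2^n] for all [n]. *)
Lemma identity_local f (a L : R) : 0 < L -> on_rect (differentiable f) (a - L) (a + L) (- L) L ->
  (forall x, a < x < a + L -> f (RtoC x) = RtoC 0) ->
  forall x, a - L / 8 < x <= a -> f (RtoC x) = RtoC 0.
Proof.
  intros HL Hd H0 x Hx.
  assert (HM : exists M, 0 <= M /\ on_rect (fun z => Cmod (f z) <= M) (a - L) (a + L) (- L) L).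
  { apply bounded_on_rect. apply on_rect_impl with (2 := Hd). apply differentiable_cont. }
  destruct HM as [M [HM BM]].
  (* Infinitely many distinct zeros within [L/8] to the right of [a]. *)
  set (b := fun j : nat => a + L / 8 * / INR (S j)).
  assert (Hb : forall j, a < b j <= a + L / 8).
  { intros j. unfold b. assert (1 <= INR (S j)) by (rewrite S_INR; pose proof (pos_INR j); lra).
    assert (0 < / INR (S j) <= 1).
    { split; [pos|]. rewrite <- Rinv_1. apply Rinv_le_contravar; lra. }
    nra. }
  set (Q := fun z => a - L <= Re z <= a + L /\ - L <= Im z <= L).
  assert (HQ : forall z, Q z -> differentiable f z).
  { intros [u v] [A B]. apply Hd; [rewrite Rmin_left, Rmax_right|rewrite Rmin_left, Rmax_right]; simpl in *; lra. }
  assert (Hon : forall P : C -> Prop, (forall z, Q z -> P z) -> on_rect P (a - L) (a + L) (- L) L).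
  { intros P HP u v A B. ordered in A. ordered in B. apply HP. split; simpl; auto. }
  pose proof (divide_out_roots Q f b HQ) as DV.
  assert (D1 : forall j, Q (RtoC (b j)) /\ f (RtoC (b j)) = RtoC 0).
  { intros j. specialize (Hb j). split; [split; simpl; lra|apply H0; lra]. }
  assert (D2 : forall i j, b i = b j -> i = j).
  { intros i j E. unfold b in E. assert (E2 : / INR (S i) = / INR (S j)) by (apply Rmult_eq_reg_l with (L / 8); lra).
    apply (f_equal Rinv) in E2. rewrite !Rinv_inv in E2. apply INR_eq in E2. lia. }
  specialize (DV D1 D2).
  assert (Hc : 0 < 7 * L / 8) by lra.
  pose proof PI_RGT_0 as HPI.
  set (K := 8 * L * M / (7 * L / 8) / (2 * PI)).
  assert (HK : 0 <= K).
  { unfold K. pos. }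
  assert (Bn : forall n, Cmod (f (RtoC x)) <= K * (1 / 2) ^ n).
  { intros n. destruct (DV n) as [g [G1 [G2 G3]]].
    assert (Nx : forall j, (j < n)%nat -> RtoC x <> RtoC (b j)).
    { intros j _ E. injection E. specialize (Hb j). lra. }
    assert (CF : rectint (fun z => g z / (z - RtoC x))%C (a - L) (a + L) (- L) L = (2 * Ci * RtoC PI * g (RtoC x))%C).
    { apply Cauchy_formula; simpl; try lra.
      - apply Hon; auto.
      - apply Hon. intros z Hz N. apply G3; auto. intros j _ E. apply N. rewrite E. reflexivity.
      - apply G3; auto. split; simpl; lra. }
    assert (Sd : on_sides (fun z => 7 * L / 8 <= Cmod (z - RtoC x) /\ (forall j, 7 * L / 8 <= Cmod (z - RtoC (b j))) /\ Q z) (a - L) (a + L) (- L) L).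
    { intros u v A B S. ordered in A. ordered in B.
      assert (T : forall y, a - L / 8 <= y <= a + L / 8 -> 7 * L / 8 <= Cmod ((u, v) - RtoC y)).
      { intros y Hy. pose proof (re_le_Cmod ((u, v) - RtoC y)%C) as R1. pose proof (im_le_Cmod ((u, v) - RtoC y)%C) as R2.
        unfold Re, Im in R1, R2; simpl in R1, R2.
        pose proof (Rle_abs (u + - y)). pose proof (Rle_abs (- (u + - y))). rewrite Rabs_Ropp in H1.
        pose proof (Rle_abs (v + - 0)). pose proof (Rle_abs (- (v + - 0))). rewrite Rabs_Ropp in H3.
        destruct S as [->|[->|[->| ->]]]; lra. }
      split; [apply T; lra|]. split; [intros j; apply T; specialize (Hb j); lra|split; simpl; auto]. }
    assert (B1 : Cmod (rectint (fun z => g z / (z - RtoC x))%C (a - L) (a + L) (- L) L) <= 2 * (Rabs (a + L - (a - L)) + Rabs (L - - L)) * (M / (7 * L / 8) ^ n / (7 * L / 8))).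
    { apply rectint_norm.
      - intros u v A B S. destruct (Sd u v A B S) as [S1 [S2 S3]].
        apply cont_Cdiv; [apply G2; auto|csolve|]. apply Cmod_gt_0. eapply Rlt_le_trans; [|exact S1]. lra.
      - intros u v A B S. destruct (Sd u v A B S) as [S1 [S2 S3]].
        assert (N1 : ((u, v) - RtoC x)%C <> RtoC 0) by (apply Cmod_gt_0; eapply Rlt_le_trans; [|exact S1]; lra).
        rewrite Cmod_div by auto.
        assert (P1 : (7 * L / 8) ^ n <= Cmod (root_prod b n (u, v))) by (apply root_prod_ge; [lra|intros; auto]).
        assert (P0 : 0 < (7 * L / 8) ^ n) by (apply pow_lt; lra).
        assert (P2 : Cmod (f (u, v)) <= M) by (apply BM; auto).
        rewrite G1, Cmod_mult in P2. pose proof (Cmod_ge_0 (g (u, v))).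
        apply Rmult_le_compat; auto.
        + left. apply Rinv_0_lt_compat. apply Cmod_gt_0; auto.
        + apply Rmult_le_reg_r with ((7 * L / 8) ^ n); auto.
          unfold Rdiv. rewrite (Rmult_assoc M), Rinv_l, Rmult_1_r by (unfold Rdiv in P0; lra). unfold Rdiv in *. nra.
        + apply Rinv_le_contravar; lra. }
    rewrite CF in B1. rewrite !Cmod_mult, Cmod_Ci, !Cmod_R, (Rabs_right 2), (Rabs_right PI) in B1 by lra.
    rewrite (Rabs_right (a + L - (a - L))), (Rabs_right (L - - L)) in B1 by lra.
    rewrite G1, Cmod_mult.
    assert (P2 : Cmod (root_prod b n (RtoC x)) <= (L / 4) ^ n).
    { apply root_prod_le; [lra|]. intros j _. specialize (Hb j). rewrite <- RtoC_minus, Cmod_R. apply Rabs_le. lra. }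
    assert (P3 : (L / 4) ^ n <= (1 / 2) ^ n * (7 * L / 8) ^ n).
    { rewrite <- Rpow_mult_distr. apply pow_incr. lra. }
    assert (P0 : 0 < (7 * L / 8) ^ n) by (apply pow_lt; lra).
    assert (Ph : 0 < (1 / 2) ^ n) by (apply pow_lt; lra).
    assert (P4 : Cmod (g (RtoC x)) <= K / (7 * L / 8) ^ n).
    { apply Rmult_le_reg_l with (2 * PI); [lra|].
      replace (2 * PI * Cmod (g (RtoC x))) with (2 * 1 * PI * Cmod (g (RtoC x))) by ring.
      eapply Rle_trans; [exact B1|]. right. unfold K. field. repeat split; try lra. }
    apply Rle_trans with ((1 / 2) ^ n * (7 * L / 8) ^ n * (K / (7 * L / 8) ^ n)).
    - apply Rmult_le_compat; try apply Cmod_ge_0; lra.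
    - right. field. lra. }
  apply Cmod_small_0. intros eps He. destruct (pow_half_small K eps He HK) as [n Hn].
  eapply Rle_trans; [apply Bn|exact Hn].
Qed.

(** At the supremum of the real points where [f] does not vanish, [identity_local] pushes the
    vanishing further left by a fixed amount. *)
Lemma identity_half_line f :
  (forall c, 0 < c -> exists L, 0 < L /\ on_rect (differentiable f) (c - L) (c + L) (- L) L) ->
  (exists c0, forall c, c0 < c -> f (RtoC c) = RtoC 0) ->
  forall c, 0 < c -> f (RtoC c) = RtoC 0.
Proof.
  intros Hd [c0 H0] c Hc. destruct (classic (f (RtoC c) = RtoC 0)) as [|N]; auto. exfalso.
  destruct (completeness (fun y => f (RtoC y) <> RtoC 0)) as [s [S1 S2]].
  - exists c0. intros y Hy. destruct (Rle_dec y c0); auto. exfalso. apply Hy, H0. lra.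
  - exists c; auto.
  - assert (Hs : c <= s) by (apply S1; auto).
    destruct (Hd s ltac:(lra)) as [L [HL Dl]].
    assert (Z : forall x, s < x -> f (RtoC x) = RtoC 0).
    { intros x Hx. destruct (classic (f (RtoC x) = RtoC 0)) as [|N']; auto. exfalso. apply S1 in N'. lra. }
    pose proof (identity_local f s L HL Dl ltac:(intros; apply Z; lra)) as I.
    assert (s <= s - L / 8); [|lra].
    apply S2. intros y Hy. destruct (Rle_dec y (s - L / 8)); auto. exfalso. apply Hy.
    destruct (Rle_dec y s); [apply I; lra|apply Z; lra].
Qed.

(** * Integration along piecewise C^1 paths *)

(** Freezes the parameter outside [[a, b]]: a path known on [[a, b]] only becomes continuous on the
    whole line. *)
Definition clip (a b t : R) : R := Rmax a (Rmin t b).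

Lemma clip_in a b t : a <= b -> a <= clip a b t <= b.
Proof.
  intros. unfold clip, Rmax, Rmin. destruct (Rle_dec t b).
  - destruct (Rle_dec a t); lra.
  - destruct (Rle_dec a b); lra.
Qed.

Lemma clip_id a b t : a <= t <= b -> clip a b t = t.
Proof. intros. unfold clip. rewrite Rmin_left, Rmax_right; lra. Qed.

Lemma clip_lip a b s t : Rabs (clip a b s - clip a b t) <= Rabs (s - t).
Proof.
  unfold clip, Rmax, Rmin.
  destruct (Rle_dec s b), (Rle_dec t b);
  repeat match goal with |- context [Rle_dec ?x ?y] => destruct (Rle_dec x y) end;
  unfold Rabs; repeat destruct Rcase_abs; lra.
Qed.

Lemma rcont_comp_clip (f : R -> C) a b : a <= b ->
  continuous_on (T := R_UniformSpace) (U := C_UniformSpace) (fun t => a <= t <= b) f ->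
  forall t, rcont (fun s => f (clip a b s)) t.
Proof.
  intros Hab H t. apply filterlim_locally. intros eps.
  specialize (H (clip a b t) (clip_in a b t Hab)).
  apply filterlim_locally with (eps := eps) in H.
  destruct H as [d Hd]. exists d. intros s Hs. apply Hd; [|apply clip_in; auto].
  eapply Rle_lt_trans; [apply clip_lip|exact Hs].
Qed.

(** Inside each piece the velocity [pd] agrees with a function [h] continuous on the whole line. Its
    values at the breakpoints are irrelevant, and integrands built with [h] are continuous, hence
    integrable. *)
Inductive pieces (g pd : R -> C) : R -> R -> Prop :=
| pieces_one c d h : c <= d -> (forall t, rcont h t) ->
    (forall t, c < t < d -> pd t = h t /\ rderive g t (h t)) -> pieces g pd c d
| pieces_cat c m d : pieces g pd c m -> pieces g pd m d -> pieces g pd c d.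

Lemma pieces_le g pd c d : pieces g pd c d -> c <= d.
Proof. induction 1; lra. Qed.

Lemma rderive_parts (h : R -> C) t (l : C) : rderive h t l ->
  is_derive (fun s => Re (h s)) t (Re l) /\ is_derive (fun s => Im (h s)) t (Im l).
Proof.
  intros D. split; [pose proof (filterdiff_comp' h fst t _ _ D (filterdiff_linear _ is_linear_fst)) as E|
    pose proof (filterdiff_comp' h snd t _ _ D (filterdiff_linear _ is_linear_snd)) as E]; exact E.
Qed.

Lemma path_derive_correct (gam : R -> C) t :
  ex_derive (V := C_R_NormedModule) gam t -> rderive gam t (path_derive gam t).
Proof.
  intros [[u v] H]. destruct (rderive_parts _ _ _ H) as [D1 D2].
  replace (path_derive gam t) with ((u, v) : C); [exact H|].
  unfold path_derive. f_equal; symmetry; apply is_derive_unique; auto.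
Qed.

(** Induction on the list of breakpoints, over all subintervals at once: a breakpoint inside cuts
    the interval in two, and once none is left the one-sided limits at both ends extend the velocity
    continuously. *)
Lemma piecewise_pieces gam a b : a <= b -> piecewise_C1 gam a b ->
  (forall t, rcont (fun s => gam (clip a b s)) t) /\ pieces (fun s => gam (clip a b s)) (path_derive gam) a b.
Proof.
  intros Hab [Hc [l [Hl [HR HL]]]]. split; [apply rcont_comp_clip; auto|].
  assert (Loc : forall t, a < t < b -> ex_derive (V := C_R_NormedModule) gam t ->
    rderive (fun s => gam (clip a b s)) t (path_derive gam t)).
  { intros t Ht Ex. apply is_derive_ext_loc with gam; [|apply path_derive_correct; auto].
    assert (Hm : 0 < Rmin (t - a) (b - t)) by (apply Rmin_pos; lra).
    exists (mkposreal _ Hm). intros s Hs. change (Rabs (s - t) < Rmin (t - a) (b - t)) in Hs.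
    assert (Q1 := Rlt_le_trans _ _ _ Hs (Rmin_l _ _)). assert (Q2 := Rlt_le_trans _ _ _ Hs (Rmin_r _ _)).
    apply Rabs_def2 in Q1. apply Rabs_def2 in Q2. rewrite clip_id; auto. lra. }
  assert (G : forall l c d, a <= c -> c <= d -> d <= b ->
    (forall t, c < t < d -> ~ In t l -> ex_derive (V := C_R_NormedModule) gam t /\ continuous (U := C_UniformSpace) (path_derive gam) t) ->
    pieces (fun s => gam (clip a b s)) (path_derive gam) c d).
  { clear l Hl. induction l as [|x l IH]; intros c d H1 H2 H3 Hg.
    - destruct (Req_dec c d) as [<-|N].
      { apply pieces_one with (h := fun _ => RtoC 0); [lra|intros; csolve|intros; lra]. }
      destruct (HR c ltac:(lra)) as [d1 Hd1]. destruct (HL d ltac:(lra)) as [d2 Hd2].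
      destruct (C0_extension_lt (T := C_UniformSpace) (path_derive gam) d1 d2 c d) as [k [K1 [K2 _]]]; auto.
      { lra. } { intros t Ht. apply Hg; auto. }
      apply pieces_one with k; auto. intros t Ht. rewrite K2 by auto. split; auto.
      apply Loc; [lra|]. apply Hg; auto.
    - destruct (Rlt_dec c x) as [A|A]; [destruct (Rlt_dec x d) as [B|B]|].
      + apply pieces_cat with x; apply IH; try lra; intros t Ht Hn; apply Hg; try lra; intros [E|E]; [lra|auto|lra|auto].
      + apply IH; try lra. intros t Ht Hn. apply Hg; auto. intros [E|E]; [lra|auto].
      + apply IH; try lra. intros t Ht Hn. apply Hg; auto. intros [E|E]; [lra|auto]. }
  apply G with l; auto; lra.
Qed.

Lemma rderive_zero_const (phi : R -> C) c d : c <= d -> (forall t, rcont phi t) ->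
  (forall t, c < t < d -> rderive phi t (RtoC 0)) -> phi d = phi c.
Proof.
  intros Hcd Hc Hd.
  assert (P : forall k : R -> R, (forall t, continuous k t) -> (forall t, c < t < d -> is_derive k t 0) -> k d = k c).
  { clear Hc Hd. intros k Kc Kd.
    destruct (MVT_gen k c d (fun _ => 0)) as [x [_ E]].
    - ordered. auto.
    - intros x _. apply continuity_pt_filterlim, Kc.
    - lra. }
  apply C_ext; [apply (P (fun t => Re (phi t)))|apply (P (fun t => Im (phi t)))]; intros t;
    try (intros Ht; apply (rderive_parts _ _ _ (Hd t Ht))); csolve; apply Hc.
Qed.

Lemma rderive_CInt (k : R -> C) c t : (forall t, rcont k t) -> rderive (fun s => CInt k c s) t (k t).
Proof.
  intros Hk. apply (is_derive_RInt (V := C_R_NormedModule) k (fun s => CInt k c s) c t); auto.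
  exists (mkposreal 1 Rlt_0_1). intros s _. apply CInt_correct_all; auto.
Qed.

Lemma pieces_integrable (g pd : R -> C) c d (k : R -> C) : pieces g pd c d -> (forall t, rcont k t) ->
  exists l : C, is_CInt (fun t => k t * pd t)%C c d l.
Proof.
  intros H Hk. induction H as [c d h Hcd Hh Hp|c m d _ [l1 I1] _ [l2 I2]].
  - exists (CInt (fun t => k t * h t)%C c d). eapply is_CInt_ext; [|apply CInt_correct_all; intros; csolve; auto].
    ordered. intros t Ht. simpl. rewrite (proj1 (Hp t Ht)). reflexivity.
  - exists (l1 + l2)%C. apply is_CInt_Chasles with m; auto.
Qed.

(** [B] plays the role of the length of the path. It is chosen before the integrand, which permits
    passing to the limit in the integrand. *)
Lemma pieces_bound (g pd : R -> C) c d : pieces g pd c d -> exists B, 0 <= B /\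
  forall (k : R -> C) (l : C) M, (forall t, rcont k t) -> (forall t, c <= t <= d -> Cmod (k t) <= M) ->
    is_CInt (fun t => k t * pd t)%C c d l -> Cmod l <= B * M.
Proof.
  intros H. induction H as [c d h Hcd Hh Hp|c m d H1 [B1 [P1 I1]] H2 [B2 [P2 I2]]].
  - destruct (bounded_on_rect (fun z => h (Re z)) c d 0 0) as [B [HB BB]].
    { intros x y _ _. apply (continuous_comp (fun z : C_UniformSpace => Re z) h); [apply cont_Re, cont_Cid|apply Hh]. }
    exists (Rabs (d - c) * B). split; [pos|].
    intros k l M Hk HM I. rewrite Rmult_assoc.
    apply is_CInt_norm_const with (h := fun t => (k t * h t)%C).
    + ordered. intros t Ht. rewrite Cmod_mult, Rmult_comm.
      rmul.
      apply (BB t 0); [rewrite Rmin_left, Rmax_right; lra|rewrite Rmin_left, Rmax_right; lra].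
    + eapply is_CInt_ext; [|exact I]. ordered.
      intros t Ht. simpl. rewrite (proj1 (Hp t Ht)). reflexivity.
  - exists (B1 + B2). split; [lra|]. intros k l M Hk HM I.
    apply pieces_le in H1 as L1. apply pieces_le in H2 as L2.
    destruct (pieces_integrable g pd c m k H1 Hk) as [l1 J1].
    destruct (pieces_integrable g pd m d k H2 Hk) as [l2 J2].
    rewrite (is_CInt_inj _ _ _ _ _ I (is_CInt_Chasles _ _ _ _ _ _ J1 J2)).
    tri. rewrite Rmult_plus_distr_r.
    apply Rplus_le_compat; [apply I1 with k|apply I2 with k]; auto; intros; apply HM; lra.
Qed.

(** On one piece, [F] along the path minus the running integral is continuous with zero derivative
    inside, hence constant. The path is clipped to the piece because [F] is only controlled along
    it. *)
Lemma pieces_FTC (F f : C -> C) (g pd : R -> C) c d : (forall t, rcont g t) -> pieces g pd c d ->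
  (forall t, c <= t <= d -> cder F (g t) (f (g t))) -> (forall t, c <= t <= d -> ccont f (g t)) ->
  is_CInt (fun t => f (g t) * pd t)%C c d (F (g d) - F (g c))%C.
Proof.
  intros Hg H. induction H as [c d h Hcd Hh Hp|c m d H1 I1 H2 I2]; intros HF Hf.
  - assert (Kg : forall t, rcont (fun s => g (clip c d s)) t).
    { intros t. apply rcont_comp_clip; auto. intros s Hs. eapply filterlim_filter_le_1; [|apply Hg].
      intros P HP. unfold within. eapply filter_imp; [|exact HP]. auto. }
    set (k := fun t => (f (g (clip c d t)) * h t)%C).
    assert (Hk : forall t, rcont k t).
    { intros t. unfold k. apply cont_Cmult; auto. apply (cont_comp_C (fun t => g (clip c d t))); auto. apply Hf, clip_in; auto. }
    set (phi := fun t => (F (g (clip c d t)) - CInt k c t)%C).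
    assert (Z : phi d = phi c).
    { apply rderive_zero_const; auto.
      - intros t. unfold phi. apply cont_Cminus.
        + apply (cont_comp_C (fun t => g (clip c d t))); auto. eapply cder_cont, HF, clip_in; auto.
        + apply (ex_derive_continuous (V := C_R_NormedModule)). eexists. apply rderive_CInt; auto.
      - intros t Ht. unfold phi. replace (RtoC 0) with (f (g t) * h t - k t)%C.
        2: { unfold k. rewrite clip_id by lra. ring. }
        apply (is_derive_minus (V := C_R_NormedModule)); [|apply rderive_CInt; auto].
        apply is_derive_ext_loc with (fun s => F (g s)).
        + assert (Hm : 0 < Rmin (t - c) (d - t)) by (apply Rmin_pos; lra).
          exists (mkposreal _ Hm). intros s Hs. change (Rabs (s - t) < Rmin (t - c) (d - t)) in Hs.
          assert (Q1 := Rlt_le_trans _ _ _ Hs (Rmin_l _ _)). assert (Q2 := Rlt_le_trans _ _ _ Hs (Rmin_r _ _)).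
          apply Rabs_def2 in Q1. apply Rabs_def2 in Q2. rewrite clip_id; auto. lra.
        + apply rderive_comp; [apply HF; lra|apply Hp; auto]. }
    unfold phi in Z. rewrite !clip_id in Z by lra.
    rewrite (is_CInt_unique _ _ _ _ (is_CInt_point k c)) in Z.
    assert (E : @eq C (F (g d) - F (g c))%C (CInt k c d)).
    { transitivity ((F (g d) - CInt k c d) + CInt k c d - F (g c))%C; [ring|]. rewrite Z. ring. }
    rewrite E.
    eapply is_CInt_ext; [|apply CInt_correct_all; auto]. ordered.
    intros t Ht. unfold k. rewrite clip_id by lra. rewrite (proj1 (Hp t Ht)). reflexivity.
  - apply pieces_le in H1 as L1. apply pieces_le in H2 as L2.
    replace (F (g d) - F (g c))%C with ((F (g m) - F (g c)) + (F (g d) - F (g m)))%C by ring.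
    apply is_CInt_Chasles with m; [apply I1|apply I2]; intros; (apply HF || apply Hf); lra.
Qed.

Lemma path_integral_clip (f : C -> C) gam a b (l : C) : a <= b ->
  is_path_integral f gam a b l <-> is_CInt (fun t => f (gam (clip a b t)) * path_derive gam t)%C a b l.
Proof.
  intros Hab. unfold is_path_integral. split; apply is_CInt_ext; ordered;
  intros t Ht; simpl; rewrite clip_id by lra; reflexivity.
Qed.

Lemma path_integral_FTC (F f : C -> C) gam a b : a <= b -> piecewise_C1 gam a b ->
  (forall t, a <= t <= b -> cder F (gam t) (f (gam t))) -> (forall t, a <= t <= b -> ccont f (gam t)) ->
  is_path_integral f gam a b (F (gam b) - F (gam a))%C.
Proof.
  intros Hab Hg HF Hf. apply path_integral_clip; auto.
  destruct (piecewise_pieces gam a b Hab Hg) as [G1 G2].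
  pose proof (pieces_FTC F f _ _ _ _ G1 G2) as K. cbv beta in K. rewrite !(clip_id a b) in K by lra.
  apply K; intros t Ht; rewrite clip_id by lra; auto.
Qed.

(** * Limits at infinity and improper integrals *)

Definition clim (I : R -> C) (l : C) : Prop :=
  forall eps, 0 < eps -> exists T0, forall T, T0 < T -> Cmod (I T - l) < eps.

Definition Clim (I : R -> C) : C := epsilon (inhabits (RtoC 0)) (clim I).

Lemma clim_close (I J : R -> C) l m : clim I l -> clim J m ->
  (forall eps, 0 < eps -> exists T0, forall T, T0 < T -> Cmod (I T - J T) < eps) -> l = m.
Proof.
  intros HI HJ H. replace l with (l - m + m)%C by ring.
  replace (l - m)%C with (RtoC 0); [ring|]. symmetry. apply Cmod_small_0. intros eps He.
  destruct (HI (eps / 3) ltac:(lra)) as [T1 H1]. destruct (HJ (eps / 3) ltac:(lra)) as [T2 H2].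
  destruct (H (eps / 3) ltac:(lra)) as [T3 H3].
  set (T := Rmax T1 (Rmax T2 T3) + 1).
  assert (T1 < T /\ T2 < T /\ T3 < T).
  { unfold T. pose proof (Rmax_l T1 (Rmax T2 T3)). pose proof (Rmax_r T1 (Rmax T2 T3)).
    pose proof (Rmax_l T2 T3). pose proof (Rmax_r T2 T3). lra. }
  specialize (H1 T ltac:(tauto)). specialize (H2 T ltac:(tauto)). specialize (H3 T ltac:(tauto)).
  replace (l - m)%C with ((I T - J T) - (I T - l) + (J T - m))%C by ring.
  tri. eapply Rle_trans; [apply Rplus_le_compat_r, Cmod_triangle_minus|]. lra.
Qed.

Lemma clim_unique (I : R -> C) l m : clim I l -> clim I m -> l = m.
Proof.
  intros H1 H2. apply (clim_close I I); auto. intros eps He. exists 0. intros T _.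
  replace (I T - I T)%C with (RtoC 0) by ring. rewrite Cmod_0; auto.
Qed.

Lemma Clim_unique (I : R -> C) l : clim I l -> Clim I = l.
Proof.
  intros H. apply (clim_unique I); auto. unfold Clim. apply epsilon_spec. exists l; auto.
Qed.

Lemma clim_ext_ge (I J : R -> C) l T1 : (forall T, T1 < T -> I T = J T) -> clim I l -> clim J l.
Proof.
  intros E H eps He. destruct (H eps He) as [T0 H0]. exists (Rmax T0 T1). intros T HT.
  rewrite <- E; [apply H0|]; eapply Rle_lt_trans; [apply Rmax_l|exact HT|apply Rmax_r|exact HT].
Qed.

Lemma clim_ext (I J : R -> C) l : (forall T, I T = J T) -> clim I l -> clim J l.
Proof. intros E. apply clim_ext_ge with 0; auto. Qed.

Lemma clim_const (l : C) : clim (fun _ => l) l.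
Proof. intros eps He. exists 0. intros T _. replace (l - l)%C with (RtoC 0) by ring. rewrite Cmod_0; auto. Qed.

Lemma clim_plus I J l m : clim I l -> clim J m -> clim (fun T => I T + J T)%C (l + m)%C.
Proof.
  intros H1 H2 eps He. destruct (H1 (eps / 2) ltac:(lra)) as [T1 W1]. destruct (H2 (eps / 2) ltac:(lra)) as [T2 W2].
  exists (Rmax T1 T2). intros T HT.
  specialize (W1 T (Rle_lt_trans _ _ _ (Rmax_l _ _) HT)). specialize (W2 T (Rle_lt_trans _ _ _ (Rmax_r _ _) HT)).
  replace (I T + J T - (l + m))%C with ((I T - l) + (J T - m))%C by ring.
  tri_lt. lra.
Qed.

Lemma clim_cmult c I l : clim I l -> clim (fun T => c * I T)%C (c * l)%C.
Proof.
  intros H eps He. pose proof (Cmod_ge_0 c). destruct (H (eps / (Cmod c + 1)) ltac:(pos)) as [T0 W].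
  exists T0. intros T HT. specialize (W T HT). replace (c * I T - c * l)%C with (c * (I T - l))%C by ring.
  rewrite Cmod_mult. apply Rle_lt_trans with ((Cmod c) * (eps / (Cmod c + 1))).
  - apply Rmult_le_compat_l; lra.
  - apply Rmult_lt_reg_r with (Cmod c + 1); [lra|].
    replace (Cmod c * (eps / (Cmod c + 1)) * (Cmod c + 1)) with (Cmod c * eps) by (field; lra). nra.
Qed.

Lemma clim_opp I l : clim I l -> clim (fun T => - I T)%C (- l)%C.
Proof.
  intros H. apply (clim_cmult (-(1))%C) in H. replace (- l)%C with (- (1) * l)%C by ring.
  eapply clim_ext; [|exact H]. intros; simpl; ring.
Qed.

Lemma clim_minus I J l m : clim I l -> clim J m -> clim (fun T => I T - J T)%C (l - m)%C.
Proof. intros; apply clim_plus; auto. apply clim_opp; auto. Qed.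

Lemma clim_affine I l s t : 0 < s -> clim I l -> clim (fun T => I (s * T + t)) l.
Proof.
  intros Hs H eps He. destruct (H eps He) as [T0 W]. exists ((T0 - t) / s). intros T HT. apply W.
  apply Rmult_lt_compat_l with (r := s) in HT; auto. replace (s * ((T0 - t) / s)) with (T0 - t) in HT by (field; lra). lra.
Qed.

Lemma clim_norm_le I l M : clim I l -> (exists T1, forall T, T1 < T -> Cmod (I T) <= M) -> Cmod l <= M.
Proof.
  intros H [T1 HM].
  destruct (Rle_dec (Cmod l) M) as [|N]; auto. exfalso.
  destruct (H (Cmod l - M) ltac:(lra)) as [T0 W]. set (T := Rmax T0 T1 + 1).
  assert (T0 < T /\ T1 < T) by (unfold T; pose proof (Rmax_l T0 T1); pose proof (Rmax_r T0 T1); lra).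
  specialize (W T ltac:(tauto)). specialize (HM T ltac:(tauto)).
  pose proof (Cmod_rev_triangle l (I T)). rewrite Cmod_minus_sym in H1. lra.
Qed.

Lemma exp_decay_small (K a eps : R) : 0 < a -> 0 < eps -> exists T0, 0 <= T0 /\ forall T, T0 < T -> K * exp (- (a * T)) < eps.
Proof.
  intros Ha He. set (K' := Rabs K + 1). assert (HK : 0 < K') by (unfold K'; pose proof (Rabs_pos K); lra).
  exists (K' / (a * eps)). split; [pos|]. intros T HT.
  assert (HT0 : 0 < T).
  { eapply Rlt_trans; [|exact HT]. apply Rdiv_lt_0_compat; auto. apply Rmult_lt_0_compat; auto. }
  assert (HaT : 0 < a * T) by pos.
  assert (Q : K' < eps * (a * T)).
  { apply Rmult_lt_compat_r with (r := a * eps) in HT; [|pos].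
    replace (K' / (a * eps) * (a * eps)) with K' in HT by (field; lra). lra. }
  rewrite exp_Ropp. pose proof (exp_ineq1 (a * T) ltac:(lra)) as E.
  apply Rle_lt_trans with (K' * / exp (a * T)).
  - apply Rmult_le_compat_r; [pos|]. unfold K'. pose proof (Rle_abs K). lra.
  - apply Rmult_lt_reg_r with (exp (a * T)); [apply exp_pos|]. rewrite Rmult_assoc, Rinv_l, Rmult_1_r by (apply Rgt_not_eq, exp_pos).
    eapply Rlt_trans; [exact Q|]. apply Rmult_lt_compat_l; lra.
Qed.

(** Absorbs a linear factor at the price of an arbitrarily small loss [s] in the exponential
    rate. *)
Lemma linear_le_exp (s t : R) : 0 < s -> 0 <= t -> 1 + t <= exp s / s * exp (s * t).
Proof.
  intros Hs Ht. replace (exp s / s * exp (s * t)) with (exp (s + s * t) / s) by (rewrite exp_plus; field; lra).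
  apply Rmult_le_reg_r with s; auto. unfold Rdiv. rewrite Rmult_assoc, Rinv_l, Rmult_1_r by lra.
  assert (0 < s + s * t) by nra. pose proof (exp_ineq1 (s + s * t) ltac:(lra)). nra.
Qed.

Lemma is_RInt_exp a K T T' : 0 < a -> is_RInt (fun t => K * exp (- (a * t))) T T' (K / a * exp (- (a * T)) - K / a * exp (- (a * T'))).
Proof.
  intros Ha.
  replace (K / a * exp (- (a * T)) - K / a * exp (- (a * T'))) with (minus ((fun t => - (K / a * exp (- (a * t)))) T') ((fun t => - (K / a * exp (- (a * t)))) T)).
  2: { unfold minus, plus, opp; simpl. ring. }
  apply (is_RInt_derive (V := R_CompleteNormedModule) (fun t => - (K / a * exp (- (a * t))))).
  - intros x _. auto_derive; auto. field. lra.
  - intros x _. apply (ex_derive_continuous (V := R_NormedModule)). auto_derive. auto.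
Qed.

Lemma exp_dominated (h : R -> C) K a : 0 < a -> (forall t, 0 <= t -> rcont h t) ->
  (forall t, 0 <= t -> Cmod (h t) <= K * exp (- (a * t))) ->
  exists l, clim (CInt h 0) l /\ forall T, 0 <= T -> Cmod (CInt h 0 T - l) <= K / a * exp (- (a * T)).
Proof.
  intros Ha Hc Hb.
  assert (HK : 0 <= K).
  { specialize (Hb 0 ltac:(lra)). rewrite Rmult_0_r, Ropp_0, exp_0 in Hb. pose proof (Cmod_ge_0 (h 0)); lra. }
  assert (HKa : 0 <= K / a) by pos.
  assert (D : forall T T', 0 <= T <= T' -> Cmod (CInt h 0 T' - CInt h 0 T) <= K / a * exp (- (a * T))).
  { intros T T' HT.
    assert (E : @eq C (CInt h 0 T' - CInt h 0 T)%C (CInt h T T')).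
    { rewrite <- (CInt_Chasles h 0 T T'); [ring| |]; intros t Ht; apply Hc; revert Ht; unfold Rmin; [destruct (Rle_dec 0 T)|destruct (Rle_dec T T')]; lra. }
    rewrite E. eapply Rle_trans; [apply is_CInt_norm with (h := h) (a := T) (b := T') (g := fun t => K * exp (- (a * t)))|].
    - lra.
    - intros t Ht; apply Hb; lra.
    - apply CInt_correct. intros t Ht. apply Hc. revert Ht; unfold Rmin; destruct (Rle_dec T T'); lra.
    - apply is_RInt_exp; auto.
    - assert (0 <= K / a * exp (- (a * T'))) by pos. lra. }
  assert (Ex : exists l : C, filterlim (CInt h 0) (Rbar_locally p_infty) (locally (T := C_UniformSpace) l)).
  { apply (filterlim_locally_cauchy (U := C_R_CompleteNormedModule)). intros eps.
    destruct (exp_decay_small (K / a) a (eps / 2) Ha ltac:(pose proof (cond_pos eps); lra)) as [T0 [HT0 W]].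
    exists (fun T => T0 + 1 < T). split; [exists (T0 + 1); auto|]. intros u v Hu Hv.
    assert (B : Cmod (CInt h 0 v - CInt h 0 u) < eps).
    { replace (CInt h 0 v - CInt h 0 u)%C with ((CInt h 0 v - CInt h 0 (T0 + 1)) - (CInt h 0 u - CInt h 0 (T0 + 1)))%C by ring.
      eapply Rle_lt_trans; [apply Cmod_triangle_minus|].
      pose proof (D (T0 + 1) u ltac:(lra)). pose proof (D (T0 + 1) v ltac:(lra)). specialize (W (T0 + 1) ltac:(lra)). lra. }
    split; (eapply Rle_lt_trans; [|exact B]); [apply (re_le_Cmod (CInt h 0 v - CInt h 0 u))|apply (im_le_Cmod (CInt h 0 v - CInt h 0 u))]. }
  destruct Ex as [l Hl]. exists l.
  assert (L : clim (CInt h 0) l).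
  { intros eps He. assert (He2 : 0 < eps / 2) by lra.
    apply filterlim_locally with (eps := mkposreal _ He2) in Hl. destruct Hl as [T0 W]. exists T0. intros T HT.
    destruct (W T HT) as [A B]. change (Rabs (Re (CInt h 0 T - l)%C) < eps / 2) in A. change (Rabs (Im (CInt h 0 T - l)%C) < eps / 2) in B.
    eapply Rle_lt_trans; [apply Cmod_le_sum|]. lra. }
  split; auto. intros T HT. rewrite Cmod_minus_sym.
  apply (clim_norm_le _ _ _ (clim_minus _ _ _ _ L (clim_const (CInt h 0 T)))). exists T. intros T' HT'. apply D. lra.
Qed.

Notation is_CInt_inf h l :=
  (is_RInt_gen (V := C_R_NormedModule) h (at_point 0) (Rbar_locally p_infty) l).

Lemma is_CInt_inf_intro (h : R -> C) (I : R -> C) l :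
  (forall T, 0 <= T -> is_CInt h 0 T (I T)) -> clim I l -> is_CInt_inf h l.
Proof.
  intros HI Hl P [e He].
  assert (He2 : 0 < e) by apply cond_pos.
  destruct (Hl e He2) as [T0 W].
  apply Filter_prod with (Q := fun a => a = 0) (R := fun T => Rmax 0 T0 < T).
  - reflexivity.
  - exists (Rmax 0 T0). auto.
  - intros a T -> HT. exists (I T). split.
    + apply HI. left. eapply Rle_lt_trans; [apply Rmax_l|exact HT].
    + apply He. specialize (W T (Rle_lt_trans _ _ _ (Rmax_r _ _) HT)).
      pose proof (re_le_Cmod (I T - l)%C). pose proof (im_le_Cmod (I T - l)%C).
      split; [change (Rabs (Re (I T - l)%C) < e)|change (Rabs (Im (I T - l)%C) < e)]; lra.
Qed.

Lemma is_CInt_inf_elim (h : R -> C) (I : R -> C) l :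
  (forall T, 0 <= T -> is_CInt h 0 T (I T)) -> is_CInt_inf h l -> clim I l.
Proof.
  intros HI H eps He.
  assert (He2 : 0 < eps / 2) by lra.
  destruct (H (ball l (mkposreal _ He2))) as [Q S HQ [T0 HS] HQS].
  { apply locally_ball. }
  exists (Rmax 0 T0). intros T HT.
  assert (A := Rle_lt_trans _ _ _ (Rmax_l _ _) HT). assert (B := Rle_lt_trans _ _ _ (Rmax_r _ _) HT).
  destruct (HQS 0 T HQ (HS T B)) as [y [Y1 [Y2 Y3]]]. simpl in Y1.
  rewrite (is_CInt_inj _ _ _ _ _ (HI T ltac:(lra)) Y1).
  eapply Rle_lt_trans; [apply Cmod_le_sum|].
  change (Rabs (Re (y - l)%C) < eps / 2) in Y2. change (Rabs (Im (y - l)%C) < eps / 2) in Y3. lra.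
Qed.

Definition CInt_inf (h : R -> C) : C := Clim (CInt h 0).

(** * Holomorphic dependence on a parameter *)

(** Differentiation under the integral sign is done with explicit second-order remainders, which
    integrate directly, instead of dominated convergence. *)
Lemma cder_quadratic (I : C -> C) p l B d : 0 < d ->
  (forall q, Cmod (q - p) < d -> Cmod (I q - I p - l * (q - p)) <= B * Cmod (q - p) ^ 2) -> cder I p l.
Proof.
  intros Hd H eps He. set (B' := Rabs B + 1).
  assert (HB : 0 < B') by (unfold B'; pose proof (Rabs_pos B); lra).
  exists (Rmin d (eps / B')). split; [apply Rmin_pos; auto; pos|].
  intros q Hq. assert (Q1 := Rlt_le_trans _ _ _ Hq (Rmin_l _ _)). assert (Q2 := Rlt_le_trans _ _ _ Hq (Rmin_r _ _)).
  eapply Rle_trans; [apply H; auto|]. set (x := Cmod (q - p)) in *. assert (0 <= x) by apply Cmod_ge_0.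
  apply Rmult_lt_compat_r with (r := B') in Q2; auto. replace (eps / B' * B') with eps in Q2 by (field; lra).
  assert (B <= B') by (unfold B'; pose proof (Rle_abs B); lra). nra.
Qed.

Lemma bounded_on_segment (h : R -> C) a b : (forall t, Rmin a b <= t <= Rmax a b -> rcont h t) ->
  exists M, 0 <= M /\ forall t, Rmin a b <= t <= Rmax a b -> Cmod (h t) <= M.
Proof.
  intros Hc. destruct (bounded_on_rect (fun z => h (Re z)) a b 0 0) as [M [HM BM]].
  - intros x y Hx _. apply (continuous_comp (fun z : C_UniformSpace => Re z) h); [apply cont_Re, cont_Cid|apply Hc; auto].
  - exists M. split; auto. intros t Ht. apply (BM t 0); auto. apply Rmin_Rmax_l.
Qed.

Lemma Cexp_second_order (c z p q : C) :
  Cmod (c * Cexp (q * z) - c * Cexp (p * z) - (q - p) * (c * z * Cexp (p * z))) <=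
  Cmod (q - p) ^ 2 * (Cmod c * exp (Re (p * z)) * Cmod z ^ 2 * exp (Cmod (q - p) * Cmod z)).
Proof.
  replace (c * Cexp (q * z) - c * Cexp (p * z) - (q - p) * (c * z * Cexp (p * z)))%C
    with (c * Cexp (p * z) * (Cexp ((q - p) * z) - 1 - (q - p) * z))%C.
  2: { pose proof (Cexp_plus (p * z) ((q - p) * z)) as K. replace (p * z + (q - p) * z)%C with (q * z)%C in K by ring. rewrite K. ring. }
  rewrite !Cmod_mult, Cmod_Cexp.
  pose proof (Cmod_Cexp_minus_1_minus_id ((q - p) * z)) as B. rewrite Cmod_mult in B.
  assert (P : 0 <= Cmod c * exp (Re (p * z))) by pos.
  eapply Rle_trans; [apply Rmult_le_compat_l; [exact P|exact B]|]. right. ring.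
Qed.

Lemma cder_exp_integral (c z : R -> C) a b p :
  (forall t, Rmin a b <= t <= Rmax a b -> rcont c t) -> (forall t, Rmin a b <= t <= Rmax a b -> rcont z t) ->
  cder (fun q => CInt (fun t => c t * Cexp (q * z t))%C a b) p (CInt (fun t => c t * z t * Cexp (p * z t))%C a b).
Proof.
  intros Hc Hz. destruct (bounded_on_segment c a b Hc) as [M1 [P1 B1]]. destruct (bounded_on_segment z a b Hz) as [M2 [P2 B2]].
  apply cder_quadratic with (B := Rabs (b - a) * (M1 * exp (Cmod p * M2) * M2 ^ 2 * exp M2)) (d := 1); [lra|].
  intros q Hq.
  pose proof (is_CInt_minus _ _ _ _ _ _ (is_CInt_minus _ _ _ _ _ _ (CInt_correct (fun t => c t * Cexp (q * z t))%C a b ltac:(intros; csolve; auto)) (CInt_correct (fun t => c t * Cexp (p * z t))%C a b ltac:(intros; csolve; auto)))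
    (is_CInt_cmult (q - p)%C _ _ _ _ (CInt_correct (fun t => c t * z t * Cexp (p * z t))%C a b ltac:(intros; csolve; auto)))) as I.
  match type of I with is_RInt _ _ _ ?l => match goal with |- Cmod ?m <= _ => replace m with l by ring end end.
  eapply Rle_trans; [apply is_CInt_norm_const with (2 := I) (M := Cmod (q - p) ^ 2 * (M1 * exp (Cmod p * M2) * M2 ^ 2 * exp M2))|right; ring].
  intros t Ht. eapply Rle_trans; [apply Cexp_second_order|].
  specialize (B1 t Ht). specialize (B2 t Ht). pose proof (Cmod_ge_0 (c t)). pose proof (Cmod_ge_0 (z t)). pose proof (Cmod_ge_0 p). pose proof (Cmod_ge_0 (q - p)).
  apply Rmult_le_compat_l; [apply pow2_ge_0|].
  assert (E1 : exp (Re (p * z t)) <= exp (Cmod p * M2)).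
  { apply exp_le_le. eapply Rle_trans; [apply Rle_abs|]. eapply Rle_trans; [apply re_le_Cmod|]. rewrite Cmod_mult. apply Rmult_le_compat_l; auto. }
  assert (E2 : exp (Cmod (q - p) * Cmod (z t)) <= exp M2) by (apply exp_le_le; nra).
  pose proof (exp_pos (Re (p * z t))). pose proof (exp_pos (Cmod (q - p) * Cmod (z t))).
  repeat apply Rmult_le_compat; auto; try lra; try (apply pow_le; lra); try (apply pow_incr; lra).
  - repeat pos.
  - repeat pos.
Qed.

Lemma cder_Cauchy_integral (c g : R -> C) a b p :
  (forall t, Rmin a b <= t <= Rmax a b -> rcont c t) -> (forall t, Rmin a b <= t <= Rmax a b -> rcont g t) ->
  (forall t, Rmin a b <= t <= Rmax a b -> g t <> p) ->
  cder (fun q => CInt (fun t => c t / (g t - q))%C a b) p (CInt (fun t => c t / (g t - p) / (g t - p))%C a b).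
Proof.
  intros Hc Hg Hn.
  assert (Hn' : forall t, Rmin a b <= t <= Rmax a b -> (g t - p)%C <> RtoC 0) by (intros; apply Cminus_neq_0; auto).
  destruct (bounded_on_segment c a b Hc) as [M1 [P1 B1]].
  destruct (bounded_on_segment (fun t => / (g t - p))%C a b ltac:(intros; csolve; auto)) as [M2' [P2' B2']].
  set (M2 := M2' + 1). assert (P2 : 0 < M2) by (unfold M2; lra).
  assert (B2 : forall t, Rmin a b <= t <= Rmax a b -> Cmod (/ (g t - p)) <= M2) by (intros t Ht; specialize (B2' t Ht); unfold M2; lra).
  (* The path stays at distance at least [1 / M2] from [p], so at least half of this from any [q]
     within [1 / (2 M2)] of [p]. *)
  assert (Low : forall t q, Rmin a b <= t <= Rmax a b -> Cmod (q - p) < / (2 * M2) -> / (2 * M2) <= Cmod (g t - q)).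
  { intros t q Ht Hq. specialize (B2 t Ht). rewrite Cmod_inv in B2 by auto.
    pose proof (proj1 (Cmod_gt_0 _) (Hn' t Ht)) as P.
    assert (/ M2 <= Cmod (g t - p)).
    { apply Rmult_le_reg_l with M2; auto. rewrite Rinv_r by lra.
      apply Rmult_le_compat_r with (r := Cmod (g t - p)) in B2; [|lra]. rewrite Rinv_l in B2; lra. }
    replace (g t - q)%C with ((g t - p) - (q - p))%C by ring.
    pose proof (Cmod_rev_triangle (g t - p) (q - p)).
    assert (/ M2 = / (2 * M2) + / (2 * M2)) by (field; lra). lra. }
  assert (H2 : 0 < / (2 * M2)) by pos.
  apply cder_quadratic with (B := Rabs (b - a) * (M1 * (2 * M2) * M2 * M2)) (d := / (2 * M2)); auto.
  intros q Hq.
  assert (Hn2 : forall t, Rmin a b <= t <= Rmax a b -> (g t - q)%C <> RtoC 0).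
  { intros t Ht. apply Cmod_gt_0. specialize (Low t q Ht Hq). lra. }
  pose proof (is_CInt_minus _ _ _ _ _ _ (is_CInt_minus _ _ _ _ _ _ (CInt_correct (fun t => c t / (g t - q))%C a b ltac:(intros; csolve; auto)) (CInt_correct (fun t => c t / (g t - p))%C a b ltac:(intros; csolve; auto)))
    (is_CInt_cmult (q - p)%C _ _ _ _ (CInt_correct (fun t => c t / (g t - p) / (g t - p))%C a b ltac:(intros; csolve; auto)))) as I.
  match type of I with is_RInt _ _ _ ?l => match goal with |- Cmod ?m <= _ => replace m with l by ring end end.
  eapply Rle_trans; [apply is_CInt_norm_const with (2 := I) (M := Cmod (q - p) ^ 2 * (M1 * (2 * M2) * M2 * M2))|right; ring].
  intros t Ht. specialize (B1 t Ht). specialize (B2 t Ht).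
  replace (c t / (g t - q) - c t / (g t - p) - (q - p) * (c t / (g t - p) / (g t - p)))%C
    with ((q - p) * (q - p) * (c t * / (g t - q) * / (g t - p) * / (g t - p)))%C by (field; auto).
  rewrite !Cmod_mult. replace (Cmod (q - p) ^ 2) with (Cmod (q - p) * Cmod (q - p)) by ring.
  apply Rmult_le_compat_l; [pos|].
  assert (B3 : Cmod (/ (g t - q)) <= 2 * M2).
  { rewrite Cmod_inv by auto. rewrite <- (Rinv_inv (2 * M2)). apply Rinv_le_contravar; auto. }
  repeat rmul; repeat pos.
Qed.

(** Budget of the decay rate [a]: moving from [p] to [q] costs [a/4] since [d * K = a/4], the factor
    [z^2] of the remainder costs twice [s = a/8], and [a/2] is left for convergence. *)
Lemma cder_exp_integral_inf (c z : R -> C) K a p : 0 < a -> 0 < K ->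
  (forall t, 0 <= t -> rcont c t) -> (forall t, 0 <= t -> rcont z t) ->
  (forall t, 0 <= t -> Cmod (z t) <= K * (1 + t)) ->
  (forall t, 0 <= t -> Cmod (c t * Cexp (p * z t)) <= K * exp (- (a * t))) ->
  cder (fun q => CInt_inf (fun t => c t * Cexp (q * z t))%C) p (CInt_inf (fun t => c t * z t * Cexp (p * z t))%C).
Proof.
  intros Ha HK Hc Hz Bz Bc.
  set (s := a / 8). assert (Hs : 0 < s) by (unfold s; lra).
  set (C1 := exp s / s). assert (HC1 : 0 < C1) by pos.
  assert (L1 : forall t, 0 <= t -> 1 + t <= C1 * exp (s * t)) by (intros; apply linear_le_exp; auto).
  set (d := a / (4 * K)). assert (Hd : 0 < d) by pos.
  assert (HdK : d * K = a / 4) by (unfold d; field; lra).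
  assert (Ez : forall q t, 0 <= t -> Cmod (q - p) < d -> exp (Cmod (q - p) * Cmod (z t)) <= exp (a / 4) * exp (a / 4 * t)).
  { intros q t Ht Hq. rewrite <- exp_plus. apply exp_le_le. specialize (Bz t Ht).
    pose proof (Cmod_ge_0 (q - p)). pose proof (Cmod_ge_0 (z t)).
    apply Rle_trans with (d * (K * (1 + t))); [apply Rmult_le_compat; lra|]. rewrite <- Rmult_assoc, HdK. lra. }
  assert (Cv0 : forall q, Cmod (q - p) < d -> exists l, clim (CInt (fun t => c t * Cexp (q * z t))%C 0) l).
  { intros q Hq. destruct (exp_dominated (fun t => c t * Cexp (q * z t))%C (K * exp (a / 4)) (a / 2)) as [l [Hl _]].
    - lra.
    - intros; csolve; auto.
    - intros t Ht.
      replace (c t * Cexp (q * z t))%C with ((c t * Cexp (p * z t)) * Cexp ((q - p) * z t))%C.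
      2: { pose proof (Cexp_plus (p * z t) ((q - p) * z t)) as X. replace (p * z t + (q - p) * z t)%C with (q * z t)%C in X by ring. rewrite X. ring. }
      rewrite Cmod_mult, Cmod_Cexp.
      assert (E1 : exp (Re ((q - p) * z t)) <= exp (a / 4) * exp (a / 4 * t)).
      { eapply Rle_trans; [|apply (Ez q t Ht Hq)]. apply exp_le_le. eapply Rle_trans; [apply Rle_abs|].
        eapply Rle_trans; [apply re_le_Cmod|]. rewrite Cmod_mult. lra. }
      eapply Rle_trans; [apply Rmult_le_compat; [apply Cmod_ge_0|pos|apply Bc; auto|exact E1]|].
      replace (K * exp (- (a * t)) * (exp (a / 4) * exp (a / 4 * t))) with (K * exp (a / 4) * (exp (- (a * t)) * exp (a / 4 * t))) by ring.
      rewrite <- exp_plus. apply Rmult_le_compat_l; [pos|].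
      apply exp_le_le. nra.
    - exists l; auto. }
  destruct (exp_dominated (fun t => c t * z t * Cexp (p * z t))%C (K * K * C1) (a / 2)) as [l1 [Hl1 _]]; [lra|intros; csolve; auto| |].
  { intros t Ht. replace (c t * z t * Cexp (p * z t))%C with ((c t * Cexp (p * z t)) * z t)%C by ring.
    rewrite Cmod_mult.
    eapply Rle_trans; [apply Rmult_le_compat; [apply Cmod_ge_0|apply Cmod_ge_0|apply Bc; auto|apply Bz; auto]|].
    apply Rle_trans with (K * exp (- (a * t)) * (K * (C1 * exp (s * t)))).
    - apply Rmult_le_compat_l; [pos|]. apply Rmult_le_compat_l; [lra|auto].
    - replace (K * exp (- (a * t)) * (K * (C1 * exp (s * t)))) with (K * K * C1 * (exp (- (a * t)) * exp (s * t))) by ring.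
      rewrite <- exp_plus. apply Rmult_le_compat_l; [pos|]. apply exp_le_le. unfold s. nra. }
  set (B := K * (K * C1) ^ 2 * exp (a / 4)).
  assert (HB : 0 <= B) by (unfold B; pos).
  apply cder_quadratic with (B := B / (a / 2)) (d := d); auto.
  intros q Hq. destruct (Cv0 q Hq) as [lq Hlq]. destruct (Cv0 p) as [lp Hlp].
  { replace (p - p)%C with (RtoC 0) by ring. rewrite Cmod_0; auto. }
  unfold CInt_inf. rewrite (Clim_unique _ _ Hlq), (Clim_unique _ _ Hlp), (Clim_unique _ _ Hl1).
  pose proof (clim_minus _ _ _ _ (clim_minus _ _ _ _ Hlq Hlp) (clim_cmult (q - p)%C _ _ Hl1)) as L.
  replace (lq - lp - l1 * (q - p))%C with (lq - lp - (q - p) * l1)%C by ring.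
  apply (clim_norm_le _ _ _ L). exists 0. intros T HT.
  assert (Hin : forall t, Rmin 0 T <= t <= Rmax 0 T -> 0 <= t) by (intros t Ht; rewrite Rmin_left in Ht; lra).
  pose proof (is_CInt_minus _ _ _ _ _ _ (is_CInt_minus _ _ _ _ _ _ (CInt_correct (fun t => c t * Cexp (q * z t))%C 0 T ltac:(intros; csolve; auto)) (CInt_correct (fun t => c t * Cexp (p * z t))%C 0 T ltac:(intros; csolve; auto)))
    (is_CInt_cmult (q - p)%C _ _ _ _ (CInt_correct (fun t => c t * z t * Cexp (p * z t))%C 0 T ltac:(intros; csolve; auto)))) as I.
  pose proof (is_RInt_exp (a / 2) (B * Cmod (q - p) ^ 2) 0 T ltac:(lra)) as J.
  eapply Rle_trans; [apply (is_CInt_norm _ _ 0 T _ _ ltac:(lra)) with (2 := I) (3 := J)|].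
  - intros t Ht. eapply Rle_trans; [apply Cexp_second_order|].
    rewrite (Rmult_comm B), !Rmult_assoc. apply Rmult_le_compat_l; [apply pow2_ge_0|].
    pose proof (Bc t ltac:(lra)) as X1. rewrite Cmod_mult, Cmod_Cexp in X1.
    pose proof (Bz t ltac:(lra)) as X2. pose proof (Ez q t ltac:(lra) Hq) as X3. pose proof (L1 t ltac:(lra)) as X4.
    rewrite <- Rmult_assoc.
    assert (X5 : Cmod (z t) ^ 2 <= (K * C1) ^ 2 * exp (a / 4 * t)).
    { apply Rle_trans with ((K * (C1 * exp (s * t))) ^ 2).
      - apply pow_incr. split; [apply Cmod_ge_0|]. eapply Rle_trans; [exact X2|]. apply Rmult_le_compat_l; lra.
      - right. replace (a / 4 * t) with (s * t + s * t) by (unfold s; field). rewrite exp_plus. ring. }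
    apply Rle_trans with (K * exp (- (a * t)) * ((K * C1) ^ 2 * exp (a / 4 * t) * (exp (a / 4) * exp (a / 4 * t)))).
    + apply Rmult_le_compat; auto.
      * pos.
      * pos.
      * apply Rmult_le_compat; auto; [apply pow2_ge_0|pos].
    + right. unfold B. replace (- (a / 2 * t)) with (- (a * t) + (a / 4 * t + a / 4 * t)) by field. rewrite !exp_plus. ring.
  - rewrite Rmult_0_r, Ropp_0, exp_0.
    assert (0 <= B * Cmod (q - p) ^ 2 / (a / 2) * exp (- (a / 2 * T))).
    { apply Rmult_le_pos; [|left; apply exp_pos]. apply Rmult_le_pos; [apply Rmult_le_pos; [auto|apply pow2_ge_0]|left; apply Rinv_0_lt_compat; lra]. }
    apply Rle_trans with (B * Cmod (q - p) ^ 2 / (a / 2)); [lra|]. right. field. lra.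
Qed.

(** * Logarithmic neighborhoods of -oo *)

Lemma Rabs_Carg (z : C) : Rabs (Carg z) = acos (Re z / Cmod z).
Proof.
  unfold Carg. pose proof (acos_bound (Re z / Cmod z)). destruct (Rle_dec 0 (Im z)).
  - apply Rabs_right; lra.
  - rewrite Rabs_Ropp. apply Rabs_right; lra.
Qed.

(** Monotonicity of the cosine on [[0, pi]] turns the condition on the argument into an inequality
    that behaves well under translations and limits. *)
Lemma cone_minus_iff (w0 w : C) theta : 0 < theta <= PI / 2 ->
  (cone_minus w0 theta w <-> cos theta * Cmod (w0 - w) < Re (w0 - w)%C).
Proof.
  unfold cone_minus. rewrite Rabs_Carg. set (z := (w0 - w)%C).
  pose proof PI_RGT_0.
  assert (Hz : Cmod z <> 0 -> -1 <= Re z / Cmod z <= 1).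
  { intros N. pose proof (Cmod_ge_0 z). pose proof (re_le_Cmod z) as B. apply Rabs_le_between in B.
    split; apply Rmult_le_reg_r with (Cmod z); try lra; unfold Rdiv; rewrite Rmult_assoc, Rinv_l; lra. }
  split.
  - intros [N L]. apply Cmod_gt_0 in N as P. specialize (Hz ltac:(lra)).
    pose proof (acos_bound (Re z / Cmod z)).
    pose proof (cos_decreasing_1 (acos (Re z / Cmod z)) theta) as D.
    rewrite cos_acos in D by auto. specialize (D ltac:(lra) ltac:(lra) ltac:(lra) ltac:(lra) L).
    apply Rmult_lt_compat_r with (r := Cmod z) in D; auto. unfold Rdiv in D. rewrite Rmult_assoc, Rinv_l in D by lra. lra.
  - intros L.
    assert (N : z <> RtoC 0). { intros E. rewrite E, Cmod_0 in L. simpl in L. lra. }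
    split; auto. apply Cmod_gt_0 in N as P. specialize (Hz ltac:(lra)).
    pose proof (acos_bound (Re z / Cmod z)).
    apply Rnot_le_lt. intros L2.
    pose proof (cos_decr_1 theta (acos (Re z / Cmod z)) ltac:(lra) ltac:(lra) ltac:(lra) ltac:(lra) L2) as D.
    rewrite cos_acos in D by auto. apply Rmult_le_compat_r with (r := Cmod z) in D; [|lra].
    unfold Rdiv in D. rewrite Rmult_assoc, Rinv_l in D by lra. lra.
Qed.

Lemma cone_minus_pos w0 theta w : cone_minus w0 theta w -> 0 < theta.
Proof. intros [_ H]. pose proof (Rabs_pos (Carg (w0 - w))). lra. Qed.

(** A smooth even substitute for [c - k ln |y|], from which it differs by a bounded amount for large
    [|y|]. *)
Definition kap (c k y : R) : R := c - k / 2 * ln (1 + y ^ 2).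

Definition log_domain (H : C -> Prop) (r : R -> R) (c k A : R) : Prop :=
  0 < k /\ 0 <= A /\ (forall w, H w <-> Re w < r (Im w)) /\
  (forall w, closure H w <-> Re w <= r (Im w)) /\
  (forall y, continuous r y) /\ (forall y y', Rabs y <= Rabs y' -> r y' <= r y) /\
  (forall y, kap c k y < r y <= kap c k y + A).

(* The two slopes [m0 < m1] leave room for the direction of a ray along which the wedge integral converges. *)
Definition cone_exhausted (H : C -> Prop) : Prop :=
  forall w, H w -> exists x m0 m1, H (RtoC x) /\ 0 < m0 < m1 /\ Rabs (Im w) < m0 * (x - Re w) /\
    forall u y, 0 <= u -> Rabs y <= m1 * u -> closure H (x - u, y).

Lemma ball_C (z w : C) e : ball (M := C_UniformSpace) z e w <-> Rabs (Re w - Re z) < e /\ Rabs (Im w - Im z) < e.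
Proof. reflexivity. Qed.

Lemma closure_subset (A : C -> Prop) w : A w -> closure A w.
Proof. exists w. split; auto. apply ball_center. Qed.

Lemma Cmod_le_of_parts (z z' : C) : Rabs (Re z) <= Rabs (Re z') -> Rabs (Im z) <= Rabs (Im z') -> Cmod z <= Cmod z'.
Proof.
  intros H1 H2. unfold Cmod. apply sqrt_le_1_alt. unfold Re, Im in *.
  apply Rsqr_le_abs_1 in H1. apply Rsqr_le_abs_1 in H2. unfold Rsqr in *. simpl. lra.
Qed.

Section LogNeighborhood.
Variable H : C -> Prop.
Hypothesis Hn : neighborhood_minus_infty H.

Lemma nbhd_cone w : H w -> exists x theta, H (RtoC x) /\ 0 < theta <= PI / 2 /\
  incl_set (cone_minus (RtoC x) theta) H /\ cone_minus (RtoC x) theta w.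
Proof.
  intros Hw. apply (proj2 Hn) in Hw. destruct Hw as [x [theta [Hx [[T1 [T2 _]] Hc]]]].
  exists x, theta. pose proof (cone_minus_pos _ _ _ Hc). repeat split; auto; try apply Hc.
Qed.

(** A cone with a real vertex that contains [w] contains every point to its left and closer to the
    real axis, and [H] is a union of such cones. *)
Lemma nbhd_move w z : H w -> Re z <= Re w -> Rabs (Im z) <= Rabs (Im w) -> H z.
Proof.
  intros Hw Hr Hi. destruct (nbhd_cone w Hw) as [x [theta [Hx [Ht [Hc Hcw]]]]].
  apply Hc. apply cone_minus_iff; auto. apply cone_minus_iff in Hcw; auto.
  assert (Hcos : 0 <= cos theta) by (apply cos_ge_0; lra).
  assert (Hcos1 : cos theta <= 1) by apply COS_bound.
  set (z' := (Re w, Im z) : C).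
  assert (P1 : Cmod (RtoC x - z') <= Cmod (RtoC x - w)).
  { apply Cmod_le_of_parts; rewrite ?Re_minus, ?Im_minus; unfold z'; simpl; [lra|].
    rewrite !Rminus_0_l, !Rabs_Ropp. auto. }
  assert (P2 : Cmod (RtoC x - z) <= Cmod (RtoC x - z') + (Re w - Re z)).
  { replace (RtoC x - z)%C with ((RtoC x - z') + RtoC (Re w - Re z))%C.
    - tri. rewrite Cmod_R, Rabs_right by lra. lra.
    - unfold z'. cring. }
  rewrite Re_minus in *. simpl in *.
  apply Rle_lt_trans with (cos theta * (Cmod (RtoC x - w) + (Re w - Re z))).
  - apply Rmult_le_compat_l; lra.
  - unfold Re in *. nra.
Qed.

Lemma nbhd_open : is_open H.
Proof.
  intros w Hw. destruct (nbhd_cone w Hw) as [x [theta [Hx [Ht [Hc Hcw]]]]].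
  apply cone_minus_iff in Hcw; auto.
  assert (Hcos : 0 <= cos theta) by (apply cos_ge_0; lra).
  assert (Hcos1 : cos theta <= 1) by apply COS_bound.
  set (e := Re (RtoC x - w)%C - cos theta * Cmod (RtoC x - w)).
  exists (e / 2). split; [unfold e; lra|]. intros z Hz. apply Hc, cone_minus_iff; auto.
  assert (P : Cmod (RtoC x - z) <= Cmod (RtoC x - w) + Cmod (z - w)).
  { replace (RtoC x - z)%C with ((RtoC x - w) - (z - w))%C by ring. apply Cmod_triangle_minus. }
  pose proof (re_le_Cmod (z - w)%C) as Q. pose proof (Rle_abs (Re (z - w)%C)) as Q2.
  rewrite Re_minus in *. unfold e in *. rewrite Re_minus in *. pose proof (Cmod_ge_0 (z - w)).
  assert (cos theta * Cmod (RtoC x - z) <= cos theta * (Cmod (RtoC x - w) + Cmod (z - w))) by (apply Rmult_le_compat_l; auto).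
  assert (cos theta * Cmod (z - w) <= Cmod (z - w)) by nra. lra.
Qed.

Lemma nbhd_every_ordinate y : exists x, H (x, y).
Proof.
  destruct (proj1 Hn (PI / 3)) as [w0 [H0 Hc]].
  { pose proof PI_RGT_0. lra. }
  exists (Re w0 - Rabs (y - Im w0) - 1). apply Hc. apply cone_minus_iff; [pose proof PI_RGT_0; lra|].
  rewrite cos_PI3. eapply Rle_lt_trans; [apply Rmult_le_compat_l; [lra|apply Cmod_le_sum]|].
  rewrite Re_minus, Im_minus. simpl. rewrite (Rabs_minus_sym (Im w0)). pose proof (Rabs_pos (y - Im w0)).
  rewrite (Rabs_right (Re w0 - _)) by lra. lra.
Qed.

(** The cone around [w] is open, so a slightly steeper cone with the same real vertex still fits in
    [H]. *)
Lemma nbhd_cone_exhausted : cone_exhausted H.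
Proof.
  intros w Hw. destruct (nbhd_cone w Hw) as [x [theta [Hx [Ht [Hc Hcw]]]]].
  apply cone_minus_iff in Hcw; auto.
  assert (Hcos : 0 <= cos theta) by (apply cos_ge_0; lra).
  assert (Hcos1 : cos theta <= 1) by apply COS_bound.
  set (X := x - Re w). set (s := Rabs (Im w) / X).
  rewrite Re_minus in Hcw. simpl in Hcw. fold X in Hcw.
  assert (HX : 0 < X) by (pose proof (Cmod_ge_0 (RtoC x - w)); nra).
  assert (Hs0 : 0 <= s) by pos.
  assert (HsX : s * X = Rabs (Im w)) by (unfold s; field; lra).
  assert (E : Cmod (RtoC x - w) = X * Cmod (1, s)).
  { unfold Cmod. rewrite <- (sqrt_pow2 X) at 1 by lra. rewrite <- sqrt_mult by (try apply pow2_ge_0; simpl; nra).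
    f_equal. simpl. replace (x + - fst w) with X by reflexivity.
    assert (Q : (Rabs (Im w)) ^ 2 = Im w ^ 2) by apply pow2_abs. rewrite <- HsX in Q. unfold Im in Q. nra. }
  set (q := cos theta * Cmod (1, s)).
  assert (Hq : q < 1).
  { unfold q. apply Rmult_lt_reg_r with X; auto. rewrite Rmult_1_l, Rmult_assoc, (Rmult_comm _ X), <- E. auto. }
  (* [q < 1] says that the slope [s] of [w] seen from [x] is strictly inside the cone; raising the
     slope by [e] increases [q] by at most [e], which keeps it below 1. *)
  set (e := (1 - q) / 2). assert (He : 0 < e) by (unfold e; lra).
  exists x, (s + e / 2), (s + e). split; auto. split; [lra|]. split; [fold X; rewrite <- HsX; nra|].
  intros u y Hu Hy. destruct (Req_dec u 0) as [->|Nu].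
  { assert (y = 0) by (rewrite Rmult_0_r in Hy; pose proof (Rabs_pos y); destruct (Req_dec y 0); auto; pose proof (Rabs_pos_lt y); lra).
    subst. apply closure_subset. replace ((x - 0, 0) : C) with (RtoC x); auto. apply C_ext; simpl; ring. }
  apply closure_subset, Hc, cone_minus_iff; auto.
  assert (B : Cmod (RtoC x - (x - u, y)) <= u * (Cmod (1, s) + e)).
  { apply Rle_trans with (Cmod (RtoC u * ((1, s) + RtoC e * Ci))).
    - apply Cmod_le_of_parts.
      + right. f_equal. unfold Re; simpl. ring.
      + unfold Im; simpl. replace (0 + - y) with (- y) by ring. rewrite Rabs_Ropp.
        rewrite (Rabs_right (_ + _)); nra.
    - rewrite Cmod_mult, Cmod_R, Rabs_right by lra. apply Rmult_le_compat_l; [lra|].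
      tri. rewrite Cmod_mult, Cmod_Ci, Cmod_R, Rabs_right by lra. lra. }
  rewrite Re_minus. simpl.
  apply Rle_lt_trans with (cos theta * (u * (Cmod (1, s) + e))); [apply Rmult_le_compat_l; auto|].
  replace (cos theta * (u * (Cmod (1, s) + e))) with (u * (q + cos theta * e)) by (unfold q; ring).
  replace (x - (x - u)) with (u * 1) by ring. apply Rmult_lt_compat_l; [lra|]. unfold e in *. nra.
Qed.

Variable rho : R -> R.
Hypothesis Hb : border_profile H rho.
Hypothesis Hleft : forall w : C, H w -> Re w <= 0.

(** Each horizontal section of [H] is nonempty, open, stable by moves to the left and bounded thanks
    to [Hleft]; its supremum is a border point, hence equal to [rho]. *)
Lemma nbhd_hypograph w : H w <-> Re w < rho (Rabs (Im w)).
Proof.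
  assert (P : forall y, is_lub (fun x => H (x, y)) (rho (Rabs y)) /\ ~ H (rho (Rabs y), y)).
  { intros y. destruct (completeness (fun x => H (x, y))) as [s Hs].
    - exists 0. intros x Hx. apply (Hleft _ Hx).
    - apply nbhd_every_ordinate.
    - assert (N : ~ H (s, y)).
      { intros Hsy. destruct (nbhd_open _ Hsy) as [e [He B]].
        assert (K : H (s + e / 2, y)).
        { apply B. replace (((s + e / 2)%R, y) - (s, y))%C with (RtoC (e / 2)) by cring.
          rewrite Cmod_R, Rabs_right; lra. }
        apply (proj1 Hs) in K. lra. }
      assert (Bd : border H (s, y)).
      { split; [|apply closure_subset; auto]. intros eps. pose proof (cond_pos eps) as He.
        destruct (classic (exists x, H (x, y) /\ s - eps < x)) as [[x [X1 X2]]|Nx].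
        - exists (x, y). split; auto. apply ball_C. simpl. apply (proj1 Hs) in X1 as X3.
          split; [rewrite Rabs_left1; lra|]. rewrite Rminus_diag, Rabs_R0. auto.
        - exfalso. assert (s <= s - eps); [|lra]. apply (proj2 Hs). intros x X1.
          destruct (Rle_dec x (s - eps)); auto. exfalso. apply Nx. exists x. split; auto. lra. }
      apply (proj2 Hb) in Bd. simpl in Bd. rewrite <- Bd. auto. }
  destruct w as [x y]. simpl. destruct (P y) as [[U L] N]. split.
  - intros Hw. destruct (Rtotal_order x (rho (Rabs y))) as [|[E|E]]; auto.
    + subst x. contradiction.
    + apply U in Hw. lra.
  - intros Hx. apply NNPP. intros Nw. assert (rho (Rabs y) <= x); [|lra]. apply L. intros x' Hx'.
    apply Rnot_lt_le. intros Lx. apply Nw. apply (nbhd_move (x', y)); simpl; auto; lra.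
Qed.

Lemma nbhd_closure w : closure H w <-> Re w <= rho (Rabs (Im w)).
Proof.
  split.
  - intros Hc. destruct (classic (H w)) as [Hw|Hw].
    + apply nbhd_hypograph in Hw. lra.
    + assert (border H w) by (split; auto; apply closure_subset; auto).
      apply (proj2 Hb) in H0. lra.
  - intros Hw eps. pose proof (cond_pos eps). exists (Re w - eps / 2, Im w). split.
    + apply ball_C. simpl. split; [rewrite Rabs_left; lra|]. rewrite Rminus_diag, Rabs_R0; auto.
    + apply nbhd_hypograph. simpl. lra.
Qed.

Lemma nbhd_profile_decreasing y y' : Rabs y <= Rabs y' -> rho (Rabs y') <= rho (Rabs y).
Proof.
  intros Hy. apply Rnot_lt_le. intros L. set (x := (rho (Rabs y) + rho (Rabs y')) / 2).
  assert (H (x, y')) by (apply nbhd_hypograph; simpl; unfold x; lra).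
  assert (H (x, y)) by (apply (nbhd_move (x, y')); simpl; auto; lra).
  apply nbhd_hypograph in H1. simpl in H1. unfold x in H1. lra.
Qed.

(** Lower semicontinuity is the openness of [H], and upper semicontinuity is the description of its
    closure. *)
Lemma nbhd_profile_continuous y : continuous (fun y => rho (Rabs y)) y.
Proof.
  apply filterlim_locally. intros eps. pose proof (cond_pos eps) as He.
  assert (L : exists d, 0 < d /\ forall y', Rabs (y' - y) < d -> rho (Rabs y) - eps < rho (Rabs y')).
  { destruct (nbhd_open (rho (Rabs y) - eps / 2, y)) as [e [He' B]]; [apply nbhd_hypograph; simpl; lra|].
    exists e. split; auto. intros y' Hy'. assert (K : H (rho (Rabs y) - eps / 2, y')).
    { apply B. replace (((rho (Rabs y) - eps / 2)%R, y') - ((rho (Rabs y) - eps / 2)%R, y))%C with (RtoC (y' - y) * Ci)%C by cring.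
      rewrite Cmod_mult, Cmod_Ci, Cmod_R. lra. }
    apply nbhd_hypograph in K. simpl in K. lra. }
  assert (U : exists d, 0 < d /\ forall y', Rabs (y' - y) < d -> rho (Rabs y') < rho (Rabs y) + eps).
  { apply NNPP. intros N.
    assert (K : closure H (rho (Rabs y) + eps / 2, y)).
    { intros d. apply NNPP. intros N'. apply N. exists d. split; [apply cond_pos|]. intros y' Hy'.
      apply Rnot_le_lt. intros Lx. apply N'. exists (rho (Rabs y) + eps / 2, y'). split.
      - apply ball_C. simpl. rewrite Rminus_diag, Rabs_R0. split; [apply cond_pos|auto].
      - apply nbhd_hypograph. simpl. lra. }
    apply nbhd_closure in K. simpl in K. lra. }
  destruct L as [d1 [D1 L]]. destruct U as [d2 [D2 U]].
  assert (Hd : 0 < Rmin d1 d2) by (apply Rmin_pos; auto).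
  exists (mkposreal _ Hd). intros y' Hy'. change (Rabs (y' - y) < Rmin d1 d2) in Hy'.
  specialize (L y' (Rlt_le_trans _ _ _ Hy' (Rmin_l _ _))). specialize (U y' (Rlt_le_trans _ _ _ Hy' (Rmin_r _ _))).
  change (Rabs (rho (Rabs y') - rho (Rabs y)) < eps). apply Rabs_def1; lra.
Qed.

Variables c0 k : R.
Hypothesis Hk : 0 < k.
Hypothesis Hlog : Rbar_locally p_infty (fun y => rho y = c0 - k * ln y).

Lemma nbhd_log_domain : exists c A, log_domain H (fun y => rho (Rabs y)) c k A.
Proof.
  destruct Hlog as [M HM]. set (Y := Rmax M 1 + 1).
  assert (HY : M < Y /\ 1 < Y) by (unfold Y; pose proof (Rmax_l M 1); pose proof (Rmax_r M 1); lra).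
  (* Puts the curve strictly below the profile: below [rho Y] for [|y| <= Y], where the profile is
     at least [rho Y], and below the logarithmic formula beyond. *)
  set (c := Rmin c0 (rho Y) - 1).
  assert (Hc : c <= c0 - 1 /\ c <= rho Y - 1) by (unfold c; pose proof (Rmin_l c0 (rho Y)); pose proof (Rmin_r c0 (rho Y)); lra).
  assert (Hsmall : forall y, Rabs y <= Y -> rho Y <= rho (Rabs y) <= 0).
  { intros y Hy. split.
    - pose proof (nbhd_profile_decreasing y Y) as D. rewrite (Rabs_right Y) in D by lra. auto.
    - apply Rnot_lt_le. intros L. assert (K : H (rho (Rabs y) / 2, y)) by (apply nbhd_hypograph; simpl; lra).
      apply Hleft in K. simpl in K. lra. }
  assert (Hln : forall y, 0 <= ln (1 + y ^ 2)).
  { intros y. rewrite <- ln_1. pose proof (pow2_ge_0 y). apply ln_le; lra. }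
  (* The term in [Y] covers the drop of the curve where the profile is only known to be at most 0;
     the term in [ln 2] covers the gap between [ln (1 + y^2)] and [2 ln |y|]. *)
  exists c, (Rabs c + Rabs c0 + k / 2 * ln (1 + Y ^ 2) + k / 2 * ln 2).
  assert (Hl2 : 0 <= ln 2) by (rewrite <- ln_1; apply ln_le; lra).
  split; auto. split.
  { pose proof (Rabs_pos c). pose proof (Rabs_pos c0). specialize (Hln Y). nra. }
  split; [apply nbhd_hypograph|]. split; [apply nbhd_closure|]. split; [apply nbhd_profile_continuous|].
  split; [apply nbhd_profile_decreasing|].
  intros y. unfold kap. pose proof (Hln y) as L0. pose proof (Hln Y) as L1.
  pose proof (Rle_abs (- c)) as A1. rewrite Rabs_Ropp in A1. pose proof (Rle_abs c0) as A2.
  pose proof (Rabs_pos c0) as A3. pose proof (Rabs_pos c) as A4.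
  assert (P0 : 0 <= k / 2 * ln (1 + y ^ 2)) by pos.
  assert (P1 : 0 <= k / 2 * ln (1 + Y ^ 2)) by pos.
  assert (P2 : 0 <= k / 2 * ln 2) by pos.
  destruct (Rle_dec (Rabs y) Y) as [Hy|Hy].
  - specialize (Hsmall y Hy).
    assert (ln (1 + y ^ 2) <= ln (1 + Y ^ 2)).
    { pose proof (pow2_ge_0 y). apply ln_le; [lra|]. rewrite <- (pow2_abs y). pose proof (Rabs_pos y). nra. }
    assert (k / 2 * ln (1 + y ^ 2) <= k / 2 * ln (1 + Y ^ 2)) by (apply Rmult_le_compat_l; lra). lra.
  - rewrite (HM (Rabs y)) by lra. set (a := Rabs y) in *.
    assert (E : y ^ 2 = a * a) by (unfold a; rewrite <- (pow2_abs y); ring). rewrite E in *.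
    assert (La : 2 * ln a = ln (a * a)) by (rewrite ln_mult by lra; ring).
    assert (ln (a * a) <= ln (1 + a * a)) by (apply ln_le; nra).
    assert (ln (1 + a * a) <= ln 2 + ln (a * a)) by (rewrite <- ln_mult by nra; apply ln_le; nra).
    assert (k * ln a = k / 2 * ln (a * a)) by (rewrite <- La; field).
    assert (k / 2 * ln (a * a) <= k / 2 * ln (1 + a * a)) by (apply Rmult_le_compat_l; lra).
    assert (k / 2 * ln (1 + a * a) <= k / 2 * (ln 2 + ln (a * a))) by (apply Rmult_le_compat_l; lra).
    lra.
Qed.
End LogNeighborhood.

Lemma logarithmic_log_domain H : logarithmic_neighborhood H -> (forall w, H w -> Re w <= 0) ->
  cone_exhausted H /\ exists r c k A, log_domain H r c k A.
Proof.
  intros [Hn [rho [Hb [c [k [Hk Hl]]]]]] Hleft. split; [apply nbhd_cone_exhausted; auto|].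
  destruct (nbhd_log_domain H Hn rho Hb Hleft c k Hk Hl) as [c' [A HA]].
  exists (fun y => rho (Rabs y)), c', k, A. exact HA.
Qed.

Lemma closure_translate a H w : closure (translate a H) w <-> closure H (w - RtoC a)%C.
Proof.
  split; intros Hc eps; destruct (Hc eps) as [z [Hz Hz2]].
  - exists (z - RtoC a)%C. split; auto. apply ball_C. apply ball_C in Hz. simpl. unfold Re, Im in *.
    replace (fst z + - a - (fst w + - a)) with (fst z - fst w) by ring.
    replace (snd z + - 0 - (snd w + - 0)) with (snd z - snd w) by ring. auto.
  - exists (z + RtoC a)%C. split; [apply ball_C; apply ball_C in Hz; simpl in *; unfold Re, Im in *|].
    + replace (fst z + a - fst w) with (fst z - (fst w + - a)) by ring.
      replace (snd z + 0 - snd w) with (snd z - (snd w + - 0)) by ring. auto.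
    + unfold translate. replace (z + RtoC a - RtoC a)%C with z by ring. auto.
Qed.

Lemma log_domain_translate H r c k A : log_domain H r c k A ->
  log_domain (translate (-1) H) (fun y => r y - 1) (c - 1) k A.
Proof.
  intros [H1 [H2 [H3 [H4 [H5 [H6 H7]]]]]]. repeat split; auto.
  - intros Hw. apply H3 in Hw. simpl in Hw. unfold Re, Im in *. replace (snd w + - 0) with (snd w) in Hw by ring. lra.
  - intros Hw. apply H3. simpl. unfold Re, Im in *. replace (snd w + - 0) with (snd w) by ring. lra.
  - intros Hw. apply closure_translate, H4 in Hw. simpl in Hw. unfold Re, Im in *. replace (snd w + - 0) with (snd w) in Hw by ring. lra.
  - intros Hw. apply closure_translate, H4. simpl. unfold Re, Im in *. replace (snd w + - 0) with (snd w) by ring. lra.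
  - intros y. csolve. apply H5.
  - intros y y' Hy. specialize (H6 y y' Hy). lra.
  - specialize (H7 y). unfold kap in *. lra.
  - specialize (H7 y). unfold kap in *. lra.
Qed.

(** * The Laplace transform *)

(** The point [z] may lie on the border of the domain: only global continuity of [f] enters. This
    lets integrals along the border be limits of integrals inside. *)
Lemma comb_integral_shift f x0 y0 z : (forall z, ccont f z) ->
  forall eps, 0 < eps -> exists d, 0 < d /\ forall e, 0 < e < d ->
    Cmod (comb_integral f x0 y0 (z - RtoC e) - comb_integral f x0 y0 z) <= eps.
Proof.
  intros Hf eps He. destruct z as [x y].
  destruct (bounded_on_rect f (x - 1) x y0 y0 ltac:(intros ? ? _ _; auto)) as [M [HM BM]].
  pose proof (Rabs_pos (y - y0)) as Hy.
  destruct (uniform_continuity_rect f x x y0 y ltac:(intros ? ? _ _; auto) (eps / (2 * (Rabs (y - y0) + 1))) ltac:(pos)) as [d [Hd Bd]].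
  exists (Rmin (Rmin d 1) (eps / (2 * (M + 1)))).
  split; [apply Rmin_pos; [apply Rmin_pos; lra|pos]|]. intros e [He0 He1].
  assert (E1 := Rlt_le_trans _ _ _ He1 (Rmin_l _ _)). assert (E2 := Rlt_le_trans _ _ _ He1 (Rmin_r _ _)).
  assert (E3 := Rlt_le_trans _ _ _ E1 (Rmin_l _ _)). assert (E4 := Rlt_le_trans _ _ _ E1 (Rmin_r _ _)).
  unfold comb_integral.
  replace (Re ((x, y) - RtoC e)) with (x - e) by reflexivity.
  replace (Im ((x, y) - RtoC e)) with y by (unfold Im; simpl; ring).
  simpl Re. simpl Im.
  rewrite <- (CInt_Chasles (fun t => f (t, y0)) x0 (x - e) x) by (intros; apply rcont_h; auto).
  assert (B1 : Cmod (CInt (fun t => f (t, y0)) (x - e) x) <= Rabs (x - (x - e)) * M).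
  { apply is_CInt_norm_const with (h := fun t => f (t, y0)).
    - intros t Ht. ordered in Ht. apply (BM t y0); rewrite ?Rmin_left, ?Rmax_right by lra; lra.
    - apply h_correct; auto. }
  assert (B2 : Cmod (CInt (fun t => f ((x - e)%R, t)) y0 y - CInt (fun t => f (x, t)) y0 y) <= Rabs (y - y0) * (eps / (2 * (Rabs (y - y0) + 1)))).
  { apply is_CInt_norm_const with (h := fun t => (f ((x - e)%R, t) - f (x, t))%C).
    - intros t Ht. left. apply (Bd x t); auto.
      + rewrite Rmin_left, Rmax_left by lra. lra.
      + replace (((x - e)%R, t) - (x, t))%C with (RtoC (- e)) by cring. rewrite Cmod_R, Rabs_Ropp, Rabs_right; lra.
    - apply is_CInt_minus; apply v_correct; auto. }
  rewrite Rabs_right in B1 by lra.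
  match goal with |- Cmod ((?a + Ci * ?b) - (?a + ?c' + Ci * ?d'))%C <= _ => replace ((a + Ci * b) - (a + c' + Ci * d'))%C with (Ci * (b - d') - c')%C by ring end.
  eapply Rle_trans; [apply Cmod_triangle_minus|]. rewrite Cmod_mult, Cmod_Ci, Rmult_1_l.
  assert (Rabs (y - y0) * (eps / (2 * (Rabs (y - y0) + 1))) <= eps / 2).
  { apply Rmult_le_reg_r with (2 * (Rabs (y - y0) + 1)); [lra|].
    replace (Rabs (y - y0) * (eps / (2 * (Rabs (y - y0) + 1))) * (2 * (Rabs (y - y0) + 1))) with (Rabs (y - y0) * eps) by (field; lra). nra. }
  assert ((x - (x - e)) * M <= eps / 2).
  { apply Rle_trans with (eps / (2 * (M + 1)) * M); [apply Rmult_le_compat_r; lra|].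
    apply Rmult_le_reg_r with (2 * (M + 1)); [lra|].
    replace (eps / (2 * (M + 1)) * M * (2 * (M + 1))) with (eps * M) by (field; lra). nra. }
  lra.
Qed.

Lemma ln_le_linear X l : 0 < X -> 0 < l -> ln X <= X / l - 1 + ln l.
Proof.
  intros HX Hl. assert (P : 0 < X / l) by (pos).
  replace X with (X / l * l) at 1 by (field; lra). rewrite ln_mult by auto.
  pose proof (exp_ineq1_le (ln (X / l))) as E. rewrite exp_ln in E by auto. lra.
Qed.

(** Tangent line of the logarithm at [l]. As [l] is free, the slope [k / l] is as small as desired:
    the curve recedes more slowly than any ray going left. *)
Lemma kap_lower c k y l : 0 < k -> 0 < l -> c - k * ((1 + Rabs y) / l - 1 + ln l) <= kap c k y.
Proof.
  intros Hk Hl. unfold kap. pose proof (Rabs_pos y). pose proof (ln_le_linear (1 + Rabs y) l ltac:(lra) Hl) as L.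
  assert (ln (1 + y ^ 2) <= 2 * ln (1 + Rabs y)).
  { replace (2 * ln (1 + Rabs y)) with (ln (1 + Rabs y) + ln (1 + Rabs y)) by ring. rewrite <- ln_mult by lra.
    apply ln_le; [pose proof (pow2_ge_0 y); lra|]. rewrite <- (pow2_abs y). nra. }
  assert (k / 2 * ln (1 + y ^ 2) <= k / 2 * (2 * ((1 + Rabs y) / l - 1 + ln l))) by (apply Rmult_le_compat_l; lra). lra.
Qed.

Definition LK (g : C -> C) (p w : C) : C := (g w * Cexp (- (p * w)))%C.

Lemma piecewise_C1_affine (c v : C) a b : piecewise_C1 (fun t => c + RtoC t * v)%C a b.
Proof.
  assert (D : path_derive (fun t => c + RtoC t * v)%C = fun _ => v).
  { apply functional_extensionality. intros t. unfold path_derive. apply C_ext; unfold Re, Im; simpl; apply is_derive_unique; auto_derive; auto; ring. }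
  split.
  - intros t _. assert (K : rcont (fun t => c + RtoC t * v)%C t) by csolve.
    eapply filterlim_filter_le_1; [|exact K]. intros P HP. unfold within. eapply filter_imp; [|exact HP]. auto.
  - exists nil. rewrite D. split; [|split].
    + intros t _ _. split; [eexists; apply rderive_affine|apply continuous_const].
    + intros t _. exists v. apply filterlim_const.
    + intros t _. exists v. apply filterlim_const.
Qed.

Section LaplaceTransform.
Variables (H : C -> Prop) (r : R -> R) (c k A : R).
Hypothesis HD : log_domain H r c k A.

Lemma H_iff w : H w <-> Re w < r (Im w). Proof. apply HD. Qed.
Lemma closure_iff w : closure H w <-> Re w <= r (Im w). Proof. apply HD. Qed.
Lemma r_cont y : continuous r y. Proof. apply HD. Qed.
Lemma r_decr y y' : Rabs y <= Rabs y' -> r y' <= r y. Proof. apply HD. Qed.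
Lemma r_kap y : kap c k y < r y <= kap c k y + A. Proof. apply HD. Qed.
Lemma k_pos : 0 < k. Proof. apply HD. Qed.

Lemma H_open : is_open H.
Proof.
  intros w Hw. apply H_iff in Hw.
  pose proof (proj1 (filterlim_locally _ _) (r_cont (Im w))) as K.
  assert (He : 0 < (r (Im w) - Re w) / 2) by lra.
  destruct (K (mkposreal _ He)) as [d Hd]. exists (Rmin d ((r (Im w) - Re w) / 2)).
  split; [apply Rmin_pos; auto; apply cond_pos|]. intros z Hz. apply Cmod_lt_parts in Hz. destruct Hz as [Z1 Z2].
  assert (Z3 := Rlt_le_trans _ _ _ Z1 (Rmin_r _ _)). assert (Z4 := Rlt_le_trans _ _ _ Z2 (Rmin_l _ _)).
  apply H_iff. specialize (Hd (Im z) Z4). change (Rabs (r (Im z) - r (Im w)) < (r (Im w) - Re w) / 2) in Hd.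
  apply Rabs_def2 in Z3. apply Rabs_def2 in Hd. lra.
Qed.

Lemma H_comb : comb H (r 0 - 1) 0.
Proof.
  split; [apply H_open|]. split; [apply H_iff; simpl; lra|]. split.
  - intros x y s Hxy Hs. apply H_iff in Hxy. apply H_iff. simpl in *. eapply Rlt_le_trans; [exact Hxy|].
    apply r_decr. apply Rabs_between in Hs. rewrite !Rminus_0_r in Hs. auto.
  - intros x t Hx Ht. apply H_iff in Hx. apply H_iff. simpl in *. revert Ht. unfold Rmin, Rmax.
    destruct (Rle_dec (r 0 - 1) x); lra.
Qed.

Lemma closure_shift w e : closure H w -> 0 < e -> H (w - RtoC e)%C.
Proof.
  intros Hw He. apply closure_iff in Hw. apply H_iff. rewrite Re_minus, Im_minus. simpl. rewrite Rminus_0_r. lra.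
Qed.

Lemma closure_move w z : closure H w -> Re z <= Re w -> Rabs (Im z) <= Rabs (Im w) -> closure H z.
Proof.
  intros Hw H1 H2. apply closure_iff in Hw. apply closure_iff. pose proof (r_decr _ _ H2). lra.
Qed.

Lemma H_closure w : H w -> closure H w.
Proof. intros Hw. apply H_iff in Hw. apply closure_iff. lra. Qed.

(** Only horizontal and vertical segments are covered: the whole segment is then dominated by one of
    its ends in the sense of [closure_move]. *)
Lemma closure_hull a b s : closure H a -> closure H b -> Re a = Re b \/ Im a = Im b -> 0 <= s <= 1 ->
  closure H (a + RtoC s * (b - a))%C.
Proof.
  intros Ha Hb E Hs.
  assert (ER : Re (a + RtoC s * (b - a))%C = Re a + s * (Re b - Re a)) by (unfold Re; simpl; ring).
  assert (EI : Im (a + RtoC s * (b - a))%C = Im a + s * (Im b - Im a)) by (unfold Im; simpl; ring).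
  destruct E as [E|E].
  - assert (Q : Rabs (Im a + s * (Im b - Im a)) <= Rmax (Rabs (Im a)) (Rabs (Im b))).
    { replace (Im a + s * (Im b - Im a)) with ((1 - s) * Im a + s * Im b) by ring.
      eapply Rle_trans; [apply Rabs_triang|]. rewrite !Rabs_mult, (Rabs_right (1 - s)), (Rabs_right s) by lra.
      pose proof (Rmax_l (Rabs (Im a)) (Rabs (Im b))). pose proof (Rmax_r (Rabs (Im a)) (Rabs (Im b))). nra. }
    unfold Rmax in Q. destruct (Rle_dec (Rabs (Im a)) (Rabs (Im b))).
    + apply (closure_move b); auto; rewrite ?ER, ?EI, ?E; try lra; auto.
    + apply (closure_move a); auto; rewrite ?ER, ?EI, ?E; try lra; auto.
  - destruct (Rle_dec (Re a) (Re b)).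
    + apply (closure_move b); auto; rewrite ?ER, ?EI; [nra|]. rewrite E. right; f_equal; ring.
    + apply (closure_move a); auto; rewrite ?ER, ?EI; [nra|]. rewrite E. right; f_equal; ring.
Qed.

Definition pot (h : C -> C) : C -> C := comb_integral h (r 0 - 1) 0.

Lemma pot_cder h : (forall z, ccont h z) -> (forall z, H z -> differentiable h z) ->
  forall z, H z -> cder (pot h) z (h z).
Proof.
  intros Hc Hd. apply (comb_primitive H (r 0 - 1) 0 h H_comb); [auto|].
  intros x1 x2 y1 y2 Hr. apply Goursat. eapply on_rect_impl; eauto.
Qed.

(* The path is pushed into the open set [H] by a small translation to the left. *)
Lemma closure_FTC h (gam pd : R -> C) a b : (forall z, ccont h z) -> (forall z, H z -> differentiable h z) ->
  (forall t, rcont gam t) -> pieces gam pd a b -> (forall t, a <= t <= b -> closure H (gam t)) ->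
  is_CInt (fun t => h (gam t) * pd t)%C a b (pot h (gam b) - pot h (gam a))%C.
Proof.
  intros Hc Hd Hg Hp Hin.
  assert (Hab := pieces_le _ _ _ _ Hp).
  assert (Kg : forall e t, rcont (fun t => h (gam t - RtoC e)%C) t).
  { intros e t. apply (cont_comp_C (fun t => gam t - RtoC e)%C); [csolve; apply Hg|apply Hc]. }
  assert (Kg0 : forall t, rcont (fun t => h (gam t)) t).
  { intros t. apply (cont_comp_C gam); [apply Hg|apply Hc]. }
  destruct (pieces_integrable _ _ _ _ (fun t => h (gam t)) Hp Kg0) as [l Il].
  replace (pot h (gam b) - pot h (gam a))%C with l; auto.
  assert (Is : forall e, 0 < e -> is_CInt (fun t => h (gam t - RtoC e) * pd t)%C a b (pot h (gam b - RtoC e) - pot h (gam a - RtoC e))%C).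
  { intros e He. apply (pieces_FTC (fun z => pot h (z - RtoC e)) (fun z => h (z - RtoC e)%C) gam pd a b Hg Hp).
    - intros t Ht. replace (h (gam t - RtoC e)%C) with (h (gam t - RtoC e) * (1 - 0))%C by ring.
      apply (cder_comp (fun z => z - RtoC e)%C (pot h)); [apply cder_minus; [apply cder_id|apply cder_const]|].
      apply pot_cder; auto. apply closure_shift; auto.
    - intros t Ht. apply (cont_comp_C (fun z => z - RtoC e)%C); [csolve|apply Hc]. }
  destruct (pieces_bound _ _ _ _ Hp) as [B [HB BB]].
  destruct (bounded_on_segment gam a b ltac:(intros; apply Hg)) as [N [HN BN]].
  cut (@eq C (l - (pot h (gam b) - pot h (gam a)))%C (RtoC 0)).
  { intros Z. transitivity ((l - (pot h (gam b) - pot h (gam a))) + (pot h (gam b) - pot h (gam a)))%C; [ring|]. rewrite Z. ring. }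
  apply Cmod_small_0. intros eps He.
  destruct (comb_integral_shift h (r 0 - 1) 0 (gam b) Hc (eps / 4) ltac:(lra)) as [d1 [D1 S1]].
  destruct (comb_integral_shift h (r 0 - 1) 0 (gam a) Hc (eps / 4) ltac:(lra)) as [d2 [D2 S2]].
  destruct (uniform_continuity_rect h (- N) N (- N) N ltac:(intros ? ? _ _; auto) (eps / (2 * (B + 1))) ltac:(pos)) as [d3 [D3 S3]].
  set (e := Rmin (Rmin d1 d2) d3 / 2).
  assert (Hm : 0 < Rmin (Rmin d1 d2) d3) by (repeat apply Rmin_pos; auto).
  assert (He3 : 0 < e < d3) by (unfold e; pose proof (Rmin_r (Rmin d1 d2) d3); lra).
  assert (He1 : 0 < e < d1) by (unfold e; pose proof (Rmin_l (Rmin d1 d2) d3); pose proof (Rmin_l d1 d2); lra).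
  assert (He2 : 0 < e < d2) by (unfold e; pose proof (Rmin_l (Rmin d1 d2) d3); pose proof (Rmin_r d1 d2); lra).
  specialize (S1 e He1). specialize (S2 e He2). fold (pot h (gam b - RtoC e)) in S1. fold (pot h (gam b)) in S1.
  fold (pot h (gam a - RtoC e)) in S2. fold (pot h (gam a)) in S2.
  pose proof (is_CInt_minus _ _ _ _ _ _ Il (Is e (proj1 He3))) as I.
  assert (BI : Cmod (l - (pot h (gam b - RtoC e) - pot h (gam a - RtoC e))) <= B * (eps / (2 * (B + 1)))).
  { apply (BB (fun t => h (gam t) - h (gam t - RtoC e))%C).
    - intros t. apply cont_Cminus; auto.
    - intros t Ht. rewrite Cmod_minus_sym. left.
      specialize (BN t ltac:(ordered; auto)).
      pose proof (re_le_Cmod (gam t)) as R1. pose proof (im_le_Cmod (gam t)) as R2.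
      assert (R1' : Rabs (Re (gam t)) <= N) by lra. assert (R2' : Rabs (Im (gam t)) <= N) by lra.
      apply Rabs_le_between in R1'. apply Rabs_le_between in R2'.
      specialize (S3 (Re (gam t)) (Im (gam t))). ordered in S3. specialize (S3 R1' R2').
      replace ((Re (gam t), Im (gam t)) : C) with (gam t) in S3 by (apply C_ext; reflexivity).
      apply S3. replace (gam t - RtoC e - gam t)%C with (- RtoC e)%C by ring. rewrite Cmod_opp, Cmod_R, Rabs_right; lra.
    - eapply is_CInt_ext; [|exact I]. intros t _. simpl. ring. }
  replace (l - (pot h (gam b) - pot h (gam a)))%C with ((l - (pot h (gam b - RtoC e) - pot h (gam a - RtoC e))) + ((pot h (gam b - RtoC e) - pot h (gam b)) - (pot h (gam a - RtoC e) - pot h (gam a))))%C by ring.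
  tri. eapply Rle_trans; [apply Rplus_le_compat_l, Cmod_triangle_minus|].
  assert (B * (eps / (2 * (B + 1))) <= eps / 2).
  { apply Rmult_le_reg_r with (2 * (B + 1)); [lra|]. replace (B * (eps / (2 * (B + 1))) * (2 * (B + 1))) with (B * eps) by (field; lra). nra. }
  lra.
Qed.

Lemma closure_segment_FTC h (a v : C) s t : (forall z, ccont h z) -> (forall z, H z -> differentiable h z) ->
  s <= t -> (forall u, s <= u <= t -> closure H (a + RtoC u * v)%C) ->
  is_CInt (fun u => h (a + RtoC u * v) * v)%C s t (pot h (a + RtoC t * v) - pot h (a + RtoC s * v))%C.
Proof.
  intros Hc Hd Hst Hin. apply (closure_FTC h (fun u => a + RtoC u * v)%C (fun _ => v)); auto.
  - intros; csolve.
  - apply pieces_one with (fun _ => v); auto; [intros; csolve|]. intros u _. split; auto. apply rderive_affine.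
Qed.

(** Rays of any slope exist once their origin is moved far enough to the left, which makes every [p]
    off the positive axis accessible. *)
Lemma far_ray (w : C) (m : R) : exists L, 0 <= L /\ forall t, 0 <= t -> closure H (w - RtoC L + RtoC t * (-1, m))%C.
Proof.
  (* With this [l], the lower line for the curve drops by at most [|m| / (|m| + 1) < 1] while the
     ray moves left by 1. *)
  pose proof k_pos as Hk. set (l := k * (Rabs m + 1)). pose proof (Rabs_pos m) as Hm. pose proof (Rabs_pos (Im w)) as Hi.
  assert (Hl : 0 < l) by (unfold l; pos).
  set (L := Rmax 0 (Re w - c + k * ((1 + Rabs (Im w)) / l - 1 + ln l))).
  exists L. split; [apply Rmax_l|]. intros t Ht. apply closure_iff.
  assert (HL : Re w - c + k * ((1 + Rabs (Im w)) / l - 1 + ln l) <= L) by apply Rmax_r.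
  replace (Re (w - RtoC L + RtoC t * (-1, m))%C) with (Re w - L - t) by (unfold Re; simpl; ring).
  replace (Im (w - RtoC L + RtoC t * (-1, m))%C) with (Im w + t * m) by (unfold Im; simpl; ring).
  pose proof (r_kap (Im w + t * m)) as [R1 _].
  pose proof (kap_lower c k (Im w + t * m) l Hk Hl) as K.
  assert (T : Rabs (Im w + t * m) <= Rabs (Im w) + t * Rabs m).
  { eapply Rle_trans; [apply Rabs_triang|]. rewrite Rabs_mult, (Rabs_right t); lra. }
  assert (Q : k * ((1 + Rabs (Im w + t * m)) / l) <= k * ((1 + Rabs (Im w)) / l) + t).
  { apply Rle_trans with (k * ((1 + (Rabs (Im w) + t * Rabs m)) / l)).
    - apply Rmult_le_compat_l; [lra|]. apply Rmult_le_compat_r; [pos|lra].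
    - assert (k * (t * Rabs m / l) <= t).
      { unfold l. replace (k * (t * Rabs m / (k * (Rabs m + 1)))) with (t * (Rabs m / (Rabs m + 1))) by (field; lra).
        assert (Rabs m / (Rabs m + 1) <= 1) by (apply Rmult_le_reg_r with (Rabs m + 1); [lra|]; unfold Rdiv; rewrite Rmult_assoc, Rinv_l; lra).
        nra. }
      replace (k * ((1 + (Rabs (Im w) + t * Rabs m)) / l)) with (k * ((1 + Rabs (Im w)) / l) + k * (t * Rabs m / l)) by (field; lra). lra. }
  lra.
Qed.

Section Function.
Variables (g : C -> C) (M : R).
Hypothesis Hgc : forall z, ccont g z.
Hypothesis Hgd : forall z, H z -> differentiable g z.
Hypothesis HgM : forall z, closure H z -> Cmod (g z) <= M.

Lemma M_nonneg : 0 <= M.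
Proof.
  assert (K : closure H (r 0, 0)) by (apply closure_iff; simpl; lra).
  specialize (HgM _ K). pose proof (Cmod_ge_0 (g (r 0, 0))). lra.
Qed.

Lemma LK_cont p z : ccont (LK g p) z.
Proof. unfold LK. csolve. apply Hgc. Qed.

Lemma Cexp_comp_differentiable (u : C -> C) z l : cder u z l -> cder (fun z => Cexp (u z)) z (Cexp (u z) * l)%C.
Proof. intros Hu. apply (cder_comp u Cexp); auto. apply cder_Cexp. Qed.

Lemma LK_differentiable p z : H z -> differentiable (LK g p) z.
Proof.
  intros Hz. destruct (Hgd z Hz) as [l Hl]. eexists. unfold LK. apply cder_mult; [exact Hl|].
  apply Cexp_comp_differentiable. apply cder_opp, cder_scal, cder_id.
Qed.

Lemma LK_norm p z : closure H z -> Cmod (LK g p z) <= M * exp (- Re (p * z)%C).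
Proof.
  intros Hz. unfold LK. rewrite Cmod_mult, Cmod_Cexp. apply Rmult_le_compat_r; [pos|auto].
Qed.

Definition LP (p : C) : C -> C := pot (LK g p).

Lemma LP_segment p (a v : C) s t : s <= t -> (forall u, s <= u <= t -> closure H (a + RtoC u * v)%C) ->
  is_CInt (fun u => LK g p (a + RtoC u * v) * v)%C s t (LP p (a + RtoC t * v) - LP p (a + RtoC s * v))%C.
Proof. apply closure_segment_FTC; auto using LK_cont, LK_differentiable. Qed.

Definition good_ray (p w1 v : C) : Prop :=
  (forall t, 0 <= t -> closure H (w1 + RtoC t * v)%C) /\ Re v < 0 /\ 0 < Re (p * v)%C.

Lemma is_Laplace_clim w0 p l : is_Laplace H g w0 p l ->
  exists w1 v, good_ray p w1 v /\ clim (fun T => LP p (w1 + RtoC T * v) - LP p w0)%C l.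
Proof.
  intros [w1 [v [gam [l1 [l2 [P1 [P2 [P3 [P4 [P5 [P6 [P7 [P8 [P9 ->]]]]]]]]]]]]]].
  exists w1, v. split; [repeat split; auto|].
  assert (E1 : l1 = (LP p w1 - LP p w0)%C).
  { destruct (piecewise_pieces gam 0 1 ltac:(lra) P1) as [G1 G2].
    apply (path_integral_clip (LK g p) gam 0 1) in P8; [|lra].
    pose proof (closure_FTC (LK g p) _ _ _ _ (LK_cont p) (LK_differentiable p) G1 G2) as K.
    cbv beta in K. rewrite !clip_id in K by lra. rewrite P2, P3 in K.
    eapply is_CInt_inj; [exact P8|apply K]. intros t Ht. rewrite clip_id by auto. auto. }
  assert (L2 : clim (fun T => LP p (w1 + RtoC T * v) - LP p (w1 + RtoC 0 * v))%C l2).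
  { apply (is_CInt_inf_elim (fun t => LK g p (w1 + RtoC t * v) * v)%C); [|exact P9].
    intros T HT. apply LP_segment; auto. intros u Hu. apply P5; lra. }
  replace (w1 + RtoC 0 * v)%C with w1 in L2 by ring.
  rewrite E1. eapply clim_ext; [|apply (clim_plus _ _ _ _ (clim_const (LP p w1 - LP p w0)%C) L2)].
  intros T. simpl. ring.
Qed.

(** On the segments joining [a T] to [b T] the integrand is at most a constant times [exp (- al T)],
    while their lengths grow linearly. This compares integrals along two different paths to
    infinity. *)
Lemma connect_decay p (a b : R -> C) al q N T1 : 0 < al -> 0 <= N ->
  (forall T, T1 < T -> q + al * T <= Re (p * a T)%C /\ q + al * T <= Re (p * b T)%C /\
     Cmod (b T - a T) <= N * (1 + T) /\
     forall s, 0 <= s <= 1 -> closure H (a T + RtoC s * (b T - a T))%C) ->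
  forall eps, 0 < eps -> exists T0, forall T, T0 < T -> Cmod (LP p (b T) - LP p (a T)) < eps.
Proof.
  intros Hal HN Hab eps He. pose proof M_nonneg as HM.
  set (s0 := al / 2). assert (Hs0 : 0 < s0) by (unfold s0; lra).
  destruct (exp_decay_small (M * exp (- q) * N * (exp s0 / s0)) s0 eps Hs0 He) as [T2 [HT2 W]].
  exists (Rmax T1 T2). intros T HT.
  assert (HT1 := Rle_lt_trans _ _ _ (Rmax_l _ _) HT). assert (HT3 := Rle_lt_trans _ _ _ (Rmax_r _ _) HT).
  destruct (Hab T HT1) as [Q1 [Q2 [Na Hin]]]. specialize (W T HT3).
  pose proof (LP_segment p (a T) (b T - a T) 0 1 ltac:(lra) Hin) as I.
  replace (a T + RtoC 1 * (b T - a T))%C with (b T) in I by ring. replace (a T + RtoC 0 * (b T - a T))%C with (a T) in I by ring.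
  eapply Rle_lt_trans; [|exact W].
  eapply Rle_trans; [apply is_CInt_norm_const with (2 := I) (M := M * exp (- q) * exp (- (al * T)) * (N * (1 + T)))|].
  - ordered. intros s Hs. rewrite Cmod_mult. rmul.
    eapply Rle_trans; [apply LK_norm; auto|]. rewrite Rmult_assoc. apply Rmult_le_compat_l; auto. rewrite <- exp_plus. apply exp_le_le.
    replace (Re (p * (a T + RtoC s * (b T - a T)))%C) with ((1 - s) * Re (p * a T)%C + s * Re (p * b T)%C) by (unfold Re; simpl; ring).
    nra.
  - rewrite Rminus_0_r, Rabs_R1, Rmult_1_l. pose proof (linear_le_exp s0 T Hs0 ltac:(lra)) as E.
    apply Rle_trans with (M * exp (- q) * exp (- (al * T)) * (N * (exp s0 / s0 * exp (s0 * T)))).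
    + apply Rmult_le_compat_l; [pos|].
      apply Rmult_le_compat_l; [lra|auto].
    + right. replace (- (s0 * T)) with (- (al * T) + s0 * T) by (unfold s0; field). rewrite exp_plus. ring.
Qed.

Lemma connect_rays_decay p (a0 a1 b0 b1 : C) : 0 < Re (p * a1)%C -> 0 < Re (p * b1)%C ->
  (exists T0, forall T, T0 < T -> forall s, 0 <= s <= 1 ->
     closure H ((a0 + RtoC T * a1) + RtoC s * ((b0 + RtoC T * b1) - (a0 + RtoC T * a1)))%C) ->
  forall eps, 0 < eps -> exists T0, forall T, T0 < T ->
    Cmod (LP p (b0 + RtoC T * b1) - LP p (a0 + RtoC T * a1)) < eps.
Proof.
  intros Ha Hb [T1 Hin].
  pose proof (Cmod_ge_0 (b0 - a0)). pose proof (Cmod_ge_0 (b1 - a1)).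
  pose proof (Rmin_l (Re (p * a1)%C) (Re (p * b1)%C)) as al1. pose proof (Rmin_r (Re (p * a1)%C) (Re (p * b1)%C)) as al2.
  pose proof (Rmin_l (Re (p * a0)%C) (Re (p * b0)%C)) as q1. pose proof (Rmin_r (Re (p * a0)%C) (Re (p * b0)%C)) as q2.
  apply (connect_decay p (fun T => a0 + RtoC T * a1)%C (fun T => b0 + RtoC T * b1)%C (Rmin (Re (p * a1)%C) (Re (p * b1)%C))
    (Rmin (Re (p * a0)%C) (Re (p * b0)%C)) (Cmod (b0 - a0) + Cmod (b1 - a1)) (Rmax 0 T1)).
  - apply Rmin_pos; auto.
  - lra.
  - intros T HT. assert (HT1 := Rle_lt_trans _ _ _ (Rmax_l _ _) HT). assert (HT3 := Rle_lt_trans _ _ _ (Rmax_r _ _) HT).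
    repeat split; auto.
    + replace (Re (p * (a0 + RtoC T * a1))%C) with (Re (p * a0)%C + T * Re (p * a1)%C) by (unfold Re; simpl; ring). nra.
    + replace (Re (p * (b0 + RtoC T * b1))%C) with (Re (p * b0)%C + T * Re (p * b1)%C) by (unfold Re; simpl; ring). nra.
    + replace (b0 + RtoC T * b1 - (a0 + RtoC T * a1))%C with ((b0 - a0) + RtoC T * (b1 - a1))%C by ring.
      tri. rewrite Cmod_mult, Cmod_R, Rabs_right by lra. nra.
Qed.

(** One ray is reparametrized so that matching points have the same abscissa when [Re p < 0], the
    same ordinate otherwise; in the second case [Im v] and [Im v'] have the same sign. The
    connecting segments then stay in the closure by [closure_hull]. *)
Lemma good_rays_same_limit p w1 v w1' v' l l' : good_ray p w1 v -> good_ray p w1' v' ->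
  clim (fun T => LP p (w1 + RtoC T * v)) l -> clim (fun T => LP p (w1' + RtoC T * v')) l' -> l = l'.
Proof.
  intros [R1 [R2 R3]] [R1' [R2' R3']] L L'.
  assert (K : forall s t, 0 < s ->
    (forall T, Re (w1 + RtoC T * v)%C = Re (w1' + RtoC (s * T + t) * v')%C \/ Im (w1 + RtoC T * v)%C = Im (w1' + RtoC (s * T + t) * v')%C) -> l = l').
  { intros s t Hs HE. pose proof (clim_affine _ _ s t Hs L') as L2. symmetry. apply (clim_close _ _ _ _ L2 L).
    assert (EB : forall T, (w1' + RtoC (s * T + t) * v')%C = ((w1' + RtoC t * v') + RtoC T * (RtoC s * v'))%C).
    { intros T. rewrite RtoC_plus, RtoC_mult. ring. }
    assert (Hd : forall eps, 0 < eps -> exists T0, forall T, T0 < T ->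
      Cmod (LP p ((w1' + RtoC t * v') + RtoC T * (RtoC s * v')) - LP p (w1 + RtoC T * v)) < eps).
    { apply connect_rays_decay; auto.
      - replace (Re (p * (RtoC s * v'))%C) with (s * Re (p * v')%C) by (unfold Re; simpl; ring). pos.
      - exists (Rmax 0 (- t / s)). intros T HT u Hu.
        assert (HT1 := Rle_lt_trans _ _ _ (Rmax_l _ _) HT). assert (HT3 := Rle_lt_trans _ _ _ (Rmax_r _ _) HT).
        rewrite <- EB. apply closure_hull; auto; [apply R1; lra|]. apply R1'.
        apply Rmult_lt_compat_l with (r := s) in HT3; auto. replace (s * (- t / s)) with (- t) in HT3 by (field; lra). lra. }
    intros eps He. destruct (Hd eps He) as [T0 W]. exists T0. intros T HT. rewrite EB. apply W; auto. }
  destruct (Rlt_dec (Re p) 0) as [Hp|Hp].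
  - apply (K (Re v / Re v') ((Re w1 - Re w1') / Re v')).
    + replace (Re v / Re v') with ((- Re v) / (- Re v')) by (field; lra). pos.
    + intros T. left. unfold Re in *; simpl. field. lra.
  - assert (S1 : Im p * Im v < 0) by (unfold Re, Im in *; simpl in *; nra).
    assert (S2 : Im p * Im v' < 0) by (unfold Re, Im in *; simpl in *; nra).
    assert (N2 : Im v' <> 0) by (intro E; rewrite E in S2; lra).
    assert (S3 : 0 < Im v * Im v') by nra.
    apply (K (Im v / Im v') ((Im w1 - Im w1') / Im v')).
    + replace (Im v / Im v') with (Im v * Im v' / (Im v' * Im v')) by (field; auto). apply Rdiv_lt_0_compat; nra.
    + intros T. right. unfold Im in *; simpl. field. auto.
Qed.

Lemma is_Laplace_unique w0 p l l' : is_Laplace H g w0 p l -> is_Laplace H g w0 p l' -> l = l'.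
Proof.
  intros H1 H2. destruct (is_Laplace_clim _ _ _ H1) as [w1 [v [G1 L1]]]. destruct (is_Laplace_clim _ _ _ H2) as [w1' [v' [G2 L2]]].
  assert (L1' : clim (fun T => LP p (w1 + RtoC T * v)) (l + LP p w0)%C).
  { eapply clim_ext; [|apply (clim_plus _ _ _ _ L1 (clim_const (LP p w0)))]. intros; simpl; ring. }
  assert (L2' : clim (fun T => LP p (w1' + RtoC T * v')) (l' + LP p w0)%C).
  { eapply clim_ext; [|apply (clim_plus _ _ _ _ L2 (clim_const (LP p w0)))]. intros; simpl; ring. }
  pose proof (good_rays_same_limit _ _ _ _ _ _ _ G1 G2 L1' L2') as E.
  replace l with (l + LP p w0 - LP p w0)%C by ring. rewrite E. ring.
Qed.

Lemma ray_integral_exists p w1 v : good_ray p w1 v ->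
  clim (CInt (fun t => LK g p (w1 + RtoC t * v) * v)%C 0) (CInt_inf (fun t => LK g p (w1 + RtoC t * v) * v)%C).
Proof.
  intros [R1 [R2 R3]].
  destruct (exp_dominated (fun t => LK g p (w1 + RtoC t * v) * v)%C (M * exp (- Re (p * w1)%C) * Cmod v) (Re (p * v)%C)) as [l [Hl _]]; auto.
  - intros t _. csolve. apply (cont_comp_C (fun t : R => w1 + RtoC t * v)%C); [csolve|apply LK_cont].
  - intros t Ht. rewrite Cmod_mult. replace (M * exp (- Re (p * w1)%C) * Cmod v * exp (- (Re (p * v)%C * t))) with (M * exp (- Re (p * (w1 + RtoC t * v))%C) * Cmod v).
    + apply Rmult_le_compat_r; [apply Cmod_ge_0|]. apply LK_norm; auto.
    + replace (- Re (p * (w1 + RtoC t * v))%C) with (- Re (p * w1)%C + - (Re (p * v)%C * t)) by (unfold Re; simpl; ring). rewrite exp_plus. ring.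
  - unfold CInt_inf. rewrite (Clim_unique _ _ Hl). auto.
Qed.

(** A canonical choice of path: go left by [L], then follow a ray. The path is fixed while [p]
    varies, so the formula can be differentiated in [p]. *)
Definition Laplace_formula (w0 : C) (L : R) (v p : C) : C :=
  (CInt (fun t => LK g p (w0 + RtoC t * - RtoC L) * - RtoC L)%C 0 1 +
   CInt_inf (fun t => LK g p ((w0 - RtoC L) + RtoC t * v) * v)%C)%C.

Lemma is_Laplace_formula w0 L v p : closure H w0 -> 0 <= L -> good_ray p (w0 - RtoC L) v ->
  is_Laplace H g w0 p (Laplace_formula w0 L v p).
Proof.
  intros Hw HL HR.
  exists (w0 - RtoC L)%C, v, (fun t => w0 + RtoC t * - RtoC L)%C, (CInt (fun t => LK g p (w0 + RtoC t * - RtoC L) * - RtoC L)%C 0 1),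
    (CInt_inf (fun t => LK g p ((w0 - RtoC L) + RtoC t * v) * v)%C).
  assert (D : path_derive (fun t => w0 + RtoC t * - RtoC L)%C = fun _ => (- RtoC L)%C).
  { apply functional_extensionality. intros t. unfold path_derive. apply C_ext; unfold Re, Im; simpl; apply is_derive_unique; auto_derive; auto; ring. }
  assert (Kc : forall (a v : C) t, rcont (fun t => LK g p (a + RtoC t * v) * v)%C t).
  { intros a u t. csolve. apply (cont_comp_C (fun t : R => a + RtoC t * u)%C); [csolve|apply LK_cont]. }
  split; [apply piecewise_C1_affine|]. split; [ring|]. split; [ring|]. split.
  { intros t Ht. apply (closure_move w0); auto.
    - unfold Re; simpl. nra.
    - right. f_equal. unfold Im; simpl. ring. }
  split; [apply HR|]. split; [apply HR|]. split; [apply HR|]. split; [|split; auto].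
  - unfold is_path_integral. rewrite D. apply CInt_correct_all. apply Kc.
  - apply (is_CInt_inf_intro _ (CInt (fun t => LK g p ((w0 - RtoC L) + RtoC t * v) * v)%C 0)).
    + intros T HT. apply CInt_correct_all. apply Kc.
    + apply ray_integral_exists; auto.
Qed.

Lemma Laplace_is w0 p l : is_Laplace H g w0 p l -> Laplace H g w0 p = l.
Proof.
  intros Hl. apply (iota_unique (V := C_R_CompleteNormedModule)); auto. intros y Hy. eapply is_Laplace_unique; eauto.
Qed.

Lemma slit_slope p : slit p -> exists m, 0 < Re (p * (-1, m))%C.
Proof.
  intros Hp. destruct (Req_dec (Im p) 0) as [E|N].
  - exists 0. destruct (Rle_dec 0 (Re p)) as [L|L]; [exfalso; apply Hp; auto|]. unfold Re, Im in *; simpl. lra.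
  - exists (- (Re p + 1) / Im p). unfold Re, Im in *; simpl. replace (fst p * -1 - snd p * (- (fst p + 1) / snd p)) with 1 by (field; auto). lra.
Qed.

Lemma Laplace_exists w0 p : closure H w0 -> slit p -> is_Laplace H g w0 p (Laplace H g w0 p).
Proof.
  intros Hw Hp. destruct (slit_slope p Hp) as [m Hm]. destruct (far_ray w0 m) as [L [HL HR]].
  assert (GR : good_ray p (w0 - RtoC L) (-1, m)) by (split; [auto|split; [simpl; lra|auto]]).
  pose proof (is_Laplace_formula w0 L (-1, m) p Hw HL GR) as K. rewrite (Laplace_is _ _ _ K). auto.
Qed.

Lemma good_ray_slit p w1 v : good_ray p w1 v -> slit p.
Proof. intros [_ [R2 R3]] [P1 P2]. unfold Re, Im in *; simpl in *. rewrite P1 in R3. nra. Qed.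

(** Any admissible ray computes the transform, wherever it starts: the primitive [LP] records the
    finite part of the path. *)
Lemma Laplace_clim w0 p w1 v : closure H w0 -> good_ray p w1 v ->
  clim (fun T => LP p (w1 + RtoC T * v) - LP p w0)%C (Laplace H g w0 p).
Proof.
  intros Hw HR. pose proof (Laplace_exists w0 p Hw (good_ray_slit _ _ _ HR)) as HL.
  destruct (is_Laplace_clim _ _ _ HL) as [w1' [v' [G L1]]].
  pose proof (ray_integral_exists p w1 v HR) as L2.
  set (l2 := CInt_inf _) in L2.
  assert (L2' : clim (fun T => LP p (w1 + RtoC T * v)) (l2 + LP p w1)%C).
  { apply (clim_ext_ge (fun T => CInt (fun t => LK g p (w1 + RtoC t * v) * v)%C 0 T + LP p w1)%C _ _ 0).
    - intros T HT. rewrite (is_CInt_unique _ _ _ _ (LP_segment p w1 v 0 T ltac:(lra) ltac:(intros; apply HR; lra))).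
      replace (w1 + RtoC 0 * v)%C with w1 by ring. ring.
    - apply (clim_plus _ _ _ _ L2 (clim_const _)). }
  assert (L1' : clim (fun T => LP p (w1' + RtoC T * v')) (Laplace H g w0 p + LP p w0)%C).
  { eapply clim_ext; [|apply (clim_plus _ _ _ _ L1 (clim_const (LP p w0)))]. intros; simpl; ring. }
  pose proof (good_rays_same_limit _ _ _ _ _ _ _ G HR L1' L2') as E.
  replace (Laplace H g w0 p) with (l2 + LP p w1 - LP p w0)%C by (rewrite <- E; ring).
  apply (clim_minus _ _ _ _ L2' (clim_const _)).
Qed.

Lemma Laplace_change_base w0 w0' p : closure H w0 -> closure H w0' -> slit p ->
  (Laplace H g w0 p - Laplace H g w0' p = LP p w0' - LP p w0)%C.
Proof.
  intros Hw Hw' Hp. destruct (slit_slope p Hp) as [m Hm]. destruct (far_ray w0 m) as [L [HL HR]].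
  assert (GR : good_ray p (w0 - RtoC L) (-1, m)) by (split; [auto|split; [simpl; lra|auto]]).
  pose proof (clim_minus _ _ _ _ (Laplace_clim w0 _ _ _ Hw GR) (Laplace_clim w0' _ _ _ Hw' GR)) as K.
  apply (clim_unique _ _ _ K). eapply clim_ext; [|apply clim_const]. intros T. simpl. ring.
Qed.

Lemma LK_as_exp p w : LK g p w = (g w * Cexp (p * - w))%C.
Proof. unfold LK. f_equal. f_equal. ring. Qed.

Lemma LP_entire w p : differentiable (fun p => LP p w) p.
Proof.
  eexists. apply cder_plus; [|apply cder_scal].
  - eapply cder_ext; [|apply (cder_exp_integral (fun t => g (t, 0)) (fun t => - (t, 0))%C (r 0 - 1) (Re w) p)].
    + intros q. apply CInt_ext. intros t _. rewrite LK_as_exp. reflexivity.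
    + intros t _. apply rcont_h, Hgc.
    + intros t _. csolve.
  - eapply cder_ext; [|apply (cder_exp_integral (fun t => g (Re w, t)) (fun t => - (Re w, t))%C 0 (Im w) p)].
    + intros q. apply CInt_ext. intros t _. rewrite LK_as_exp. reflexivity.
    + intros t _. apply rcont_v, Hgc.
    + intros t _. csolve.
Qed.

Lemma good_ray_open p w1 v : good_ray p w1 v -> exists d, 0 < d /\ forall q, Cmod (q - p) < d -> good_ray q w1 v.
Proof.
  intros [R1 [R2 R3]]. pose proof (Cmod_ge_0 v). exists (Re (p * v)%C / (Cmod v + 1)). split; [pos|].
  intros q Hq. split; [auto|split; [auto|]].
  replace (q * v)%C with (p * v + (q - p) * v)%C by ring. change (Re (p * v + (q - p) * v)) with (Re (p * v) + Re ((q - p) * v)).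
  pose proof (re_le_Cmod ((q - p) * v)%C) as B. rewrite Cmod_mult in B. pose proof (Rle_abs (- Re ((q - p) * v)%C)) as B2. rewrite Rabs_Ropp in B2.
  apply Rmult_lt_compat_r with (r := Cmod v + 1) in Hq; [|lra]. replace (Re (p * v)%C / (Cmod v + 1) * (Cmod v + 1)) with (Re (p * v)%C) in Hq by (field; lra).
  pose proof (Cmod_ge_0 (q - p)). nra.
Qed.

Lemma ray_integral_cder p w1 v : good_ray p w1 v -> differentiable (fun p => CInt_inf (fun t => LK g p (w1 + RtoC t * v) * v)%C) p.
Proof.
  intros [R1 [R2 R3]]. pose proof M_nonneg.
  pose proof (Cmod_ge_0 v) as Hv. pose proof (Cmod_ge_0 w1) as Hw1.
  set (K := Rmax (Cmod w1 + Cmod v + 1) (M * exp (- Re (p * w1)%C) * Cmod v)).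
  assert (K1 : Cmod w1 + Cmod v + 1 <= K) by apply Rmax_l. assert (K2 : M * exp (- Re (p * w1)%C) * Cmod v <= K) by apply Rmax_r.
  assert (Kc : forall t, rcont (fun t => g (w1 + RtoC t * v)%C) t).
  { intros t. apply (cont_comp_C (fun t : R => w1 + RtoC t * v)%C); [csolve|apply Hgc]. }
  eexists. eapply cder_ext; [|apply (cder_exp_integral_inf (fun t => g (w1 + RtoC t * v) * v)%C (fun t => - (w1 + RtoC t * v))%C K (Re (p * v)%C) p); auto].
  - intros q. unfold CInt_inf. f_equal. apply functional_extensionality. intros T. apply CInt_ext. intros t _. rewrite LK_as_exp. ring.
  - lra.
  - intros t Ht. csolve. apply Kc.
  - intros t Ht. csolve.
  - intros t Ht. rewrite Cmod_opp. tri. rewrite Cmod_mult, Cmod_R, Rabs_right by lra. nra.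
  - intros t Ht. replace (g (w1 + RtoC t * v) * v * Cexp (p * - (w1 + RtoC t * v)))%C with (LK g p (w1 + RtoC t * v) * v)%C by (rewrite LK_as_exp; ring).
    rewrite Cmod_mult. apply Rle_trans with (M * exp (- Re (p * w1)%C) * Cmod v * exp (- (Re (p * v)%C * t))).
    + replace (M * exp (- Re (p * w1)%C) * Cmod v * exp (- (Re (p * v)%C * t))) with (M * exp (- Re (p * (w1 + RtoC t * v))%C) * Cmod v).
      * apply Rmult_le_compat_r; [apply Cmod_ge_0|]. apply LK_norm; auto.
      * replace (- Re (p * (w1 + RtoC t * v))%C) with (- Re (p * w1)%C + - (Re (p * v)%C * t)) by (unfold Re; simpl; ring). rewrite exp_plus. ring.
    + apply Rmult_le_compat_r; [pos|auto].
Qed.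

(** A ray good for [p] is good for all nearby parameters, so near [p] the transform coincides with
    one [Laplace_formula]. *)
Lemma Laplace_differentiable w0 p : closure H w0 -> slit p -> differentiable (Laplace H g w0) p.
Proof.
  intros Hw Hp. destruct (slit_slope p Hp) as [m Hm]. destruct (far_ray w0 m) as [L [HL HR]].
  assert (GR : good_ray p (w0 - RtoC L) (-1, m)) by (split; [auto|split; [simpl; lra|auto]]).
  destruct (good_ray_open _ _ _ GR) as [d [Hd Hop]].
  destruct (ray_integral_cder _ _ _ GR) as [l2 D2].
  eexists. apply (cder_ext_loc (Laplace_formula w0 L (-1, m)) _ p _ d Hd).
  - intros q Hq. symmetry. apply Laplace_is, is_Laplace_formula; auto.
  - unfold Laplace_formula. apply cder_plus; [|exact D2].
    eapply cder_ext; [|apply (cder_exp_integral (fun t => g (w0 + RtoC t * - RtoC L) * - RtoC L)%C (fun t => - (w0 + RtoC t * - RtoC L))%C 0 1 p)].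
    + intros q. apply CInt_ext. intros t _. rewrite LK_as_exp. ring.
    + intros t _. csolve. apply (cont_comp_C (fun t : R => w0 + RtoC t * - RtoC L)%C); [csolve|apply Hgc].
    + intros t _. csolve.
Qed.

End Function.
End LaplaceTransform.

(** * Continuous extension of the elements of E_0 *)

Lemma is_Laplace_ext H g g' w0 p l : (forall w, closure H w -> g w = g' w) ->
  is_Laplace H g w0 p l -> is_Laplace H g' w0 p l.
Proof.
  intros E [w1 [v [gam [l1 [l2 [P1 [P2 [P3 [P4 [P5 [P6 [P7 [P8 [P9 P10]]]]]]]]]]]]]].
  exists w1, v, gam, l1, l2. repeat (split; auto).
  - eapply is_RInt_ext; [|exact P8]. ordered. intros t Ht. simpl.
    rewrite E; auto. apply P4; lra.
  - eapply is_RInt_gen_ext; [|exact P9].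
    apply Filter_prod with (Q := fun a => a = 0) (R := fun T => 0 < T).
    + reflexivity.
    + exists 0; auto.
    + intros a T -> HT t Ht. simpl in Ht. rewrite Rmin_left in Ht by lra. rewrite E; auto. apply P5; lra.
Qed.

Lemma Laplace_ext H g g' w0 p : (forall w, closure H w -> g w = g' w) -> Laplace H g w0 p = Laplace H g' w0 p.
Proof.
  intros E. unfold Laplace. f_equal. apply functional_extensionality. intros l. apply propositional_extensionality.
  split; apply is_Laplace_ext; auto. intros; symmetry; auto.
Qed.

(** Composition with the horizontal projection onto the closure of [H]. It gives a representative
    continuous on the whole plane with the same Laplace transform, so that no continuity condition
    has to be restricted to a subset. *)
Definition extend (r : R -> R) (g : C -> C) (w : C) : C := g (Rmin (Re w) (r (Im w)), Im w).

Definition regular (H : C -> Prop) (g : C -> C) (M : R) : Prop :=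
  (forall z, ccont g z) /\ (forall z, H z -> differentiable g z) /\ (forall z, closure H z -> Cmod (g z) <= M).

Section Extend.
Variables (H : C -> Prop) (r : R -> R) (c k A : R).
Hypothesis HD : log_domain H r c k A.

Lemma extend_closure g w : closure H w -> extend r g w = g w.
Proof.
  intros Hw. apply (closure_iff _ _ _ _ _ HD) in Hw. unfold extend. rewrite Rmin_left by auto. f_equal. apply C_ext; reflexivity.
Qed.

Lemma Rmin_Rabs a b : Rmin a b = (a + b - Rabs (a - b)) / 2.
Proof. unfold Rmin. destruct (Rle_dec a b); [rewrite Rabs_left1|rewrite Rabs_right]; lra. Qed.

Lemma extend_cont g : E0 H g -> forall z, ccont (extend r g) z.
Proof.
  intros [_ [_ Hc]] z.
  set (pr := fun w : C => (Rmin (Re w) (r (Im w)), Im w) : C).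
  assert (Hpr : forall w, closure H (pr w)) by (intros w; apply (closure_iff _ _ _ _ _ HD); apply Rmin_r).
  assert (Cpr : ccont pr z).
  { assert (Cr : continuous (fun w : C_UniformSpace => r (Im w)) z).
    { apply (continuous_comp (fun w : C_UniformSpace => Im w) r); [csolve|apply (r_cont _ _ _ _ _ HD)]. }
    apply cont_mkC; [|csolve].
    apply (continuous_ext (fun w : C_UniformSpace => (Re w + r (Im w) - Rabs (Re w - r (Im w))) * / 2)).
    - intros w. symmetry. apply Rmin_Rabs.
    - csolve. apply (cont_Rcomp Rabs (fun w : C_UniformSpace => Re w - r (Im w))); [apply Rcontinuity_abs|csolve]. }
  specialize (Hc (pr z) (Hpr z)). apply filterlim_locally. intros eps.
  apply filterlim_locally with (eps := eps) in Hc. unfold within in Hc.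
  specialize (Cpr _ Hc). unfold filtermap in Cpr. eapply filter_imp; [|exact Cpr].
  intros w Hw. apply Hw, Hpr.
Qed.

Lemma closure_bound (u : C -> C) M : (forall z, ccont u z) -> (forall w, H w -> Cmod (u w) <= M) ->
  forall z, closure H z -> Cmod (u z) <= M.
Proof.
  intros Cu HM z Hz. apply Rnot_lt_le. intros L.
  destruct (proj1 (ccont_eps _ _) (Cu z) (Cmod (u z) - M) ltac:(lra)) as [d [Hd W]].
  assert (K : H (z - RtoC (d / 2))%C) by (apply (closure_shift _ _ _ _ _ HD); auto; lra).
  specialize (W (z - RtoC (d / 2))%C).
  replace (z - RtoC (d / 2) - z)%C with (- RtoC (d / 2))%C in W by ring.
  rewrite Cmod_opp, Cmod_R, Rabs_right in W by lra. specialize (W ltac:(lra)). specialize (HM _ K).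
  pose proof (Cmod_rev_triangle (u z) (u (z - RtoC (d / 2))%C)) as Q. rewrite Cmod_minus_sym in Q. lra.
Qed.

Lemma extend_regular g M : E0 H g -> (forall w, H w -> Cmod (g w) <= M) -> regular H (extend r g) M.
Proof.
  intros HE HM. split; [apply extend_cont; auto|]. split.
  - intros z Hz. destruct (proj1 (holomorphic_at_cder g z) (proj1 HE z Hz)) as [l Hl]. exists l.
    destruct (H_open _ _ _ _ _ HD z Hz) as [e [He B]].
    apply cder_ext_loc with g e; auto. intros w Hw. symmetry. apply extend_closure. apply (H_closure _ _ _ _ _ HD); auto.
  - apply closure_bound; [apply extend_cont; auto|]. intros w Hw.
    rewrite extend_closure by (apply (H_closure _ _ _ _ _ HD); auto). auto.
Qed.

Lemma Laplace_extend g w0 p : Laplace H g w0 p = Laplace H (extend r g) w0 p.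
Proof. apply Laplace_ext. intros w Hw. symmetry. apply extend_closure; auto. Qed.
End Extend.

(** * Extension of the Laplace transform across the gaps *)

Definition open_R (I : R -> Prop) : Prop := forall x, I x -> exists d, 0 < d /\ forall y, Rabs (y - x) < d -> I y.

Lemma nonreal_slit p : Im p <> 0 -> slit p.
Proof. intros N [E _]. auto. Qed.

(** Used for [z] on the real axis: two continuous functions that agree with the Laplace transform
    off the axis agree on it. *)
Lemma eq_by_slit_limit (f g : C -> C) (z : C) d : 0 < d -> ccont f z -> ccont g z ->
  (forall p, Cmod (p - z) < d -> Im p <> Im z -> f p = g p) -> f z = g z.
Proof.
  intros Hd Cf Cg E. replace (f z) with ((f z - g z) + g z)%C by ring. replace (f z - g z)%C with (RtoC 0); [ring|].
  symmetry. apply Cmod_small_0. intros eps He.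
  destruct (proj1 (ccont_eps _ _) Cf (eps / 2) ltac:(lra)) as [d1 [D1 W1]].
  destruct (proj1 (ccont_eps _ _) Cg (eps / 2) ltac:(lra)) as [d2 [D2 W2]].
  set (e := Rmin d (Rmin d1 d2) / 2).
  assert (Hm : 0 < Rmin d (Rmin d1 d2)) by (repeat apply Rmin_pos; auto).
  assert (He0 : 0 < e) by (unfold e; lra).
  assert (e < d /\ e < d1 /\ e < d2).
  { unfold e. pose proof (Rmin_l d (Rmin d1 d2)). pose proof (Rmin_r d (Rmin d1 d2)).
    pose proof (Rmin_l d1 d2). pose proof (Rmin_r d1 d2). lra. }
  set (p := (z + RtoC e * Ci)%C).
  assert (Hp : Cmod (p - z) = e).
  { replace (p - z)%C with (RtoC e * Ci)%C by (unfold p; ring). rewrite Cmod_mult, Cmod_Ci, Cmod_R, Rabs_right; lra. }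
  specialize (W1 p ltac:(lra)). specialize (W2 p ltac:(lra)).
  specialize (E p ltac:(lra) ltac:(unfold p, Im; simpl; lra)).
  replace (f z - g z)%C with ((g p - g z) - (f p - f z))%C by (rewrite E; ring).
  eapply Rle_trans; [apply Cmod_triangle_minus|]. lra.
Qed.

(** Local extensions, one for each point of the gap on the positive axis, are glued by using at each
    such point its own extension; any two agree where both are defined, since they coincide off the
    real axis. *)
Lemma Laplace_across_exists H g I w0 : open_R I ->
  (forall p, slit p -> differentiable (Laplace H g w0) p) ->
  (forall b, I b -> 0 <= b -> Laplace_extends_at H g w0 b) ->
  exists f, is_Laplace_across H I g w0 f.
Proof.
  intros HI Hd Hext.
  assert (Fex : exists F : R -> C -> C, forall b, I b -> 0 <= b -> exists e, 0 < e /\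
     (forall p, Cmod (p - RtoC b)%C < e -> differentiable (F b) p) /\
     (forall p, Cmod (p - RtoC b)%C < e -> slit p -> F b p = Laplace H g w0 p)).
  { exists (fun b => epsilon (inhabits (fun p => p)) (fun f => exists e, 0 < e /\
     (forall p, Cmod (p - RtoC b)%C < e -> differentiable f p) /\
     (forall p, Cmod (p - RtoC b)%C < e -> slit p -> f p = Laplace H g w0 p))).
    intros b Ib Hb.
    apply (epsilon_spec (inhabits (fun p : C => p)) (fun f => exists e, 0 < e /\
     (forall p, Cmod (p - RtoC b)%C < e -> differentiable f p) /\
     (forall p, Cmod (p - RtoC b)%C < e -> slit p -> f p = Laplace H g w0 p))).
    destruct (Hext b Ib Hb) as [e [f [F1 F2]]]. exists f, e. split; [apply cond_pos|]. split; auto.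
    intros p Hp. apply holomorphic_at_cder; auto. }
  destruct Fex as [F HF].
  exists (fun p => if excluded_middle_informative (slit p) then Laplace H g w0 p else F (Re p) p).
  split.
  2: { intros p Hp. destruct (excluded_middle_informative (slit p)); tauto. }
  intros p Hp. apply holomorphic_at_cder.
  destruct (classic (slit p)) as [Sp|Sp].
  - destruct (Hd p Sp) as [l Hl]. exists l.
    assert (Ns : exists e, 0 < e /\ forall q, Cmod (q - p) < e -> slit q).
    { destruct (Req_dec (Im p) 0) as [E|N].
      - assert (Re p < 0) by (apply Rnot_le_lt; intro; apply Sp; auto).
        exists (- Re p). split; [lra|]. intros q Hq [_ Q]. apply Cmod_lt_parts in Hq. destruct Hq as [Hq _].
        apply Rabs_def2 in Hq. lra.
      - exists (Rabs (Im p)). split; [apply Rabs_pos_lt; auto|]. intros q Hq. apply nonreal_slit.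
        intros E. apply Cmod_lt_parts in Hq. destruct Hq as [_ Hq]. rewrite E, Rminus_0_l, Rabs_Ropp in Hq. lra. }
    destruct Ns as [e [He Ne]]. apply cder_ext_loc with (Laplace H g w0) e; auto. intros w Hw.
    destruct (excluded_middle_informative (slit w)); [reflexivity|exfalso; auto].
  - destruct Hp as [|[b [Ib ->]]]; [contradiction|].
    assert (Hb : 0 <= b). { apply Rnot_lt_le. intros L. apply Sp. intros [_ Q]. simpl in Q. lra. }
    destruct (HF b Ib Hb) as [e [He [F1 F2]]]. destruct (HI b Ib) as [d [Hd' Id]].
    destruct (F1 (RtoC b)) as [l Hl]. { replace (RtoC b - RtoC b)%C with (RtoC 0) by ring. rewrite Cmod_0; auto. }
    exists l. apply cder_ext_loc with (F b) (Rmin e d); [apply Rmin_pos; auto| |exact Hl].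
    intros q Hq. assert (Q1 := Rlt_le_trans _ _ _ Hq (Rmin_l _ _)). assert (Q2 := Rlt_le_trans _ _ _ Hq (Rmin_r _ _)).
    destruct (excluded_middle_informative (slit q)) as [Sq|Sq]; [apply F2; auto|].
    apply NNPP in Sq. destruct Sq as [Iq Rq].
    set (b' := Re q) in *. assert (Eq : q = RtoC b') by (apply C_ext; [reflexivity|auto]). clearbody b'. subst q.
    assert (Ib' : I b').
    { apply Id. apply Cmod_lt_parts in Q2. simpl in Q2. apply Q2. }
    destruct (HF b' Ib' Rq) as [e' [He' [F1' F2']]].
    (* At a nearby real point [b'] the glued function takes the value of the extension chosen for
       [b']; this radius keeps the comparison inside the discs of both extensions. *)
    apply eq_by_slit_limit with (d := Rmin e' (e - Cmod (RtoC b' - RtoC b))).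
    + apply Rmin_pos; lra.
    + apply differentiable_cont, F1; auto.
    + apply differentiable_cont, F1'. replace (RtoC b' - RtoC b')%C with (RtoC 0) by ring. rewrite Cmod_0; auto.
    + intros p Hp Np. assert (P1 := Rlt_le_trans _ _ _ Hp (Rmin_l _ _)). assert (P2 := Rlt_le_trans _ _ _ Hp (Rmin_r _ _)).
      assert (Sp' : slit p) by (apply nonreal_slit; auto).
      rewrite F2, F2'; auto.
      replace (p - RtoC b)%C with ((p - RtoC b') + (RtoC b' - RtoC b))%C by ring.
      tri_lt. lra.
Qed.

(** * Contours *)

(* The plane with slits outside the open set [O] of crossing points. *)
Definition punctured (O : R -> Prop) (z : C) : Prop := Im z <> 0 \/ O (Re z).

(** The half-plane on the side [s] together with the full vertical strips over [O]. Unlike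
    [punctured], it is a comb, so primitives exist on it. *)
Definition half (O : R -> Prop) (s : R) (z : C) : Prop := 0 < s * Im z \/ O (Re z).

Lemma half_comb O s b : open_R O -> s = 1 \/ s = -1 -> comb (half O s) b s.
Proof.
  intros HO Hs. repeat split.
  - intros z [Hz|Hz].
    + exists (s * Im z). split; auto. intros w Hw. apply Cmod_lt_parts in Hw. destruct Hw as [_ Hw]. apply Rabs_def2 in Hw. left.
      destruct Hs; subst; lra.
    + destruct (HO _ Hz) as [d [Hd Od]]. exists d. split; auto. intros w Hw. apply Cmod_lt_parts in Hw. right. apply Od, Hw.
  - left. simpl. destruct Hs; subst; lra.
  - intros x y t [Hz|Hz] Ht; [left|right; exact Hz]. simpl in *. revert Ht. unfold Rmin, Rmax. destruct (Rle_dec s y), Hs; subst; lra.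
  - intros x t _ _. left. simpl. destruct Hs; subst; lra.
Qed.

Lemma half_punctured O s z : half O s z -> punctured O z.
Proof. intros [Hz|Hz]; [left|right; auto]. intros E. rewrite E in Hz. lra. Qed.

Lemma half_primitive O F s : open_R O -> s = 1 \/ s = -1 -> (forall z, punctured O z -> differentiable F z) ->
  exists P, forall z, half O s z -> cder P z (F z).
Proof.
  intros HO Hs HF. apply comb_primitive_ex with (x0 := 0) (y0 := s); [apply half_comb; auto|].
  intros z Hz. apply HF. eapply half_punctured; eauto.
Qed.

(** The slits meet neither the rectangles above or below the axis nor those over an interval
    contained in [O]. Both the height and the crossing points are therefore free, which is what the
    averaging and the study of the support exploit. *)
Lemma rectint_crossing O F b1 b2 b1' b2' h h' : 0 < h -> 0 < h' ->
  (forall z, punctured O z -> differentiable F z) ->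
  (forall x, Rmin b1 b1' <= x <= Rmax b1 b1' -> O x) -> (forall x, Rmin b2 b2' <= x <= Rmax b2 b2' -> O x) ->
  rectint F b1 b2 (- h) h = rectint F b1' b2' (- h') h'.
Proof.
  intros Hh Hh' HF O1 O2.
  assert (Hc : forall z, punctured O z -> ccont F z) by (intros; apply differentiable_cont; auto).
  assert (Sides : forall c1 c2 y1 y2, O c1 -> O c2 -> y1 <> 0 -> y2 <> 0 -> on_sides (ccont F) c1 c2 y1 y2).
  { intros c1 c2 y1 y2 Q1 Q2 N1 N2 x y _ _ S. apply Hc. destruct S as [->|[->|[->| ->]]]; [right|right|left|left]; auto. }
  assert (V : forall c1 c2 y1 y2, (0 < y1 * y2) -> rectint F c1 c2 y1 y2 = RtoC 0).
  { intros c1 c2 y1 y2 N. apply Goursat. intros x y _ Hy. apply HF. left. simpl.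
    revert Hy. unfold Rmin, Rmax. destruct (Rle_dec y1 y2); nra. }
  assert (Ht : forall c1 c2, O c1 -> O c2 -> rectint F c1 c2 (- h) h = rectint F c1 c2 (- h') h').
  { intros c1 c2 Q1 Q2.
    rewrite <- (rectint_Chasles_v F c1 c2 (- h') (- h) h') by (apply Sides; auto; lra).
    rewrite <- (rectint_Chasles_v F c1 c2 (- h) h h') by (apply Sides; auto; lra).
    rewrite (V c1 c2 (- h') (- h)), (V c1 c2 h h') by nra. ring. }
  assert (S : forall c1 c2 d, (forall x, Rmin c1 c2 <= x <= Rmax c1 c2 -> O x) -> rectint F c1 c2 (- d) d = RtoC 0).
  { intros c1 c2 d Q. apply Goursat. intros x y Hx _. apply HF. right. simpl. auto. }
  assert (Q1 : O b1) by (apply O1, Rmin_Rmax_l). assert (Q1' : O b1') by (apply O1, Rmin_Rmax_r).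
  assert (Q2 : O b2) by (apply O2, Rmin_Rmax_l). assert (Q2' : O b2') by (apply O2, Rmin_Rmax_r).
  rewrite Ht by auto.
  rewrite <- (rectint_Chasles_h F b1 b1' b2) by (apply Sides; auto; lra).
  rewrite <- (rectint_Chasles_h F b1' b2 b2') by (apply Sides; auto; lra).
  rewrite (S b1 b1'), (S b2 b2') by auto. ring.
Qed.

(** The value depends only on the primitives at the crossing points, which makes it comparable with
    an arbitrary loop. On each vertical line over [O] the two primitives differ by a constant, so
    the base height of the sides disappears. *)
Lemma rectint_half_primitives O F Pu Pd b1 b2 : O b1 -> O b2 ->
  (forall z, punctured O z -> ccont F z) ->
  (forall z, half O 1 z -> cder Pu z (F z)) -> (forall z, half O (-1) z -> cder Pd z (F z)) ->
  rectint F b1 b2 (-1) 1 = (Pu (RtoC b1) - Pu (RtoC b2) - (Pd (RtoC b1) - Pd (RtoC b2)))%C.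
Proof.
  intros O1 O2 Hc Hu Hd. unfold rectint.
  rewrite (CInt_h_primitive Pd F b1 b2 (-1)), (CInt_h_primitive Pu F b1 b2 1).
  2,4: intros t Ht; (apply Hd || apply Hu); left; simpl; lra.
  2,3: intros t Ht; apply Hc; left; simpl; lra.
  rewrite (CInt_v_primitive Pu F b1), (CInt_v_primitive Pu F b2).
  2,4: intros t Ht; apply Hu; right; auto.
  2,3: intros t Ht; apply Hc; right; auto.
  assert (K : forall b, O b -> (Pu (RtoC b) - Pu (b, -1) = Pd (RtoC b) - Pd (b, -1))%C).
  { intros b Ob. apply primitive_unique_segment with F. intros t _.
    assert (E : Re ((b, -1) + RtoC t * (RtoC b - (b, -1)))%C = b) by (unfold Re; simpl; ring).
    split; [apply Hu|apply Hd]; right; rewrite E; auto. }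
  pose proof (K b1 O1) as K1. pose proof (K b2 O2) as K2.
  replace (Pu (RtoC b1)) with (Pu (RtoC b1) - Pu (b1, -1) + Pu (b1, -1))%C by ring. rewrite K1.
  replace (Pu (RtoC b2)) with (Pu (RtoC b2) - Pu (b2, -1) + Pu (b2, -1))%C by ring. rewrite K2. ring.
Qed.

Lemma piecewise_C1_sub gam a b c d : a <= c -> d <= b -> piecewise_C1 gam a b -> piecewise_C1 gam c d.
Proof.
  intros Ha Hb [Hc [l [H1 [H2 H3]]]]. split.
  - intros t Ht. specialize (Hc t ltac:(lra)). eapply filterlim_filter_le_1; [|exact Hc].
    intros P HP. unfold within in *. eapply filter_imp; [|exact HP]. intros x Hx Hx2. apply Hx. lra.
  - exists l. split; [|split]; intros; [apply H1|apply H2|apply H3]; auto; lra.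
Qed.

Lemma rcont_sign (h : R -> R) a b : (forall t, continuous h t) -> (forall t, a < t < b -> h t <> 0) ->
  (forall t, a <= t <= b -> 0 <= h t) \/ (forall t, a <= t <= b -> h t <= 0).
Proof.
  intros Hc Hn. apply NNPP. intros N. apply not_or_and in N. destruct N as [N1 N2].
  apply not_all_ex_not in N1. destruct N1 as [u Hu]. apply imply_to_and in Hu. destruct Hu as [U1 U2].
  apply not_all_ex_not in N2. destruct N2 as [v Hv]. apply imply_to_and in Hv. destruct Hv as [V1 V2].
  assert (Huv : h u * h v <= 0) by nra.
  assert (Cc : forall x, continuity_pt h x) by (intros; apply continuity_pt_filterlim, Hc).
  destruct (Rtotal_order u v) as [L|[->|L]]; [|lra|].
  - destruct (IVT_cor h u v Cc ltac:(lra) Huv) as [z [Z1 Z2]].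
    assert (z <> u) by (intros ->; lra). assert (z <> v) by (intros ->; lra).
    apply (Hn z); [lra|auto].
  - destruct (IVT_cor h v u Cc ltac:(lra) ltac:(lra)) as [z [Z1 Z2]].
    assert (z <> u) by (intros ->; lra). assert (z <> v) by (intros ->; lra).
    apply (Hn z); [lra|auto].
Qed.

Definition arc_primitive (gam : R -> C) (f P : C -> C) (s : R) : Prop :=
  forall t, 0 <= t <= 1 -> 0 <= s * Im (gam t) -> cder P (gam t) (f (gam t)).

Lemma arc_integral gam f P s a b : piecewise_C1 gam 0 1 -> 0 <= a -> a <= b -> b <= 1 ->
  arc_primitive gam f P s -> (forall t, 0 <= t <= 1 -> ccont f (gam t)) ->
  (forall t, a <= t <= b -> 0 <= s * Im (gam t)) ->
  is_path_integral f gam a b (P (gam b) - P (gam a))%C.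
Proof.
  intros Hg Ha Hab Hb HP Hc Hs. apply path_integral_FTC; auto.
  - apply piecewise_C1_sub with 0 1; auto.
  - intros t Ht. apply HP; [lra|auto].
  - intros t Ht. apply Hc; lra.
Qed.

(** Between its two real points the loop stays on one side of the axis, by the intermediate value
    theorem. The sides [s] and [t] of the arcs are still unknown here, so both primitives are kept
    abstract. *)
Lemma loop_two_arcs gam u v : piecewise_C1 gam 0 1 -> gam 0 = gam 1 -> 0 <= u < v -> v < 1 ->
  (forall t, 0 <= t < 1 -> Im (gam t) = 0 -> t = u \/ t = v) -> Im (gam u) = 0 -> Im (gam v) = 0 ->
  exists s t, (s = 1 \/ s = -1) /\ (t = 1 \/ t = -1) /\ forall f P Q, arc_primitive gam f P s -> arc_primitive gam f Q t ->
    (forall t, 0 <= t <= 1 -> ccont f (gam t)) ->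
    is_path_integral f gam 0 1 ((P (gam v) - P (gam u)) + (Q (gam u) - Q (gam v)))%C.
Proof.
  intros Hg E01 Hu Hv Hz Zu Zv.
  destruct (piecewise_pieces gam 0 1 ltac:(lra) Hg) as [Gc _].
  set (h := fun t => Im (gam (clip 0 1 t))).
  assert (Hh : forall t, continuous h t) by (intros t; apply cont_Im, Gc).
  assert (Hhe : forall t, 0 <= t <= 1 -> h t = Im (gam t)) by (intros; unfold h; rewrite clip_id; auto).
  assert (Sgn : forall a b, 0 <= a -> b <= 1 -> (forall t, a < t < b -> h t <> 0) -> exists s, (s = 1 \/ s = -1) /\ forall t, a <= t <= b -> 0 <= s * Im (gam t)).
  { intros a b Ha Hb Hn. destruct (rcont_sign h a b Hh Hn) as [S|S].
    - exists 1. split; auto. intros t Ht. rewrite <- Hhe by lra. specialize (S t Ht). lra.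
    - exists (-1). split; auto. intros t Ht. rewrite <- Hhe by lra. specialize (S t Ht). lra. }
  assert (Nz : forall t, 0 <= t < 1 -> t <> u -> t <> v -> h t <> 0).
  { intros t Ht Nu Nv E. rewrite Hhe in E by lra. destruct (Hz t Ht E); auto. }
  destruct (Sgn u v) as [s [Hs S]]; try lra. { intros t Ht. apply Nz; lra. }
  destruct (Sgn v 1) as [t1 [Ht1 S1]]; try lra. { intros t Ht. apply Nz; lra. }
  destruct (Sgn 0 u) as [t2 [Ht2 S2]]; try lra. { intros t Ht. apply Nz; lra. }
  exists s, t1. split; auto. split; auto. intros f P Q HP HQ Hc.
  assert (I1 := arc_integral gam f P s u v Hg ltac:(lra) ltac:(lra) ltac:(lra) HP Hc S).
  assert (I2 := arc_integral gam f Q t1 v 1 Hg ltac:(lra) ltac:(lra) ltac:(lra) HQ Hc S1).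
  assert (I3 : is_path_integral f gam 0 u (Q (gam u) - Q (gam 0))%C).
  { apply arc_integral with t1; auto; try lra. intros t Ht. destruct (Req_dec u 0) as [E|N].
    - replace t with 0 by lra. rewrite E01. apply S1; lra.
    - assert (h 0 <> 0) by (apply Nz; lra). rewrite Hhe in H by lra.
      (* The second arc passes through the base point of the loop; [gam 0 = gam 1] is not real here,
         so the parts before and after it lie on the same side. *)
      assert (A1 := S1 1 ltac:(lra)). assert (A2 := S2 0 ltac:(lra)). rewrite <- E01 in A1.
      assert (t1 = t2) by (destruct Ht1, Ht2; subst; lra). subst t2. apply S2; auto. }
  replace (P (gam v) - P (gam u) + (Q (gam u) - Q (gam v)))%C with ((Q (gam u) - Q (gam 0)) + ((P (gam v) - P (gam u)) + (Q (gam 1) - Q (gam v))))%C by (rewrite E01; ring).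
  unfold is_path_integral. apply is_CInt_Chasles with u; [exact I3|]. apply is_CInt_Chasles with v; [exact I1|exact I2].
Qed.

Lemma two_pi_i_neq_0 : (2 * Ci * RtoC PI)%C <> RtoC 0.
Proof. intros E. injection E; intros E1 E2. pose proof PI_RGT_0. lra. Qed.

(** The winding number clause settles the sides of the arcs: both on the same side would give 0, and
    the wrong orientation [-2 i pi], instead of [2 i pi]. *)
Lemma direct_loop_integral I b1 b2 gam f Pu Pd : b1 < b2 -> simple_direct_loop I b1 b2 gam ->
  arc_primitive gam f Pu 1 -> arc_primitive gam f Pd (-1) -> (forall t, 0 <= t <= 1 -> ccont f (gam t)) ->
  is_path_integral f gam 0 1 (Pu (RtoC b1) - Pu (RtoC b2) - (Pd (RtoC b1) - Pd (RtoC b2)))%C.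
Proof.
  intros Hb [Hg [E01 [Inj [Hin [Hre Hw]]]]] HPu HPd Hc.
  assert (T : forall x, x = b1 \/ x = b2 -> exists t, 0 <= t < 1 /\ gam t = RtoC x).
  { intros x Hx. apply Hre in Hx. destruct Hx as [t [Ht Et]]. destruct (Req_dec t 1) as [->|N].
    - exists 0. split; [lra|]. rewrite E01; auto.
    - exists t. split; [lra|auto]. }
  destruct (T b1 ltac:(auto)) as [t1 [Ht1 G1]]. destruct (T b2 ltac:(auto)) as [t2 [Ht2 G2]].
  assert (Z : forall t, 0 <= t < 1 -> Im (gam t) = 0 -> t = t1 \/ t = t2).
  { intros t Ht E. assert (Er : gam t = RtoC (Re (gam t))) by (apply C_ext; auto).
    destruct (proj1 (Hre (Re (gam t)))) as [X|X].
    - exists t. split; [lra|auto].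
    - left. apply Inj; auto. rewrite Er, X, G1. reflexivity.
    - right. apply Inj; auto. rewrite Er, X, G2. reflexivity. }
  assert (Z1 : Im (gam t1) = 0) by (rewrite G1; reflexivity). assert (Z2 : Im (gam t2) = 0) by (rewrite G2; reflexivity).
  assert (Nt : t1 <> t2). { intros E. rewrite E, G2 in G1. injection G1; lra. }
  (* One test point between the crossings suffices; the two branches of [log (z - x)] serve as
     primitives on the arcs. *)
  set (x := (b1 + b2) / 2). assert (Hx : b1 < x < b2) by (unfold x; lra).
  destruct (log_branches (RtoC x)) as [Lu [Ld [HLu [HLd HL]]]].
  specialize (HL (RtoC b1) (RtoC b2) ltac:(simpl; lra)). specialize (Hw x Hx).
  assert (Rx : forall t, 0 <= t <= 1 -> Im (gam t) = 0 -> Re (gam t) <> x).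
  { intros t Ht E. destruct (proj1 (Hre (Re (gam t)))) as [X|X]; [|lra|lra].
    exists t. split; auto. apply C_ext; auto. }
  assert (ALu : arc_primitive gam (fun z => / (z - RtoC x))%C Lu 1).
  { intros t Ht Hs. apply HLu. simpl. destruct (Req_dec (Im (gam t)) 0) as [E|N]; [left; apply Rx; auto|right; lra]. }
  assert (ALd : arc_primitive gam (fun z => / (z - RtoC x))%C Ld (-1)).
  { intros t Ht Hs. apply HLd. simpl. destruct (Req_dec (Im (gam t)) 0) as [E|N]; [left; apply Rx; auto|right; lra]. }
  assert (CL : forall t, 0 <= t <= 1 -> ccont (fun z => / (z - RtoC x))%C (gam t)).
  { intros t Ht. eapply cder_cont, cder_inv_minus. intros E. apply (Rx t Ht); rewrite E; reflexivity. }
  set (U := (Lu (RtoC b1) - Lu (RtoC b2))%C) in *. set (D := (Ld (RtoC b1) - Ld (RtoC b2))%C) in *.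
  pose proof two_pi_i_neq_0 as N2.
  assert (Bad : forall X Y : C, X = Y -> (X - Y)%C = (2 * Ci * RtoC PI)%C -> False).
  { intros X Y E E2. apply N2. rewrite <- E2, E. ring. }
  assert (Bad2 : forall X : C, X = (2 * Ci * RtoC PI)%C -> (- X)%C = (2 * Ci * RtoC PI)%C -> False).
  { intros X E E2. rewrite E in E2. apply N2.
    replace (2 * Ci * RtoC PI)%C with (/ 2 * (2 * Ci * RtoC PI - - (2 * Ci * RtoC PI)))%C by field. rewrite E2. ring. }
  assert (Uq : forall l, is_path_integral (fun z => / (z - RtoC x))%C gam 0 1 l -> l = (2 * Ci * RtoC PI)%C).
  { intros l Hl. eapply is_CInt_inj; [exact Hl|exact Hw]. }
  destruct (Rtotal_order t1 t2) as [L|[E|L]]; [|contradiction|].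
  - destruct (loop_two_arcs gam t1 t2 Hg E01 ltac:(lra) ltac:(lra) Z Z1 Z2) as [s [t [Hs [Ht K]]]].
    rewrite G1, G2 in K.
    destruct Hs as [-> | ->], Ht as [-> | ->].
    + exfalso. pose proof (Uq _ (K _ _ _ ALu ALu CL)) as E. apply N2. rewrite <- E. ring.
    + exfalso. pose proof (Uq _ (K _ _ _ ALu ALd CL)) as E. apply (Bad2 _ HL). rewrite <- E. unfold U, D. ring.
    + pose proof (K _ _ _ HPd HPu Hc) as J. match type of J with is_path_integral _ _ _ _ ?j => match goal with |- is_path_integral _ _ _ _ ?j' => replace j' with j by ring end end. exact J.
    + exfalso. pose proof (Uq _ (K _ _ _ ALd ALd CL)) as E. apply N2. rewrite <- E. ring.
  - assert (Z' : forall t, 0 <= t < 1 -> Im (gam t) = 0 -> t = t2 \/ t = t1) by (intros t A B; destruct (Z t A B); auto).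
    destruct (loop_two_arcs gam t2 t1 Hg E01 ltac:(lra) ltac:(lra) Z' Z2 Z1) as [s [t [Hs [Ht K]]]].
    rewrite G1, G2 in K.
    destruct Hs as [-> | ->], Ht as [-> | ->].
    + exfalso. pose proof (Uq _ (K _ _ _ ALu ALu CL)) as E. apply N2. rewrite <- E. ring.
    + pose proof (K _ _ _ HPu HPd Hc) as J. match type of J with is_path_integral _ _ _ _ ?j => match goal with |- is_path_integral _ _ _ _ ?j' => replace j' with j by ring end end. exact J.
    + exfalso. pose proof (Uq _ (K _ _ _ ALd ALu CL)) as E. apply (Bad2 _ HL). rewrite <- E. unfold U, D. ring.
    + exfalso. pose proof (Uq _ (K _ _ _ ALd ALd CL)) as E. apply N2. rewrite <- E. ring.
Qed.

(** * The partial sums as rectangle integrals *)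

Lemma cos_eq_1 x : cos x = 1 -> - (2 * PI) < x < 2 * PI -> x = 0.
Proof.
  intros E Hx. replace x with (2 * (x / 2)) in E by field. rewrite cos_2a_sin in E.
  assert (S : sin (x / 2) = 0) by nra.
  destruct (Rtotal_order (x / 2) 0) as [L|[L|L]]; [|lra|].
  - pose proof (sin_gt_0 (- (x / 2)) ltac:(lra) ltac:(lra)) as P. rewrite sin_neg in P. lra.
  - pose proof (sin_gt_0 (x / 2) ltac:(lra) ltac:(lra)) as P. lra.
Qed.

Definition circle (m R0 t : R) : C := (m + R0 * cos (2 * PI * t), R0 * sin (2 * PI * t)).

Lemma rderive_circle m R0 t : rderive (circle m R0) t (- (R0 * (2 * PI) * sin (2 * PI * t)), R0 * (2 * PI) * cos (2 * PI * t)).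
Proof. apply rderive_pair; auto_derive; auto; ring. Qed.

Lemma cont_derivable (h : R -> R) t : ex_derive h t -> continuous h t.
Proof. apply (ex_derive_continuous (V := R_NormedModule)). Qed.

(** Needed for existence: [partial_sum] is defined by [iota], which is only characterized if some
    loop realizes the value. *)
Lemma circle_loop I b1 b2 : b1 < b2 -> I b1 -> I b2 -> exists gam, simple_direct_loop I b1 b2 gam.
Proof.
  intros Hb I1 I2. set (m := (b1 + b2) / 2). set (R0 := (b2 - b1) / 2). assert (HR : 0 < R0) by (unfold R0; lra).
  pose proof PI_RGT_0 as HPI.
  exists (circle m R0).
  assert (Rc : forall t, rcont (circle m R0) t).
  { intros t. apply (ex_derive_continuous (V := C_R_NormedModule)). eexists. apply rderive_circle. }
  assert (D : path_derive (circle m R0) = fun t => (- (R0 * (2 * PI) * sin (2 * PI * t)), R0 * (2 * PI) * cos (2 * PI * t))).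
  { apply functional_extensionality. intros t. unfold path_derive, circle. simpl.
    f_equal; apply is_derive_unique; auto_derive; auto; ring. }
  assert (Dc : forall t, continuous (U := C_UniformSpace) (path_derive (circle m R0)) t).
  { intros t. rewrite D. apply cont_mkC; apply cont_derivable; auto_derive; auto. }
  assert (Hg : piecewise_C1 (circle m R0) 0 1).
  { split.
    - intros t _. eapply filterlim_filter_le_1; [|apply (Rc t)]. intros P HP. unfold within. eapply filter_imp; [|exact HP]. auto.
    - exists nil. split; [|split].
      + intros t _ _. split; [eexists; apply rderive_circle|apply Dc].
      + intros t _. exists (path_derive (circle m R0) t). eapply filterlim_filter_le_1; [apply filter_le_within|apply Dc].
      + intros t _. exists (path_derive (circle m R0) t). eapply filterlim_filter_le_1; [apply filter_le_within|apply Dc]. }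
  assert (G0 : circle m R0 0 = RtoC b2).
  { unfold circle. rewrite Rmult_0_r, cos_0, sin_0. apply C_ext; unfold Re, Im; simpl; [unfold m, R0; field|ring]. }
  assert (G1 : circle m R0 1 = RtoC b2).
  { unfold circle. rewrite Rmult_1_r, cos_2PI, sin_2PI. apply C_ext; unfold Re, Im; simpl; [unfold m, R0; field|ring]. }
  assert (Gh : circle m R0 (1 / 2) = RtoC b1).
  { unfold circle. replace (2 * PI * (1 / 2)) with PI by field. rewrite cos_PI, sin_PI. apply C_ext; unfold Re, Im; simpl; [unfold m, R0; field|ring]. }
  assert (Up : forall t, 0 < t < 1 / 2 -> 0 < Im (circle m R0 t)).
  { intros t Ht. unfold circle, Im; simpl. apply Rmult_lt_0_compat; auto. apply sin_gt_0; nra. }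
  assert (Dn : forall t, 1 / 2 < t < 1 -> Im (circle m R0 t) < 0).
  { intros t Ht. unfold circle, Im; simpl. assert (sin (2 * PI * t) < 0) by (apply sin_lt_0; nra). nra. }
  assert (Re0 : forall t, 0 <= t <= 1 -> Im (circle m R0 t) = 0 -> circle m R0 t = RtoC b1 \/ circle m R0 t = RtoC b2).
  { intros t Ht E. destruct (Rtotal_order t (1 / 2)) as [L|[->|L]]; auto.
    - destruct (Req_dec t 0) as [->|N]; auto. specialize (Up t ltac:(lra)). lra.
    - destruct (Req_dec t 1) as [->|N]; auto. specialize (Dn t ltac:(lra)). lra. }
  split; [exact Hg|]. split; [rewrite G0, G1; auto|]. split; [|split; [|split]].
  - intros s t Hs Ht E. injection E; intros E2 E1.
    assert (Ec : cos (2 * PI * s) = cos (2 * PI * t)) by (apply Rmult_eq_reg_l with R0; lra).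
    assert (Es : sin (2 * PI * s) = sin (2 * PI * t)) by (apply Rmult_eq_reg_l with R0; lra).
    assert (C1 : cos (2 * PI * s - 2 * PI * t) = 1).
    { rewrite cos_minus, Ec, Es. pose proof (sin2_cos2 (2 * PI * t)) as Q. unfold Rsqr in Q. lra. }
    apply cos_eq_1 in C1; nra.
  - intros t Ht. destruct (Req_dec (Im (circle m R0 t)) 0) as [E|N]; [right|left; apply nonreal_slit; auto].
    destruct (Re0 t Ht E) as [E1|E1]; rewrite E1; eauto.
  - intros x. split.
    + intros [t [Ht E]]. destruct (Re0 t Ht) as [E1|E1]; [rewrite E; reflexivity| |]; rewrite E in E1; injection E1; auto.
    + intros [->| ->]; [exists (1 / 2)|exists 0]; split; auto; lra.
  - intros x Hx. destruct (log_branches (RtoC x)) as [Lu [Ld [HLu [HLd HL]]]].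
    specialize (HL (RtoC b1) (RtoC b2) ltac:(simpl; lra)).
    assert (Nx : forall t, 0 <= t <= 1 -> Im (circle m R0 t) = 0 -> Re (circle m R0 t) <> x).
    { intros t Ht E. destruct (Re0 t Ht E) as [E1|E1]; rewrite E1; simpl; lra. }
    assert (Ct : forall t, 0 <= t <= 1 -> ccont (fun z => / (z - RtoC x))%C (circle m R0 t)).
    { intros t Ht. eapply cder_cont, cder_inv_minus. intros E. apply (Nx t Ht); rewrite E; reflexivity. }
    rewrite <- HL.
    replace (Lu (RtoC b1) - Lu (RtoC b2) - (Ld (RtoC b1) - Ld (RtoC b2)))%C with
      ((Lu (circle m R0 (1 / 2)) - Lu (circle m R0 0)) + (Ld (circle m R0 1) - Ld (circle m R0 (1 / 2))))%C by (rewrite G0, G1, Gh; ring).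
    unfold is_path_integral. apply is_CInt_Chasles with (1 / 2).
    + apply (path_integral_FTC Lu (fun z => / (z - RtoC x))%C); [lra|apply piecewise_C1_sub with 0 1; auto; lra| |intros; apply Ct; lra].
      intros t Ht. apply HLu. simpl. destruct (Req_dec (Im (circle m R0 t)) 0) as [E|N]; [left; apply Nx; auto; lra|].
      right. apply Up. destruct (Req_dec t 0) as [->|]; [rewrite G0 in N; simpl in N; lra|].
      destruct (Req_dec t (1 / 2)) as [->|]; [rewrite Gh in N; simpl in N; lra|]. lra.
    + apply (path_integral_FTC Ld (fun z => / (z - RtoC x))%C); [lra|apply piecewise_C1_sub with 0 1; auto; lra| |intros; apply Ct; lra].
      intros t Ht. apply HLd. simpl. destruct (Req_dec (Im (circle m R0 t)) 0) as [E|N]; [left; apply Nx; auto; lra|].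
      right. apply Dn. destruct (Req_dec t 1) as [->|]; [rewrite G1 in N; simpl in N; lra|].
      destruct (Req_dec t (1 / 2)) as [->|]; [rewrite Gh in N; simpl in N; lra|]. lra.
Qed.

Definition rect_sum (f : C -> C) (b1 b2 : R) (w : C) : C :=
  (rectint (fun p => f p * Cexp (p * w))%C b1 b2 (-1) 1 / (2 * Ci * RtoC PI))%C.

(** The transform is holomorphic across the negative axis anyway, so rectangles may also cross
    there; in the half-line case the left side passes through [-1]. *)
Definition with_negative (I : R -> Prop) (x : R) : Prop := I x \/ x < 0.

Lemma with_negative_open I : open_R I -> open_R (with_negative I).
Proof.
  intros HI x [Hx|Hx].
  - destruct (HI x Hx) as [d [Hd Id]]. exists d. split; auto. intros y Hy. left; auto.
  - exists (- x). split; [lra|]. intros y Hy. right. apply Rabs_def2 in Hy. lra.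
Qed.

Lemma punctured_slit_with I p : punctured (with_negative I) p -> slit_with I p.
Proof.
  intros [N|[N|N]].
  - left. apply nonreal_slit; auto.
  - destruct (Req_dec (Im p) 0) as [E|E]; [|left; apply nonreal_slit; auto].
    right. exists (Re p). split; auto. apply C_ext; auto.
  - left. intros [_ Q]. lra.
Qed.

Lemma across_differentiable H I g w0 f : is_Laplace_across H I g w0 f ->
  forall p, punctured (with_negative I) p -> differentiable f p.
Proof.
  intros [Hf _] p Hp. destruct (proj1 (holomorphic_at_cder f p) (Hf p (punctured_slit_with I p Hp))) as [l Hl]. exists l; auto.
Qed.

Lemma differentiable_mult f g z : differentiable f z -> differentiable g z -> differentiable (fun z => f z * g z)%C z.
Proof. intros [l Hl] [m Hm]. eexists. apply cder_mult; eauto. Qed.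
Lemma differentiable_minus f g z : differentiable f z -> differentiable g z -> differentiable (fun z => f z - g z)%C z.
Proof. intros [l Hl] [m Hm]. eexists. apply cder_minus; eauto. Qed.
Lemma differentiable_plus f g z : differentiable f z -> differentiable g z -> differentiable (fun z => f z + g z)%C z.
Proof. intros [l Hl] [m Hm]. eexists. apply cder_plus; eauto. Qed.
Lemma differentiable_Cexp_mult w z : differentiable (fun p => Cexp (p * w))%C z.
Proof.
  eexists. apply (cder_comp (fun p => p * w)%C Cexp); [|apply cder_Cexp].
  apply cder_mult; [apply cder_id|apply cder_const].
Qed.

Lemma differentiable_ext f g z : (forall w, f w = g w) -> differentiable f z -> differentiable g z.
Proof. intros E [l Hl]. exists l. eapply cder_ext; eauto. Qed.

(* Two representatives of [Lg] differ by an entire function, which does not contribute. *)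
Lemma rectint_entire_difference O (f f' E : C -> C) b1 b2 w : O b1 -> O b2 ->
  (forall p, punctured O p -> ccont f p) -> (forall p, punctured O p -> ccont f' p) ->
  (forall p, differentiable E p) -> (forall p, Im p <> 0 -> f p = f' p + E p)%C ->
  rectint (fun p => f p * Cexp (p * w))%C b1 b2 (-1) 1 = rectint (fun p => f' p * Cexp (p * w))%C b1 b2 (-1) 1.
Proof.
  intros O1 O2 Cf Cf' DE HE.
  assert (CE : forall p, ccont E p) by (intros; apply differentiable_cont; auto).
  assert (Sides : forall Q : C -> Prop, (forall z, punctured O z -> Q z) -> on_sides Q b1 b2 (-1) 1).
  { intros Q HQ x y _ _ S. apply HQ. destruct S as [->|[->|[->| ->]]]; [right; auto|right; auto|left; simpl; lra|left; simpl; lra]. }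
  assert (HE' : forall p, punctured O p -> f p = (f' p + E p)%C).
  { intros p Hp. destruct (Req_dec (Im p) 0) as [E0|N]; auto.
    apply (eq_by_slit_limit f (fun p => f' p + E p)%C p 1); [lra|auto|apply cont_Cplus; auto|].
    intros q _ Nq. apply HE. rewrite E0 in Nq. auto. }
  rewrite (rectint_ext _ (fun p => f' p * Cexp (p * w) + E p * Cexp (p * w))%C).
  - rewrite rectint_plus.
    + rewrite (Goursat (fun p => E p * Cexp (p * w))%C); [ring|].
      intros x y _ _. apply differentiable_mult; auto. apply differentiable_Cexp_mult.
    + apply Sides. intros z Hz. csolve. auto.
    + apply Sides. intros z Hz. csolve. apply CE.
  - apply Sides. intros z Hz. rewrite HE' by auto. ring.
Qed.

Section Value.
Variables (H : C -> Prop) (r : R -> R) (c k A : R).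
Hypothesis HD : log_domain H r c k A.
Variables (I : R -> Prop).
Hypothesis HI : open_R I.
Variables (g : C -> C) (M : R).
Hypothesis Hg : regular H g M.

Lemma across_rect_sum_unique w0 w0' f f' b1 b2 w : H w0 -> H w0' ->
  with_negative I b1 -> with_negative I b2 ->
  is_Laplace_across H I g w0 f -> is_Laplace_across H I g w0' f' ->
  rect_sum f b1 b2 w = rect_sum f' b1 b2 w.
Proof.
  intros Hw Hw' I1 I2 Hf Hf'. unfold rect_sum. f_equal.
  destruct Hg as [G1 [G2 G3]].
  apply rectint_entire_difference with (O := with_negative I) (E := fun p => (LP r g p w0' - LP r g p w0)%C); auto.
  - intros p Hp. eapply differentiable_cont, across_differentiable; eauto.
  - intros p Hp. eapply differentiable_cont, across_differentiable; eauto.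
  - intros p. apply differentiable_minus; eapply LP_entire; eauto.
  - intros p Np. rewrite (proj2 Hf), (proj2 Hf') by (apply nonreal_slit; auto).
    rewrite <- (Laplace_change_base H r c k A HD g M G1 G2 G3 w0 w0' p); [ring| | |apply nonreal_slit; auto];
    apply (H_closure _ _ _ _ _ HD); auto.
Qed.

(** All loops, base points and extensions give the same value: loops are compared with the rectangle
    through primitives on the two halves, and base points through the entire difference of the
    transforms. *)
Lemma partial_sum_rect w0 f b1 b2 w : H w0 -> b1 < b2 -> I b1 -> I b2 -> is_Laplace_across H I g w0 f ->
  partial_sum H I b1 b2 g w = rect_sum f b1 b2 w.
Proof.
  intros Hw Hb I1 I2 Hf.
  assert (Key : forall w0' f' gam, is_Laplace_across H I g w0' f' -> simple_direct_loop I b1 b2 gam ->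
    is_path_integral (fun p => f' p * Cexp (p * w))%C gam 0 1 (rectint (fun p => f' p * Cexp (p * w))%C b1 b2 (-1) 1)).
  { intros w0' f' gam Hf' Hl.
    assert (DF : forall p, punctured I p -> differentiable (fun p => f' p * Cexp (p * w))%C p).
    { intros p Hp. apply differentiable_mult; [|apply differentiable_Cexp_mult]. eapply across_differentiable; eauto.
      destruct Hp; [left|right; left]; auto. }
    destruct (half_primitive I _ 1 HI ltac:(auto) DF) as [Pu HPu]. destruct (half_primitive I _ (-1) HI ltac:(auto) DF) as [Pd HPd].
    rewrite (rectint_half_primitives I _ Pu Pd); auto; [|intros; apply differentiable_cont; auto].
    assert (Rl : forall t, 0 <= t <= 1 -> Im (gam t) = 0 -> I (Re (gam t))).
    { intros t Ht E. destruct Hl as [_ [_ [_ [_ [Hre _]]]]]. destruct (proj1 (Hre (Re (gam t)))) as [X|X].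
      - exists t. split; auto. apply C_ext; auto.
      - rewrite X; auto.
      - rewrite X; auto. }
    apply (direct_loop_integral I); auto.
    - intros t Ht Hs. apply HPu. destruct (Req_dec (Im (gam t)) 0); [right; auto|left; lra].
    - intros t Ht Hs. apply HPd. destruct (Req_dec (Im (gam t)) 0); [right; auto|left; lra].
    - intros t Ht. apply differentiable_cont, DF. destruct (Req_dec (Im (gam t)) 0); [right; auto|left; auto]. }
  apply (iota_unique (V := C_R_CompleteNormedModule)).
  - intros s [w0' [f' [gam [J [Hw' [Hf' [Hl [HJ ->]]]]]]]].
    rewrite (across_rect_sum_unique w0 w0' f f'); auto; try (left; auto).
    unfold rect_sum. f_equal. eapply is_CInt_inj; [exact HJ|]. apply (Key w0' f' gam); auto.
  - destruct (circle_loop I b1 b2 Hb I1 I2) as [gam Hl].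
    exists w0, f, gam, (rectint (fun p => f p * Cexp (p * w))%C b1 b2 (-1) 1). split; auto. split; auto. split; auto. split; auto.
    apply (Key w0 f gam); auto.
Qed.
End Value.

(** The exponent [z q] is left general to cover both [q] itself, for derivatives of the partial sum,
    and [q - p], for its Laplace integrand. *)
Lemma rectint_exp_cder (f z : C -> C) x1 x2 y1 y2 w : on_sides (ccont f) x1 x2 y1 y2 -> on_sides (ccont z) x1 x2 y1 y2 ->
  cder (fun w => rectint (fun q => f q * Cexp (z q * w))%C x1 x2 y1 y2) w
    (rectint (fun q => f q * z q * Cexp (z q * w))%C x1 x2 y1 y2).
Proof.
  intros Cf Cz. unfold on_sides in *.
  assert (Hside : forall x, x = x1 \/ x = x2 -> forall y1 y2 t : R, x = x1 \/ x = x2 \/ t = y1 \/ t = y2).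
  { intros x [E|E]; auto. }
  assert (Hh : forall y, y = y1 \/ y = y2 -> cder (fun w => CInt (fun t => f (t, y) * Cexp (z (t, y) * w))%C x1 x2) w
    (CInt (fun t => f (t, y) * z (t, y) * Cexp (z (t, y) * w))%C x1 x2)).
  { intros y Hy. assert (By : Rmin y1 y2 <= y <= Rmax y1 y2) by (destruct Hy; subst; [apply Rmin_Rmax_l|apply Rmin_Rmax_r]).
    rewrite (CInt_ext _ (fun t => f (t, y) * z (t, y) * Cexp (w * z (t, y)))%C) by (intros; f_equal; f_equal; apply Cmult_comm).
    eapply cder_ext; [|apply (cder_exp_integral (fun t => f (t, y)) (fun t => z (t, y)) x1 x2 w)].
    - intros q. apply CInt_ext. intros t _. rewrite (Cmult_comm q). reflexivity.
    - intros t Ht. exact (rcont_h f t y (Cf t y Ht By (or_intror (or_intror Hy)))).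
    - intros t Ht. exact (rcont_h z t y (Cz t y Ht By (or_intror (or_intror Hy)))). }
  assert (Hv : forall x, x = x1 \/ x = x2 -> cder (fun w => CInt (fun t => f (x, t) * Cexp (z (x, t) * w))%C y1 y2) w
    (CInt (fun t => f (x, t) * z (x, t) * Cexp (z (x, t) * w))%C y1 y2)).
  { intros x Hx. assert (Bx : Rmin x1 x2 <= x <= Rmax x1 x2) by (destruct Hx; subst; [apply Rmin_Rmax_l|apply Rmin_Rmax_r]).
    rewrite (CInt_ext _ (fun t => f (x, t) * z (x, t) * Cexp (w * z (x, t)))%C) by (intros; f_equal; f_equal; apply Cmult_comm).
    eapply cder_ext; [|apply (cder_exp_integral (fun t => f (x, t)) (fun t => z (x, t)) y1 y2 w)].
    - intros q. apply CInt_ext. intros t _. rewrite (Cmult_comm q). reflexivity.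
    - intros t Ht. exact (rcont_v f x t (Cf x t Bx Ht (Hside x Hx y1 y2 t))).
    - intros t Ht. exact (rcont_v z x t (Cz x t Bx Ht (Hside x Hx y1 y2 t))). }
  unfold rectint. repeat first [apply cder_minus|apply cder_plus|apply cder_scal]; [apply (Hh y1)|apply (Hv x2)|apply (Hh y2)|apply (Hv x1)]; auto.
Qed.

Lemma rect_sum_cder O (f : C -> C) b1 b2 w : O b1 -> O b2 -> (forall p, punctured O p -> ccont f p) ->
  cder (rect_sum f b1 b2) w (rect_sum (fun p => f p * p)%C b1 b2 w).
Proof.
  intros O1 O2 Cf.
  assert (E : forall u : C, (u / (2 * Ci * RtoC PI))%C = (/ (2 * Ci * RtoC PI) * u)%C) by (intros; apply Cmult_comm).
  unfold rect_sum. rewrite E. eapply cder_ext; [intros v; symmetry; apply E|].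
  apply cder_scal. apply (rectint_exp_cder f (fun p => p)).
  - intros x y _ _ S. apply Cf. destruct S as [->|[->|[->| ->]]]; [right|right|left|left]; simpl; auto; lra.
  - intros x y _ _ _. apply cont_Cid.
Qed.

(** * Fubini's theorem on rectangles *)

Lemma inner_integral_cont_v (G : C -> C) (y1 y2 x : R) : (forall z, ccont G z) -> rcont (fun x => CInt (fun t => G (x, t)) y1 y2) x.
Proof.
  intros HG. apply rcont_eps. intros eps He. pose proof (Rabs_pos (y2 - y1)) as Hy.
  destruct (uniform_continuity_rect G x x y1 y2 ltac:(intros ? ? _ _; auto) (eps / (2 * (Rabs (y2 - y1) + 1))) ltac:(pos)) as [d [Hd Bd]].
  exists d. split; auto. intros s Hs.
  eapply Rle_lt_trans; [apply is_CInt_norm_const with (h := fun t => (G (s, t) - G (x, t))%C) (a := y1) (b := y2) (M := eps / (2 * (Rabs (y2 - y1) + 1)))|].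
  - intros t Ht. left. apply (Bd x t); auto; [rewrite Rmin_left, Rmax_left by lra; lra|].
    replace ((s, t) - (x, t))%C with (RtoC (s - x)) by cring. rewrite Cmod_R. auto.
  - apply is_CInt_minus; apply v_correct; auto.
  - apply Rmult_lt_reg_r with (2 * (Rabs (y2 - y1) + 1)); [lra|].
    replace (Rabs (y2 - y1) * (eps / (2 * (Rabs (y2 - y1) + 1))) * (2 * (Rabs (y2 - y1) + 1))) with (Rabs (y2 - y1) * eps) by (field; lra). nra.
Qed.

Definition iterated (G : C -> C) x1 x2 y1 y2 : C := CInt (fun x => CInt (fun y => G (x, y)) y1 y2) x1 x2.

Definition transpose (z : C) : C := (Im z, Re z).

Lemma transpose_cont (G : C -> C) : (forall z, ccont G z) -> forall z, ccont (fun z => G (transpose z)) z.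
Proof. intros HG z. apply (cont_comp_C (fun z : C_UniformSpace => transpose z)); [apply cont_mkC; csolve|apply HG]. Qed.

Lemma iterated_correct (G : C -> C) x1 x2 y1 y2 : (forall z, ccont G z) ->
  is_CInt (fun x => CInt (fun y => G (x, y)) y1 y2) x1 x2 (iterated G x1 x2 y1 y2).
Proof. intros HG. apply CInt_correct_all. intros t. apply inner_integral_cont_v; auto. Qed.

Lemma iterated_split_x (G : C -> C) x1 x2 x3 y1 y2 : (forall z, ccont G z) ->
  iterated G x1 x3 y1 y2 = (iterated G x1 x2 y1 y2 + iterated G x2 x3 y1 y2)%C.
Proof. intros HG. symmetry. apply CInt_Chasles; intros; apply inner_integral_cont_v; auto. Qed.

Lemma iterated_split_y (G : C -> C) x1 x2 y1 y2 y3 : (forall z, ccont G z) ->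
  iterated G x1 x2 y1 y3 = (iterated G x1 x2 y1 y2 + iterated G x1 x2 y2 y3)%C.
Proof.
  intros HG. apply is_CInt_unique.
  eapply is_CInt_ext; [|apply (is_CInt_plus _ _ _ _ _ _ (iterated_correct G x1 x2 y1 y2 HG) (iterated_correct G x1 x2 y2 y3 HG))].
  intros x _. simpl. apply CInt_Chasles; intros; apply rcont_v; auto.
Qed.

Lemma iterated_const_dist (G : C -> C) x a y b (w : C) e : 0 <= a -> 0 <= b -> (forall z, ccont G z) ->
  (forall s t, x <= s <= x + a -> y <= t <= y + b -> Cmod (G (s, t) - w) <= e) ->
  Cmod (iterated G x (x + a) y (y + b) - RtoC (a * b) * w) <= e * (a * b).
Proof.
  intros Ha Hb HG HB.
  assert (Inner : forall s, x <= s <= x + a -> Cmod (CInt (fun t => G (s, t)) y (y + b) - RtoC b * w) <= b * e).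
  { intros s Hs. pose proof (is_CInt_minus _ _ _ _ _ _ (v_correct G s y (y + b) ltac:(auto)) (is_CInt_const y (y + b) w)) as I.
    replace (y + b - y) with b in I by ring.
    eapply Rle_trans; [apply is_CInt_norm_const with (2 := I) (M := e)|].
    - ordered. intros t Ht. auto.
    - replace (y + b - y) with b by ring. rewrite Rabs_right; lra. }
  pose proof (is_CInt_minus _ _ _ _ _ _ (iterated_correct G x (x + a) y (y + b) HG) (is_CInt_const x (x + a) (RtoC b * w)%C)) as I.
  replace (x + a - x) with a in I by ring.
  replace (RtoC (a * b) * w)%C with (RtoC a * (RtoC b * w))%C by (rewrite RtoC_mult; ring).
  eapply Rle_trans; [apply is_CInt_norm_const with (2 := I) (M := b * e)|].
  - ordered. intros s Hs. auto.
  - replace (x + a - x) with a by ring. rewrite Rabs_right; lra.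
Qed.

(** By bisection: on a small rectangle both iterated integrals are within [e] times the area of a
    constant times the area, and these errors add up under subdivision. *)
Lemma Fubini (G : C -> C) x1 x2 y1 y2 : x1 <= x2 -> y1 <= y2 -> (forall z, ccont G z) ->
  CInt (fun x => CInt (fun y => G (x, y)) y1 y2) x1 x2 = CInt (fun y => CInt (fun x => G (x, y)) x1 x2) y1 y2.
Proof.
  intros Hx Hy HG. set (G' := fun z => G (transpose z)).
  assert (HG' : forall z, ccont G' z) by (apply transpose_cont; auto).
  change (iterated G x1 x2 y1 y2 = iterated G' y1 y2 x1 x2).
  cut (@eq C (iterated G x1 x2 y1 y2 - iterated G' y1 y2 x1 x2)%C (RtoC 0)).
  { intros E. transitivity ((iterated G x1 x2 y1 y2 - iterated G' y1 y2 x1 x2) + iterated G' y1 y2 x1 x2)%C; [ring|]. rewrite E. ring. }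
  apply Cmod_small_0. intros eps He.
  set (w := x2 - x1). set (h := y2 - y1). assert (Hwh : 0 <= w * h) by (apply Rmult_le_pos; unfold w, h; lra).
  set (e := eps / (2 * (w * h + 1))). assert (He' : 0 < e) by (pos).
  pose proof (rect_induction (fun x y a b => Cmod (iterated G x (x + a) y (y + b) - iterated G' y (y + b) x (x + a)) <= 2 * e * (a * b)) x1 y1 w h) as K.
  cbv beta in K. replace (x1 + w) with x2 in K by (unfold w; ring). replace (y1 + h) with y2 in K by (unfold h; ring).
  eapply Rle_trans; [apply K; clear K|].
  - unfold w; lra.
  - unfold h; lra.
  - intros x y a b Ha Hb _ K1 K2 K3 K4.
    rewrite (iterated_split_x G x (x + a) (x + 2 * a)), !(iterated_split_y G _ _ y (y + b) (y + 2 * b)) by auto.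
    rewrite (iterated_split_x G' y (y + b) (y + 2 * b)), !(iterated_split_y G' _ _ x (x + a) (x + 2 * a)) by auto.
    replace (x + 2 * a) with (x + a + a) by ring. replace (y + 2 * b) with (y + b + b) by ring.
    match goal with |- Cmod ((?p1 + ?p2 + (?p3 + ?p4)) - (?q1 + ?q2 + (?q3 + ?q4)))%C <= _ =>
      replace ((p1 + p2 + (p3 + p4)) - (q1 + q2 + (q3 + q4)))%C with (((p1 - q1) + (p3 - q2)) + ((p2 - q3) + (p4 - q4)))%C by ring end.
    tri. eapply Rle_trans; [apply Rplus_le_compat; apply Cmod_triangle|]. lra.
  - intros x y Ix Iy.
    destruct (proj1 (ccont_eps G (x, y)) (HG _) e He') as [d [Hd W]].
    exists (d / 2). split; [lra|]. intros x' y' a b _ Ha Hb Hx' Hy'.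
    assert (B : forall s t, x' <= s <= x' + a -> y' <= t <= y' + b -> Cmod (G (s, t) - G (x, y)) <= e).
    { intros s t Hs Ht. left. apply W. eapply Rle_lt_trans; [apply Cmod_le_sum|]. unfold Re, Im; simpl.
      apply Rle_lt_trans with (a + b); [|lra]. apply Rplus_le_compat; apply Rabs_le; lra. }
    pose proof (iterated_const_dist G x' a y' b (G (x, y)) e ltac:(lra) ltac:(lra) HG B) as D1.
    pose proof (iterated_const_dist G' y' b x' a (G (x, y)) e ltac:(lra) ltac:(lra) HG' ltac:(intros s t Hs Ht; apply B; auto)) as D2.
    replace (iterated G x' (x' + a) y' (y' + b) - iterated G' y' (y' + b) x' (x' + a))%C with
      ((iterated G x' (x' + a) y' (y' + b) - RtoC (a * b) * G (x, y)) - (iterated G' y' (y' + b) x' (x' + a) - RtoC (b * a) * G (x, y)))%C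
      by (rewrite (Rmult_comm b a); ring).
    eapply Rle_trans; [apply Cmod_triangle_minus|]. lra.
  - unfold e. apply Rmult_le_reg_r with (w * h + 1); [lra|].
    replace (2 * (eps / (2 * (w * h + 1))) * (w * h) * (w * h + 1)) with (eps * (w * h)) by (field; lra). nra.
Qed.

(** * Decay of the transform of a smooth bump *)

Inductive polynomial : (R -> R) -> Prop :=
| poly_const c : polynomial (fun _ => c)
| poly_id : polynomial (fun t => t)
| poly_plus p q : polynomial p -> polynomial q -> polynomial (fun t => p t + q t)
| poly_mult p q : polynomial p -> polynomial q -> polynomial (fun t => p t * q t).

Lemma polynomial_derive p : polynomial p -> exists q, polynomial q /\ forall t, is_derive p t (q t).
Proof.
  induction 1 as [c| |p q _ [p' [P1 P2]] _ [q' [Q1 Q2]]|p q Hp [p' [P1 P2]] Hq [q' [Q1 Q2]]].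
  - exists (fun _ => 0). split; [constructor|]. intros t. apply (is_derive_const (V := R_NormedModule)).
  - exists (fun _ => 1). split; [constructor|]. intros t. apply (is_derive_id (K := R_AbsRing)).
  - exists (fun t => p' t + q' t). split; [constructor; auto|]. intros t. apply (is_derive_plus (V := R_NormedModule)); auto.
  - exists (fun t => p' t * q t + p t * q' t). split; [repeat constructor; auto|]. intros t.
    apply (is_derive_mult (K := R_AbsRing)); auto. intros; apply Rmult_comm.
Qed.

Lemma polynomial_cont p : polynomial p -> forall t, continuous p t.
Proof. intros Hp t. destruct (polynomial_derive p Hp) as [q [_ Q]]. apply cont_derivable. eexists; apply Q. Qed.

Definition bump (d : R) (m : nat) (t : R) : R := (d ^ 2 - t ^ 2) ^ m.

Lemma bump_cont d m t : continuous (bump d m) t.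
Proof. apply cont_derivable. unfold bump. auto_derive. auto. Qed.

Definition transform (d : R) (u : R -> R) (z : C) : C := CInt (fun t => RtoC (u t) * Cexp (RtoC t * z))%C (- d) d.

Lemma transform_correct d u z : (forall t, continuous u t) ->
  is_CInt (fun t => RtoC (u t) * Cexp (RtoC t * z))%C (- d) d (transform d u z).
Proof. intros Hu. apply CInt_correct_all. intros t. csolve. apply Hu. Qed.

Lemma transform_bounded d u : 0 < d -> (forall t, continuous u t) -> exists K, 0 <= K /\
  forall z, Cmod (transform d u z) <= K * exp (d * Rabs (Re z)).
Proof.
  intros Hd Hu. destruct (bounded_on_segment (fun t => RtoC (u t)) (- d) d ltac:(intros; csolve; apply Hu)) as [M [HM BM]].
  exists (2 * d * M). split; [nra|]. intros z.
  eapply Rle_trans; [apply is_CInt_norm_const with (2 := transform_correct d u z Hu) (M := M * exp (d * Rabs (Re z)))|].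
  - intros t Ht. rewrite Cmod_mult, Cmod_Cexp. rmul; [pos|].
    apply exp_le_le. replace (Re (RtoC t * z)) with (t * Re z) by (unfold Re; simpl; ring).
    ordered in Ht. eapply Rle_trans; [apply Rle_abs|]. rewrite Rabs_mult.
    apply Rmult_le_compat_r; [apply Rabs_pos|]. apply Rabs_le; lra.
  - rewrite Rabs_right by lra. right; ring.
Qed.

(** Integration by parts; the boundary terms vanish with [u] at both ends. Each use gains one power
    of [1 / z]. *)
Lemma transform_derive d u u' z : 0 < d -> (forall t, is_derive u t (u' t)) -> (forall t, continuous u' t) ->
  u (- d) = 0 -> u d = 0 -> (z * transform d u z = - transform d u' z)%C.
Proof.
  intros Hd Hu Hu' U1 U2.
  assert (Cu : forall t, continuous u t) by (intros; apply cont_derivable; eexists; apply Hu).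
  assert (D : forall t, rderive (fun t => RtoC (u t) * Cexp (RtoC t * z))%C t (RtoC (u' t) * Cexp (RtoC t * z) + z * (RtoC (u t) * Cexp (RtoC t * z)))%C).
  { intros t. pose proof (rderive_Cexp z t) as D2.
    assert (D1 : rderive (fun t => RtoC (u t)) t (RtoC (u' t))).
    { apply rderive_pair; [apply Hu|apply (is_derive_const (V := R_NormedModule))]. }
    apply rderive_eps. intros eps He.
    set (K := Cmod (Cexp (RtoC t * z)) + Cmod (RtoC (u' t)) + 2). set (U := Cmod (RtoC (u t)) + 1).
    pose proof (Cmod_ge_0 (Cexp (RtoC t * z))). pose proof (Cmod_ge_0 (RtoC (u' t))). pose proof (Cmod_ge_0 (RtoC (u t))).
    assert (HK : 2 <= K) by (unfold K; lra). assert (HU : 1 <= U) by (unfold U; lra).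
    destruct (proj1 (rderive_eps _ _ _) D1 (Rmin 1 (eps / (4 * K))) ltac:(apply Rmin_pos; [lra|pos])) as [d1 [P1 W1]].
    destruct (proj1 (rderive_eps _ _ _) D2 (eps / (4 * U)) ltac:(pos)) as [d2 [P2 W2]].
    assert (C2 : rcont (fun t => Cexp (RtoC t * z))%C t) by csolve.
    destruct (proj1 (rcont_eps _ _) C2 (Rmin 1 (eps / (4 * K))) ltac:(apply Rmin_pos; [lra|pos])) as [d3 [P3 W3]].
    exists (Rmin d1 (Rmin d2 d3)). split; [repeat apply Rmin_pos; auto|]. intros s Hs.
    specialize (W1 s (Rlt_le_trans _ _ _ Hs (Rmin_l _ _))). assert (Hs' := Rlt_le_trans _ _ _ Hs (Rmin_r _ _)).
    specialize (W2 s (Rlt_le_trans _ _ _ Hs' (Rmin_l _ _))). specialize (W3 s (Rlt_le_trans _ _ _ Hs' (Rmin_r _ _))).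
    set (a := RtoC (u t)) in *. set (a' := RtoC (u' t)) in *. set (e := Cexp (RtoC t * z)) in *.
    set (b := RtoC (u s)) in *. set (e2 := Cexp (RtoC s * z)) in *. set (x := RtoC (s - t)) in *.
    replace (b * e2 - a * e - x * (a' * e + z * (a * e)))%C with
      ((b - a - x * a') * e2 + x * a' * (e2 - e) + a * (e2 - e - x * (z * e)))%C by ring.
    tri. eapply Rle_trans; [apply Rplus_le_compat_r, Cmod_triangle|]. rewrite !Cmod_mult.
    assert (Hx : Cmod x = Rabs (s - t)) by apply Cmod_R. rewrite Hx. pose proof (Rabs_pos (s - t)) as Hst. set (X := Rabs (s - t)) in *.
    assert (R1 : Rmin 1 (eps / (4 * K)) <= 1) by apply Rmin_l. assert (R2 : Rmin 1 (eps / (4 * K)) <= eps / (4 * K)) by apply Rmin_r.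
    assert (E2 : Cmod e2 <= K).
    { replace e2 with ((e2 - e) + e)%C by ring. tri. unfold K. lra. }
    assert (T1 : Cmod (b - a - x * a') * Cmod e2 <= eps / 4 * X).
    { apply Rle_trans with (eps / (4 * K) * X * K); [|right; field; lra].
      rmul. eapply Rle_trans; [exact W1|]. apply Rmult_le_compat_r; auto. }
    assert (T2 : X * Cmod a' * Cmod (e2 - e) <= eps / 4 * X).
    { apply Rle_trans with (X * K * (eps / (4 * K))); [|right; field; lra].
      rmul; [pos| |lra].
      apply Rmult_le_compat_l; auto. unfold K. lra. }
    assert (T3 : Cmod a * Cmod (e2 - e - x * (z * e)) <= eps / 4 * X).
    { apply Rle_trans with (U * (eps / (4 * U) * X)); [|right; field; lra].
      rmul. unfold U. lra. }
    nra. }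
  pose proof (is_CInt_rderive _ _ (- d) d (fun t _ => D t) ltac:(intros; csolve; auto)) as I. cbv beta in I.
  rewrite U1, U2 in I.
  pose proof (is_CInt_plus _ _ _ _ _ _ (transform_correct d u' z Hu') (is_CInt_cmult z _ _ _ _ (transform_correct d u z Cu))) as J.
  pose proof (is_CInt_inj _ _ _ _ _ I J) as E.
  transitivity ((transform d u' z + z * transform d u z) - transform d u' z)%C; [ring|]. rewrite <- E. ring.
Qed.

(** Induction on [m] with an arbitrary polynomial factor: the derivative of [(d^2 - t^2)^(m+1) q] is
    [(d^2 - t^2)^m] times another polynomial. *)
Lemma transform_bump_decay d : 0 < d -> forall m q, polynomial q -> exists K, 0 <= K /\
  forall z, Cmod z ^ m * Cmod (transform d (fun t => bump d m t * q t) z) <= K * exp (d * Rabs (Re z)).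
Proof.
  intros Hd. induction m as [|m IH]; intros q Hq.
  - destruct (transform_bounded d (fun t => bump d 0 t * q t) Hd) as [K [HK B]].
    { intros t. apply cont_Rmult; [apply bump_cont|apply polynomial_cont; auto]. }
    exists K. split; auto. intros z. simpl. rewrite Rmult_1_l. auto.
  - destruct (polynomial_derive q Hq) as [q' [Hq' Dq]].
    set (q2 := fun t => (- (2 * INR (S m))) * (t * q t) + (d ^ 2 + (-1) * (t * t)) * q' t).
    assert (Hq2 : polynomial q2) by (unfold q2; repeat (constructor; auto)).
    destruct (IH q2 Hq2) as [K [HK B]]. exists K. split; auto. intros z.
    assert (E : (z * transform d (fun t => (bump d (S m) t * q t)%R) z = - transform d (fun t => (bump d m t * q2 t)%R) z)%C).
    { apply transform_derive; auto.
      - intros t. replace (bump d m t * q2 t) with ((INR (S m) * (- (2 * t)) * bump d m t) * q t + bump d (S m) t * q' t).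
        2: { unfold q2, bump. simpl pow. ring. }
        apply (is_derive_mult (K := R_AbsRing)); auto; [|intros; apply Rmult_comm].
        unfold bump. auto_derive; auto. change (match m with 0%nat => 1 | S _ => INR m + 1 end) with (INR (S m)). unfold Rminus. simpl pow. simpl Init.Nat.pred. ring.
      - intros t. apply cont_Rmult; [apply bump_cont|apply polynomial_cont; auto].
      - unfold bump. replace (d ^ 2 - (- d) ^ 2) with 0 by ring. simpl. ring.
      - unfold bump. replace (d ^ 2 - d ^ 2) with 0 by ring. simpl. ring. }
    eapply Rle_trans; [|apply (B z)]. right. apply (f_equal Cmod) in E. rewrite Cmod_mult, Cmod_opp in E.
    rewrite <- E. simpl. ring.
Qed.

Lemma bump_mass d m : 0 < d -> 0 < RInt (bump d m) (- d) d.
Proof.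
  intros Hd. apply RInt_gt_0; [lra| |].
  - intros x Hx. unfold bump. apply pow_lt. nra.
  - intros x Hx. apply bump_cont.
Qed.

(** * The sup norm estimate *)

Lemma ln_1_sqr_nonneg y : 0 <= ln (1 + y ^ 2).
Proof. rewrite <- ln_1. pose proof (pow2_ge_0 y). apply ln_le; lra. Qed.

Lemma kap_even c k y : kap c k (- y) = kap c k y.
Proof. unfold kap. do 3 f_equal. ring. Qed.

(* Peetre's inequality [1 + y^2 <= 2 (1 + y'^2) (1 + (y - y')^2)] *)
Lemma kap_difference c k y y' : 0 < k -> Rabs (kap c k y - kap c k y') <= k / 2 * ln (2 * (1 + (y - y') ^ 2)).
Proof.
  intros Hk.
  assert (P : forall a b, ln (1 + a ^ 2) - ln (1 + b ^ 2) <= ln (2 * (1 + (a - b) ^ 2))).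
  { intros a b. pose proof (pow2_ge_0 a). pose proof (pow2_ge_0 b). pose proof (pow2_ge_0 (a - b)).
    assert (ln (1 + a ^ 2) <= ln (2 * (1 + (a - b) ^ 2)) + ln (1 + b ^ 2)); [|lra].
    rewrite <- ln_mult by lra. apply ln_le; [lra|].
    assert (Q : 0 <= (a - 2 * b) ^ 2) by apply pow2_ge_0.
    assert (0 <= (a - b) ^ 2 * b ^ 2) by (pos). nra. }
  replace (kap c k y - kap c k y') with (k / 2 * (ln (1 + y' ^ 2) - ln (1 + y ^ 2))) by (unfold kap; ring).
  rewrite Rabs_mult, (Rabs_right (k / 2)) by lra. apply Rmult_le_compat_l; [lra|].
  apply Rabs_le. pose proof (P y y') as P1. pose proof (P y' y) as P2.
  replace ((y' - y) ^ 2) with ((y - y') ^ 2) in P2 by ring. lra.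
Qed.

(** Half of the integration curve, upper for [sg = 1] and lower for [sg = -1]; it computes the
    Laplace transform where [sg * Im p < 0]. *)
Definition cur (c k s sg u : R) : C := (kap c k u - s, sg * u).
Definition dcur (k sg u : R) : C := (- (k * u / (1 + u ^ 2)), sg).

Lemma rderive_cur c k s sg u : rderive (cur c k s sg) u (dcur k sg u).
Proof.
  pose proof (pow2_ge_0 u). apply rderive_pair.
  - unfold kap. auto_derive; [nra|]. field. nra.
  - auto_derive; auto. ring.
Qed.

Lemma cur_cont c k s sg u : rcont (cur c k s sg) u.
Proof. apply (ex_derive_continuous (V := C_R_NormedModule)). eexists. apply rderive_cur. Qed.

Lemma dcur_cont k sg u : rcont (dcur k sg) u.
Proof.
  pose proof (pow2_ge_0 u). apply cont_mkC; [|csolve]. apply cont_derivable. auto_derive. nra.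
Qed.

Lemma dcur_norm k sg u : 0 < k -> sg = 1 \/ sg = -1 -> Cmod (dcur k sg u) <= 1 + k.
Proof.
  intros Hk Hs. eapply Rle_trans; [apply Cmod_le_sum|]. unfold dcur, Re, Im; simpl.
  assert (Rabs sg = 1) by (destruct Hs; subst; [apply Rabs_R1|rewrite Rabs_left; lra]).
  assert (Rabs (- (k * u / (1 + u * (u * 1)))) <= k); [|lra].
  rewrite Rabs_Ropp. pose proof (pow2_ge_0 u) as P. simpl in P.
  unfold Rdiv. rewrite Rabs_mult, (Rabs_right (/ _)) by (left; apply Rinv_0_lt_compat; lra).
  apply Rmult_le_reg_r with (1 + u * (u * 1)); [lra|]. rewrite Rmult_assoc, Rinv_l, Rmult_1_r by lra.
  rewrite Rabs_mult, (Rabs_right k) by lra. apply Rmult_le_compat_l; [lra|].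
  apply Rabs_le. nra.
Qed.

Lemma clim_of_close (I J : R -> C) l : clim I l ->
  (forall eps, 0 < eps -> exists T0, forall T, T0 < T -> Cmod (J T - I T) < eps) -> clim J l.
Proof.
  intros HI H eps He. destruct (HI (eps / 2) ltac:(lra)) as [T1 W1]. destruct (H (eps / 2) ltac:(lra)) as [T2 W2].
  exists (Rmax T1 T2). intros T HT.
  specialize (W1 T (Rle_lt_trans _ _ _ (Rmax_l _ _) HT)). specialize (W2 T (Rle_lt_trans _ _ _ (Rmax_r _ _) HT)).
  replace (J T - l)%C with ((J T - I T) + (I T - l))%C by ring.
  tri_lt. lra.
Qed.

Lemma Rabs_sg sg u : sg = 1 \/ sg = -1 -> Rabs (sg * u) = Rabs u.
Proof. intros [-> | ->]; [f_equal; ring|]. replace (-1 * u) with (- u) by ring. apply Rabs_Ropp. Qed.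

Section Curve.
Variables (H : C -> Prop) (r : R -> R) (c k A : R).
Hypothesis HD : log_domain H r c k A.
Variables (s sg : R).
Hypothesis Hs : 0 <= s.
Hypothesis Hsg : sg = 1 \/ sg = -1.

Notation cu := (cur c k s sg).

Lemma kap_sg u : kap c k (sg * u) = kap c k u.
Proof. destruct Hsg as [-> | ->]; [f_equal; ring|]. replace (-1 * u) with (- u) by ring. apply kap_even. Qed.

Lemma cur_in u : H (cu u).
Proof.
  apply (H_iff _ _ _ _ _ HD). simpl. pose proof (r_kap _ _ _ _ _ HD (sg * u)) as K. rewrite kap_sg in K. lra.
Qed.

(** The linear growth [eta u] coming from the ordinate beats the logarithmic abscissa, uniformly for
    [|Re p| <= B]; half of it is kept. *)
Lemma cur_exponent B eta : 0 <= B -> 0 < eta -> exists q, forall p u,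
  Rabs (Re p) <= B -> eta <= - (sg * Im p) -> 0 <= u -> q + eta / 2 * u <= Re (p * cu u)%C.
Proof.
  intros HB He. pose proof (k_pos _ _ _ _ _ HD) as Hk.
  (* Chosen so that [B * k / l <= eta / 2]; the [+ 1] keeps [l] positive when [B = 0]. *)
  set (l := 2 * (B * k + 1) / eta). assert (Hl : 0 < l) by (apply Rdiv_lt_0_compat; nra).
  set (X := Rabs c + s + k * (1 / l - 1 + ln l)).
  exists (- (B * X)). intros p u Hp Hi Hu.
  replace (Re (p * cu u)%C) with (Re p * (kap c k u - s) + - (sg * Im p) * u) by (unfold cur, Re, Im; simpl; ring).
  assert (N : Rabs (kap c k u - s) <= X + k * (u / l)).
  { pose proof (kap_lower c k u l Hk Hl) as K. rewrite (Rabs_right u) in K by lra.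
    assert (kap c k u <= c) by (unfold kap; pose proof (ln_1_sqr_nonneg u); nra).
    pose proof (Rle_abs c). pose proof (Rle_abs (- c)). rewrite Rabs_Ropp in *.
    assert (E : k * ((1 + u) / l - 1 + ln l) = k * (1 / l - 1 + ln l) + k * (u / l)) by (field; lra).
    apply Rabs_le. unfold X. lra. }
  assert (Q : Rabs (Re p) * Rabs (kap c k u - s) <= B * (X + k * (u / l))) by (apply Rmult_le_compat; auto using Rabs_pos).
  rewrite <- Rabs_mult in Q. pose proof (Rle_abs (- (Re p * (kap c k u - s)))) as Q2. rewrite Rabs_Ropp in Q2.
  assert (B * (k * (u / l)) <= eta / 2 * u).
  { unfold l. replace (B * (k * (u / (2 * (B * k + 1) / eta)))) with (eta / 2 * u * (B * k / (B * k + 1))) by (field; nra).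
    assert (B * k / (B * k + 1) <= 1).
    { apply Rmult_le_reg_r with (B * k + 1); [nra|]. unfold Rdiv. rewrite Rmult_assoc, Rinv_l by nra. lra. }
    assert (0 <= eta / 2 * u) by nra. nra. }
  nra.
Qed.

Section Function.
Variables (g : C -> C) (M : R).
Hypothesis Hg : regular H g M.

Lemma cur_LP p Y : 0 <= Y -> is_CInt (fun u => LK g p (cu u) * dcur k sg u)%C 0 Y (LP r g p (cu Y) - LP r g p (cu 0))%C.
Proof.
  intros HY. destruct Hg as [G1 [G2 G3]].
  apply (closure_FTC H r c k A HD (LK g p) cu (dcur k sg)); auto.
  - apply LK_cont; auto.
  - apply (LK_differentiable H); auto.
  - apply cur_cont.
  - apply pieces_one with (dcur k sg); auto; [apply dcur_cont|]. intros t _. split; auto. apply rderive_cur.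
  - intros t _. apply (H_closure _ _ _ _ _ HD), cur_in.
Qed.

(** The curve is no ray, so it is compared with one of slope [sg * m] through horizontal segments.
    Rescaling the ray by [/ m] makes the ordinates agree, and [m] is large enough for
    [Re (p * v) >= 1]. *)
Lemma cur_Laplace p : 0 < - (sg * Im p) ->
  clim (fun Y => LP r g p (cu Y) - LP r g p (cu 0))%C (Laplace H g (cu 0) p).
Proof.
  intros Hp. pose proof (k_pos _ _ _ _ _ HD) as Hk. destruct Hg as [G1 [G2 G3]].
  set (eta := - (sg * Im p)) in *. set (m := (Rabs (Re p) + 1) / eta).
  pose proof (Rabs_pos (Re p)) as Hrp. assert (Hm : 0 < m) by (pos).
  assert (Hsg2 : sg * sg = 1) by (destruct Hsg; subst; ring).
  destruct (far_ray H r c k A HD (cu 0) (sg * m)) as [L [HL HR]].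
  set (v := (-1, sg * m)) in *. set (w1 := (cu 0 - RtoC L)%C) in *.
  assert (Hv : 1 <= Re (p * v)%C).
  { replace (Re (p * v)%C) with (- Re p + m * eta) by (unfold v, eta, Re, Im; simpl; ring).
    unfold m. replace ((Rabs (Re p) + 1) / eta * eta) with (Rabs (Re p) + 1) by (field; lra). pose proof (Rle_abs (Re p)). lra. }
  assert (GR : good_ray H p w1 v) by (split; [exact HR|split; [simpl; lra|lra]]).
  assert (Hc0 : closure H (cu 0)) by (apply (H_closure _ _ _ _ _ HD), cur_in).
  pose proof (Laplace_clim H r c k A HD g M G1 G2 G3 (cu 0) p w1 v Hc0 GR) as L1.
  assert (Him : 0 < / m) by (pos).
  pose proof (clim_affine _ _ (/ m) 0 Him L1) as L2.
  apply (clim_of_close _ _ _ L2).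
  set (b := fun Y => (w1 + RtoC (/ m * Y + 0) * v)%C).
  destruct (cur_exponent (Rabs (Re p)) eta Hrp Hp) as [q Hq].
  set (l := 1). pose proof (kap_lower c k) as KL.
  assert (D : forall eps, 0 < eps -> exists T0, forall T, T0 < T -> Cmod (LP r g p (cu T) - LP r g p (b T)) < eps).
  { apply (connect_decay H r c k A HD g M G1 G2 G3 p b cu (Rmin (eta / 2) (/ m)) (Rmin q (Re (p * w1)%C))
      (Rabs c + s + k + Rabs (Re w1) + / m) 0).
    - apply Rmin_pos; lra.
    - pose proof (Rabs_pos c). pose proof (Rabs_pos (Re w1)). lra.
    - intros T HT.
      pose proof (Rmin_l (eta / 2) (/ m)). pose proof (Rmin_r (eta / 2) (/ m)).
      pose proof (Rmin_l q (Re (p * w1)%C)). pose proof (Rmin_r q (Re (p * w1)%C)).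
      split; [|split; [|split]].
      + replace (Re (p * b T)%C) with (Re (p * w1)%C + / m * T * Re (p * v)%C) by (unfold b, Re; simpl; ring).
        assert (0 < / m * T) by (pos). nra.
      + specialize (Hq p T ltac:(lra) ltac:(unfold eta; lra) ltac:(lra)). nra.
      + assert (E : (cu T - b T)%C = RtoC (kap c k T - s - Re w1 + / m * T)).
        { unfold b, v, cur, w1. apply C_ext; unfold Re, Im; simpl; [ring|]. field. lra. }
        rewrite E, Cmod_R.
        assert (K1 : Rabs (kap c k T) <= Rabs c + k * T).
        { specialize (KL T 1 Hk ltac:(lra)). rewrite ln_1, (Rabs_right T) in KL by lra.
          assert (kap c k T <= c) by (unfold kap; pose proof (ln_1_sqr_nonneg T); nra).
          pose proof (Rle_abs c). pose proof (Rle_abs (- c)). rewrite Rabs_Ropp in *.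
          apply Rabs_le. split; [|nra]. apply Rle_trans with (c - k * ((1 + T) / 1 - 1 + 0)); [|auto].
          replace (k * ((1 + T) / 1 - 1 + 0)) with (k * T) by field. lra. }
        unfold Rminus. eapply Rle_trans; [apply Rabs_triang|]. eapply Rle_trans; [apply Rplus_le_compat_r, Rabs_triang|].
        eapply Rle_trans; [apply Rplus_le_compat_r, Rplus_le_compat_r, Rabs_triang|]. rewrite !Rabs_Ropp.
        assert (0 < / m * T) by (pos).
        rewrite (Rabs_right s), (Rabs_right (/ m * T)) by lra.
        pose proof (Rabs_pos c). pose proof (Rabs_pos (Re w1)).
        assert (0 <= Rabs c * T) by (pos). assert (0 <= Rabs (Re w1) * T) by (pos).
        assert (0 <= s * T) by (pos). assert (0 <= k * T) by (pos). lra.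
      + intros t Ht. apply (closure_hull H r c k A HD); auto.
        * apply GR. assert (0 < / m * T) by (pos). lra.
        * apply (H_closure _ _ _ _ _ HD), cur_in.
        * right. unfold b, v, cur, w1, Im; simpl. field. lra. }
  intros eps He. destruct (D eps He) as [T0 W]. exists T0. intros T HT. specialize (W T HT).
  replace (LP r g p (cu T) - LP r g p (cu 0) - (LP r g p (w1 + RtoC (/ m * T + 0) * v) - LP r g p (cu 0)))%C with
    (LP r g p (cu T) - LP r g p (b T))%C by (unfold b; ring). auto.
Qed.

(** The threshold is uniform in [p] along a whole horizontal side of the rectangle, so the
    truncation can be integrated over it. *)
Lemma cur_tail B eta : 0 <= B -> 0 < eta -> forall eps, 0 < eps -> exists Y0, forall Y, Y0 < Y -> 0 <= Y /\
  forall p, Rabs (Re p) <= B -> - (sg * Im p) = eta ->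
    Cmod (CInt (fun u => LK g p (cu u) * dcur k sg u)%C 0 Y - Laplace H g (cu 0) p) <= eps.
Proof.
  intros HB He eps Heps. pose proof (k_pos _ _ _ _ _ HD) as Hk. destruct (cur_exponent B eta HB He) as [q Hq].
  pose proof (proj1 Hg) as G1. pose proof (M_nonneg H r c k A HD g M (proj2 (proj2 Hg))) as HM.
  destruct (exp_decay_small (M * exp (- q) * (1 + k) / (eta / 2)) (eta / 2) eps ltac:(lra) Heps) as [T0 [HT0 W]].
  exists T0. intros Y HY. split; [lra|]. intros p Hp Hi.
  assert (Lim : forall Y, 0 <= Y -> @eq C (CInt (fun u => LK g p (cu u) * dcur k sg u)%C 0 Y) (LP r g p (cu Y) - LP r g p (cu 0))%C).
  { intros Z HZ. apply is_CInt_unique, cur_LP; auto. }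
  destruct (exp_dominated (fun u => LK g p (cu u) * dcur k sg u)%C (M * exp (- q) * (1 + k)) (eta / 2)) as [l [Hl Bl]].
  - lra.
  - intros t _. apply cont_Cmult; [|apply dcur_cont]. apply (cont_comp_C cu); [apply cur_cont|apply LK_cont; auto].
  - intros t Ht. rewrite Cmod_mult.
    replace (M * exp (- q) * (1 + k) * exp (- (eta / 2 * t))) with (M * (exp (- q) * exp (- (eta / 2 * t))) * (1 + k)) by ring.
    rmul; [|apply dcur_norm; auto].
    eapply Rle_trans; [apply (LK_norm H g M (proj2 (proj2 Hg))); apply (H_closure _ _ _ _ _ HD), cur_in|].
    apply Rmult_le_compat_l; auto. rewrite <- exp_plus. apply exp_le_le.
    specialize (Hq p t Hp ltac:(lra) Ht). lra.
  - assert (E : l = Laplace H g (cu 0) p).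
    { apply (clim_unique _ _ _ Hl). apply (clim_ext_ge (fun Y => LP r g p (cu Y) - LP r g p (cu 0))%C _ _ 0).
      - intros T HT. symmetry. apply Lim. lra.
      - apply cur_Laplace. lra. }
    rewrite <- E. eapply Rle_trans; [apply Bl; lra|]. left. apply W. auto.
Qed.

End Function.
End Curve.

(* Averaging over the crossing points makes the kernel decay. *)

Definition band_kernel (b1 b2 : R) (z : C) : C := CInt (fun a => Cexp (RtoC a * z))%C b1 b2.

Lemma band_kernel_cont b1 b2 z : ccont (band_kernel b1 b2) z.
Proof.
  eapply cder_cont. eapply cder_ext; [|apply (cder_exp_integral (fun _ => 1%C) (fun a => RtoC a) b1 b2 z)].
  - intros w. apply CInt_ext. intros t _. rewrite (Cmult_comm w). ring.
  - intros; csolve.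
  - intros; csolve.
Qed.

Lemma band_kernel_correct b1 b2 z : is_CInt (fun a => Cexp (RtoC a * z))%C b1 b2 (band_kernel b1 b2 z).
Proof. apply CInt_correct_all. intros; csolve. Qed.

Lemma band_kernel_norm b1 b2 z B : b1 <= b2 -> Rabs b1 <= B -> Rabs b2 <= B ->
  Cmod (band_kernel b1 b2 z) <= (b2 - b1) * exp (B * Rabs (Re z)).
Proof.
  intros Hb B1 B2. eapply Rle_trans; [apply is_CInt_norm_const with (2 := band_kernel_correct b1 b2 z) (M := exp (B * Rabs (Re z)))|].
  - ordered. intros a Ha. rewrite Cmod_Cexp. apply exp_le_le.
    replace (Re (RtoC a * z)) with (a * Re z) by (unfold Re; simpl; ring).
    eapply Rle_trans; [apply Rle_abs|]. rewrite Rabs_mult. apply Rmult_le_compat_r; [apply Rabs_pos|].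
    apply Rabs_le_between in B1. apply Rabs_le_between in B2. apply Rabs_le. lra.
  - rewrite Rabs_right by lra. lra.
Qed.

Lemma nat_above x : exists n : nat, x <= INR n.
Proof. destruct (INR_unbounded x) as [n Hn]. exists n. lra. Qed.

(** The first bound serves for [d2 <= 1], the second for [d2 > 1], where [1 + d2 <= 2 d2]. *)
Lemma rational_decay (P K d2 : R) (n : nat) : 0 <= K -> 0 <= d2 -> 0 <= P ->
  P <= K * (1 + d2) ^ n -> d2 ^ S n * P <= K * (1 + d2) ^ n -> P <= K * 2 ^ S n / (1 + d2).
Proof.
  intros HK Hd HP H1 H2. apply Rmult_le_reg_r with (1 + d2); [lra|].
  unfold Rdiv. rewrite Rmult_assoc, Rinv_l, Rmult_1_r by lra.
  destruct (Rle_dec d2 1) as [L|L].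
  - assert ((1 + d2) ^ S n <= 2 ^ S n) by (apply pow_incr; lra).
    apply Rle_trans with (K * (1 + d2) ^ n * (1 + d2)); [apply Rmult_le_compat_r; lra|].
    replace (K * (1 + d2) ^ n * (1 + d2)) with (K * (1 + d2) ^ S n) by (simpl; ring). apply Rmult_le_compat_l; auto.
  - assert (Q : (1 + d2) ^ S n <= (2 * d2) ^ S n) by (apply pow_incr; lra). rewrite Rpow_mult_distr in Q.
    assert (Pd : 0 < d2 ^ S n) by (apply pow_lt; lra).
    apply Rmult_le_reg_l with (d2 ^ S n); auto.
    replace (d2 ^ S n * (P * (1 + d2))) with (d2 ^ S n * P * (1 + d2)) by ring.
    apply Rle_trans with (K * (1 + d2) ^ n * (1 + d2)); [apply Rmult_le_compat_r; lra|].
    replace (K * (1 + d2) ^ n * (1 + d2)) with (K * (1 + d2) ^ S n) by (simpl; ring).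
    replace (d2 ^ S n * (K * 2 ^ S n)) with (K * (2 ^ S n * d2 ^ S n)) by ring. apply Rmult_le_compat_l; auto.
Qed.

(** [band_kernel] is [(e^(b2 z) - e^(b1 z)) / z], written without division. Since [w] and the curve
    point both follow [kap] up to a bounded shift, [|Re z|] is logarithmic in [Im z] and the
    exponentials are powers of [1 + y^2]; the bump compensates them and leaves the integrable
    [1 / (1 + y^2)], uniformly in [w] and [s]. *)
Lemma kernel_decay c k A b1 b2 d : 0 < k -> 0 <= A -> b1 <= b2 -> 0 < d -> exists (m : nat) K, 0 <= K /\
  forall w y s sg u, sg = 1 \/ sg = -1 -> y = Im w + - (sg * u) -> 0 <= s ->
      kap c k (Im w) - s <= Re w <= kap c k (Im w) - s + A ->
      Cmod (band_kernel b1 b2 (w - cur c k s sg u) * transform d (bump d m) (w - cur c k s sg u)) <= K / (1 + y ^ 2).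
Proof.
  intros Hk HA Hb Hd.
  set (B := Rabs b1 + Rabs b2). pose proof (Rabs_pos b1). pose proof (Rabs_pos b2).
  (* The exponentials are then at most a constant times [(1 + y^2)^n]. A bump of order [2 (n + 1)]
     gains [(y^2)^(n + 1)], one power of [y^2] more. *)
  destruct (nat_above ((B + d) * k / 2)) as [n Hn].
  exists (2 * S n)%nat.
  destruct (transform_bump_decay d Hd (2 * S n) (fun _ => 1) ltac:(constructor)) as [K1 [HK1 D1]].
  destruct (transform_bounded d (bump d (2 * S n)) Hd (bump_cont d (2 * S n))) as [K0 [HK0 D0]].
  assert (E1 : (fun t => bump d (2 * S n) t * 1) = bump d (2 * S n)) by (apply functional_extensionality; intros; ring).
  rewrite E1 in D1.
  set (K := (b2 - b1) * (K0 + K1) * exp ((B + d) * A) * 2 ^ n).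
  assert (HK : 0 <= K).
  { unfold K. repeat apply Rmult_le_pos; try lra; [left; apply exp_pos|apply pow_le; lra]. }
  exists (K * 2 ^ S n). split; [apply Rmult_le_pos; auto; apply pow_le; lra|].
  intros w y s sg u Hsg Hy Hs Hw. set (z := (w - cur c k s sg u)%C).
  assert (Iz : Im z = y) by (unfold z, cur, Im; simpl; rewrite Hy; unfold Im; ring).
  pose proof (pow2_ge_0 y) as Hy2.
  assert (Rz : Rabs (Re z) <= A + k / 2 * ln (2 * (1 + y ^ 2))).
  { assert (Ez : Re z = (Re w - kap c k (Im w) + s) + (kap c k (Im w) - kap c k (sg * u))).
    { unfold z, cur, Re; simpl. rewrite (kap_sg c k sg Hsg). ring. }
    rewrite Ez. eapply Rle_trans; [apply Rabs_triang|]. apply Rplus_le_compat.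
    - apply Rabs_le. lra.
    - pose proof (kap_difference c k (Im w) (sg * u) Hk) as Q. replace (Im w - sg * u) with y in Q by (rewrite Hy; ring). auto. }
  assert (HB : 0 <= B) by (unfold B; lra).
  assert (Ex : exp ((B + d) * Rabs (Re z)) <= exp ((B + d) * A) * (2 ^ n * (1 + y ^ 2) ^ n)).
  { apply Rle_trans with (exp ((B + d) * A + INR n * ln (2 * (1 + y ^ 2)))).
    - apply exp_le_le. apply Rle_trans with ((B + d) * (A + k / 2 * ln (2 * (1 + y ^ 2)))); [apply Rmult_le_compat_l; lra|].
      rewrite Rmult_plus_distr_l. apply Rplus_le_compat_l.
      assert (0 <= ln (2 * (1 + y ^ 2))) by (rewrite <- ln_1; apply ln_le; lra).
      replace ((B + d) * (k / 2 * ln (2 * (1 + y ^ 2)))) with ((B + d) * k / 2 * ln (2 * (1 + y ^ 2))) by field.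
      apply Rmult_le_compat_r; auto.
    - rewrite exp_plus. apply Rmult_le_compat_l; [pos|]. right.
      rewrite <- Rpow_mult_distr, <- ln_pow by lra. rewrite exp_ln; auto. apply pow_lt; lra. }
  pose proof (band_kernel_norm b1 b2 z B Hb ltac:(unfold B; lra) ltac:(unfold B; lra)) as Nb.
  set (P := Cmod (band_kernel b1 b2 z * transform d (bump d (2 * S n)) z)).
  assert (Mono : forall X Kx, 0 <= Kx -> Kx <= K0 + K1 -> 0 <= X -> X * Cmod (transform d (bump d (2 * S n)) z) <= Kx * exp (d * Rabs (Re z)) ->
     X * P <= K * (1 + y ^ 2) ^ n).
  { intros X Kx HKx HKx2 HX HT. unfold P. rewrite Cmod_mult.
    replace (X * (Cmod (band_kernel b1 b2 z) * Cmod (transform d (bump d (2 * S n)) z))) with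
      (Cmod (band_kernel b1 b2 z) * (X * Cmod (transform d (bump d (2 * S n)) z))) by ring.
    apply Rle_trans with ((b2 - b1) * exp (B * Rabs (Re z)) * ((K0 + K1) * exp (d * Rabs (Re z)))).
    - rmul; [pos|].
      eapply Rle_trans; [exact HT|]. apply Rmult_le_compat_r; [pos|auto].
    - replace ((b2 - b1) * exp (B * Rabs (Re z)) * ((K0 + K1) * exp (d * Rabs (Re z)))) with
        ((b2 - b1) * (K0 + K1) * (exp (B * Rabs (Re z)) * exp (d * Rabs (Re z)))) by ring.
      rewrite <- exp_plus, <- Rmult_plus_distr_r.
      replace (K * (1 + y ^ 2) ^ n) with ((b2 - b1) * (K0 + K1) * (exp ((B + d) * A) * (2 ^ n * (1 + y ^ 2) ^ n))) by (unfold K; ring).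
      apply Rmult_le_compat_l; [pos|auto]. }
  apply rational_decay; auto.
  - apply Cmod_ge_0.
  - rewrite <- (Rmult_1_l P). apply (Mono 1 K0); try lra. rewrite Rmult_1_l. apply D0.
  - apply (Mono _ K1); try lra; [apply pow_le; auto|].
    eapply Rle_trans; [|apply (D1 z)]. apply Rmult_le_compat_r; [apply Cmod_ge_0|].
    rewrite <- (pow2_abs y), <- pow_mult.
    apply pow_incr. split; [apply Rabs_pos|]. rewrite <- Iz. apply im_le_Cmod.
Qed.

(** The bound depends neither on [a], which will be [Im w], nor on the truncation [Y]. *)
Lemma is_RInt_arctan a sg Y : sg = 1 \/ sg = -1 -> 0 <= Y ->
  exists I, is_RInt (fun u => / (1 + (a + - (sg * u)) ^ 2)) 0 Y I /\ I <= PI.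
Proof.
  intros Hs HY. exists (- sg * atan (a + - (sg * Y)) - - sg * atan (a + - (sg * 0))). split.
  - apply (is_RInt_derive (V := R_CompleteNormedModule) (fun u => - sg * atan (a + - (sg * u)))).
    + intros u _. pose proof (pow2_ge_0 (a + - (sg * u))). auto_derive; auto.
      destruct Hs; subst; field; nra.
    + intros u _. apply cont_derivable. pose proof (pow2_ge_0 (a + - (sg * u))). auto_derive. nra.
  - pose proof (atan_bound (a + - (sg * Y))). pose proof (atan_bound (a + - (sg * 0))). destruct Hs; subst; lra.
Qed.

Section Averaging.
Variables (H : C -> Prop) (r : R -> R) (c k A : R).
Hypothesis HD : log_domain H r c k A.
Variables (g : C -> C) (M : R).
Hypothesis Hg : regular H g M.
Variables (b1 b2 d : R) (m : nat).
Hypothesis Hb : b1 < b2.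
Hypothesis Hd : 0 < d.
Variables (s sg : R).
Hypothesis Hs : 0 <= s.
Hypothesis Hsg : sg = 1 \/ sg = -1.
Variables (w : C) (eta Y : R).
Hypothesis HY : 0 <= Y.

Notation cu := (cur c k s sg).

(** The Laplace integral along the half curve cut at [Y], multiplied by [e^(pw)], at
    [p = a - i sg eta]. The cut keeps all integrals over compact intervals, so that [Fubini]
    applies. *)
Definition trunc (a : R) : C :=
  CInt (fun u => g (cu u) * dcur k sg u * Cexp ((a, (- (sg * eta))%R) * (w - cu u)))%C 0 Y.

Definition trunc_band (t : R) : C := CInt (fun a => trunc (a + t)) b1 b2.

Lemma density_cont u : rcont (fun u => g (cu u) * dcur k sg u)%C u.
Proof.
  apply cont_Cmult; [|apply dcur_cont]. apply (cont_comp_C cu); [apply cur_cont|apply (proj1 Hg)].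
Qed.

Lemma density_cont_Im (z : C) : ccont (fun z => g (cu (Im z)) * dcur k sg (Im z))%C z.
Proof. apply (cont_comp_R (fun z : C_UniformSpace => Im z) (fun u => g (cu u) * dcur k sg u)%C); [csolve|apply density_cont]. Qed.

Lemma cur_cont_Im (z : C) : ccont (fun z => cu (Im z)) z.
Proof. apply (cont_comp_R (fun z : C_UniformSpace => Im z) cu); [csolve|apply cur_cont]. Qed.

Lemma Cexp_split a t e z : Cexp (((a + t)%R, e) * z) = (Cexp ((t, e) * z) * Cexp (RtoC a * z))%C.
Proof. rewrite <- Cexp_plus. f_equal. cring. Qed.

Lemma trunc_band_kernel t : trunc_band t =
  CInt (fun u => g (cu u) * dcur k sg u * Cexp ((t, (- (sg * eta))%R) * (w - cu u)) * band_kernel b1 b2 (w - cu u))%C 0 Y.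
Proof.
  unfold trunc_band, trunc.
  pose proof (Fubini (fun z => g (cu (Im z)) * dcur k sg (Im z) * Cexp (((Re z + t)%R, (- (sg * eta))%R) * (w - cu (Im z))))%C b1 b2 0 Y ltac:(lra) HY) as F.
  etransitivity; [apply F|].
  2: { apply CInt_ext. intros u _. apply is_CInt_unique.
    eapply is_CInt_ext; [|apply (is_CInt_cmult (g (cu u) * dcur k sg u * Cexp ((t, (- (sg * eta))%R) * (w - cu u)))%C _ _ _ _ (band_kernel_correct b1 b2 (w - cu u)))].
    intros a _. simpl. rewrite Cexp_split. ring. }
  intros z. apply cont_Cmult; [apply density_cont_Im|].
    apply cont_Cexp, cont_Cmult; [apply cont_mkC; csolve|]. apply cont_Cminus; [csolve|apply cur_cont_Im].
Qed.

Lemma trunc_band_cont t : rcont trunc_band t.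
Proof.
  apply (rcont_ext (fun t => CInt (fun u => g (cu u) * dcur k sg u * Cexp ((t, (- (sg * eta))%R) * (w - cu u)) * band_kernel b1 b2 (w - cu u))%C 0 Y)).
  { intros; symmetry; apply trunc_band_kernel. }
  apply (inner_integral_cont_v (fun z => g (cu (Im z)) * dcur k sg (Im z) * Cexp ((Re z, (- (sg * eta))%R) * (w - cu (Im z))) * band_kernel b1 b2 (w - cu (Im z)))%C).
  intros z. apply cont_Cmult; [apply cont_Cmult; [apply density_cont_Im|]|].
  - apply cont_Cexp, cont_Cmult; [apply cont_mkC; csolve|]. apply cont_Cminus; [csolve|apply cur_cont_Im].
  - apply (cont_comp_C (fun z => w - cu (Im z))%C); [|apply band_kernel_cont]. apply cont_Cminus; [csolve|apply cur_cont_Im].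
Qed.

(** Translating both crossing points by [t] multiplies the kernel by [e^(t z)], so averaging over
    [t] against the bump produces its transform as a factor. *)
Lemma averaged_kernel : CInt (fun t => RtoC (bump d m t) * trunc_band t)%C (- d) d =
  CInt (fun u => g (cu u) * dcur k sg u * Cexp ((0%R, (- (sg * eta))%R) * (w - cu u)) *
    (band_kernel b1 b2 (w - cu u) * transform d (bump d m) (w - cu u)))%C 0 Y.
Proof.
  set (G := fun z => (RtoC (bump d m (Re z)) * (g (cu (Im z)) * dcur k sg (Im z) * Cexp ((Re z, (- (sg * eta))%R) * (w - cu (Im z))) * band_kernel b1 b2 (w - cu (Im z))))%C).
  assert (HG : forall z, ccont G z).
  { intros z. unfold G. apply cont_Cmult.
    - apply cont_RtoC. apply (continuous_comp (fun z : C_UniformSpace => Re z) (bump d m)); [csolve|apply bump_cont].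
    - apply cont_Cmult; [apply cont_Cmult; [apply density_cont_Im|]|].
      + apply cont_Cexp, cont_Cmult; [apply cont_mkC; csolve|]. apply cont_Cminus; [csolve|apply cur_cont_Im].
      + apply (cont_comp_C (fun z => w - cu (Im z))%C); [|apply band_kernel_cont]. apply cont_Cminus; [csolve|apply cur_cont_Im]. }
  pose proof (Fubini G (- d) d 0 Y ltac:(lra) HY HG) as F.
  transitivity (CInt (fun x => CInt (fun y => G (x, y)) 0 Y) (- d) d).
  - apply CInt_ext. intros t _. rewrite trunc_band_kernel. symmetry. apply is_CInt_unique.
    apply (is_CInt_cmult (RtoC (bump d m t)) (fun u => g (cu u) * dcur k sg u * Cexp ((t, (- (sg * eta))%R) * (w - cu u)) * band_kernel b1 b2 (w - cu u))%C).
    apply CInt_correct_all. intros u. apply cont_Cmult; [apply cont_Cmult; [apply density_cont|]|].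
    + apply cont_Cexp, cont_Cmult; [csolve|]. apply cont_Cminus; [csolve|apply cur_cont].
    + apply (cont_comp_C (fun u => w - cu u)%C); [|apply band_kernel_cont]. apply cont_Cminus; [csolve|apply cur_cont].
  - rewrite F. apply CInt_ext. intros u _. apply is_CInt_unique. rewrite Cmult_assoc.
    eapply is_CInt_ext; [|apply (is_CInt_cmult (g (cu u) * dcur k sg u * Cexp ((0%R, (- (sg * eta))%R) * (w - cu u)) * band_kernel b1 b2 (w - cu u))%C _ _ _ _ (transform_correct d (bump d m) (w - cu u) (bump_cont d m)))].
    intros t _. unfold G. simpl.
      assert (E : Cexp ((t, (- (sg * eta))%R) * (w - cu u)) = (Cexp ((0%R, (- (sg * eta))%R) * (w - cu u)) * Cexp (RtoC t * (w - cu u)))%C).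
      { rewrite <- Cexp_split. rewrite Rplus_0_r. reflexivity. }
      rewrite E. ring.
Qed.

Lemma averaged_bound K : 0 <= K -> 0 < eta -> eta * (1 + Rabs (Im w)) <= 1 ->
  (forall u, Cmod (band_kernel b1 b2 (w - cu u) * transform d (bump d m) (w - cu u)) <= K / (1 + (Im w + - (sg * u)) ^ 2)) ->
  Cmod (CInt (fun t => RtoC (bump d m t) * trunc_band t)%C (- d) d) <= M * (1 + k) * exp 1 * K * PI.
Proof.
  intros HK He He1 HKu. rewrite averaged_kernel.
  pose proof (M_nonneg H r c k A HD g M (proj2 (proj2 Hg))) as HM. pose proof (k_pos _ _ _ _ _ HD) as Hk.
  destruct (is_RInt_arctan (Im w) sg Y Hsg HY) as [I [HI BI]].
  set (K2 := M * (1 + k) * exp 1 * K).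
  assert (HK2 : 0 <= K2).
  { unfold K2. apply Rmult_le_pos; auto. apply Rmult_le_pos; [apply Rmult_le_pos; lra|left; apply exp_pos]. }
  apply Rle_trans with (K2 * I); [|apply Rmult_le_compat_l; auto].
  pose proof (is_RInt_scal (V := R_NormedModule) _ _ _ K2 _ HI) as HI2.
  eapply is_CInt_norm; [exact HY| |apply CInt_correct_all|exact HI2].
  - intros u Hu. cbv beta. rewrite !Cmod_mult.
    (* The only trace of the height [eta]: its exponent is at most [eta * |Im w| <= 1], because the
       contribution [- eta u] of the curve is negative. *)
    assert (Ex : Cmod (Cexp ((0%R, (- (sg * eta))%R) * (w - cu u))) <= exp 1).
    { rewrite Cmod_Cexp. apply exp_le_le.
      replace (Re ((0%R, (- (sg * eta))%R) * (w - cu u))) with (sg * eta * Im w - (sg * sg) * eta * u) by (unfold cur, Re, Im; simpl; ring).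
      assert (sg * sg = 1) by (destruct Hsg; subst; ring). rewrite H0.
      assert (sg * eta * Im w <= eta * Rabs (Im w)).
      { pose proof (Rle_abs (Im w)). pose proof (Rle_abs (- Im w)). rewrite Rabs_Ropp in H2. destruct Hsg; subst; nra. }
      nra. }
    change (scal K2 (/ (1 + (Im w + - (sg * u)) ^ 2))) with (K2 * (/ (1 + (Im w + - (sg * u)) ^ 2))).
    rewrite <- (Cmod_mult (band_kernel b1 b2 (w - cu u))%C).
    apply Rle_trans with (M * (1 + k) * exp 1 * (K / (1 + (Im w + - (sg * u)) ^ 2))); [|right; unfold K2, Rdiv; ring].
    rmul.
    + pos.
    + rmul; [pos|].
      rmul; [|apply dcur_norm; auto].
      apply (proj2 (proj2 Hg)). apply (H_closure _ _ _ _ _ HD). apply (cur_in H r c k A HD s sg Hs Hsg).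
  - intros u. apply cont_Cmult; [apply cont_Cmult; [apply density_cont|]|apply cont_Cmult].
    + apply cont_Cexp, cont_Cmult; [csolve|]. apply cont_Cminus; [csolve|apply cur_cont].
    + apply (cont_comp_C (fun u => w - cu u)%C); [|apply band_kernel_cont]. apply cont_Cminus; [csolve|apply cur_cont].
    + apply (cont_comp_C (fun u => w - cu u)%C (transform d (bump d m))); [apply cont_Cminus; [csolve|apply cur_cont]|].
      eapply cder_cont. eapply cder_ext; [|apply (cder_exp_integral (fun a => RtoC (bump d m a)) (fun a => RtoC a) (- d) d)].
      * intros q. apply CInt_ext. intros t _. rewrite (Cmult_comm q). reflexivity.
      * intros t _. apply cont_RtoC, bump_cont.
      * intros; csolve.
Qed.

End Averaging.

Lemma CInt_shift (h : R -> C) a b t : (forall x, Rmin (a + t) (b + t) <= x <= Rmax (a + t) (b + t) -> rcont h x) ->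
  is_CInt (fun x => h (x + t)) a b (CInt h (a + t) (b + t)).
Proof.
  intros Hc. pose proof (CInt_correct h (a + t) (b + t) Hc) as I.
  replace (a + t) with (1 * a + t) in I by ring. replace (b + t) with (1 * b + t) in I by ring.
  apply (is_RInt_comp_lin (V := C_R_NormedModule)) in I.
  replace (1 * a + t) with (a + t) in I by ring. replace (1 * b + t) with (b + t) in I by ring.
  eapply is_CInt_ext; [|exact I]. intros x _. simpl. rewrite (scal_one (K := R_AbsRing) (V := C_R_NormedModule)). f_equal. ring.
Qed.

(** The central estimate: the rectangle integral is the same for all translates of the crossing
    points by [|t| <= d], hence equals its average against the normalized bump, and the averaged
    kernels of the two half curves are integrable uniformly in [w]. *)
Lemma rect_sum_bound H r c k A O b1 b2 d : log_domain H r c k A -> b1 < b2 -> 0 < d ->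
  (forall x, Rabs (x - b1) <= d -> O x) -> (forall x, Rabs (x - b2) <= d -> O x) ->
  exists K, 0 <= K /\ forall g M f w0, regular H g M -> H w0 ->
    (forall p, punctured O p -> differentiable f p) -> (forall p, Im p <> 0 -> f p = Laplace H g w0 p) ->
    forall w, closure H w -> Cmod (rect_sum f b1 b2 w) <= K * M.
Proof.
  intros HD Hb Hd O1 O2. pose proof (k_pos _ _ _ _ _ HD) as Hk.
  assert (HA : 0 <= A) by apply HD.
  destruct (kernel_decay c k A b1 b2 d Hk HA ltac:(lra) Hd) as [m [K [HK KD]]].
  pose proof (bump_mass d m Hd) as Hm. set (m0 := RInt (bump d m) (- d) d) in *.
  pose proof PI_RGT_0 as HPI.
  set (K1 := (1 + k) * exp 1 * K * PI).
  assert (HK1 : 0 <= K1).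
  { unfold K1. apply Rmult_le_pos; [|lra]. apply Rmult_le_pos; auto. apply Rmult_le_pos; [lra|left; apply exp_pos]. }
  exists (2 * K1 / (m0 * (2 * PI))). split.
  { apply Rmult_le_pos; [lra|]. left. apply Rinv_0_lt_compat. apply Rmult_lt_0_compat; lra. }
  intros g M f0 w0 Hg Hw0 Df0 Ef0 w Hw.
  pose proof (M_nonneg H r c k A HD g M (proj2 (proj2 Hg))) as HM.
  (* The curve is pushed left until it passes through [w] if [w] lies to its left, and is left in
     place otherwise; either way [w] is at most [A] to the right of it. *)
  set (s := Rmax 0 (kap c k (Im w) - Re w)).
  assert (Hs : 0 <= s) by apply Rmax_l.
  assert (Hws : kap c k (Im w) - s <= Re w <= kap c k (Im w) - s + A).
  { apply (closure_iff _ _ _ _ _ HD) in Hw. pose proof (r_kap _ _ _ _ _ HD (Im w)) as Q.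
    unfold s, Rmax. destruct (Rle_dec 0 (kap c k (Im w) - Re w)); lra. }
  set (base := cur c k s 1 0).
  assert (Eb : forall sg, cur c k s sg 0 = base) by (intros; unfold base, cur; f_equal; ring).
  assert (Hbase : H base) by (apply (cur_in H r c k A HD s 1 Hs); auto).
  destruct Hg as [G1 [G2 G3]]. assert (Hg : regular H g M) by (split; auto).
  (* Change of base point to the common origin of the two half curves; the correction is entire and
     does not contribute to the rectangle integral. *)
  set (f := fun p => (f0 p + (LP r g p w0 - LP r g p base))%C).
  assert (DE : forall p, differentiable (fun p => LP r g p w0 - LP r g p base)%C p).
  { intros p. apply differentiable_minus; eapply LP_entire; eauto. }
  assert (Df : forall p, punctured O p -> differentiable f p).
  { intros p Hp. apply differentiable_plus; auto. }
  assert (Ef : forall p, Im p <> 0 -> f p = Laplace H g base p).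
  { intros p Hp. unfold f. rewrite Ef0 by auto.
    rewrite <- (Laplace_change_base H r c k A HD g M G1 G2 G3 base w0 p); [ring| | |apply nonreal_slit; auto]; apply (H_closure _ _ _ _ _ HD); auto. }
  assert (Ob1 : O b1) by (apply O1; rewrite Rminus_diag, Rabs_R0; lra).
  assert (Ob2 : O b2) by (apply O2; rewrite Rminus_diag, Rabs_R0; lra).
  assert (EV : rect_sum f0 b1 b2 w = rect_sum f b1 b2 w).
  { unfold rect_sum. f_equal. apply rectint_entire_difference with (O := O) (E := fun p => (LP r g p base - LP r g p w0)%C); auto.
    - intros; apply differentiable_cont; auto.
    - intros; apply differentiable_cont; auto.
    - intros p. apply differentiable_minus; eapply LP_entire; eauto.
    - intros p Np. unfold f. ring. }
  rewrite EV. clear EV Df0 Ef0 DE.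
  set (F := fun p => (f p * Cexp (p * w))%C).
  assert (DF : forall p, punctured O p -> differentiable F p) by (intros; apply differentiable_mult; auto; apply differentiable_Cexp_mult).
  assert (CF : forall p, punctured O p -> ccont F p) by (intros; apply differentiable_cont; auto).
  set (V := rectint F b1 b2 (-1) 1).
  assert (Box : forall b, (forall x, Rabs (x - b) <= d -> O x) -> exists N, 0 <= N /\ on_rect (fun z => Cmod (F z) <= N) (b - d) (b + d) (-1) 1).
  { intros b Ob. apply bounded_on_rect. intros x y Hx Hy. apply CF. right. simpl. apply Ob.
    ordered in Hx. apply Rabs_le. lra. }
  destruct (Box b1 O1) as [N1 [HN1 BN1]]. destruct (Box b2 O2) as [N2 [HN2 BN2]].
  set (B := Rabs b1 + Rabs b2 + d).
  set (W := exp (B * Rabs (Re w) + Rabs (Im w))).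
  assert (HW : 0 < W) by apply exp_pos.
  assert (HB : forall a t, b1 <= a <= b2 -> - d <= t <= d -> Rabs (a + t) <= B).
  { intros a t Ha Ht. pose proof (Rle_abs b2). pose proof (Rle_abs (- b1)). rewrite Rabs_Ropp in *. pose proof (Rabs_pos b1). pose proof (Rabs_pos b2).
    unfold B. apply Rabs_le. lra. }
  assert (HB0 : 0 <= B) by (unfold B; pose proof (Rabs_pos b1); pose proof (Rabs_pos b2); lra).
  assert (Goal0 : forall e, 0 < e -> m0 * Cmod V <= 2 * (M * K1) + m0 * e).
  { intros e He.
    (* The first bound controls the exponent in [averaged_bound], the second makes the two vertical
       sides, of length [2 eta], contribute at most [e / 2]. *)
    set (eta := Rmin (/ (1 + Rabs (Im w))) (e / (4 * (N1 + N2 + 1)))).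
    pose proof (Rabs_pos (Im w)) as HIw.
    assert (Heta : 0 < eta) by (apply Rmin_pos; [pos|pos]).
    assert (Heta1 : eta * (1 + Rabs (Im w)) <= 1).
    { apply Rle_trans with (/ (1 + Rabs (Im w)) * (1 + Rabs (Im w))); [apply Rmult_le_compat_r; [lra|apply Rmin_l]|]. rewrite Rinv_l; lra. }
    assert (Heta2 : eta <= 1) by nra.
    assert (Heta3 : 2 * eta * (N1 + N2) <= e / 2).
    { apply Rle_trans with (2 * (e / (4 * (N1 + N2 + 1))) * (N1 + N2)).
      - apply Rmult_le_compat_r; [lra|]. apply Rmult_le_compat_l; [lra|apply Rmin_r].
      - apply Rmult_le_reg_r with (4 * (N1 + N2 + 1)); [lra|].
        replace (2 * (e / (4 * (N1 + N2 + 1))) * (N1 + N2) * (4 * (N1 + N2 + 1))) with (2 * e * (N1 + N2)) by (field; lra). nra. }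
    (* Truncation then costs at most [e / 4] on each horizontal side, [W] bounding [|e^(pw)|]
       there. *)
    set (e1 := e / (4 * ((b2 - b1) * W))). assert (He1 : 0 < e1) by (pos).
    destruct (cur_tail H r c k A HD s 1 Hs ltac:(auto) g M Hg B eta HB0 Heta e1 He1) as [Y1 T1].
    destruct (cur_tail H r c k A HD s (-1) Hs ltac:(auto) g M Hg B eta HB0 Heta e1 He1) as [Y2 T2].
    set (Y := Rmax Y1 Y2 + 1).
    assert (HY12 : Y1 < Y /\ Y2 < Y) by (unfold Y; pose proof (Rmax_l Y1 Y2); pose proof (Rmax_r Y1 Y2); lra).
    destruct (T1 Y (proj1 HY12)) as [HY T1']. destruct (T2 Y (proj2 HY12)) as [_ T2']. clear T1 T2.
    set (Q := fun sg => trunc_band c k g b1 b2 s sg w eta Y).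
    assert (CQ : forall sg t, sg = 1 \/ sg = -1 -> rcont (Q sg) t).
    { intros sg t Hsg. apply (trunc_band_cont H c k g M Hg b1 b2 Hb s sg w eta Y HY). }
    assert (Side : forall sg t, (sg = 1 \/ sg = -1) -> - d <= t <= d ->
      (forall p, Rabs (Re p) <= B -> - (sg * Im p) = eta -> Cmod (CInt (fun u => LK g p (cur c k s sg u) * dcur k sg u)%C 0 Y - Laplace H g (cur c k s sg 0) p) <= e1) ->
      Cmod (CInt (fun x => F (x, (- (sg * eta))%R)) (b1 + t) (b2 + t) - Q sg t) <= e / 4).
    { intros sg t Hsg Ht T.
      assert (Nz : - (sg * eta) <> 0) by (destruct Hsg; subst; lra).
      assert (I1 : is_CInt (fun a => F ((a + t)%R, (- (sg * eta))%R)) b1 b2 (CInt (fun x => F (x, (- (sg * eta))%R)) (b1 + t) (b2 + t))).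
      { apply (CInt_shift (fun x => F (x, (- (sg * eta))%R))). intros x _. apply rcont_h, CF. left; auto. }
      assert (Ct : forall a, rcont (fun a => trunc c k g s sg w eta Y (a + t)) a).
      { intros a. apply (cont_comp_R (fun a => a + t)); [csolve|]. unfold trunc.
        apply (inner_integral_cont_v (fun z => g (cur c k s sg (Im z)) * dcur k sg (Im z) * Cexp ((Re z, (- (sg * eta))%R) * (w - cur c k s sg (Im z))))%C).
        intros z. apply cont_Cmult; [apply (density_cont_Im H c k g M Hg)|].
        apply cont_Cexp, cont_Cmult; [apply cont_mkC; csolve|]. apply cont_Cminus; [csolve|apply cur_cont_Im]. }
      pose proof (is_CInt_minus _ _ _ _ _ _ I1 (CInt_correct_all _ b1 b2 Ct)) as I2.
      eapply Rle_trans; [apply is_CInt_norm_const with (2 := I2) (M := e1 * W)|].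
      - ordered. intros a Ha.
        set (p := ((a + t)%R, (- (sg * eta))%R) : C).
        assert (Hp : Rabs (Re p) <= B) by (apply HB; auto).
        assert (Hpi : - (sg * Im p) = eta) by (unfold p, Im; simpl; destruct Hsg; subst; ring).
        assert (E : trunc c k g s sg w eta Y (a + t) = (CInt (fun u => LK g p (cur c k s sg u) * dcur k sg u) 0 Y * Cexp (p * w))%C).
        { unfold trunc. apply is_CInt_unique. rewrite Cmult_comm.
          eapply is_CInt_ext; [|apply is_CInt_cmult, CInt_correct_all].
          - intros u _. simpl. unfold LK. fold p.
            assert (E2 : Cexp (p * (w - cur c k s sg u)) = (Cexp (p * w) * Cexp (- (p * cur c k s sg u)))%C) by (rewrite <- Cexp_plus; f_equal; ring).
            rewrite E2. ring.
          - intros u. apply cont_Cmult; [|apply dcur_cont]. apply (cont_comp_C (cur c k s sg)); [apply cur_cont|apply LK_cont; auto]. }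
        fold p. rewrite E. unfold F. rewrite Ef by (unfold p; simpl; auto). rewrite <- (Eb sg).
        match goal with |- Cmod (?x * ?y - ?z * ?y)%C <= _ => replace (x * y - z * y)%C with (- ((z - x) * y))%C by ring end.
        rewrite Cmod_opp, Cmod_mult. rmul.
        rewrite Cmod_Cexp. unfold W. apply exp_le_le. rewrite Re_mult.
        assert (Re p * Re w <= B * Rabs (Re w)).
        { eapply Rle_trans; [apply Rle_abs|]. rewrite Rabs_mult. apply Rmult_le_compat_r; auto. apply Rabs_pos. }
        assert (- (Im p * Im w) <= Rabs (Im w)).
        { eapply Rle_trans; [apply Rle_abs|]. rewrite Rabs_Ropp, Rabs_mult.
          assert (Rabs (Im p) <= 1). { unfold p, Im; simpl. rewrite Rabs_Ropp, Rabs_sg by auto. rewrite Rabs_right; lra. }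
          nra. }
        lra.
      - rewrite Rabs_right by lra. right. unfold e1. field. split; lra. }
    assert (Pt : forall t, - d <= t <= d -> Cmod (V - (Q 1 t - Q (-1) t)) <= e).
    { intros t Ht.
      assert (EV : V = rectint F (b1 + t) (b2 + t) (- eta) eta).
      { apply rectint_crossing with O; auto; try lra.
        - intros x Hx. apply O1. pose proof (Rabs_between _ _ _ Hx) as Q1. replace (b1 + t - b1) with t in Q1 by ring.
          assert (Rabs t <= d) by (apply Rabs_le; lra). lra.
        - intros x Hx. apply O2. pose proof (Rabs_between _ _ _ Hx) as Q1. replace (b2 + t - b2) with t in Q1 by ring.
          assert (Rabs t <= d) by (apply Rabs_le; lra). lra. }
      assert (Vert : forall b N, (forall x, Rabs (x - b) <= d -> O x) -> on_rect (fun z => Cmod (F z) <= N) (b - d) (b + d) (-1) 1 ->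
        Cmod (CInt (fun y => F ((b + t)%R, y)) (- eta) eta) <= 2 * eta * N).
      { intros b N Ob BN. eapply Rle_trans; [apply is_CInt_norm_const with (h := fun y => F ((b + t)%R, y)) (a := - eta) (b := eta) (M := N)|].
        - intros y Hy. ordered in Hy. apply BN; ordered; lra.
        - apply v_correct. intros y _. apply CF. right. simpl. apply Ob. apply Rabs_le. lra.
        - rewrite Rabs_right by lra. right; ring. }
      pose proof (Vert b1 N1 O1 BN1) as V1. pose proof (Vert b2 N2 O2 BN2) as V2.
      pose proof (Side 1 t ltac:(auto) Ht T1') as S1. pose proof (Side (-1) t ltac:(auto) Ht T2') as S2.
      replace (- (1 * eta)) with (- eta) in S1 by ring. replace (- (-1 * eta)) with eta in S2 by ring.
      rewrite EV. unfold rectint.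
      match goal with |- Cmod (?x1 + Ci * ?x2 - ?x3 - Ci * ?x4 - (?q1 - ?q2))%C <= _ =>
        replace (x1 + Ci * x2 - x3 - Ci * x4 - (q1 - q2))%C with ((x1 - q1) - (x3 - q2) + Ci * (x2 - x4))%C by ring end.
      tri. rewrite Cmod_mult, Cmod_Ci, Rmult_1_l.
      eapply Rle_trans; [apply Rplus_le_compat; apply Cmod_triangle_minus|]. lra. }
    assert (Av : forall sg, (sg = 1 \/ sg = -1) -> Cmod (CInt (fun t => RtoC (bump d m t) * Q sg t)%C (- d) d) <= M * K1).
    { intros sg Hsg. replace (M * K1) with (M * (1 + k) * exp 1 * K * PI) by (unfold K1; ring).
      apply (averaged_bound H r c k A HD g M Hg b1 b2 d m Hb Hd s sg Hs Hsg w eta Y HY K HK Heta Heta1).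
      intros u. apply (KD w (Im w + - (sg * u)) s sg u Hsg eq_refl Hs Hws). }
    assert (IQ : forall sg, (sg = 1 \/ sg = -1) -> is_CInt (fun t => RtoC (bump d m t) * Q sg t)%C (- d) d (CInt (fun t => RtoC (bump d m t) * Q sg t)%C (- d) d)).
    { intros sg Hsg. apply CInt_correct_all. intros t. apply cont_Cmult; [apply cont_RtoC, bump_cont|apply CQ; auto]. }
    assert (Ib : is_RInt (bump d m) (- d) d m0).
    { apply (RInt_correct (V := R_CompleteNormedModule)). apply (ex_RInt_continuous (V := R_CompleteNormedModule)). intros t _. apply bump_cont. }
    assert (IV : is_CInt (fun t => RtoC (bump d m t) * V)%C (- d) d (RtoC m0 * V)%C).
    { assert (I0 : is_CInt (fun t => RtoC (bump d m t)) (- d) d (RtoC m0)).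
      { apply is_CInt_pair; auto. pose proof (is_RInt_const (V := R_NormedModule) (- d) d 0) as J0. change (is_RInt (V := R_NormedModule) (fun _ : R => 0) (- d) d ((d - - d) * 0)) in J0. rewrite Rmult_0_r in J0. exact J0. }
      rewrite Cmult_comm. eapply is_CInt_ext; [|apply is_CInt_cmult; exact I0]. intros t _. simpl. ring. }
    pose proof (is_CInt_minus _ _ _ _ _ _ IV (is_CInt_minus _ _ _ _ _ _ (IQ 1 ltac:(auto)) (IQ (-1) ltac:(auto)))) as ID.
    pose proof (is_RInt_scal (V := R_NormedModule) _ _ _ e _ Ib) as Ie.
    assert (BD : Cmod (RtoC m0 * V - (CInt (fun t => RtoC (bump d m t) * Q 1 t)%C (- d) d - CInt (fun t => RtoC (bump d m t) * Q (-1) t)%C (- d) d)) <= e * m0).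
    { eapply (is_CInt_norm _ _ (- d) d); [lra| |exact ID|exact Ie]. intros t Ht. cbv beta.
      replace (RtoC (bump d m t) * V - (RtoC (bump d m t) * Q 1 t - RtoC (bump d m t) * Q (-1) t))%C with (RtoC (bump d m t) * (V - (Q 1 t - Q (-1) t)))%C by ring.
      assert (Bp : 0 <= bump d m t) by (unfold bump; apply pow_le; nra).
      rewrite Cmod_mult, Cmod_R, Rabs_right by lra.
      change (scal e (bump d m t)) with (e * bump d m t). rewrite Rmult_comm. apply Rmult_le_compat_r; [exact Bp|apply Pt; exact Ht]. }
    pose proof (Av 1 ltac:(auto)) as A1. pose proof (Av (-1) ltac:(auto)) as A2.
    assert (E : m0 * Cmod V = Cmod (RtoC m0 * V)) by (rewrite Cmod_mult, Cmod_R, Rabs_right by lra; ring).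
    rewrite E.
    match type of BD with Cmod (?x - (?y - ?z))%C <= _ => replace x with ((x - (y - z)) + (y - z))%C by ring end.
    tri. pose proof (Cmod_triangle_minus (CInt (fun t => RtoC (bump d m t) * Q 1 t)%C (- d) d) (CInt (fun t => RtoC (bump d m t) * Q (-1) t)%C (- d) d)). lra. }
  (* [eta] and [Y] depended on [e], but [K1] does not, so [e] can tend to 0. *)
  assert (Fin : m0 * Cmod V <= 2 * (M * K1)).
  { apply Rnot_lt_le. intros L. set (x := m0 * Cmod V - 2 * (M * K1)) in *.
    specialize (Goal0 (x / (2 * m0)) ltac:(apply Rdiv_lt_0_compat; unfold x; lra)).
    replace (m0 * (x / (2 * m0))) with (x / 2) in Goal0 by (field; lra). unfold x in *. lra. }
  unfold rect_sum. fold F. fold V. rewrite Cmod_div by apply two_pi_i_neq_0.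
  rewrite !Cmod_mult, Cmod_Ci, !Cmod_R, (Rabs_right 2), (Rabs_right PI) by lra.
  apply Rmult_le_reg_r with (m0 * (2 * PI)); [pos|].
  replace (2 * K1 / (m0 * (2 * PI)) * M * (m0 * (2 * PI))) with (2 * (M * K1)) by (field; lra).
  replace (Cmod V / (2 * 1 * PI) * (m0 * (2 * PI))) with (m0 * Cmod V) by (field; lra). exact Fin.
Qed.

(** * The Laplace transform of a rectangle sum and its support *)

Lemma bounded_on_sides (f : C -> C) x1 x2 y1 y2 : on_sides (ccont f) x1 x2 y1 y2 ->
  exists M, 0 <= M /\ on_sides (fun z => Cmod (f z) <= M) x1 x2 y1 y2.
Proof.
  intros Cf.
  assert (Hh : forall y, y = y1 \/ y = y2 -> exists M, 0 <= M /\ on_rect (fun z => Cmod (f z) <= M) x1 x2 y y).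
  { intros y Hy. apply bounded_on_rect. intros x y' Hx Hy'. rewrite Rmin_left, Rmax_left in Hy' by lra.
    assert (y' = y) as -> by lra. apply Cf; auto. destruct Hy; subst; [apply Rmin_Rmax_l|apply Rmin_Rmax_r]. }
  assert (Hv : forall x, x = x1 \/ x = x2 -> exists M, 0 <= M /\ on_rect (fun z => Cmod (f z) <= M) x x y1 y2).
  { intros x Hx. apply bounded_on_rect. intros x' y Hx' Hy. rewrite Rmin_left, Rmax_left in Hx' by lra.
    assert (x' = x) as -> by lra. apply Cf; auto; [|destruct Hx; auto]. destruct Hx; subst; [apply Rmin_Rmax_l|apply Rmin_Rmax_r]. }
  destruct (Hh y1 ltac:(auto)) as [M1 [P1 B1]]. destruct (Hh y2 ltac:(auto)) as [M2 [P2 B2]].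
  destruct (Hv x1 ltac:(auto)) as [M3 [P3 B3]]. destruct (Hv x2 ltac:(auto)) as [M4 [P4 B4]].
  exists (M1 + M2 + M3 + M4). split; [lra|]. intros x y Hx Hy S.
  destruct S as [->|[->|[->| ->]]].
  - specialize (B3 x1 y (Rmin_Rmax_l _ _) Hy). simpl in B3. lra.
  - specialize (B4 x2 y (Rmin_Rmax_l _ _) Hy). simpl in B4. lra.
  - specialize (B1 x y1 Hx (Rmin_Rmax_l _ _)). simpl in B1. lra.
  - specialize (B2 x y2 Hx (Rmin_Rmax_l _ _)). simpl in B2. lra.
Qed.

Lemma rectint_Cauchy_differentiable (f : C -> C) x1 x2 y1 y2 p : on_sides (ccont f) x1 x2 y1 y2 ->
  on_sides (fun q => q <> p) x1 x2 y1 y2 -> differentiable (fun p => rectint (fun q => f q / (q - p))%C x1 x2 y1 y2) p.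
Proof.
  intros Cf Np. unfold on_sides in *.
  assert (Hside : forall x, x = x1 \/ x = x2 -> forall y1 y2 t : R, x = x1 \/ x = x2 \/ t = y1 \/ t = y2).
  { intros x [E|E]; auto. }
  assert (Hh : forall y, y = y1 \/ y = y2 -> differentiable (fun p => CInt (fun t => f (t, y) / ((t, y) - p))%C x1 x2) p).
  { intros y Hy. assert (By : Rmin y1 y2 <= y <= Rmax y1 y2) by (destruct Hy; subst; [apply Rmin_Rmax_l|apply Rmin_Rmax_r]).
    eexists. apply (cder_Cauchy_integral (fun t => f (t, y)) (fun t => (t, y)) x1 x2 p).
    - intros t Ht. exact (rcont_h f t y (Cf t y Ht By (or_intror (or_intror Hy)))).
    - intros t Ht. csolve.
    - intros t Ht. exact (Np t y Ht By (or_intror (or_intror Hy))). }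
  assert (Hv : forall x, x = x1 \/ x = x2 -> differentiable (fun p => CInt (fun t => f (x, t) / ((x, t) - p))%C y1 y2) p).
  { intros x Hx. assert (Bx : Rmin x1 x2 <= x <= Rmax x1 x2) by (destruct Hx; subst; [apply Rmin_Rmax_l|apply Rmin_Rmax_r]).
    eexists. apply (cder_Cauchy_integral (fun t => f (x, t)) (fun t => (x, t)) y1 y2 p).
    - intros t Ht. exact (rcont_v f x t (Cf x t Bx Ht (Hside x Hx y1 y2 t))).
    - intros t Ht. csolve.
    - intros t Ht. exact (Np x t Bx Ht (Hside x Hx y1 y2 t)). }
  destruct (Hh y1 ltac:(auto)) as [l1 D1]. destruct (Hh y2 ltac:(auto)) as [l2 D2].
  destruct (Hv x1 ltac:(auto)) as [l3 D3]. destruct (Hv x2 ltac:(auto)) as [l4 D4].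
  eexists. unfold rectint.
  apply cder_minus; [apply cder_minus; [apply cder_plus; [exact D1|apply cder_scal; exact D4]|exact D2]|apply cder_scal; exact D3].
Qed.

Lemma on_sides_punctured O (P : C -> Prop) b1 b2 y1 y2 : O b1 -> O b2 -> y1 <> 0 -> y2 <> 0 ->
  (forall p, punctured O p -> P p) -> on_sides P b1 b2 y1 y2.
Proof.
  intros O1 O2 N1 N2 HP x y _ _ S. apply HP. destruct S as [->|[->|[->| ->]]]; [right|right|left|left]; auto.
Qed.

Section Support.
Variables (H : C -> Prop) (r : R -> R) (c k A : R).
Hypothesis HD : log_domain H r c k A.
Variables (O : R -> Prop) (f : C -> C) (b1 b2 M : R).
Hypothesis Hf : forall p, punctured O p -> differentiable f p.
Hypothesis O1 : O b1.
Hypothesis O2 : O b2.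
Hypothesis Hb : b1 <= b2.
Hypothesis HV : regular H (rect_sum f b1 b2) M.

Notation pi2 := (2 * Ci * RtoC PI)%C.

(** Dividing by [q - p] integrates [e^((q - p) w)] in [w]; the rectangle integral of this kernel is
    thus a primitive of the Laplace integrand of [rect_sum]. *)
Definition rect_kernel (p w q : C) : C := (f q * Cexp ((q - p) * w) / (q - p))%C.

Lemma rect_kernel_sides p w y1 y2 : O b1 -> O b2 -> y1 <> 0 -> y2 <> 0 ->
  (Re p < b1 \/ b2 < Re p) -> on_sides (ccont (rect_kernel p w)) b1 b2 y1 y2.
Proof.
  intros _ _ N1 N2 Hp x y Hx Hy S.
  assert (Q : (x, y) <> p).
  { intros E. apply (f_equal Re) in E. simpl in E. ordered in Hx. lra. }
  unfold rect_kernel. apply cont_Cdiv; [|csolve|apply Cminus_neq_0; exact Q].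
  apply cont_Cmult; [|csolve]. revert S. apply (on_sides_punctured O (ccont f) b1 b2 y1 y2); auto.
  intros; apply differentiable_cont; auto.
Qed.

Lemma rect_kernel_height p w h h' : 0 < h -> 0 < h' -> (Re p < b1 \/ b2 < Re p) ->
  rectint (rect_kernel p w) b1 b2 (- h) h = rectint (rect_kernel p w) b1 b2 (- h') h'.
Proof.
  intros Hh Hh' Hp.
  assert (Z : forall y1 y2, 0 < y1 * y2 -> rectint (rect_kernel p w) b1 b2 y1 y2 = RtoC 0).
  { intros y1 y2 N. apply Goursat. intros x y Hx Hy.
    assert (Q : (x, y) <> p).
    { intros E. apply (f_equal Re) in E. simpl in E. ordered in Hx. lra. }
    unfold rect_kernel, Cdiv. apply differentiable_mult.
    - apply differentiable_mult.
      + apply Hf. left. simpl. revert Hy. unfold Rmin, Rmax. destruct (Rle_dec y1 y2); nra.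
      + apply differentiable_ext with (fun q => Cexp (q * w) * Cexp (- (p * w)))%C.
        * intros q. rewrite <- Cexp_plus. f_equal. ring.
        * apply differentiable_mult; [apply differentiable_Cexp_mult|eexists; apply cder_const].
    - eexists. apply cder_inv_minus. exact Q. }
  rewrite <- (rectint_Chasles_v _ b1 b2 (- h') (- h) h') by (apply rect_kernel_sides; auto; lra).
  rewrite <- (rectint_Chasles_v _ b1 b2 (- h) h h') by (apply rect_kernel_sides; auto; lra).
  rewrite (Z (- h') (- h)), (Z h h') by nra. ring.
Qed.

Lemma rect_kernel_primitive p w : (Re p < b1 \/ b2 < Re p) ->
  cder (fun w => rectint (rect_kernel p w) b1 b2 (-1) 1 / pi2)%C w (LK (rect_sum f b1 b2) p w).
Proof.
  intros Hp.
  assert (E : forall u : C, (u / pi2)%C = (/ pi2 * u)%C) by (intros; apply Cmult_comm).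
  assert (EL : LK (rect_sum f b1 b2) p w = (/ pi2 * rectint (fun q => f q / (q - p) * (q - p) * Cexp ((q - p) * w)) b1 b2 (-1) 1)%C).
  { unfold LK, rect_sum. rewrite E, <- Cmult_assoc. f_equal. rewrite Cmult_comm, <- rectint_scal.
    - apply rectint_ext. intros x y Hx Hy _.
      assert (Q : (x, y) <> p).
      { intros E0. apply (f_equal Re) in E0. simpl in E0. ordered in Hx. lra. }
      replace (((x, y) - p) * w)%C with ((x, y) * w + - (p * w))%C by ring. rewrite Cexp_plus. field. apply Cminus_neq_0; auto.
    - apply (on_sides_punctured O); auto; try lra. intros; apply cont_Cmult; [apply differentiable_cont; auto|csolve]. }
  rewrite EL. eapply cder_ext; [intros v; symmetry; apply E|]. apply cder_scal.
  apply (cder_ext (fun w => rectint (fun q => f q / (q - p) * Cexp ((q - p) * w)) b1 b2 (-1) 1)%C);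
    [|apply (rectint_exp_cder (fun q => f q / (q - p))%C (fun q => q - p)%C b1 b2 (-1) 1 w)].
  - intros v. apply (rectint_ext (fun q => f q / (q - p) * Cexp ((q - p) * v))%C (rect_kernel p v)).
    intros x y _ _ _. unfold rect_kernel, Cdiv. ring.
  - intros x y Hx Hy S. apply cont_Cdiv; [|csolve|].
    + revert Hx Hy S. generalize x y. apply (on_sides_punctured O (ccont f) b1 b2 (-1) 1); auto; try lra. intros; apply differentiable_cont; auto.
    + apply Cminus_neq_0. intros E0. apply (f_equal Re) in E0. simpl in E0. ordered in Hx. lra.
  - intros x y _ _ _. csolve.
Qed.

(* On a rectangle of height [|Im p|], a steep ray makes [Re ((q - p) v)] uniformly negative, so that the primitive of the kernel vanishes at infinity along it. *)
Lemma rect_sum_Laplace w0 p : H w0 -> Im p <> 0 -> (Re p < b1 \/ b2 < Re p) ->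
  Laplace H (rect_sum f b1 b2) w0 p = (- (rectint (rect_kernel p w0) b1 b2 (-1) 1 / pi2))%C.
Proof.
  intros Hw0 Hi Hp. destruct HV as [V1 [V2 V3]].
  set (W := fun w => (rectint (rect_kernel p w) b1 b2 (-1) 1 / pi2)%C).
  assert (He : 0 < Rabs (Im p)) by (apply Rabs_pos_lt; auto).
  set (h := Rabs (Im p) / 2).
  set (m := (2 + 2 * Rabs (Re p) + Rabs b1) / h).
  assert (Hh : 0 < h) by (unfold h; lra).
  assert (Hmh : m * h = 2 + 2 * Rabs (Re p) + Rabs b1) by (unfold m; field; lra).
  assert (Hm : 0 < m).
  { unfold m. apply Rdiv_lt_0_compat; auto. pose proof (Rabs_pos (Re p)). pose proof (Rabs_pos b1). lra. }
  set (sg := if Rlt_dec 0 (Im p) then 1 else -1).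
  assert (Hsg : sg * Im p = Rabs (Im p) /\ (sg = 1 \/ sg = -1)).
  { unfold sg. destruct (Rlt_dec 0 (Im p)); split; auto; [rewrite Rabs_right; lra|rewrite Rabs_left; lra]. }
  destruct Hsg as [Hsg Hsg'].
  set (v := (-1, - (m * sg)) : C).
  assert (Hv : forall q, Re (q * v)%C = - Re q + m * (sg * Im q)) by (intros q; unfold v, Re, Im; simpl; ring).
  destruct (far_ray H r c k A HD w0 (- (m * sg))) as [L [HL Ray]].
  assert (Hpv : 0 < Re (p * v)%C).
  { rewrite Hv, Hsg. unfold h in Hmh. pose proof (Rle_abs (Re p)). pose proof (Rabs_pos (Re p)). pose proof (Rabs_pos b1). lra. }
  assert (Good : good_ray H p (w0 - RtoC L)%C v).
  { split; [exact Ray|]. split; [unfold v; simpl; lra|exact Hpv]. }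
  pose proof (Laplace_clim H r c k A HD _ M V1 V2 V3 w0 p _ v (H_closure _ _ _ _ _ HD _ Hw0) Good) as CL.
  assert (EW : forall T, 0 <= T ->
    (LP r (rect_sum f b1 b2) p ((w0 - RtoC L) + RtoC T * v) - LP r (rect_sum f b1 b2) p w0)%C = (W ((w0 - RtoC L) + RtoC T * v) - W w0)%C).
  { intros T HT.
    assert (Seg : forall a u s t, s <= t -> (forall x, s <= x <= t -> closure H (a + RtoC x * u)%C) ->
      (LP r (rect_sum f b1 b2) p (a + RtoC t * u) - LP r (rect_sum f b1 b2) p (a + RtoC s * u))%C = (W (a + RtoC t * u) - W (a + RtoC s * u))%C).
    { intros a u s t Hst Hc. eapply is_CInt_inj.
      - apply (LP_segment H r c k A HD _ V1 V2 p a u s t Hst Hc).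
      - apply (is_CInt_segment W (LK (rect_sum f b1 b2) p)).
        + intros x _. exact (rect_kernel_primitive p _ Hp).
        + intros x _. exact (LK_cont _ V1 p _). }
    pose proof (Seg (w0 - RtoC L)%C v 0 T HT ltac:(intros x Hx; apply Ray; lra)) as S1.
    pose proof (Seg w0 (- RtoC L)%C 0 1 ltac:(lra)) as S2.
    replace (w0 - RtoC L + RtoC 0 * v)%C with (w0 - RtoC L)%C in S1 by ring.
    replace (w0 + RtoC 0 * - RtoC L)%C with w0 in S2 by ring.
    replace (w0 + RtoC 1 * - RtoC L)%C with (w0 - RtoC L)%C in S2 by ring.
    rewrite <- (Cplus_0_r (W _ - W w0)%C).
    replace (W (w0 - RtoC L + RtoC T * v) - W w0 + 0)%C with ((W (w0 - RtoC L + RtoC T * v) - W (w0 - RtoC L)) + (W (w0 - RtoC L) - W w0))%C by ring.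
    rewrite <- S1, <- S2; [ring|]. intros x Hx. apply (closure_move _ _ _ _ _ HD w0).
    - apply H_closure with (1 := HD); auto.
    - unfold Re; simpl. nra.
    - right. f_equal. unfold Im; simpl. ring. }
  assert (Dec : clim (fun T => W ((w0 - RtoC L) + RtoC T * v)%C) (RtoC 0)).
  { assert (Cs : on_sides (ccont (rect_kernel p (w0 - RtoC L))) b1 b2 (- h) h) by (apply rect_kernel_sides; auto; lra).
    destruct (bounded_on_sides _ _ _ _ _ Cs) as [K [HK BK]].
    set (K2 := 2 * (Rabs (b2 - b1) + Rabs (h - - h)) * K / Cmod pi2).
    assert (HP : 0 < Cmod pi2) by (apply Cmod_gt_0, two_pi_i_neq_0).
    intros eps Heps. destruct (exp_decay_small K2 1 eps ltac:(lra) Heps) as [T0 [HT0 BT]].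
    exists T0. intros T HT. eapply Rle_lt_trans; [|apply (BT T HT)].
    replace (W (w0 - RtoC L + RtoC T * v) - RtoC 0)%C with (W (w0 - RtoC L + RtoC T * v)%C) by ring.
    unfold W. rewrite (rect_kernel_height p _ 1 h ltac:(lra) Hh Hp).
    rewrite Cmod_div by apply two_pi_i_neq_0.
    assert (B : Cmod (rectint (rect_kernel p (w0 - RtoC L + RtoC T * v)) b1 b2 (- h) h) <= 2 * (Rabs (b2 - b1) + Rabs (h - - h)) * (K * exp (- (1 * T)))).
    { apply rectint_norm; [apply rect_kernel_sides; auto; lra|]. intros x y Hx Hy S.
      specialize (BK x y Hx Hy S). simpl in BK.
      assert (E : rect_kernel p (w0 - RtoC L + RtoC T * v) (x, y) = (rect_kernel p (w0 - RtoC L) (x, y) * Cexp (RtoC T * (((x, y) - p) * v)))%C).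
      { unfold rect_kernel. replace (((x, y) - p) * (w0 - RtoC L + RtoC T * v))%C with (((x, y) - p) * (w0 - RtoC L) + RtoC T * (((x, y) - p) * v))%C by ring.
        rewrite Cexp_plus. unfold Cdiv. ring. }
      rewrite E, Cmod_mult, Cmod_Cexp. rmul; [pos|].
      apply exp_le_le. rewrite Re_mult. change (Re (RtoC T)) with T. change (Im (RtoC T)) with 0.
      replace (((x, y) - p) * v)%C with ((x, y) * v - p * v)%C by ring. rewrite Re_minus, !Hv, Hsg. simpl.
      rewrite Rmin_left, Rmax_right in Hx, Hy by lra.
      assert (m * (sg * y) <= m * h). { apply Rmult_le_compat_l; [lra|]. destruct Hsg' as [-> | ->]; lra. }
      pose proof (Rle_abs (- b1)). rewrite Rabs_Ropp in *. pose proof (Rle_abs (Re p)).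
      unfold h in Hmh, H0.  pose proof (Rabs_pos (Re p)). nra. }
    apply Rle_trans with (2 * (Rabs (b2 - b1) + Rabs (h - - h)) * (K * exp (- (1 * T))) / Cmod pi2).
    - apply Rmult_le_compat_r; [pos|exact B].
    - right. unfold K2. field. lra. }
  fold (W w0).
  assert (D2 : clim (fun T => W ((w0 - RtoC L) + RtoC T * v) - W w0)%C (RtoC 0 - W w0)%C) by (apply clim_minus; [exact Dec|apply clim_const]).
  replace (- W w0)%C with (RtoC 0 - W w0)%C by ring.
  apply (clim_unique _ _ _ CL). eapply clim_ext_ge with (T1 := 0); [|exact D2]. intros T HT. symmetry. apply EW. lra.
Qed.

(** The formula for nonreal [p] is a Cauchy integral over the rectangle, holomorphic in [p] wherever
    [Re p] is outside [[b1, b2]], in particular across the real axis at [beta]. *)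
Lemma rect_sum_extends_off w0 beta : H w0 -> beta < b1 \/ b2 < beta ->
  Laplace_extends_at H (rect_sum f b1 b2) w0 beta.
Proof.
  intros Hw0 Hbeta. destruct HV as [V1 [V2 V3]].
  set (phi := fun p => (- (rectint (rect_kernel p w0) b1 b2 (-1) 1 / pi2))%C).
  assert (Hd : exists d, 0 < d /\ forall x, Rabs (x - beta) < d -> x < b1 \/ b2 < x).
  { destruct Hbeta as [Q|Q]; [exists (b1 - beta)|exists (beta - b2)]; (split; [lra|]); intros x Hx; apply Rabs_def2 in Hx; lra. }
  destruct Hd as [d [Hd Off]].
  assert (Near : forall p, Cmod (p - RtoC beta) < d -> Re p < b1 \/ b2 < Re p).
  { intros p Hp. apply Off. apply Cmod_lt_parts in Hp. exact (proj1 Hp). }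
  assert (Dphi : forall p, Cmod (p - RtoC beta) < d -> differentiable phi p).
  { intros p Hp. specialize (Near p Hp).
    destruct (rectint_Cauchy_differentiable (fun q => f q * Cexp (q * w0))%C b1 b2 (-1) 1 p) as [l Hl].
    - apply (on_sides_punctured O); auto; try lra. intros; apply cont_Cmult; [apply differentiable_cont; auto|csolve].
    - intros x y Hx _ _ E. apply (f_equal Re) in E. simpl in E. ordered in Hx. lra.
    (* The kernel is [e^(- p w0)] times a Cauchy kernel, so only the factor [1 / (q - p)] has to be
       differentiated under the integral. *)
    - destruct (differentiable_Cexp_mult (- w0)%C p) as [l' Hl'].
      pose proof (cder_scal (- / pi2)%C _ _ _ (cder_mult _ _ _ _ _ Hl' Hl)) as D.
      eexists. eapply cder_ext_loc; [|intros q Hq|exact D].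
      + assert (Hlt : 0 < d - Cmod (p - RtoC beta)) by lra. exact Hlt.
      + assert (Hq2 : Cmod (q - RtoC beta) < d).
        { replace (q - RtoC beta)%C with ((q - p) + (p - RtoC beta))%C by ring. tri_lt. lra. }
        unfold phi. rewrite <- rectint_scal.
        * unfold Cdiv. replace (- / pi2 * rectint (fun z => Cexp (q * - w0) * (f z * Cexp (z * w0) * / (z - q))) b1 b2 (-1) 1)%C with (- (rectint (fun z => Cexp (q * - w0) * (f z * Cexp (z * w0) * / (z - q))) b1 b2 (-1) 1 * / pi2))%C by ring.
          f_equal. f_equal. apply rectint_ext. intros x y _ _ _. unfold rect_kernel.
          replace (((x, y) - q) * w0)%C with (q * - w0 + (x, y) * w0)%C by ring. rewrite Cexp_plus. unfold Cdiv. ring.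
        * intros x y Hx Hy S. apply cont_Cdiv; [|csolve|].
          -- apply cont_Cmult; [|csolve]. revert Hx Hy S. generalize x y. apply (on_sides_punctured O (ccont f) b1 b2 (-1) 1); auto; try lra. intros; apply differentiable_cont; auto.
          -- apply Cminus_neq_0. intros E. apply (f_equal Re) in E. simpl in E.
             assert (Nq : Re q < b1 \/ b2 < Re q). { apply Off. apply Cmod_lt_parts in Hq2. exact (proj1 Hq2). }
             ordered in Hx. lra. }
  assert (Eq : forall p, Cmod (p - RtoC beta) < d -> Im p <> 0 -> phi p = Laplace H (rect_sum f b1 b2) w0 p).
  { intros p Hp Hi. symmetry. apply rect_sum_Laplace; auto. }
  exists (mkposreal d Hd), phi. split; simpl.
  - intros p Hp. apply holomorphic_at_cder. apply Dphi; auto.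
  - intros p Hp Hs. destruct (Req_dec (Im p) 0) as [Z|N]; [|auto].
    apply (eq_by_slit_limit phi (Laplace H (rect_sum f b1 b2) w0) p (d - Cmod (p - RtoC beta))); [lra| | |].
    + apply differentiable_cont; auto.
    + apply differentiable_cont. eapply (Laplace_differentiable H r c k A HD); eauto. apply (H_closure _ _ _ _ _ HD); auto.
    + intros q Hq Hqi. apply Eq; [|congruence].
      replace (q - RtoC beta)%C with ((q - p) + (p - RtoC beta))%C by ring. tri_lt. lra.
Qed.
End Support.

Lemma rect_sum_crossing O f b1 b2 b1' b2' : (forall p, punctured O p -> differentiable f p) ->
  (forall x, Rmin b1 b1' <= x <= Rmax b1 b1' -> O x) -> (forall x, Rmin b2 b2' <= x <= Rmax b2 b2' -> O x) ->
  rect_sum f b1 b2 = rect_sum f b1' b2'.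
Proof.
  intros Hf Q1 Q2. apply functional_extensionality. intros w. unfold rect_sum. f_equal.
  apply (rectint_crossing O _ b1 b2 b1' b2' 1 1); auto; try lra.
  intros z Hz. apply differentiable_mult; auto. apply differentiable_Cexp_mult.
Qed.

(** A point [beta] of the gap may lie inside [[b1, b2]]; moving the sides within the gaps to [b1'],
    [b2'] puts it outside without changing the sum. *)
Lemma rect_sum_extends H r c k A O f b1 b2 M b1' b2' w0 beta : log_domain H r c k A ->
  (forall p, punctured O p -> differentiable f p) ->
  (forall x, Rmin b1 b1' <= x <= Rmax b1 b1' -> O x) -> (forall x, Rmin b2 b2' <= x <= Rmax b2 b2' -> O x) ->
  b1' <= b2' -> beta < b1' \/ b2' < beta -> regular H (rect_sum f b1 b2) M -> H w0 ->
  Laplace_extends_at H (rect_sum f b1 b2) w0 beta.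
Proof.
  intros HD Hf Q1 Q2 Hb Hbeta HV Hw0. rewrite (rect_sum_crossing O f b1 b2 b1' b2') in * by auto.
  eapply rect_sum_extends_off with (O := O); eauto; [apply Q1, Rmin_Rmax_r|apply Q2, Rmin_Rmax_r].
Qed.

(** * Cauchy's formula in a sector opening to the left *)

Lemma linear_exp_small (K B eps : R) : 0 <= K -> 0 < eps -> exists T0, 0 <= T0 /\ forall T, T0 < T -> K * T * exp (B - T) < eps.
Proof.
  intros HK He.
  destruct (exp_decay_small (K * (exp (1 / 2) / (1 / 2)) * exp B) (1 / 2) eps ltac:(lra) He) as [T0 [H0 HT]].
  exists T0. split; auto. intros T Hl. eapply Rle_lt_trans; [|apply (HT T Hl)].
  pose proof (linear_le_exp (1 / 2) T ltac:(lra) ltac:(lra)) as L.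
  replace (exp (B - T)) with (exp B * exp (- (1 / 2 * T)) * exp (- (1 / 2 * T))) by (rewrite <- !exp_plus; f_equal; lra).
  assert (L2 : T * exp (- (1 / 2 * T)) <= exp (1 / 2) / (1 / 2)).
  { apply Rmult_le_reg_r with (exp (1 / 2 * T)); [apply exp_pos|]. rewrite Rmult_assoc, <- exp_plus.
    replace (- (1 / 2 * T) + 1 / 2 * T) with 0 by ring. rewrite exp_0. lra. }
  apply Rle_trans with (K * (T * exp (- (1 / 2 * T))) * (exp B * exp (- (1 / 2 * T)))); [right; ring|].
  apply Rle_trans with (K * (exp (1 / 2) / (1 / 2)) * (exp B * exp (- (1 / 2 * T)))); [|right; ring].
  apply Rmult_le_compat_r; [pos|]. apply Rmult_le_compat_l; auto.
Qed.

Section Sector.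
Variables (H : C -> Prop) (r : R -> R) (c k A : R).
Hypothesis HD : log_domain H r c k A.
Variables (g : C -> C) (M : R).
Hypothesis Hg : regular H g M.
Variables (a om : C) (m : R).
Hypothesis Ha : H a.
Hypothesis Hm : 0 < m.
Hypothesis Rays : forall sg u, sg = 1 \/ sg = -1 -> 0 <= u -> H (om + RtoC u * (-1, (sg * m)%R))%C.
Hypothesis Left : Rabs (Im a - Im om) < m * (Re om - Re a).

Definition Cauchy_integrand (z : C) : C := (g z * Cexp (z - a) / (z - a))%C.

Lemma H_vertical z y : H z -> Rabs y <= Rabs (Im z) -> H (Re z, y).
Proof.
  intros Hz Hy. apply (H_iff _ _ _ _ _ HD). apply (H_iff _ _ _ _ _ HD) in Hz. simpl.
  eapply Rlt_le_trans; [exact Hz|]. apply (r_decr _ _ _ _ _ HD). exact Hy.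
Qed.

(** The pole is split off: [g z * Cexp (z - a)] takes the value [g a] at [a], so the integrand is
    [g a / (z - a)], with the two branches of the logarithm as primitives, plus a difference
    quotient having a primitive [Q] on all of [H]. *)
Lemma Cauchy_integrand_primitives : exists Q Pu Pd : C -> C,
  (forall z, H z -> Re z <> Re a \/ Im a < Im z -> cder (fun z => g a * Pu z + Q z)%C z (Cauchy_integrand z)) /\
  (forall z, H z -> Re z <> Re a \/ Im z < Im a -> cder (fun z => g a * Pd z + Q z)%C z (Cauchy_integrand z)) /\
  (forall u v, Re u < Re a < Re v -> (Pu u - Pu v - (Pd u - Pd v) = 2 * Ci * RtoC PI)%C).
Proof.
  destruct Hg as [G1 [G2 G3]].
  assert (Dh : forall z, H z -> differentiable (fun z => g z * Cexp (z - a))%C z).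
  { intros z Hz. apply differentiable_mult; auto.
    apply differentiable_ext with (fun z => Cexp (z * 1) * Cexp (- a))%C; [intros; rewrite <- Cexp_plus; f_equal; ring|].
    apply differentiable_mult; [apply differentiable_Cexp_mult|eexists; apply cder_const]. }
  assert (Ch : forall z, ccont (fun z => g z * Cexp (z - a))%C z) by (intros; csolve; apply G1).
  destruct (difference_quotient _ a (Dh a Ha)) as [q [Q1 [Q2 [Q3 Q4]]]].
  assert (Cq : forall z, ccont q z).
  { intros z. destruct (classic (z = a)) as [->|N]; auto. }
  assert (Pq : forall z, H z -> cder (comb_integral q (r 0 - 1) 0) z (q z)).
  { apply comb_primitive.
    - apply (H_comb _ _ _ _ _ HD).
    - intros; apply Cq.
    - intros x1 x2 y1 y2 Hr. apply Goursat_off_line with (c := Im a).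
      + intros x y _ _. apply Cq.
      + intros x y Hx Hy N. apply Q4; [intros E; apply N; rewrite E; reflexivity|]. apply Dh. apply Hr; auto. }
  destruct (log_branches a) as [Pu [Pd [L1 [L2 L3]]]].
  exists (comb_integral q (r 0 - 1) 0), Pu, Pd.
  assert (Key : forall P z, H z -> z <> a -> cder P z (/ (z - a))%C ->
    cder (fun z => g a * P z + comb_integral q (r 0 - 1) 0 z)%C z (Cauchy_integrand z)).
  { intros P z Hz N D.
    assert (E : Cauchy_integrand z = (g a * / (z - a) + q z)%C).
    { unfold Cauchy_integrand. rewrite Q1. replace (a - a)%C with (RtoC 0) by ring. rewrite Cexp_0. field. apply Cminus_neq_0; auto. }
    rewrite E. apply cder_plus; [apply cder_scal; exact D|apply Pq; auto]. }
  split; [|split; auto].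
  - intros z Hz N. apply Key; auto. intros ->. destruct N; [congruence|lra].
  - intros z Hz N. apply Key; auto. intros ->. destruct N; [congruence|lra].
Qed.

Lemma ray_avoids sg u : sg = 1 \/ sg = -1 -> Re (om + RtoC u * (-1, (sg * m)%R))%C <> Re a \/ 0 < sg * (Im (om + RtoC u * (-1, (sg * m)%R))%C - Im a).
Proof.
  intros Hsg. apply Rabs_def2 in Left.
  replace (Re (om + RtoC u * (-1, (sg * m)%R))%C) with (Re om - u) by (unfold Re, Im; simpl; ring).
  replace (Im (om + RtoC u * (-1, (sg * m)%R))%C) with (Im om + u * (sg * m)) by (unfold Re, Im; simpl; ring).
  destruct (Req_dec (Re om - u) (Re a)) as [E|N]; [right|auto]. assert (u = Re om - Re a) as -> by lra.
  destruct Hsg as [-> | ->]; lra.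
Qed.

(** The sector is closed by a vertical segment at abscissa [Re om - S]: its length is [2 m S] while
    the integrand is of size [exp (- S)]. The factor [Cexp (z - a)] supplies this decay, [g] being
    only bounded. *)
Lemma sector_Cauchy : clim (fun S =>
    CInt (fun u => Cauchy_integrand (om + RtoC u * (-1, (1 * m)%R)) * (-1, (1 * m)%R))%C 0 S -
    CInt (fun u => Cauchy_integrand (om + RtoC u * (-1, (-1 * m)%R)) * (-1, (-1 * m)%R))%C 0 S)%C (2 * Ci * RtoC PI * g a)%C.
Proof.
  destruct Hg as [G1 [G2 G3]]. destruct Cauchy_integrand_primitives as [Q [Pu [Pd [D1 [D2 D3]]]]].
  assert (Cc : forall z, z <> a -> ccont Cauchy_integrand z).
  { intros z N. unfold Cauchy_integrand. apply cont_Cdiv; [|csolve|apply Cminus_neq_0; auto]. csolve. apply G1. }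
  assert (Na : forall sg u, sg = 1 \/ sg = -1 -> (om + RtoC u * (-1, (sg * m)%R))%C <> a).
  { intros sg u Hsg E. destruct (ray_avoids sg u Hsg) as [X|X]; rewrite E in X; [auto|].  replace (Im a - Im a) with 0 in X by ring. lra. }
  assert (Hdist : 0 < Re om - Re a) by (pose proof (Rabs_pos (Im a - Im om)); nra).
  assert (IP : forall sg P S, sg = 1 \/ sg = -1 -> 0 <= S ->
    (forall z, H z -> Re z <> Re a \/ 0 < sg * (Im z - Im a) -> cder (fun z => g a * P z + Q z)%C z (Cauchy_integrand z)) ->
    CInt (fun u => Cauchy_integrand (om + RtoC u * (-1, (sg * m)%R)) * (-1, (sg * m)%R))%C 0 S =
    (g a * P (om + RtoC S * (-1, (sg * m)%R)) + Q (om + RtoC S * (-1, (sg * m)%R)) - (g a * P om + Q om))%C).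
  { intros sg P S Hsg HS D. apply is_CInt_unique.
    replace (g a * P om + Q om)%C with (g a * P (om + RtoC 0 * (-1, (sg * m)%R)) + Q (om + RtoC 0 * (-1, (sg * m)%R)))%C
      by (replace (om + RtoC 0 * (-1, (sg * m)%R))%C with om by ring; reflexivity).
    apply (is_CInt_segment (fun z => g a * P z + Q z)%C Cauchy_integrand om (-1, (sg * m)%R) 0 S); intros u Hu; [|apply Cc, Na; auto].
    rewrite Rmin_left in Hu by lra. apply D; [apply Rays; auto; lra|apply ray_avoids; auto]. }
  pose proof (M_nonneg H r c k A HD g M G3) as HM.
  intros eps Heps.
  destruct (linear_exp_small (2 * m * M) (Re om - Re a) eps ltac:(nra) Heps) as [T0 [HT0 Dec]].
  exists (T0 + (Re om - Re a) + 1). intros S HS.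
  assert (HS0 : 0 <= S) by lra.
  rewrite (IP 1 Pu), (IP (-1) Pd); auto; try (intros z Hz [N|N]; [|clear IP]; (apply D1 || apply D2); auto; right; lra).
  set (u := (om + RtoC S * (-1, (1 * m)%R))%C). set (u' := (om + RtoC S * (-1, (-1 * m)%R))%C).
  assert (Ru : Re u = Re om - S) by (unfold u, Re, Im; simpl; ring). assert (Iu : Im u = Im om + S * m) by (unfold u, Re, Im; simpl; ring).
  assert (Ru' : Re u' = Re om - S) by (unfold u', Re, Im; simpl; ring). assert (Iu' : Im u' = Im om - S * m) by (unfold u', Re, Im; simpl; ring).
  assert (E : Pu u = (Pu om + (Pd u - Pd om) + 2 * Ci * RtoC PI)%C) by (rewrite <- (D3 u om) by lra; ring).
  rewrite E.
  assert (HSm : 0 < S * m) by (pos).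
  assert (Hu : H u) by (apply Rays; auto). assert (Hu' : H u') by (apply Rays; auto).
  assert (Hz : forall t, Im u' <= t <= Im u -> H (Re om - S, t)).
  { intros t Ht. destruct (Rle_dec (Rabs t) (Rabs (Im u))) as [X|X]; [rewrite <- Ru|rewrite <- Ru']; apply H_vertical; auto.
    rewrite Iu, Iu' in *. revert X. unfold Rabs. repeat match goal with |- context [Rcase_abs ?x] => destruct (Rcase_abs x) end; lra. }
  assert (IV : is_CInt (fun t => Ci * Cauchy_integrand ((Re om - S)%R, t))%C (Im u') (Im u) ((g a * Pd u + Q u) - (g a * Pd u' + Q u'))%C).
  { replace u with ((Re om - S, Im u) : C) at 2 3 by (rewrite <- Ru; apply C_ext; reflexivity).
    replace u' with ((Re om - S, Im u') : C) at 2 3 by (rewrite <- Ru'; apply C_ext; reflexivity).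
    apply (is_CInt_v_primitive (fun z => g a * Pd z + Q z)%C Cauchy_integrand).
    - intros t Ht. ordered in Ht. apply D2; [auto|left; simpl; lra].
    - intros t _. apply Cc. intros E2. apply (f_equal Re) in E2. simpl in E2. lra. }
  match goal with |- Cmod ?x < _ => replace x with ((g a * Pd u + Q u) - (g a * Pd u' + Q u'))%C by ring end.
  apply is_CInt_norm_const with (M := M * exp ((Re om - Re a) - S)) in IV.
  - eapply Rle_lt_trans; [exact IV|]. rewrite Rabs_right by lra.
    replace ((Im u - Im u') * (M * exp (Re om - Re a - S))) with (2 * m * M * S * exp (Re om - Re a - S)) by (rewrite Iu, Iu'; ring).
    apply Dec. lra.
  - intros t Ht. ordered in Ht. rewrite Cmod_mult, Cmod_Ci, Rmult_1_l.
    unfold Cauchy_integrand.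
    assert (D : 1 <= Cmod (((Re om - S)%R, t) - a)).
    { eapply Rle_trans; [|apply re_le_Cmod]. rewrite Re_minus. simpl. rewrite Rabs_left; lra. }
    assert (N : (((Re om - S)%R, t) - a)%C <> RtoC 0) by (intros E2; rewrite E2, Cmod_0 in D; lra).
    rewrite Cmod_div, Cmod_mult, Cmod_Cexp, Re_minus by exact N. simpl (Re _).
    apply Rmult_le_reg_r with (Cmod (((Re om - S)%R, t) - a)); [lra|]. unfold Rdiv. rewrite Rmult_assoc, Rinv_l, Rmult_1_r by lra.
    assert (B : Cmod (g (Re om - S, t)) * exp (Re om - S - Re a) <= M * exp (Re om - Re a - S)).
    { replace (Re om - S - Re a) with (Re om - Re a - S) by ring. apply Rmult_le_compat_r; [pos|]. apply G3. apply (H_closure _ _ _ _ _ HD); auto. }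
    eapply Rle_trans; [exact B|]. assert (0 <= M * exp (Re om - Re a - S)) by (pos). nra.
Qed.
End Sector.

(** * Laplace inversion at points far to the left *)

Definition first_leg (F : C -> C) (t0 : R) (e : C) : C :=
  CInt (fun t => F (- (1) + RtoC t * (RtoC t0 * e + 1)) * (RtoC t0 * e + 1))%C 0 1.

(** Together with [first_leg] this is a path from [-1] to infinity in direction [e]. The starting
    point [-1] is common to the upper and lower paths and lies where the transform is
    holomorphic. *)
Definition second_leg (F : C -> C) (t0 : R) (e : C) (S : R) : C :=
  CInt (fun s => F (RtoC t0 * e + RtoC s * e) * e)%C 0 S.

Lemma exp_dominated_inf (h : R -> C) K a : 0 < a -> (forall t, 0 <= t -> rcont h t) ->
  (forall t, 0 <= t -> Cmod (h t) <= K * exp (- (a * t))) -> clim (CInt h 0) (CInt_inf h) /\ Cmod (CInt_inf h) <= K / a.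
Proof.
  intros Ha Hc Hb. destruct (exp_dominated h K a Ha Hc Hb) as [l [Hl B]].
  unfold CInt_inf. rewrite (Clim_unique _ _ Hl). split; auto.
  specialize (B 0 ltac:(lra)). rewrite Rmult_0_r, Ropp_0, exp_0, Rmult_1_r in B.
  rewrite (is_CInt_unique _ _ _ _ (is_CInt_point h 0)) in B.
  replace (RtoC 0 - l)%C with (- l)%C in B by ring. rewrite Cmod_opp in B. exact B.
Qed.

Lemma CInt_inf_cmult (c : C) (h : R -> C) : (forall t, 0 <= t -> rcont h t) -> clim (CInt h 0) (CInt_inf h) ->
  CInt_inf (fun t => c * h t)%C = (c * CInt_inf h)%C.
Proof.
  intros Hc Hl. apply Clim_unique. eapply clim_ext_ge with (T1 := 0); [|apply (clim_cmult c _ _ Hl)].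
  intros T HT. symmetry. apply is_CInt_unique, is_CInt_cmult, CInt_correct.
  intros t Ht. rewrite Rmin_left in Ht by lra. apply Hc. lra.
Qed.

Section FarInversion.
Variables (H : C -> Prop) (r : R -> R) (c k A : R).
Hypothesis HD : log_domain H r c k A.
Variables (g : C -> C) (M : R).
Hypothesis Hg : regular H g M.
Variables (w0 a : C) (L m tau : R).
Hypothesis Hw0 : H w0.
Hypothesis Ha : H a.
Hypothesis HL : 0 <= L.
Hypothesis Hm : 0 < m.
Hypothesis Htau : 0 < tau.
Hypothesis Hmt : 1 < tau * m.

Notation om := (w0 - RtoC L)%C.
Notation dir sg := ((-1, (sg * m)%R) : C).
Notation Lf := (Laplace H g w0).

Hypothesis Rays : forall sg u, sg = 1 \/ sg = -1 -> 0 <= u -> H (om + RtoC u * dir sg)%C.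
Hypothesis Far : tau * Rabs (Im (a - om)%C) < - Re (a - om)%C.

(** The two parts of [Laplace_formula] times [e^(pa)], with the integrand divided by [a - w']: this
    division integrates [e^(p (a - w'))] in [p]. *)
Definition horizontal_term (p : C) : C :=
  CInt (fun t => g (w0 + RtoC t * - RtoC L) * - RtoC L / (a - (w0 + RtoC t * - RtoC L)) * Cexp (p * (a - (w0 + RtoC t * - RtoC L))))%C 0 1.

Definition ray_density (sg u : R) : C := (g (om + RtoC u * dir sg) * dir sg / (a - (om + RtoC u * dir sg)))%C.

Definition ray_term (sg : R) (p : C) : C :=
  CInt_inf (fun u => ray_density sg u * Cexp (p * (a - (om + RtoC u * dir sg))))%C.

Lemma far_left : Re (a - om)%C < 0 /\ Rabs (Im (a - om)%C) < m * - Re (a - om)%C.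
Proof.
  pose proof (Rabs_pos (Im (a - om)%C)). assert (Re (a - om)%C < 0) by nra. split; auto.
  apply Rmult_lt_reg_l with tau; auto. eapply Rlt_le_trans; [exact Far|]. nra.
Qed.

(** The combination [- m Re z - sg Im z] is constant along the ray, positive because [a] lies inside
    the sector, and at most [(m + 1) |z|]. *)
Lemma ray_distance sg : sg = 1 \/ sg = -1 -> exists d, 0 < d /\ forall u, 0 <= u -> d <= Cmod (a - (om + RtoC u * dir sg))%C.
Proof.
  intros Hsg. destruct far_left as [F1 F2]. apply Rabs_def2 in F2.
  exists ((m * - Re (a - om)%C - sg * Im (a - om)%C) / (m + 1)). split.
  - apply Rdiv_lt_0_compat; [|lra]. destruct Hsg as [-> | ->]; lra.
  - intros u Hu. set (z := (a - (om + RtoC u * dir sg))%C).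
    assert (E1 : Re z = Re (a - om)%C + u) by (unfold z, Re, Im; simpl; ring).
    assert (E2 : sg * Im z = sg * Im (a - om)%C - m * u).
    { replace (Im z) with (Im (a - om)%C - u * (sg * m)) by (unfold z, Re, Im; simpl; ring). destruct Hsg as [-> | ->]; ring. }
    apply Rmult_le_reg_r with (m + 1); [lra|]. unfold Rdiv. rewrite Rmult_assoc, Rinv_l, Rmult_1_r by lra.
    pose proof (re_le_Cmod z) as B1. pose proof (im_le_Cmod z) as B2.
    assert (B3 : - (sg * Im z) <= Rabs (Im z)).
    { pose proof (Rle_abs (Im z)). pose proof (Rle_abs (- Im z)). rewrite Rabs_Ropp in H1. destruct Hsg as [-> | ->]; lra. }
    pose proof (Rle_abs (- Re z)) as B4. rewrite Rabs_Ropp in B4. nra.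
Qed.

Lemma ray_not_a sg u : sg = 1 \/ sg = -1 -> 0 <= u -> (a - (om + RtoC u * dir sg))%C <> RtoC 0.
Proof.
  intros Hsg Hu E. destruct (ray_distance sg Hsg) as [d [Hd B]]. specialize (B u Hu). rewrite E, Cmod_0 in B. lra.
Qed.

Lemma horizontal_not_a t : 0 <= t <= 1 -> (a - (w0 + RtoC t * - RtoC L))%C <> RtoC 0.
Proof.
  intros Ht E. destruct far_left as [F1 _]. apply (f_equal Re) in E.
  replace (Re (a - (w0 + RtoC t * - RtoC L))%C) with (Re (a - om)%C - (1 - t) * L) in E by (unfold Re, Im; simpl; ring).
  change (Re (RtoC 0)) with 0 in E. assert (0 <= (1 - t) * L) by (pos). lra.
Qed.

Lemma ray_density_cont sg u : sg = 1 \/ sg = -1 -> 0 <= u -> rcont (ray_density sg) u.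
Proof.
  intros Hsg Hu. unfold ray_density. apply cont_Cdiv; [|csolve|apply ray_not_a; auto].
  apply cont_Cmult; [|csolve]. apply (cont_comp_C (fun u : R => om + RtoC u * dir sg)%C); [csolve|apply (proj1 Hg)].
Qed.

Lemma ray_term_bound sg : sg = 1 \/ sg = -1 -> exists K, 0 < K /\ forall p u, 0 <= u ->
  Cmod (ray_density sg u * Cexp (p * (a - (om + RtoC u * dir sg))))%C <= K * exp (Re (p * (a - om))%C) * exp (- (Re (p * dir sg)%C * u)).
Proof.
  intros Hsg. destruct (ray_distance sg Hsg) as [d [Hd B]]. destruct Hg as [G1 [G2 G3]].
  pose proof (M_nonneg H r c k A HD g M G3) as HM. pose proof (Cmod_ge_0 (dir sg)) as Hv.
  exists (M * Cmod (dir sg) / d + 1). split.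
  { assert (0 <= M * Cmod (dir sg) / d) by (pos). lra. }
  intros p u Hu. rewrite Cmod_mult, Cmod_Cexp.
  replace (Re (p * (a - (om + RtoC u * dir sg)))%C) with (Re (p * (a - om))%C + - (Re (p * dir sg)%C * u)) by (unfold Re, Im; simpl; ring).
  rewrite exp_plus, <- Rmult_assoc. apply Rmult_le_compat_r; [pos|]. apply Rmult_le_compat_r; [pos|].
  unfold ray_density. rewrite Cmod_div by (apply ray_not_a; auto). rewrite Cmod_mult.
  apply Rle_trans with (M * Cmod (dir sg) / d); [|lra].
  unfold Rdiv. apply Rmult_le_compat; [apply Rmult_le_pos; apply Cmod_ge_0|left; apply Rinv_0_lt_compat; specialize (B u Hu); lra| |].
  - apply Rmult_le_compat_r; auto. apply G3, (H_closure _ _ _ _ _ HD), Rays; auto.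
  - apply Rinv_le_contravar; auto.
Qed.

Lemma ray_exp_cont sg p u : sg = 1 \/ sg = -1 -> 0 <= u -> rcont (fun u => ray_density sg u * Cexp (p * (a - (om + RtoC u * dir sg))))%C u.
Proof. intros Hsg Hu. apply cont_Cmult; [apply ray_density_cont; auto|csolve]. Qed.

Lemma good_ray_dir sg p : sg = 1 \/ sg = -1 -> 0 < Re (p * dir sg)%C -> good_ray H p om (dir sg).
Proof.
  intros Hsg Hp. split; [|split; [simpl; lra|auto]]. intros t Ht. apply (H_closure _ _ _ _ _ HD), Rays; auto.
Qed.

(** One primitive of [Lf p * Cexp (p * a)] for each of the two rays, valid on the half-plane where
    that ray is admissible. Both half-planes contain [-1]. *)
Lemma term_cder sg p : sg = 1 \/ sg = -1 -> 0 < Re (p * dir sg)%C ->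
  cder (fun p => horizontal_term p + ray_term sg p)%C p (Lf p * Cexp (p * a))%C.
Proof.
  intros Hsg Hp. destruct Hg as [G1 [G2 G3]].
  pose proof (good_ray_dir sg p Hsg Hp) as GR.
  rewrite (Laplace_is H r c k A HD g M G1 G2 G3 w0 p _ (is_Laplace_formula H r c k A HD g M G1 G3 w0 L (dir sg) p (H_closure _ _ _ _ _ HD _ Hw0) HL GR)).
  unfold Laplace_formula. rewrite Cmult_plus_distr_r. apply cder_plus.
  - assert (E : (CInt (fun t => LK g p (w0 + RtoC t * - RtoC L) * - RtoC L) 0 1 * Cexp (p * a))%C =
      CInt (fun t => g (w0 + RtoC t * - RtoC L) * - RtoC L / (a - (w0 + RtoC t * - RtoC L)) * (a - (w0 + RtoC t * - RtoC L)) * Cexp (p * (a - (w0 + RtoC t * - RtoC L))))%C 0 1).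
    { symmetry. apply is_CInt_unique. rewrite Cmult_comm.
      eapply is_CInt_ext; [|apply is_CInt_cmult, CInt_correct_all].
      - intros t Ht. ordered in Ht. cbv beta. unfold LK.
        replace (p * (a - (w0 + RtoC t * - RtoC L)))%C with (p * a + - (p * (w0 + RtoC t * - RtoC L)))%C by ring. rewrite Cexp_plus.
        field. apply horizontal_not_a. lra.
      - intros t. apply cont_Cmult; [|csolve]. apply (cont_comp_C (fun t : R => w0 + RtoC t * - RtoC L)%C); [csolve|apply LK_cont; auto]. }
    rewrite E. unfold horizontal_term.
    apply (cder_exp_integral (fun t => g (w0 + RtoC t * - RtoC L) * - RtoC L / (a - (w0 + RtoC t * - RtoC L)))%C (fun t => a - (w0 + RtoC t * - RtoC L))%C 0 1 p).
    + intros t Ht. ordered in Ht. apply cont_Cdiv; [|csolve|apply horizontal_not_a; auto].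
      apply cont_Cmult; [|csolve]. apply (cont_comp_C (fun t : R => w0 + RtoC t * - RtoC L)%C); [csolve|apply G1].
    + intros t _. csolve.
  - pose proof (ray_integral_exists H g M G1 G3 p om (dir sg) GR) as RI.
    assert (E : (CInt_inf (fun t => LK g p (om + RtoC t * dir sg) * dir sg) * Cexp (p * a))%C =
      CInt_inf (fun u => ray_density sg u * (a - (om + RtoC u * dir sg)) * Cexp (p * (a - (om + RtoC u * dir sg))))%C).
    { rewrite Cmult_comm, <- CInt_inf_cmult; auto.
      - symmetry. apply Clim_unique. eapply clim_ext_ge with (T1 := 0);
          [|rewrite CInt_inf_cmult; [apply clim_cmult; exact RI| |exact RI]].
        + intros T HT. symmetry. apply is_CInt_unique. eapply is_CInt_ext; [|apply is_CInt_cmult, CInt_correct_all].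
          * intros u Hu. rewrite Rmin_left in Hu by lra. cbv beta. unfold LK, ray_density.
            replace (p * (a - (om + RtoC u * dir sg)))%C with (p * a + - (p * (om + RtoC u * dir sg)))%C by ring. rewrite Cexp_plus.
            field. apply ray_not_a; auto; lra.
          * intros u. apply cont_Cmult; [|csolve]. apply (cont_comp_C (fun t : R => om + RtoC t * dir sg)%C); [csolve|apply LK_cont; auto].
        + intros t _. apply cont_Cmult; [|csolve]. apply (cont_comp_C (fun t : R => om + RtoC t * dir sg)%C); [csolve|apply LK_cont; auto].
      - intros t _. apply cont_Cmult; [|csolve]. apply (cont_comp_C (fun t : R => om + RtoC t * dir sg)%C); [csolve|apply LK_cont; auto]. }
    rewrite E. unfold ray_term.
    destruct (ray_term_bound sg Hsg) as [K [HK B]].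
    set (K2 := Rmax (K * exp (Re (p * (a - om))%C)) (Cmod (a - om) + Cmod (dir sg) + 1)).
    assert (K2a : K * exp (Re (p * (a - om))%C) <= K2) by apply Rmax_l.
    assert (K2b : Cmod (a - om) + Cmod (dir sg) + 1 <= K2) by apply Rmax_r.
    pose proof (Cmod_ge_0 (a - om)) as P1. pose proof (Cmod_ge_0 (dir sg)) as P2.
    apply (cder_exp_integral_inf (ray_density sg) (fun u => a - (om + RtoC u * dir sg))%C K2 (Re (p * dir sg)%C) p); auto.
    + lra.
    + intros u Hu. apply ray_density_cont; auto.
    + intros u _. csolve.
    + intros u Hu. replace (a - (om + RtoC u * dir sg))%C with ((a - om) - RtoC u * dir sg)%C by ring.
      eapply Rle_trans; [apply Cmod_triangle_minus|]. rewrite Cmod_mult, Cmod_R, Rabs_right by lra. nra.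
    + intros u Hu. eapply Rle_trans; [apply B; auto|]. apply Rmult_le_compat_r; [pos|auto].
Qed.

Notation lat sg := ((1, (- (sg * tau))%R) : C).

Lemma lat_dir sg : sg = 1 \/ sg = -1 -> Re (lat sg * dir sg)%C = tau * m - 1.
Proof. intros [-> | ->]; unfold Re; simpl; ring. Qed.

(** [Far] makes [Re (lat sg * (a - om))] negative and [Hmt] makes [Re (lat sg * dir sg)] positive,
    so every exponential decays, uniformly along the horizontal segment and integrably along the
    ray. *)
Lemma term_decay sg : sg = 1 \/ sg = -1 -> clim (fun T => horizontal_term (RtoC T * lat sg) + ray_term sg (RtoC T * lat sg))%C (RtoC 0).
Proof.
  intros Hsg. destruct (ray_term_bound sg Hsg) as [K [HK B]]. destruct Hg as [G1 _].
  set (al := - Re (a - om)%C - tau * Rabs (Im (a - om)%C)).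
  assert (Hal : 0 < al) by (unfold al; lra).
  assert (Dir : Re (lat sg * (a - om))%C <= - al).
  { rewrite Re_mult. simpl (Re (lat sg)). simpl (Im (lat sg)). unfold al.
    pose proof (Rle_abs (Im (a - om)%C)) as Q1. pose proof (Rle_abs (- Im (a - om)%C)) as Q2. rewrite Rabs_Ropp in Q2.
    assert (sg * Im (a - om)%C <= Rabs (Im (a - om)%C)) by (destruct Hsg as [-> | ->]; lra).
    change (Re (1, - (sg * tau))) with 1. change (Im (1, - (sg * tau))) with (- (sg * tau)). nra. }
  destruct (bounded_on_segment (fun t => g (w0 + RtoC t * - RtoC L) * - RtoC L / (a - (w0 + RtoC t * - RtoC L)))%C 0 1) as [N [HN BN]].
  { intros t Ht. ordered in Ht. apply cont_Cdiv; [|csolve|apply horizontal_not_a; auto].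
    apply cont_Cmult; [|csolve]. apply (cont_comp_C (fun t : R => w0 + RtoC t * - RtoC L)%C); [csolve|apply G1]. }
  intros eps Heps. destruct (exp_decay_small (N + K / (tau * m - 1)) al eps Hal Heps) as [T0 [HT0 Dec]].
  exists (T0 + 1). intros T HT. eapply Rle_lt_trans; [|apply (Dec T); lra].
  match goal with |- Cmod ?x <= _ => replace x with (horizontal_term (RtoC T * lat sg) + ray_term sg (RtoC T * lat sg))%C by ring end.
  tri. rewrite Rmult_plus_distr_r.
  assert (Re_T : forall z : C, Re (RtoC T * lat sg * z)%C = T * Re (lat sg * z)%C) by (intros z; unfold Re; simpl; ring).
  apply Rplus_le_compat.
  - unfold horizontal_term. replace (N * exp (- (al * T))) with (Rabs (1 - 0) * (N * exp (- (al * T)))) by (rewrite Rabs_right by lra; ring).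
    eapply is_CInt_norm_const; [|apply CInt_correct].
    + intros t Ht. cbv beta. rewrite Cmod_mult, Cmod_Cexp. apply Rmult_le_compat; [apply Cmod_ge_0|pos|apply (BN t Ht)|].
      apply exp_le_le. rewrite Re_T. ordered in Ht.
      replace (Re (lat sg * (a - (w0 + RtoC t * - RtoC L)))%C) with (Re (lat sg * (a - om))%C - (1 - t) * L) by (unfold Re; simpl; ring).
      assert (0 <= (1 - t) * L) by (pos). nra.
    + intros t Ht. ordered in Ht. apply cont_Cmult; [|csolve]. apply cont_Cdiv; [|csolve|apply horizontal_not_a; auto].
      apply cont_Cmult; [|csolve]. apply (cont_comp_C (fun t : R => w0 + RtoC t * - RtoC L)%C); [csolve|apply G1].
  - apply Rle_trans with (K * exp (- (al * T)) / (tau * m - 1)); [|right; field; lra].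
    apply exp_dominated_inf; [lra| |].
    + intros u Hu. apply ray_exp_cont; auto.
    + intros u Hu. eapply Rle_trans; [apply B; auto|]. rewrite !Re_T, lat_dir by auto.
      apply Rmult_le_compat; [pos|pos| |].
      * apply Rmult_le_compat_l; [lra|]. apply exp_le_le. nra.
      * apply exp_le_le. assert (0 <= (tau * m - 1) * u) by (pos). nra.
Qed.

(** At [p = -1] the integrands of the ray terms are, up to sign, those of [sector_Cauchy]. *)
Lemma ray_term_difference : (ray_term 1 (- (1)) - ray_term (-1) (- (1)))%C = (- (2 * Ci * RtoC PI * g a))%C.
Proof.
  destruct far_left as [F1 F2].
  assert (Hleft : Rabs (Im a - Im om) < m * (Re om - Re a)).
  { replace (Im a - Im om) with (Im (a - om)%C) by (unfold Im; simpl; ring). replace (Re om - Re a) with (- Re (a - om)%C) by (unfold Re; simpl; ring). exact F2. }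
  pose proof (sector_Cauchy H r c k A HD g M Hg a om m Ha Hm Rays Hleft) as SC.
  assert (Cl : forall sg, sg = 1 \/ sg = -1 -> clim (fun S => CInt (fun u => Cauchy_integrand g a (om + RtoC u * dir sg) * dir sg)%C 0 S) (- ray_term sg (- (1)))%C).
  { intros sg Hsg. destruct (ray_term_bound sg Hsg) as [K [HK B]].
    assert (Hp : Re (- (1) * dir sg)%C = 1) by (unfold Re; simpl; ring).
    destruct (exp_dominated_inf (fun u => ray_density sg u * Cexp (- (1) * (a - (om + RtoC u * dir sg))))%C (K * exp (Re (- (1) * (a - om))%C)) 1) as [Cv _].
    - lra.
    - intros u Hu. apply ray_exp_cont; auto.
    - intros u Hu. pose proof (B (- (1))%C u Hu) as Bu. rewrite Hp in Bu. exact Bu.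
    - eapply clim_ext_ge with (T1 := 0); [|apply clim_opp; exact Cv].
      intros T HT. symmetry. apply is_CInt_unique. eapply is_CInt_ext; [|apply is_CInt_opp, CInt_correct].
      + intros u Hu. rewrite Rmin_left in Hu by lra. cbv beta. unfold ray_density, Cauchy_integrand.
        replace (- (1) * (a - (om + RtoC u * dir sg)))%C with (om + RtoC u * dir sg - a)%C by ring.
        field. split; [|apply ray_not_a; auto; lra].
        intros E. apply (ray_not_a sg u Hsg ltac:(lra)). 
        replace (a - (om + RtoC u * dir sg))%C with (- (om + RtoC u * dir sg - a))%C by ring. rewrite E. ring.
      + intros u Hu. rewrite Rmin_left in Hu by lra. apply ray_exp_cont; auto; lra. }
  pose proof (clim_minus _ _ _ _ (Cl 1 ltac:(auto)) (Cl (-1) ltac:(auto))) as CM.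
  pose proof (clim_unique _ _ _ SC CM) as E. rewrite E. ring.
Qed.

(** The primitives vanish at infinity, so each path from [-1] contributes minus the value at [-1].
    The horizontal terms cancel in the difference and the ray terms give [g a]. *)
Lemma far_inversion t0 : 0 < t0 -> exists Y : R -> C,
  (forall sg, sg = 1 \/ sg = -1 -> clim (fun S => first_leg (fun p => Lf p * Cexp (p * a))%C t0 (lat sg) +
      second_leg (fun p => Lf p * Cexp (p * a))%C t0 (lat sg) S)%C (Y sg)) /\
  (Y (-1) - Y 1)%C = (- (2 * Ci * RtoC PI * g a))%C.
Proof.
  intros Ht0. exists (fun sg => RtoC 0 - (horizontal_term (- (1)) + ray_term sg (- (1))))%C. split.
  2: { rewrite <- ray_term_difference. ring. }
  intros sg Hsg. set (F := fun p => (Lf p * Cexp (p * a))%C).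
  set (Z := fun p => (horizontal_term p + ray_term sg p)%C).
  assert (DF : forall p, 0 < Re (p * dir sg)%C -> ccont F p).
  { intros p Hp. unfold F. apply cont_Cmult; [|csolve]. apply differentiable_cont. destruct Hg as [G1 [G2 G3]].
    apply (Laplace_differentiable H r c k A HD g M G1 G2 G3); [apply (H_closure _ _ _ _ _ HD); auto|].
    apply (good_ray_slit H p om (dir sg)). apply good_ray_dir; auto. }
  assert (E1 : first_leg F t0 (lat sg) = (Z (RtoC t0 * lat sg) - Z (- (1)))%C).
  { unfold first_leg. apply is_CInt_unique.
    assert (Pos : forall t, Rmin 0 1 <= t <= Rmax 0 1 -> 0 < Re ((- (1) + RtoC t * (RtoC t0 * lat sg + 1)) * dir sg)%C).
    { intros t Ht. ordered in Ht.
      replace (Re ((- (1) + RtoC t * (RtoC t0 * lat sg + 1)) * dir sg)%C) with ((1 - t) + t * t0 * Re (lat sg * dir sg)%C) by (unfold Re; simpl; ring).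
      rewrite lat_dir by auto. destruct (Req_dec t 1) as [->|N].
      - assert (0 < t0 * (tau * m - 1)) by (pos). lra.
      - assert (0 <= t * t0 * (tau * m - 1)) by (pos). lra. }
    pose proof (is_CInt_segment Z F (- (1))%C (RtoC t0 * lat sg + 1)%C 0 1
      (fun t Ht => term_cder sg _ Hsg (Pos t Ht)) (fun t Ht => DF _ (Pos t Ht))) as Sg.
    replace (- (1) + RtoC 1 * (RtoC t0 * lat sg + 1))%C with (RtoC t0 * lat sg)%C in Sg by ring.
    replace (- (1) + RtoC 0 * (RtoC t0 * lat sg + 1))%C with (- (1))%C in Sg by ring. exact Sg. }
  assert (E2 : forall S, 0 < S -> second_leg F t0 (lat sg) S = (Z (RtoC (1 * S + t0) * lat sg) - Z (RtoC t0 * lat sg))%C).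
  { intros S HS. unfold second_leg. apply is_CInt_unique.
    replace (RtoC (1 * S + t0) * lat sg)%C with (RtoC t0 * lat sg + RtoC S * lat sg)%C by (rewrite RtoC_plus, RtoC_mult; ring).
    assert (Pos : forall t, Rmin 0 S <= t <= Rmax 0 S -> 0 < Re ((RtoC t0 * lat sg + RtoC t * lat sg) * dir sg)%C).
    { intros t Ht. ordered in Ht.
      replace (Re ((RtoC t0 * lat sg + RtoC t * lat sg) * dir sg)%C) with ((t0 + t) * Re (lat sg * dir sg)%C) by (unfold Re; simpl; ring).
      rewrite lat_dir by auto. pos. }
    pose proof (is_CInt_segment Z F (RtoC t0 * lat sg)%C (lat sg) 0 S
      (fun t Ht => term_cder sg _ Hsg (Pos t Ht)) (fun t Ht => DF _ (Pos t Ht))) as Sg.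
    replace (RtoC t0 * lat sg + RtoC 0 * lat sg)%C with (RtoC t0 * lat sg)%C in Sg by ring. exact Sg. }
  pose proof (clim_affine _ _ 1 t0 ltac:(lra) (term_decay sg Hsg)) as TD.
  pose proof (clim_minus _ _ _ _ TD (clim_const (Z (- (1))%C))) as TM.
  eapply clim_ext_ge with (T1 := 0); [|exact TM]. intros S HS. cbv beta. rewrite E1, (E2 S HS). unfold Z. ring.
Qed.
End FarInversion.

(** * Abel summation of a convergent improper integral *)

Lemma rderive_mult (f h : R -> C) t (l m : C) : rderive f t l -> rderive h t m ->
  rderive (fun s => f s * h s)%C t (l * h t + f t * m)%C.
Proof.
  intros Df Dh.
  pose proof (is_derive_plus (V := C_R_NormedModule) _ _ _ _ _ Df Dh) as Ds.
  pose proof (rderive_comp _ _ _ _ _ (cder_sqr _) Ds) as S1. pose proof (rderive_comp _ _ _ _ _ (cder_sqr _) Df) as S2. pose proof (rderive_comp _ _ _ _ _ (cder_sqr _) Dh) as S3.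
  pose proof (is_derive_minus (V := C_R_NormedModule) _ _ _ _ _ (is_derive_minus (V := C_R_NormedModule) _ _ _ _ _ S1 S2) S3) as S4.
  pose proof (rderive_comp _ _ _ _ _ (cder_scal (/ 2)%C _ _ _ (cder_id _)) S4) as S5.
  eapply (is_derive_ext (V := C_R_NormedModule)); [|replace (l * h t + f t * m)%C with (/ 2 * 1 * (2 * (f t + h t) * (l + m) - 2 * f t * l - 2 * h t * m))%C; [exact S5|]].
  - intros s. cbn. change (minus ?x ?y) with (x - y)%C. change (plus ?x ?y) with (x + y)%C.
    transitivity (/ 2 * (((f s + h s) * (f s + h s)) - f s * f s - h s * h s))%C; [reflexivity|]. field.
  - field.
Qed.

Lemma Cexp_near_1 (z : C) eps : 0 < eps -> exists d, 0 < d /\ forall c, 0 < c < d -> Cmod (Cexp (- (RtoC c * z)) - 1) < eps.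
Proof.
  intros He. assert (Cc : ccont (fun x : C => Cexp (- (x * z))) (RtoC 0)) by csolve.
  destruct (proj1 (ccont_eps _ _) Cc eps He) as [d [Hd B]]. exists d. split; auto. intros c Hc.
  specialize (B (RtoC c)). replace (Cexp (- (RtoC 0 * z))) with (RtoC 1) in B by (replace (- (RtoC 0 * z))%C with (RtoC 0) by ring; symmetry; apply Cexp_0).
  apply B. replace (RtoC c - RtoC 0)%C with (RtoC c) by ring. rewrite Cmod_R, Rabs_right; lra.
Qed.

Lemma clim_bounded (I : R -> C) l : (forall t, 0 <= t -> rcont I t) -> clim I l -> exists N, 0 < N /\ forall t, 0 <= t -> Cmod (I t) <= N.
Proof.
  intros Hc Hl. destruct (Hl 1 ltac:(lra)) as [T0 B]. set (T := Rmax 0 T0 + 1).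
  destruct (bounded_on_segment I 0 T) as [N [HN BN]].
  { intros t Ht. apply Hc. unfold T in Ht. pose proof (Rmax_l 0 T0). rewrite Rmin_left in Ht; lra. }
  assert (HT : 0 < T /\ T0 < T) by (unfold T; pose proof (Rmax_l 0 T0); pose proof (Rmax_r 0 T0); lra).
  exists (N + Cmod l + 1). pose proof (Cmod_ge_0 l). split; [lra|]. intros t Ht.
  destruct (Rle_dec t T) as [Q|Q].
  - specialize (BN t). ordered in BN. specialize (BN (conj Ht Q)). lra.
  - specialize (B t ltac:(lra)). pose proof (Cmod_rev_triangle (I t) l). lra.
Qed.

Section Abel.
Variables (b : R -> C) (l e : C) (t0 : R).
Hypothesis Hb : forall s, 0 <= s -> rcont b s.
Hypothesis Hl : clim (CInt b 0) l.
Hypothesis He : Re e = 1.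
Hypothesis Ht0 : 0 < t0.

Notation pt s := (RtoC t0 * e + RtoC s * e)%C.

(** [b] is frozen to the left of 0, where its continuity is unknown, so that the running integral is
    differentiable on the whole line. *)
Definition running (s : R) : C := CInt (fun u => b (Rmax 0 u)) 0 s.

Lemma nonneg_part_cont u : rcont (fun u => b (Rmax 0 u)) u.
Proof.
  apply rcont_eps. intros eps Heps. destruct (proj1 (rcont_eps _ _) (Hb (Rmax 0 u) (Rmax_l _ _)) eps Heps) as [d [Hd B]].
  exists d. split; auto. intros s Hs. apply B. eapply Rle_lt_trans; [|exact Hs].
  unfold Rmax, Rabs. destruct (Rle_dec 0 s), (Rle_dec 0 u); repeat match goal with |- context [Rcase_abs ?x] => destruct (Rcase_abs x) end; lra.
Qed.

Lemma running_eq S : 0 <= S -> running S = CInt b 0 S.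
Proof. intros HS. apply CInt_ext. intros u Hu. rewrite Rmin_left in Hu by lra. rewrite Rmax_right by lra. reflexivity. Qed.

Lemma running_clim : clim running l.
Proof. eapply clim_ext_ge with (T1 := 0); [|exact Hl]. intros T HT. symmetry. apply running_eq. lra. Qed.

Lemma running_cont s : rcont running s.
Proof. apply (ex_derive_continuous (V := C_R_NormedModule)). eexists. apply rderive_CInt. apply nonneg_part_cont. Qed.

Lemma damping (z : C) s : Re (- (z * pt s))%C = - (Re (z * e)%C * t0) + - (Re (z * e)%C * s).
Proof. unfold Re; simpl; ring. Qed.

Lemma integration_by_parts (z : C) S : 0 <= S ->
  CInt (fun s => b s * Cexp (- (z * pt s)))%C 0 S =
  (running S * Cexp (- (z * pt S)) + z * e * CInt (fun s => running s * Cexp (- (z * pt s))) 0 S)%C.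
Proof.
  intros HS.
  assert (D : forall s, rderive (fun s => running s * Cexp (- (z * pt s)))%C s
    (b (Rmax 0 s) * Cexp (- (z * pt s)) + running s * (Cexp (- (z * pt s)) * - (z * e)))%C).
  { intros s. apply rderive_mult; [apply (rderive_CInt (fun u => b (Rmax 0 u)) 0 s), nonneg_part_cont|].
    apply (rderive_comp Cexp (fun s => - (z * pt s))%C); [apply cder_Cexp|].
    eapply (is_derive_ext (V := C_R_NormedModule)); [|apply (rderive_affine (- (z * (RtoC t0 * e)))%C (- (z * e))%C)]. intros u. simpl. ring. }
  assert (C1 : forall s, rcont (fun s => b (Rmax 0 s) * Cexp (- (z * pt s)))%C s) by (intros; apply cont_Cmult; [apply nonneg_part_cont|csolve]).
  assert (C2 : forall s, rcont (fun s => running s * Cexp (- (z * pt s)))%C s) by (intros; apply cont_Cmult; [apply running_cont|csolve]).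
  pose proof (is_CInt_rderive _ _ 0 S (fun s _ => D s)) as P.
  assert (P2 := P ltac:(intros s _; apply cont_Cplus; [apply C1|apply cont_Cmult; [apply running_cont|csolve]])). clear P.
  pose proof (is_CInt_plus _ _ _ _ _ _ (CInt_correct_all _ 0 S C1) (is_CInt_cmult (- (z * e))%C _ _ _ _ (CInt_correct_all _ 0 S C2))) as Q.
  assert (E : (running S * Cexp (- (z * pt S)) - running 0 * Cexp (- (z * pt 0)))%C =
    (CInt (fun s => b (Rmax 0 s) * Cexp (- (z * pt s))) 0 S + - (z * e) * CInt (fun s => running s * Cexp (- (z * pt s))) 0 S)%C).
  { eapply is_CInt_inj; [exact P2|]. eapply is_CInt_ext; [|exact Q]. intros s _. cbv beta. ring. }
  assert (R0 : running 0 = RtoC 0) by (apply is_CInt_unique, is_CInt_point).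
  rewrite R0 in E.
  rewrite (CInt_ext (fun s => b s * Cexp (- (z * pt s)))%C (fun s => b (Rmax 0 s) * Cexp (- (z * pt s)))%C).
  - replace (running S * Cexp (- (z * pt S)))%C with (running S * Cexp (- (z * pt S)) - RtoC 0 * Cexp (- (z * pt 0)))%C by ring.
    rewrite E. symmetry. match goal with |- ?a = ?b => enough (X : @eq C a b) by exact X end. ring.
  - intros s Hs. rewrite Rmin_left in Hs by lra. rewrite Rmax_right by lra. reflexivity.
Qed.

(** The damped integral of [b], after integration by parts. The integral of [b] need not converge
    absolutely, but [running] is bounded, so this form converges absolutely and is holomorphic for
    [Re (z e) > 0]. *)
Definition damped (z : C) : C := (z * e * CInt_inf (fun s => running s * Cexp (z * - pt s)))%C.

Lemma damped_term z s : (running s * Cexp (- (z * pt s)))%C = (running s * Cexp (z * - pt s))%C.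
Proof. f_equal. f_equal. ring. Qed.

Lemma damped_bound : exists N, 0 < N /\ forall z s, 0 <= s ->
  Cmod (running s * Cexp (z * - pt s))%C <= N * exp (- (Re (z * e)%C * t0)) * exp (- (Re (z * e)%C * s)).
Proof.
  destruct (clim_bounded running l) as [N [HN B]]; [intros; apply running_cont|apply running_clim|].
  exists N. split; auto. intros z s Hs. rewrite <- damped_term, Cmod_mult, Cmod_Cexp, damping, exp_plus.
  rewrite <- Rmult_assoc. apply Rmult_le_compat_r; [pos|]. apply Rmult_le_compat_r; [pos|auto].
Qed.

Lemma damped_differentiable z : 0 < Re (z * e)%C -> differentiable damped z.
Proof.
  intros Hz. destruct damped_bound as [N [HN B]].
  set (K := Rmax (N * exp (- (Re (z * e)%C * t0))) ((t0 + 1) * Cmod e)).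
  assert (K1 : N * exp (- (Re (z * e)%C * t0)) <= K) by apply Rmax_l. assert (K2 : (t0 + 1) * Cmod e <= K) by apply Rmax_r.
  pose proof (exp_pos (- (Re (z * e)%C * t0))) as Ep. assert (0 < K) by nra.
  unfold damped. apply differentiable_mult.
  - apply differentiable_mult; [eexists; apply cder_id|eexists; apply cder_const].
  - eexists. apply (cder_exp_integral_inf running (fun s => - pt s)%C K (Re (z * e)%C)); auto.
    + intros; apply running_cont.
    + intros s _. csolve.
    + intros s Hs. rewrite Cmod_opp. replace (pt s) with (RtoC (t0 + s) * e)%C by (rewrite RtoC_plus; ring).
      rewrite Cmod_mult, Cmod_R, Rabs_right by lra. pose proof (Cmod_ge_0 e). assert (0 <= t0 * s * Cmod e) by (pos). nra.
    + intros s Hs. eapply Rle_trans; [apply B; auto|]. apply Rmult_le_compat_r; [pos|auto].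
Qed.

Lemma damped_inf_clim z : 0 < Re (z * e)%C ->
  clim (CInt (fun s => running s * Cexp (z * - pt s))%C 0) (CInt_inf (fun s => running s * Cexp (z * - pt s))%C).
Proof.
  intros Hz. destruct damped_bound as [N [HN B]].
  apply (exp_dominated_inf _ (N * exp (- (Re (z * e)%C * t0))) (Re (z * e)%C) Hz).
  - intros s _. apply cont_Cmult; [apply running_cont|csolve].
  - intros s Hs. apply B; auto.
Qed.

Lemma damped_clim z : 0 < Re (z * e)%C -> clim (CInt (fun s => b s * Cexp (- (z * pt s)))%C 0) (damped z).
Proof.
  intros Hz. destruct damped_bound as [N [HN B]].
  assert (V : clim (fun S => running S * Cexp (- (z * pt S)))%C (RtoC 0)).
  { intros eps Heps. destruct (exp_decay_small (N * exp (- (Re (z * e)%C * t0))) (Re (z * e)%C) eps Hz Heps) as [T0 [HT0 Dec]].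
    exists T0. intros T HT. replace (running T * Cexp (- (z * pt T)) - RtoC 0)%C with (running T * Cexp (- (z * pt T)))%C by ring.
    rewrite damped_term. eapply Rle_lt_trans; [apply B; lra|apply Dec; auto]. }
  pose proof (clim_plus _ _ _ _ V (clim_cmult (z * e)%C _ _ (damped_inf_clim z Hz))) as CP.
  replace (damped z) with (RtoC 0 + damped z)%C by ring.
  eapply clim_ext_ge with (T1 := 0); [|exact CP]. intros T HT. rewrite integration_by_parts by lra. cbv beta. f_equal. f_equal.
  apply CInt_ext. intros s _. symmetry. apply damped_term.
Qed.

(** Abel's theorem. Up to the factor [Cexp (- (c * pt 0))] on [l], the difference is [c e] times the
    damped integral of [running - l]: small on [[0, S0]] because of the factor [c], and beyond
    because [running] is close to [l] while [c] times the integral of [e^(- c s)] is at most 1. *)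
Lemma damped_limit eps : 0 < eps -> exists d, 0 < d /\ forall c, 0 < c < d -> Cmod (damped (RtoC c) - l) < eps.
Proof.
  intros Heps.
  assert (He1 : 0 < Cmod e) by (pose proof (re_le_Cmod e) as Q; rewrite He, Rabs_R1 in Q; lra).
  set (e1 := eps / (4 * Cmod e)). assert (H1 : 0 < e1) by (pos).
  destruct (running_clim e1 H1) as [T0 BT]. set (S0 := Rmax 0 T0 + 1).
  assert (HS0 : 0 < S0 /\ T0 < S0) by (unfold S0; pose proof (Rmax_l 0 T0); pose proof (Rmax_r 0 T0); lra).
  destruct (clim_bounded running l) as [N [HN B]]; [intros; apply running_cont|apply running_clim|].
  pose proof (Cmod_ge_0 l) as Hl0.
  set (d1 := eps / (4 * (Cmod e * ((N + Cmod l) * S0)))).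
  assert (HX : 0 < Cmod e * ((N + Cmod l) * S0)) by (pos).
  assert (Hd1 : 0 < d1) by (pos).
  destruct (Cexp_near_1 (pt 0) (eps / (4 * (Cmod l + 1))) ltac:(pos)) as [d2 [Hd2 B2]].
  exists (Rmin d1 d2). split; [apply Rmin_pos; auto|]. intros c [Hc Hcd].
  assert (Hc1 : c < d1) by (eapply Rlt_le_trans; [exact Hcd|apply Rmin_l]). assert (Hc2 : c < d2) by (eapply Rlt_le_trans; [exact Hcd|apply Rmin_r]).
  assert (Rc : Re (RtoC c * e)%C = c) by (rewrite Re_mult, He; simpl; ring).
  assert (Nc : RtoC c <> RtoC 0) by (intros E; apply (f_equal Re) in E; simpl in E; lra).
  assert (Ne : e <> RtoC 0) by (intros E; rewrite E, Cmod_0 in He1; lra).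
  set (h := fun s => ((running s - l) * Cexp (RtoC c * - pt s))%C).
  assert (Ch : forall s, rcont h s) by (intros; apply cont_Cmult; [apply cont_Cminus; [apply running_cont|csolve]|csolve]).
  assert (Ce : forall S, CInt (fun s => Cexp (RtoC c * - pt s))%C 0 S = ((Cexp (- (RtoC c * pt 0)) - Cexp (- (RtoC c * pt S))) / (RtoC c * e))%C).
  { intros S. apply is_CInt_unique.
    pose proof (is_CInt_rderive (fun s => - (/ (RtoC c * e)) * Cexp (RtoC c * - pt s))%C (fun s => Cexp (RtoC c * - pt s)) 0 S) as P.
    replace ((Cexp (- (RtoC c * pt 0)) - Cexp (- (RtoC c * pt S))) / (RtoC c * e))%C with
      (- (/ (RtoC c * e)) * Cexp (RtoC c * - pt S) - - (/ (RtoC c * e)) * Cexp (RtoC c * - pt 0))%C.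
    - apply P; [|intros; csolve]. intros s _.
      replace (Cexp (RtoC c * - pt s)) with (- / (RtoC c * e) * (Cexp (RtoC c * - pt s)) * (- (RtoC c * e)))%C by (field; auto).
      apply (rderive_comp (fun z => - / (RtoC c * e) * Cexp z)%C (fun s => RtoC c * - pt s)%C); [apply cder_scal, cder_Cexp|].
      eapply (is_derive_ext (V := C_R_NormedModule)); [|apply (rderive_affine (- (RtoC c * (RtoC t0 * e)))%C (- (RtoC c * e))%C)]. intros u. simpl. ring.
    - replace (RtoC c * - pt S)%C with (- (RtoC c * pt S))%C by ring. replace (RtoC c * - pt 0)%C with (- (RtoC c * pt 0))%C by ring. field; auto. }
  assert (Split : forall S, 0 <= S -> (CInt (fun s => running s * Cexp (RtoC c * - pt s)) 0 S = CInt h 0 S + l * CInt (fun s => Cexp (RtoC c * - pt s)) 0 S)%C).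
  { intros S HS. apply is_CInt_unique. eapply is_CInt_ext; [|apply is_CInt_plus; [apply CInt_correct_all; exact Ch|apply is_CInt_cmult, CInt_correct_all; intros; csolve]].
    intros s _. unfold h. cbv beta. ring. }
  assert (Vanish : clim (fun S => Cexp (- (RtoC c * pt S))) (RtoC 0)).
  { intros ep Hep. destruct (exp_decay_small (exp (- (c * t0))) c ep Hc Hep) as [T1 [HT1 Dec]]. exists T1. intros T HT.
    replace (Cexp (- (RtoC c * pt T)) - RtoC 0)%C with (Cexp (- (RtoC c * pt T))) by ring.
    rewrite Cmod_Cexp, damping, Rc, exp_plus. apply Dec; auto. }
  assert (Lim : clim (fun S => RtoC c * e * CInt h 0 S)%C (damped (RtoC c) - l * Cexp (- (RtoC c * pt 0)))%C).
  { pose proof (clim_cmult (RtoC c * e)%C _ _ (damped_inf_clim (RtoC c) ltac:(rewrite Rc; auto))) as L1.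
    pose proof (clim_cmult l _ _ (clim_minus _ _ _ _ (clim_const (Cexp (- (RtoC c * pt 0)))) Vanish)) as L2.
    pose proof (clim_minus _ _ _ _ L1 L2) as L3.
    replace (damped (RtoC c) - l * Cexp (- (RtoC c * pt 0)))%C with (RtoC c * e * CInt_inf (fun s => running s * Cexp (RtoC c * - pt s)) - l * (Cexp (- (RtoC c * pt 0)) - RtoC 0))%C by (unfold damped; ring).
    eapply clim_ext_ge with (T1 := 0); [|exact L3]. intros S HS. cbv beta. rewrite Split, Ce by lra.
    field. auto. }
  assert (Bd : Cmod (damped (RtoC c) - l * Cexp (- (RtoC c * pt 0))) <= eps / 2).
  { eapply clim_norm_le; [exact Lim|]. exists S0. intros S HS.
    rewrite <- (CInt_Chasles h 0 S0 S) by (intros; apply Ch).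
    rewrite !Cmod_mult, Cmod_R, Rabs_right by lra.
    assert (B1 : Cmod (CInt h 0 S0) <= S0 * (N + Cmod l)).
    { replace S0 with (Rabs (S0 - 0)) at 2 by (rewrite Rabs_right; lra). eapply is_CInt_norm_const; [|apply CInt_correct_all; exact Ch].
      intros s Hs. ordered in Hs. unfold h. rewrite <- (Rmult_1_r (N + Cmod l)), Cmod_mult.
      rmul.
      - eapply Rle_trans; [apply Cmod_triangle_minus|]. specialize (B s ltac:(lra)). lra.
      - rewrite Cmod_Cexp. replace (RtoC c * - pt s)%C with (- (RtoC c * pt s))%C by ring. rewrite damping, Rc, <- exp_0. apply exp_le_le. nra. }
    assert (B3 : Cmod (CInt h S0 S) <= e1 / c).
    { eapply Rle_trans; [apply (is_CInt_norm h (fun s => e1 * exp (- (c * s))) S0 S); [lra| |apply CInt_correct_all; exact Ch|apply is_RInt_exp; auto]|].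
      - intros s Hs. unfold h. rewrite Cmod_mult. rmul; [left; apply BT; lra|].
        rewrite Cmod_Cexp. replace (RtoC c * - pt s)%C with (- (RtoC c * pt s))%C by ring. rewrite damping, Rc. apply exp_le_le. nra.
      - assert (0 <= e1 / c) by (pos). assert (exp (- (c * S0)) <= 1) by (rewrite <- exp_0; apply exp_le_le; nra).
        pose proof (exp_pos (- (c * S))). nra. }
    apply Rle_trans with (c * Cmod e * (S0 * (N + Cmod l) + e1 / c)).
    { apply Rmult_le_compat_l; [pos|]. tri. lra. }
    replace (c * Cmod e * (S0 * (N + Cmod l) + e1 / c)) with (c * (Cmod e * ((N + Cmod l) * S0)) + eps / 4) by (unfold e1; field; lra).
    assert (Qd : c * (Cmod e * ((N + Cmod l) * S0)) <= d1 * (Cmod e * ((N + Cmod l) * S0))) by (apply Rmult_le_compat_r; lra).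
    replace (d1 * (Cmod e * ((N + Cmod l) * S0))) with (eps / 4) in Qd by (unfold d1; field; lra). lra. }
  replace (damped (RtoC c) - l)%C with ((damped (RtoC c) - l * Cexp (- (RtoC c * pt 0))) + l * (Cexp (- (RtoC c * pt 0)) - 1))%C by ring.
  tri_lt. rewrite (Cmod_mult l).
  specialize (B2 c (conj Hc Hc2)).
  assert (Cmod l * Cmod (Cexp (- (RtoC c * pt 0)) - 1) <= Cmod l * (eps / (4 * (Cmod l + 1)))) by (apply Rmult_le_compat_l; lra).
  assert (Cmod l * (eps / (4 * (Cmod l + 1))) <= eps / 4).
  { apply Rmult_le_reg_r with (4 * (Cmod l + 1)); [lra|]. replace (Cmod l * (eps / (4 * (Cmod l + 1))) * (4 * (Cmod l + 1))) with (Cmod l * eps) by (field; lra). nra. }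
  lra.
Qed.
End Abel.

(** * The inversion formula at every point of H *)

Section WedgeInversion.
Variables (H : C -> Prop) (r : R -> R) (c k A : R).
Hypothesis HD : log_domain H r c k A.
Variables (g : C -> C) (M : R).
Hypothesis Hg : regular H g M.
Variables (w0 w : C) (tau t0 : R).
Hypothesis Hw0 : H w0.
Hypothesis Hw : H w.
Hypothesis Htau : 0 < tau.
Hypothesis Ht0 : 0 < t0.

Notation Lf := (Laplace H g w0).
Notation lat sg := ((1, (- (sg * tau))%R) : C).
Notation Fat z := (fun p => Lf p * Cexp (p * z))%C.

Lemma two_sided_ray m : exists L, 0 <= L /\ forall sg u, sg = 1 \/ sg = -1 -> 0 <= u ->
  H (w0 - RtoC L + RtoC u * (-1, (sg * m)%R))%C.
Proof.
  destruct (far_ray H r c k A HD w0 m) as [L1 [HL1 R1]]. destruct (far_ray H r c k A HD w0 (- m)) as [L2 [HL2 R2]].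
  exists (Rmax L1 L2 + 1). pose proof (Rmax_l L1 L2) as Q1. pose proof (Rmax_r L1 L2) as Q2. split; [lra|].
  intros sg u Hsg Hu.
  assert (Cl : closure H (w0 - RtoC (Rmax L1 L2) + RtoC u * (-1, (sg * m)%R))%C).
  { destruct Hsg as [-> | ->].
    - apply (closure_move _ _ _ _ _ HD (w0 - RtoC L1 + RtoC u * (-1, m))%C); auto; [unfold Re; simpl; lra|right; f_equal; unfold Im; simpl; ring].
    - apply (closure_move _ _ _ _ _ HD (w0 - RtoC L2 + RtoC u * (-1, (- m)%R))%C); auto; [unfold Re; simpl; lra|right; f_equal; unfold Im; simpl; ring]. }
  pose proof (closure_shift _ _ _ _ _ HD _ 1 Cl ltac:(lra)) as Q. rewrite RtoC_plus.
  match goal with |- H ?z => replace z with (w0 - RtoC (Rmax L1 L2) + RtoC u * (-1, (sg * m)%R) - RtoC 1)%C by ring end. exact Q.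
Qed.

Lemma upper_slit sg s : 0 <= s -> sg = 1 \/ sg = -1 -> slit (RtoC t0 * lat sg + RtoC s * lat sg)%C.
Proof.
  intros Hs Hsg. apply nonreal_slit. replace (Im (RtoC t0 * lat sg + RtoC s * lat sg)%C) with ((t0 + s) * - (sg * tau)) by (unfold Im; simpl; ring).
  assert (0 < (t0 + s) * tau) by (pos). destruct Hsg as [-> | ->]; lra.
Qed.

Lemma first_leg_slit sg t : 0 <= t <= 1 -> sg = 1 \/ sg = -1 -> slit (- (1) + RtoC t * (RtoC t0 * lat sg + 1))%C.
Proof.
  intros Ht Hsg [E1 E2].
  replace (Im (- (1) + RtoC t * (RtoC t0 * lat sg + 1))%C) with (t * (t0 * - (sg * tau))) in E1 by (unfold Im; simpl; ring).
  replace (Re (- (1) + RtoC t * (RtoC t0 * lat sg + 1))%C) with (- 1 + t * (t0 + 1)) in E2 by (unfold Re; simpl; ring).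
  assert (0 < t0 * tau) by (pos).
  destruct (Req_dec t 0) as [->|N]; [lra|]. assert (0 < t * (t0 * tau)) by (pos). destruct Hsg as [-> | ->]; nra.
Qed.

Lemma Lf_cont p : slit p -> ccont Lf p.
Proof.
  intros Hp. apply differentiable_cont. destruct Hg as [G1 [G2 G3]].
  apply (Laplace_differentiable H r c k A HD g M G1 G2 G3); auto. apply (H_closure _ _ _ _ _ HD); auto.
Qed.

Definition path_point (sg t : R) : C := (- (1) + RtoC t * (RtoC t0 * lat sg + 1))%C.

Lemma first_leg_differentiable sg z : sg = 1 \/ sg = -1 ->
  differentiable (fun x => first_leg (Fat (w - x)%C) t0 (lat sg)) z.
Proof.
  intros Hsg. eexists.
  apply (cder_ext (fun x => CInt (fun t => Lf (path_point sg t) * Cexp (path_point sg t * w) * (RtoC t0 * lat sg + 1) * Cexp (x * - path_point sg t)) 0 1)%C).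
  - intros x. unfold first_leg. apply CInt_ext. intros t _. fold (path_point sg t).
    replace (path_point sg t * (w - x))%C with (path_point sg t * w + x * - path_point sg t)%C by ring. rewrite Cexp_plus. ring.
  - apply (cder_exp_integral (fun t => Lf (path_point sg t) * Cexp (path_point sg t * w) * (RtoC t0 * lat sg + 1))%C (fun t => - path_point sg t)%C 0 1 z).
    + intros t Ht. ordered in Ht. apply cont_Cmult; [apply cont_Cmult|csolve].
      * apply (cont_comp_C (path_point sg)); [unfold path_point; csolve|]. apply Lf_cont. apply first_leg_slit; auto.
      * unfold path_point; csolve.
    + intros t _. unfold path_point; csolve.
Qed.

(** Convergence at [w] is merely assumed. Replacing [w] by [w - x] damps the integrals, so the
    formula makes sense and is holomorphic in [x] near the positive axis; it holds for large [x],
    hence for all [x > 0], and Abel's theorem lets [x] tend to 0. *)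
Theorem wedge_inversion (l : R -> C) : (forall sg, sg = 1 \/ sg = -1 -> clim (second_leg (Fat w) t0 (lat sg)) (l sg)) ->
  ((first_leg (Fat w) t0 (lat 1) + l 1%R) - (first_leg (Fat w) t0 (lat (-1)) + l (-1)%R) = 2 * Ci * RtoC PI * g w)%C.
Proof.
  intros Hl. destruct Hg as [G1 [G2 G3]].
  set (b := fun sg s => (Lf (RtoC t0 * lat sg + RtoC s * lat sg) * Cexp ((RtoC t0 * lat sg + RtoC s * lat sg) * w) * lat sg)%C).
  assert (Hb : forall sg, sg = 1 \/ sg = -1 -> forall s, 0 <= s -> rcont (b sg) s).
  { intros sg Hsg s Hs. unfold b. apply cont_Cmult; [apply cont_Cmult; [|csolve]|csolve].
    apply (cont_comp_C (fun s : R => RtoC t0 * lat sg + RtoC s * lat sg)%C); [csolve|]. apply Lf_cont, upper_slit; auto. }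
  set (Rf := fun sg => damped (b sg) (lat sg) t0).
  assert (Rd : forall sg z, sg = 1 \/ sg = -1 -> 0 < Re (z * lat sg)%C -> differentiable (Rf sg) z).
  { intros sg z Hsg Hz. exact (damped_differentiable (b sg) (l sg) (lat sg) t0 (Hb sg Hsg) (Hl sg Hsg) Ht0 z Hz). }
  assert (Rc : forall sg x, sg = 1 \/ sg = -1 -> 0 < x -> clim (second_leg (Fat (w - RtoC x)%C) t0 (lat sg)) (Rf sg (RtoC x))).
  { intros sg x Hsg Hx. eapply clim_ext_ge with (T1 := 0); [|apply (damped_clim (b sg) (l sg) (lat sg) t0 (Hb sg Hsg) (Hl sg Hsg) (RtoC x))].
    - intros T HT. apply CInt_ext. intros s _. unfold b.
      replace ((RtoC t0 * lat sg + RtoC s * lat sg) * (w - RtoC x))%C with ((RtoC t0 * lat sg + RtoC s * lat sg) * w + - (RtoC x * (RtoC t0 * lat sg + RtoC s * lat sg)))%C by ring.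
      rewrite Cexp_plus. ring.
    - rewrite Re_mult. simpl. lra. }
  assert (Rl : forall sg eps, sg = 1 \/ sg = -1 -> 0 < eps -> exists d, 0 < d /\ forall x, 0 < x < d -> Cmod (Rf sg (RtoC x) - l sg) < eps).
  { intros sg eps Hsg Heps. exact (damped_limit (b sg) (l sg) (lat sg) t0 (Hb sg Hsg) (Hl sg Hsg) eq_refl Ht0 eps Heps). }
  set (fl := fun sg x => first_leg (Fat (w - x)%C) t0 (lat sg)).
  (* Defect of the inversion formula at [w - x], as a function of complex [x]; only its values at
     positive real [x] are needed in the end. *)
  set (Psi := fun x => ((fl 1 x + Rf 1 x) - (fl (-1) x + Rf (-1) x) - 2 * Ci * RtoC PI * g (w - x))%C).
  assert (Hsh : forall x, 0 < x -> H (w - RtoC x)%C).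
  { intros x Hx. apply (closure_shift _ _ _ _ _ HD); auto. apply (H_closure _ _ _ _ _ HD); auto. }
  assert (Large : exists x0, forall x, x0 < x -> Psi (RtoC x) = RtoC 0).
  (* Any slope with [tau * m > 1] would do; 2 is a convenient value. *)
  { set (m := 2 / tau). assert (Hm : 0 < m) by (pos). assert (Hmt : tau * m = 2) by (unfold m; field; lra).
    destruct (two_sided_ray m) as [L [HL Ray]].
    exists (Rmax 0 (Re (w - w0)%C + L + tau * Rabs (Im (w - w0)%C))). intros x Hx.
    pose proof (Rmax_l 0 (Re (w - w0)%C + L + tau * Rabs (Im (w - w0)%C))) as Q1. pose proof (Rmax_r 0 (Re (w - w0)%C + L + tau * Rabs (Im (w - w0)%C))) as Q2.
    assert (Hx0 : 0 < x) by lra.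
    destruct (far_inversion H r c k A HD g M Hg w0 (w - RtoC x)%C L m tau Hw0 (Hsh x Hx0) HL Hm Htau ltac:(lra) Ray) with (t0 := t0) as [Y [Y1 Y2]]; auto.
    { replace (Re (w - RtoC x - (w0 - RtoC L))%C) with (Re (w - w0)%C + L - x) by (unfold Re; simpl; ring).
      replace (Im (w - RtoC x - (w0 - RtoC L))%C) with (Im (w - w0)%C) by (unfold Im; simpl; ring). lra. }
    assert (EY : forall sg, sg = 1 \/ sg = -1 -> (fl sg (RtoC x) + Rf sg (RtoC x) = Y sg)%C).
    { intros sg Hsg. apply (clim_unique (fun S => first_leg (Fat (w - RtoC x)%C) t0 (lat sg) + second_leg (Fat (w - RtoC x)%C) t0 (lat sg) S)%C).
      - apply clim_plus; [apply clim_const|apply Rc; auto].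
      - apply Y1; auto. }
    unfold Psi. rewrite !EY by auto.
    replace (Y 1 - Y (-1))%C with (- (Y (-1)%R - Y 1%R))%C by ring. rewrite Y2. ring. }
  assert (Zero : forall x, 0 < x -> Psi (RtoC x) = RtoC 0).
  { apply identity_half_line; [|exact Large]. intros x Hx.
    destruct (H_open _ _ _ _ _ HD _ (Hsh x Hx)) as [d [Hd HO]].
    (* The square around [x] must keep [w - (u, v)] in [H], by the first bound, and stay in both
       half-planes [Re ((u, v) * lat sg) > 0], that is [u > tau |v|], by the second. *)
    set (L := Rmin (d / 4) (x / (2 * (1 + tau)))).
    assert (HL : 0 < L) by (apply Rmin_pos; [lra|pos]).
    assert (HL1 : L <= d / 4) by apply Rmin_l.
    assert (HL2 : L * (2 * (1 + tau)) <= x).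
    { apply Rle_trans with (x / (2 * (1 + tau)) * (2 * (1 + tau))); [apply Rmult_le_compat_r; [lra|apply Rmin_r]|right; field; lra]. }
    exists L. split; auto. intros u v Hu Hv. rewrite Rmin_left, Rmax_right in Hu, Hv by lra.
    assert (Pos : forall sg, sg = 1 \/ sg = -1 -> 0 < Re ((u, v) * lat sg)%C).
    { intros sg Hsg. replace (Re ((u, v) * lat sg)%C) with (u + sg * (tau * v)) by (unfold Re; simpl; ring).
      assert (- (tau * L) <= tau * v <= tau * L) by (split; [assert (tau * - L <= tau * v) by (apply Rmult_le_compat_l; lra); lra|apply Rmult_le_compat_l; lra]).
      destruct Hsg as [-> | ->]; lra. }
    unfold Psi. apply differentiable_minus.
    - apply differentiable_minus; apply differentiable_plus; try (apply first_leg_differentiable; auto); apply Rd; auto.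
    - apply differentiable_mult; [eexists; apply cder_const|].
      destruct (G2 (w - (u, v))%C) as [l' Hl'].
      + apply HO. replace (w - (u, v) - (w - RtoC x))%C with (RtoC x - (u, v))%C by ring.
        eapply Rle_lt_trans; [apply Cmod_le_sum|]. replace (Re (RtoC x - (u, v))%C) with (x - u) by (unfold Re; simpl; ring). replace (Im (RtoC x - (u, v))%C) with (- v) by (unfold Im; simpl; ring).
        assert (Rabs (x - u) <= L) by (apply Rabs_le; lra). assert (Rabs (- v) <= L) by (apply Rabs_le; lra). lra.
      + eexists. apply (cder_comp (fun x => w - x)%C g); [|exact Hl']. apply cder_minus; [apply cder_const|apply cder_id]. }
  assert (Fl0 : forall sg, fl sg (RtoC 0) = first_leg (Fat w) t0 (lat sg)).
  { intros sg. unfold fl. replace (w - RtoC 0)%C with w by ring. reflexivity. }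
  set (X := ((first_leg (Fat w) t0 (lat 1) + l 1%R) - (first_leg (Fat w) t0 (lat (-1)) + l (-1)%R))%C).
  assert (EX : (X - 2 * Ci * RtoC PI * g w)%C = RtoC 0).
  (* Five terms of the defect move continuously to their values at [x = 0]: both first legs, [g],
     and both damped legs, the latter by Abel's theorem. *)
  { apply Cmod_small_0. intros eps Heps.
    assert (Small : forall (f : C -> C), ccont f (RtoC 0) -> exists d, 0 < d /\ forall x, 0 < x < d -> Cmod (f (RtoC x) - f (RtoC 0)) < eps / 6).
    { intros f Cf. destruct (proj1 (ccont_eps _ _) Cf (eps / 6) ltac:(lra)) as [d [Hd B]]. exists d. split; auto. intros x Hx. apply B.
      replace (RtoC x - RtoC 0)%C with (RtoC x) by ring. rewrite Cmod_R, Rabs_right; lra. }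
    destruct (Small (fl 1)) as [d1 [Hd1 B1]]; [apply differentiable_cont, first_leg_differentiable; auto|].
    destruct (Small (fl (-1))) as [d2 [Hd2 B2]]; [apply differentiable_cont, first_leg_differentiable; auto|].
    destruct (Small (fun x => 2 * Ci * RtoC PI * g (w - x))%C) as [d3 [Hd3 B3]].
    { apply cont_Cmult; [csolve|]. apply (cont_comp_C (fun x => w - x)%C); [csolve|apply G1]. }
    destruct (Rl 1 (eps / 6) ltac:(auto) ltac:(lra)) as [d4 [Hd4 B4]]. destruct (Rl (-1) (eps / 6) ltac:(auto) ltac:(lra)) as [d5 [Hd5 B5]].
    set (d := Rmin (Rmin (Rmin d1 d2) (Rmin d3 d4)) d5).
    assert (Hd : 0 < d) by (repeat apply Rmin_pos; auto).
    assert (Dl : d <= d1 /\ d <= d2 /\ d <= d3 /\ d <= d4 /\ d <= d5).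
    { unfold d. pose proof (Rmin_l (Rmin (Rmin d1 d2) (Rmin d3 d4)) d5). pose proof (Rmin_r (Rmin (Rmin d1 d2) (Rmin d3 d4)) d5).
      pose proof (Rmin_l (Rmin d1 d2) (Rmin d3 d4)). pose proof (Rmin_r (Rmin d1 d2) (Rmin d3 d4)).
      pose proof (Rmin_l d1 d2). pose proof (Rmin_r d1 d2). pose proof (Rmin_l d3 d4). pose proof (Rmin_r d3 d4). repeat split; lra. }
    set (x := d / 2). assert (Hx : 0 < x < d) by (unfold x; lra).
    specialize (B1 x ltac:(lra)). specialize (B2 x ltac:(lra)). specialize (B3 x ltac:(lra)). specialize (B4 x ltac:(lra)). specialize (B5 x ltac:(lra)).
    cbv beta in B3. replace (w - RtoC 0)%C with w in B3 by ring. rewrite Fl0 in B1, B2.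
    assert (EZ : (X - 2 * Ci * RtoC PI * g w)%C = ((X - 2 * Ci * RtoC PI * g w) - Psi (RtoC x))%C) by (rewrite Zero by lra; ring).
    rewrite EZ. unfold X, Psi.
    match goal with |- Cmod ?y <= _ => replace y with
      (((2 * Ci * RtoC PI * g (w - RtoC x) - 2 * Ci * RtoC PI * g w) - (fl 1 (RtoC x) - first_leg (Fat w) t0 (lat 1))) - (Rf 1%R (RtoC x) - l 1%R)
       + ((fl (-1)%R (RtoC x) - first_leg (Fat w) t0 (lat (-1))) + (Rf (-1)%R (RtoC x) - l (-1)%R)))%C by ring end.
    tri. eapply Rle_trans; [apply Rplus_le_compat; [apply Cmod_triangle_minus|apply Cmod_triangle]|].
    eapply Rle_trans; [apply Rplus_le_compat_r, Rplus_le_compat_r, Cmod_triangle_minus|]. lra. }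
  replace X with ((X - 2 * Ci * RtoC PI * g w) + 2 * Ci * RtoC PI * g w)%C by ring. rewrite EX. ring.
Qed.
End WedgeInversion.

(** * From the wedge contour to two paths issued from -1 *)

Section WedgeLegs.
Variables (O : R -> Prop) (F : C -> C) (b tau : R).
Hypothesis HO : open_R O.
Hypothesis HF : forall p, punctured O p -> differentiable F p.
Hypothesis Om1 : O (-1).
Hypothesis Ob : O b.
Hypothesis Hb : 0 <= b.
Hypothesis Htau : 0 < tau.

Notation lat sg := ((1, (- (sg * tau))%R) : C).

Lemma lat_half s sg t0 t : s = - sg -> sg = 1 \/ sg = -1 -> b <= t0 -> 0 <= t -> half O s (RtoC t0 * lat sg + RtoC t * lat sg)%C.
Proof.
  intros -> Hsg H0 Ht. unfold half.
  replace (Im (RtoC t0 * lat sg + RtoC t * lat sg)%C) with (- sg * ((t0 + t) * tau)) by (unfold Im; simpl; ring).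
  replace (Re (RtoC t0 * lat sg + RtoC t * lat sg)%C) with (t0 + t) by (unfold Re; simpl; ring).
  destruct (Req_dec (t0 + t) 0) as [E|N].
  - right. rewrite E. replace 0 with b by lra. exact Ob.
  - left. assert (0 < (t0 + t) * tau) by (pos). destruct Hsg as [-> | ->]; nra.
Qed.

Lemma first_leg_half s sg t : s = - sg -> sg = 1 \/ sg = -1 -> 0 <= t <= 1 -> half O s (- (1) + RtoC t * (RtoC (b + 1) * lat sg + 1))%C.
Proof.
  intros -> Hsg Ht. unfold half.
  replace (Im (- (1) + RtoC t * (RtoC (b + 1) * lat sg + 1))%C) with (- sg * (t * ((b + 1) * tau))) by (unfold Im; simpl; ring).
  destruct (Req_dec t 0) as [->|N].
  - right. replace (Re (- (1) + RtoC 0 * (RtoC (b + 1) * lat sg + 1))%C) with (-1) by (unfold Re; simpl; ring). exact Om1.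
  - left. assert (0 < t * ((b + 1) * tau)) by (pos). destruct Hsg as [-> | ->]; nra.
Qed.

Lemma second_leg_primitive P s sg t0 S : s = - sg -> sg = 1 \/ sg = -1 -> b <= t0 -> 0 <= S ->
  (forall z, half O s z -> cder P z (F z)) ->
  is_CInt (fun t => F (RtoC t0 * lat sg + RtoC t * lat sg) * lat sg)%C 0 S (P (RtoC (t0 + S) * lat sg) - P (RtoC t0 * lat sg))%C.
Proof.
  intros Hs Hsg H0 HS HP.
  assert (Hh : forall t, Rmin 0 S <= t <= Rmax 0 S -> half O s (RtoC t0 * lat sg + RtoC t * lat sg)%C).
  { intros t Ht. rewrite Rmin_left in Ht by lra. apply lat_half; auto; lra. }
  pose proof (is_CInt_segment P F (RtoC t0 * lat sg)%C (lat sg) 0 S (fun t Ht => HP _ (Hh t Ht))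
    (fun t Ht => differentiable_cont F _ (HF _ (half_punctured O s _ (Hh t Ht))))) as I.
  replace (RtoC t0 * lat sg + RtoC 0 * lat sg)%C with (RtoC t0 * lat sg)%C in I by ring.
  replace (RtoC t0 * lat sg + RtoC S * lat sg)%C with (RtoC (t0 + S) * lat sg)%C in I by (rewrite RtoC_plus; ring). exact I.
Qed.

Lemma first_leg_primitive P s sg : s = - sg -> sg = 1 \/ sg = -1 -> (forall z, half O s z -> cder P z (F z)) ->
  first_leg F (b + 1) (lat sg) = (P (RtoC (b + 1) * lat sg) - P (- (1)))%C.
Proof.
  intros Hs Hsg HP. apply is_CInt_unique.
  assert (Hh : forall t, Rmin 0 1 <= t <= Rmax 0 1 -> half O s (- (1) + RtoC t * (RtoC (b + 1) * lat sg + 1))%C).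
  { intros t Ht. ordered in Ht. apply first_leg_half; auto. }
  pose proof (is_CInt_segment P F (- (1))%C (RtoC (b + 1) * lat sg + 1)%C 0 1 (fun t Ht => HP _ (Hh t Ht))
    (fun t Ht => differentiable_cont F _ (HF _ (half_punctured O s _ (Hh t Ht))))) as I.
  replace (- (1) + RtoC 0 * (RtoC (b + 1) * lat sg + 1))%C with (- (1))%C in I by ring.
  replace (- (1) + RtoC 1 * (RtoC (b + 1) * lat sg + 1))%C with (RtoC (b + 1) * lat sg)%C in I by ring. exact I.
Qed.

(** The rays of the wedge start at abscissa [b], which may be 0 and so give the origin. Starting the
    legs at [b + 1] keeps them off the real axis, where the transform itself is available; the
    primitive accounts for the missing segment. *)
Lemma ray_integral_iff_leg P s sg l : s = - sg -> sg = 1 \/ sg = -1 -> (forall z, half O s z -> cder P z (F z)) ->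
  is_ray_integral F (b, (- (sg * (b * tau)))%R) (lat sg) l <->
  clim (second_leg F (b + 1) (lat sg)) (l - (P (RtoC (b + 1) * lat sg) - P (RtoC b * lat sg)))%C.
Proof.
  intros Hs Hsg HP.
  assert (E0 : ((b, (- (sg * (b * tau)))%R) : C) = (RtoC b * lat sg)%C) by cring.
  rewrite E0. clear E0.
  assert (I0 : forall T, 0 <= T -> is_CInt (fun t => F (RtoC b * lat sg + RtoC t * lat sg) * lat sg)%C 0 T (P (RtoC (b + T) * lat sg) - P (RtoC b * lat sg))%C).
  { intros T HT. apply second_leg_primitive with (s := s); auto; lra. }
  assert (I1 : forall T, 0 <= T -> second_leg F (b + 1) (lat sg) T = (P (RtoC (b + 1 + T) * lat sg) - P (RtoC (b + 1) * lat sg))%C).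
  { intros T HT. apply is_CInt_unique, second_leg_primitive with (s := s); auto; lra. }
  split; intros Q.
  - pose proof (is_CInt_inf_elim _ (fun T => P (RtoC (b + T) * lat sg) - P (RtoC b * lat sg))%C _ I0 Q) as L.
    pose proof (clim_minus _ _ _ _ (clim_affine _ _ 1 1 ltac:(lra) L) (clim_const (P (RtoC (b + 1) * lat sg) - P (RtoC b * lat sg))%C)) as L2.
    eapply clim_ext_ge with (T1 := 0); [|exact L2]. intros T HT. cbv beta. rewrite I1 by lra.
    replace (b + (1 * T + 1)) with (b + 1 + T) by ring. ring.
  - apply (is_CInt_inf_intro _ (fun T => P (RtoC (b + T) * lat sg) - P (RtoC b * lat sg))%C); auto.
    pose proof (clim_plus _ _ _ _ (clim_affine _ _ 1 (-1) ltac:(lra) Q) (clim_const (P (RtoC (b + 1) * lat sg) - P (RtoC b * lat sg))%C)) as L2.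
    replace l with (l - (P (RtoC (b + 1) * lat sg) - P (RtoC b * lat sg)) + (P (RtoC (b + 1) * lat sg) - P (RtoC b * lat sg)))%C by ring.
    eapply clim_ext_ge with (T1 := 1); [|exact L2]. intros T HT. cbv beta. rewrite I1 by lra.
    replace (b + 1 + (1 * T + -1)) with (b + T) by ring. ring.
Qed.

Variable theta : R.
Hypothesis Etau : tan theta = tau.

Lemma vertical_side Pu Pd : (forall z, half O 1 z -> cder Pu z (F z)) -> (forall z, half O (-1) z -> cder Pd z (F z)) ->
  is_CInt (fun t => F (b, t) * Ci)%C (b * tau) (- (b * tau))
    (Pd (RtoC b * lat 1) - Pd (RtoC b) + (Pu (RtoC b) - Pu (RtoC b * lat (-1))))%C.
Proof.
  intros HPu HPd.
  assert (E1 : (RtoC b * lat 1)%C = ((b, - (b * tau)) : C)) by cring.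
  assert (E2 : (RtoC b * lat (-1))%C = ((b, b * tau) : C)) by cring.
  assert (Cf : forall t, ccont F (b, t)) by (intros; apply differentiable_cont, HF; right; auto).
  rewrite E1, E2.
  replace (Pd (b, (- (b * tau))%R) - Pd (RtoC b) + (Pu (RtoC b) - Pu (b, (b * tau)%R)))%C
    with ((Pu (RtoC b) - Pu (b, (b * tau)%R)) + (Pd (b, (- (b * tau))%R) - Pd (RtoC b)))%C by ring.
  apply is_CInt_ext with (h := fun t => (Ci * F (b, t))%C); [intros; apply Cmult_comm|].
  apply is_CInt_Chasles with (b := 0).
  - apply (is_CInt_v_primitive Pu F b (b * tau) 0); auto. intros t _. apply HPu. right; auto.
  - apply (is_CInt_v_primitive Pd F b 0 (- (b * tau))); auto. intros t _. apply HPd. right; auto.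
Qed.

(** The wedge contour around [[b, +oo[] plus the rectangle around [[-1, b]] deforms into the lower
    path ([lat 1]) minus the upper one ([lat (-1)]), both issued from [-1]. *)
Lemma wedge_integral_legs J : is_wedge_integral F b theta J -> exists l : R -> C,
  (forall sg, sg = 1 \/ sg = -1 -> clim (second_leg F (b + 1) (lat sg)) (l sg)) /\
  (J + rectint F (-1) b (-1) 1 =
    (first_leg F (b + 1) (lat 1) + l 1%R) - (first_leg F (b + 1) (lat (-1)) + l (-1)%R))%C.
Proof.
  intros [l1 [l2 [l3 [J1 [J2 [J3 ->]]]]]]. rewrite Etau in J1, J2, J3.
  destruct (half_primitive O F 1 HO ltac:(auto) HF) as [Pu HPu]. destruct (half_primitive O F (-1) HO ltac:(auto) HF) as [Pd HPd].
  assert (L1 : ((1, tau) : C) = lat (-1)) by cring.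
  assert (L3 : ((1, - tau) : C) = lat 1) by cring.
  assert (B1 : ((b, b * tau) : C) = (b, (- (-1 * (b * tau)))%R)) by cring.
  assert (B3 : ((b, - (b * tau)) : C) = (b, (- (1 * (b * tau)))%R)) by cring.
  rewrite L1, B1 in J1. rewrite L3, B3 in J3.
  apply (ray_integral_iff_leg Pu 1 (-1)) in J1; [|lra|auto|exact HPu].
  apply (ray_integral_iff_leg Pd (-1) 1) in J3; [|lra|auto|exact HPd].
  pose proof (is_CInt_inj _ _ _ _ _ J2 (vertical_side Pu Pd HPu HPd)) as E2.
  exists (fun sg => if Rlt_dec 0 sg then (l3 - (Pd (RtoC (b + 1) * lat 1) - Pd (RtoC b * lat 1)))%C else (l1 - (Pu (RtoC (b + 1) * lat (-1)) - Pu (RtoC b * lat (-1))))%C).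
  split.
  - intros sg [-> | ->]; [destruct (Rlt_dec 0 1)|destruct (Rlt_dec 0 (-1))]; try lra; auto.
  - destruct (Rlt_dec 0 1); [|lra]. destruct (Rlt_dec 0 (-1)); [lra|].
    rewrite (rectint_half_primitives O F Pu Pd); auto; [|intros; apply differentiable_cont; auto].
    rewrite (first_leg_primitive Pd (-1) 1), (first_leg_primitive Pu 1 (-1)); auto; try lra.
    rewrite E2. replace (RtoC (-1)) with (- (1))%C by cring. ring.
Qed.

Lemma wedge_integral_exists (l : R -> C) : (forall sg, sg = 1 \/ sg = -1 -> clim (second_leg F (b + 1) (lat sg)) (l sg)) ->
  exists J, is_wedge_integral F b theta J.
Proof.
  intros Hl.
  destruct (half_primitive O F 1 HO ltac:(auto) HF) as [Pu HPu]. destruct (half_primitive O F (-1) HO ltac:(auto) HF) as [Pd HPd].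
  set (l1 := (l (-1)%R + (Pu (RtoC (b + 1) * lat (-1)) - Pu (RtoC b * lat (-1))))%C).
  set (l3 := (l 1%R + (Pd (RtoC (b + 1) * lat 1) - Pd (RtoC b * lat 1)))%C).
  eexists. exists l1, (Pd (RtoC b * lat 1) - Pd (RtoC b) + (Pu (RtoC b) - Pu (RtoC b * lat (-1))))%C, l3.
  rewrite Etau. split; [|split; [apply vertical_side; auto|split; [|reflexivity]]].
  - assert (L1 : ((1, tau) : C) = lat (-1)) by cring.
    assert (B1 : ((b, b * tau) : C) = (b, (- (-1 * (b * tau)))%R)) by cring.
    rewrite L1, B1. apply (ray_integral_iff_leg Pu 1 (-1)); [lra|auto|exact HPu|].
    unfold l1. match goal with |- clim _ ?x => replace x with (l (-1)%R) by ring end. apply Hl; auto.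
  - assert (L3 : ((1, - tau) : C) = lat 1) by cring.
    assert (B3 : ((b, - (b * tau)) : C) = (b, (- (1 * (b * tau)))%R)) by cring.
    rewrite L3, B3. apply (ray_integral_iff_leg Pd (-1) 1); [lra|auto|exact HPd|].
    unfold l3. match goal with |- clim _ ?x => replace x with (l 1%R) by ring end. apply Hl; auto.
Qed.
End WedgeLegs.

(** * Convergence of the wedge integral for a suitable angle *)

Section WedgeConvergence.
Variables (H : C -> Prop) (r : R -> R) (c k A : R).
Hypothesis HD : log_domain H r c k A.
Hypothesis HC : cone_exhausted H.
Variables (g : C -> C) (M : R).
Hypothesis Hg : regular H g M.

(** The base point is the vertex of the cone and the ray is its edge, starting there with [L = 0];
    this gives the sharp factor [exp (- (Re p * x))]. *)
Lemma Laplace_cone_bound x m1 sg p : H (RtoC x) -> (forall u y, 0 <= u -> Rabs y <= m1 * u -> closure H (x - u, y)) ->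
  0 < m1 -> sg = 1 \/ sg = -1 -> 0 < Re (p * (-1, (sg * m1)%R))%C ->
  Cmod (Laplace H g (RtoC x) p) <= M * Cmod (-1, (sg * m1)%R) * exp (- (Re p * x)) / Re (p * (-1, (sg * m1)%R))%C.
Proof.
  intros Hx Cone Hm Hsg Hp. destruct Hg as [G1 [G2 G3]]. set (v := ((-1, (sg * m1)%R) : C)) in *.
  assert (GR : good_ray H p (RtoC x - RtoC 0)%C v).
  { split; [|split; [simpl; lra|exact Hp]]. intros t Ht.
    replace (RtoC x - RtoC 0 + RtoC t * v)%C with ((x - t, sg * (m1 * t)) : C) by (apply C_ext; unfold v, Re, Im; simpl; ring).
    apply Cone; auto. rewrite Rabs_mult, (Rabs_right (m1 * t)) by nra. destruct Hsg as [-> | ->]; [rewrite Rabs_R1|rewrite Rabs_left by lra]; lra. }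
  rewrite (Laplace_is H r c k A HD g M G1 G2 G3 _ p _ (is_Laplace_formula H r c k A HD g M G1 G3 (RtoC x) 0 v p (H_closure _ _ _ _ _ HD _ Hx) (Rle_refl 0) GR)).
  unfold Laplace_formula.
  assert (Z : CInt (fun t => LK g p (RtoC x + RtoC t * - RtoC 0) * - RtoC 0)%C 0 1 = RtoC 0).
  { apply is_CInt_unique. eapply is_CInt_ext; [|replace (RtoC 0) with (RtoC (1 - 0) * RtoC 0)%C by ring; apply is_CInt_const].
    intros t _. cbv beta. ring. }
  rewrite Z, Cplus_0_l.
  apply exp_dominated_inf; auto.
  - intros t _. apply cont_Cmult; [|csolve]. apply (cont_comp_C (fun t : R => RtoC x - RtoC 0 + RtoC t * v)%C); [csolve|apply LK_cont; auto].
  - intros t Ht. rewrite Cmod_mult.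
    apply Rle_trans with (M * exp (- Re (p * (RtoC x - RtoC 0 + RtoC t * v))%C) * Cmod v).
    + apply Rmult_le_compat_r; [apply Cmod_ge_0|]. apply (LK_norm H g M G3). apply GR; auto.
    + replace (- Re (p * (RtoC x - RtoC 0 + RtoC t * v))%C) with (- (Re p * x) + - (Re (p * v)%C * t)) by (unfold Re, Im; simpl; ring).
      rewrite exp_plus. right; ring.
Qed.

(** With [tau = / m] for a slope [m] strictly between [m0] and [m1], [tau * m1 > 1] makes the edge
    of the cone admissible for the transform, and [tau * m0 < 1] makes [Re (p * (w - x))] tend to
    [-oo] linearly along both rays. *)
Lemma wedge_converges w b : H w -> 0 <= b -> exists w0 theta (l : R -> C), H w0 /\ 0 < theta < PI / 2 /\
  forall sg, sg = 1 \/ sg = -1 -> clim (second_leg (fun p => Laplace H g w0 p * Cexp (p * w))%C (b + 1) (1, (- (sg * tan theta))%R)) (l sg).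
Proof.
  intros Hw Hb. destruct (HC w Hw) as [x [m0 [m1 [Hx [Hm [Hcw Cone]]]]]].
  set (m := (m0 + m1) / 2). assert (Hmm : m0 < m < m1) by (unfold m; lra).
  set (tau := / m). assert (Htau : 0 < tau) by (pos).
  assert (T0 : tau * m0 < 1) by (apply Rmult_lt_reg_r with m; [lra|]; unfold tau; replace (/ m * m0 * m) with m0 by (field; lra); lra).
  assert (T1 : 1 < tau * m1) by (apply Rmult_lt_reg_r with m; [lra|]; unfold tau; replace (/ m * m1 * m) with m1 by (field; lra); lra).
  set (al := tau * m1 - 1). assert (Hal : 0 < al) by (unfold al; lra).
  assert (Hxw : 0 < x - Re w) by (pose proof (Rabs_pos (Im w)); nra).
  set (a := x - Re w - tau * Rabs (Im w)).
  assert (Ha : 0 < a).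
  { unfold a. assert (tau * Rabs (Im w) < tau * (m0 * (x - Re w))) by (apply Rmult_lt_compat_l; auto). nra. }
  set (theta := atan tau).
  assert (Hth : 0 < theta < PI / 2) by (unfold theta; split; [rewrite <- atan_0; apply atan_increasing; auto|apply atan_bound]).
  assert (Et : tan theta = tau) by apply tan_atan.
  pose proof (M_nonneg H r c k A HD g M (proj2 (proj2 Hg))) as HM. destruct Hg as [G1 [G2 G3]].
  assert (Key : forall sg, sg = 1 \/ sg = -1 -> exists l, clim (second_leg (fun p => Laplace H g (RtoC x) p * Cexp (p * w))%C (b + 1) (1, (- (sg * tau))%R)) l).
  { intros sg Hsg. set (e := ((1, (- (sg * tau))%R) : C)). set (v := ((-1, (sg * m1)%R) : C)).
    assert (Eev : Re (e * v)%C = al) by (unfold e, v, al, Re; simpl; destruct Hsg as [-> | ->]; ring).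
    destruct (exp_dominated (fun s => Laplace H g (RtoC x) (RtoC (b + 1) * e + RtoC s * e) * Cexp ((RtoC (b + 1) * e + RtoC s * e) * w) * e)%C
      (M * Cmod v / al * Cmod e) a Ha) as [l [Hl _]]; [| |exists l; exact Hl].
    - intros s Hs. apply cont_Cmult; [apply cont_Cmult; [|csolve]|csolve].
      apply (cont_comp_C (fun s : R => RtoC (b + 1) * e + RtoC s * e)%C); [csolve|].
      apply differentiable_cont, (Laplace_differentiable H r c k A HD g M G1 G2 G3); [apply (H_closure _ _ _ _ _ HD); auto|].
      apply nonreal_slit. replace (Im (RtoC (b + 1) * e + RtoC s * e)%C) with ((b + 1 + s) * - (sg * tau)) by (unfold e, Im; simpl; ring).
      assert (0 < (b + 1 + s) * tau) by (pos). destruct Hsg as [-> | ->]; lra.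
    - intros s Hs. replace (RtoC (b + 1) * e + RtoC s * e)%C with (RtoC (b + 1 + s) * e)%C by (rewrite !RtoC_plus; ring).
      set (y := b + 1 + s). assert (Hy : 1 <= y /\ s <= y) by (unfold y; lra).
      assert (Epv : Re (RtoC y * e * v)%C = y * al) by (rewrite <- Eev; unfold Re; simpl; ring).
      assert (Hpv : 0 < Re (RtoC y * e * v)%C) by (rewrite Epv; pos).
      pose proof (Laplace_cone_bound x m1 sg _ Hx Cone ltac:(lra) Hsg Hpv) as B. fold v in B. rewrite Epv in B.
      replace (Re (RtoC y * e)%C) with y in B by (unfold e, Re; simpl; ring).
      rewrite !Cmod_mult, Cmod_Cexp.
      assert (Ew : Re (RtoC y * e * w)%C <= y * (x - a)).
      { replace (Re (RtoC y * e * w)%C) with (y * (Re w + sg * (tau * Im w))) by (unfold e, Re, Im; simpl; ring).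
        apply Rmult_le_compat_l; [lra|]. unfold a.
        assert (sg * (tau * Im w) <= tau * Rabs (Im w)).
        { pose proof (Rle_abs (Im w)). pose proof (Rle_abs (- Im w)) as Q. rewrite Rabs_Ropp in Q. destruct Hsg as [-> | ->]; nra. }
        lra. }
      apply Rle_trans with (M * Cmod v * exp (- (y * x)) / (y * al) * exp (y * (x - a)) * Cmod e).
      { apply Rmult_le_compat_r; [apply Cmod_ge_0|]. apply Rmult_le_compat; [apply Cmod_ge_0|pos|exact B|apply exp_le_le; exact Ew]. }
      replace (M * Cmod v * exp (- (y * x)) / (y * al) * exp (y * (x - a)) * Cmod e) with (M * Cmod v / al * Cmod e * (exp (- (a * y)) / y)).
      + apply Rmult_le_compat_l.
        * pos.
        * apply Rle_trans with (exp (- (a * y)) * 1); [|rewrite Rmult_1_r; apply exp_le_le; nra].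
          apply Rmult_le_compat_l; [pos|]. rewrite <- Rinv_1. apply Rinv_le_contravar; lra.
      + replace (- (a * y)) with (- (y * x) + y * (x - a)) by ring. rewrite exp_plus. field. split; lra. }
  destruct (Key 1 ltac:(auto)) as [l1 L1]. destruct (Key (-1) ltac:(auto)) as [l2 L2].
  exists (RtoC x), theta, (fun sg => if Rlt_dec 0 sg then l1 else l2). split; auto. split; auto. rewrite Et.
  intros sg [-> | ->]; [destruct (Rlt_dec 0 1)|destruct (Rlt_dec 0 (-1))]; try lra; auto.
Qed.
End WedgeConvergence.

(** * The sup norm, linearity and restriction to the translated domain *)

Lemma norm_sup_ub H u B w : (forall w, H w -> Cmod (u w) <= B) -> H w -> Cmod (u w) <= norm_sup H u.
Proof.
  intros HB Hw. unfold norm_sup. set (E := fun x => exists w, H w /\ x = Cmod (u w)).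
  destruct (Lub_Rbar_correct E) as [Ub Least].
  assert (U1 : Rbar_le (Cmod (u w)) (Lub_Rbar E)) by (apply Ub; exists w; auto).
  assert (U2 : Rbar_le (Lub_Rbar E) B) by (apply Least; intros x [z [Hz ->]]; simpl; auto).
  (* [real] sends infinite suprema to 0; the bound [B] and the point [w] exclude them. *)
  destruct (Lub_Rbar E); simpl in *; [auto|contradiction|contradiction].
Qed.

Lemma norm_sup_le H u B : 0 <= B -> (forall w, H w -> Cmod (u w) <= B) -> norm_sup H u <= B.
Proof.
  intros HB0 HB. unfold norm_sup. set (E := fun x => exists w, H w /\ x = Cmod (u w)).
  destruct (Lub_Rbar_correct E) as [_ Least].
  assert (U2 : Rbar_le (Lub_Rbar E) B) by (apply Least; intros x [z [Hz ->]]; simpl; auto).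
  destruct (Lub_Rbar E); simpl in *; auto.
Qed.

Lemma clim_linear (kap sig : C) I J l m : clim I l -> clim J m -> clim (fun T => kap * I T + sig * J T)%C (kap * l + sig * m)%C.
Proof. intros. apply clim_plus; apply clim_cmult; auto. Qed.

Lemma is_CInt_linear (kap sig : C) (h1 h2 : R -> C) a b (l m : C) : is_CInt h1 a b l -> is_CInt h2 a b m ->
  is_CInt (fun t => kap * h1 t + sig * h2 t)%C a b (kap * l + sig * m)%C.
Proof. intros. apply is_CInt_plus; apply is_CInt_cmult; auto. Qed.

Section Linearity.
Variables (H : C -> Prop) (r : R -> R) (c k A : R).
Hypothesis HD : log_domain H r c k A.
Variables (g1 g2 : C -> C) (M1 M2 : R) (kap sig : C).
Hypothesis Hg1 : regular H g1 M1.
Hypothesis Hg2 : regular H g2 M2.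

Notation comb w := (kap * g1 w + sig * g2 w)%C.

Lemma regular_linear : regular H (fun w => comb w) (Cmod kap * M1 + Cmod sig * M2).
Proof.
  destruct Hg1 as [A1 [A2 A3]]. destruct Hg2 as [B1 [B2 B3]]. split; [|split].
  - intros z. csolve; auto.
  - intros z Hz. apply differentiable_plus; apply differentiable_mult; auto; eexists; apply cder_const.
  - intros z Hz. tri. rewrite !Cmod_mult.
    apply Rplus_le_compat; apply Rmult_le_compat_l; auto using Cmod_ge_0.
Qed.

Lemma Laplace_linear w0 p : closure H w0 -> slit p ->
  Laplace H (fun w => comb w) w0 p = (kap * Laplace H g1 w0 p + sig * Laplace H g2 w0 p)%C.
Proof.
  intros Hw Hp. pose proof regular_linear as [C1 [C2 C3]].
  destruct Hg1 as [A1 [A2 A3]]. destruct Hg2 as [B1 [B2 B3]].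
  destruct (slit_slope p Hp) as [m Hm]. destruct (far_ray H r c k A HD w0 m) as [L [HL HR]].
  assert (GR : good_ray H p (w0 - RtoC L)%C (-1, m)) by (split; [auto|split; [simpl; lra|auto]]).
  rewrite (Laplace_is H r c k A HD g1 M1 A1 A2 A3 w0 p _ (is_Laplace_formula H r c k A HD g1 M1 A1 A3 w0 L _ p Hw HL GR)).
  rewrite (Laplace_is H r c k A HD g2 M2 B1 B2 B3 w0 p _ (is_Laplace_formula H r c k A HD g2 M2 B1 B3 w0 L _ p Hw HL GR)).
  rewrite (Laplace_is H r c k A HD _ _ C1 C2 C3 w0 p _ (is_Laplace_formula H r c k A HD _ _ C1 C3 w0 L _ p Hw HL GR)).
  unfold Laplace_formula.
  assert (Ct : forall (g : C -> C) (a v : C) t, (forall z, ccont g z) -> rcont (fun t => LK g p (a + RtoC t * v) * v)%C t).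
  { intros g a v t Hg. apply cont_Cmult; [|csolve]. apply (cont_comp_C (fun t : R => a + RtoC t * v)%C); [csolve|apply LK_cont; auto]. }
  assert (I : forall (a v : C) x y, CInt (fun t => LK (fun w => comb w) p (a + RtoC t * v) * v)%C x y =
    (kap * CInt (fun t => LK g1 p (a + RtoC t * v) * v)%C x y + sig * CInt (fun t => LK g2 p (a + RtoC t * v) * v)%C x y)%C).
  { intros a v x y. apply is_CInt_unique.
    eapply is_CInt_ext; [|apply (is_CInt_linear kap sig _ _ _ _ _ _ (CInt_correct_all _ x y (fun t => Ct g1 a v t A1)) (CInt_correct_all _ x y (fun t => Ct g2 a v t B1)))].
    intros t _. cbv beta. unfold LK. ring. }
  rewrite I.
  assert (J : CInt_inf (fun t => LK (fun w => comb w) p (w0 - RtoC L + RtoC t * (-1, m)) * (-1, m))%C =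
    (kap * CInt_inf (fun t => LK g1 p (w0 - RtoC L + RtoC t * (-1, m)) * (-1, m)) + sig * CInt_inf (fun t => LK g2 p (w0 - RtoC L + RtoC t * (-1, m)) * (-1, m)))%C).
  { apply Clim_unique. eapply clim_ext; [intros T; symmetry; apply I|].
    apply clim_linear; [apply (ray_integral_exists H g1 M1)|apply (ray_integral_exists H g2 M2)]; auto. }
  rewrite J. ring.
Qed.

Lemma Laplace_extends_linear w0 beta : closure H w0 -> Laplace_extends_at H g1 w0 beta -> Laplace_extends_at H g2 w0 beta ->
  Laplace_extends_at H (fun w => comb w) w0 beta.
Proof.
  intros Hw [e1 [f1 [D1 E1]]] [e2 [f2 [D2 E2]]].
  exists (mkposreal _ (Rmin_stable_in_posreal e1 e2)), (fun p => kap * f1 p + sig * f2 p)%C. simpl. split.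
  - intros p Hp. apply holomorphic_at_cder.
    destruct (proj1 (holomorphic_at_cder _ _) (D1 p (Rlt_le_trans _ _ _ Hp (Rmin_l _ _)))) as [l1 L1].
    destruct (proj1 (holomorphic_at_cder _ _) (D2 p (Rlt_le_trans _ _ _ Hp (Rmin_r _ _)))) as [l2 L2].
    eexists. apply cder_plus; apply cder_scal; eauto.
  - intros p Hp Hs. rewrite Laplace_linear by auto.
    rewrite E1, E2; auto; eapply Rlt_le_trans; [exact Hp|apply Rmin_r|exact Hp|apply Rmin_l].
Qed.
End Linearity.

Lemma rect_sum_linear O f1 f2 (kap sig : C) b1 b2 w : O b1 -> O b2 ->
  (forall p, punctured O p -> differentiable f1 p) -> (forall p, punctured O p -> differentiable f2 p) ->
  rect_sum (fun p => kap * f1 p + sig * f2 p)%C b1 b2 w = (kap * rect_sum f1 b1 b2 w + sig * rect_sum f2 b1 b2 w)%C.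
Proof.
  intros O1 O2 D1 D2.
  assert (S : forall f, (forall p, punctured O p -> differentiable f p) -> on_sides (ccont (fun p => f p * Cexp (p * w))%C) b1 b2 (-1) 1).
  { intros f Df. apply (on_sides_punctured O); auto; try lra. intros p Hp. apply cont_Cmult; [apply differentiable_cont; auto|csolve]. }
  assert (S2 : forall (x : C) f, (forall p, punctured O p -> differentiable f p) -> on_sides (ccont (fun p => x * (f p * Cexp (p * w)))%C) b1 b2 (-1) 1).
  { intros x f Df u v Hu Hv Huv. apply cont_Cmult; [csolve|]. apply (S f Df u v Hu Hv Huv). }
  unfold rect_sum.
  rewrite (rectint_ext _ (fun p => kap * (f1 p * Cexp (p * w)) + sig * (f2 p * Cexp (p * w)))%C) by (intros x y _ _ _; ring).
  rewrite rectint_plus by auto. rewrite !rectint_scal by auto. unfold Cdiv. ring.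
Qed.

(** The closure of [-1 + H] lies in [H], so a path admissible for the smaller domain is admissible
    for [H], where the value is unique. *)
Lemma Laplace_translate H r c k A g M w0 p : log_domain H r c k A -> regular H g M -> translate (-1) H w0 -> slit p ->
  Laplace (translate (-1) H) g w0 p = Laplace H g w0 p.
Proof.
  intros HD [G1 [G2 G3]] Hw Hp.
  pose proof (log_domain_translate _ _ _ _ _ HD) as HD'.
  assert (Sub : forall z, closure (translate (-1) H) z -> H z).
  { intros z Hz. apply closure_translate in Hz. pose proof (closure_shift _ _ _ _ _ HD _ 1 Hz ltac:(lra)) as Q.
    replace (z - RtoC (-1) - RtoC 1)%C with z in Q by cring. exact Q. }
  symmetry. apply (Laplace_is H r c k A HD g M G1 G2 G3).
  assert (L : is_Laplace (translate (-1) H) g w0 p (Laplace (translate (-1) H) g w0 p)).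
  { apply (Laplace_exists _ _ _ _ _ HD' g M); auto.
    - intros z Hz. apply G2, Sub, (H_closure _ _ _ _ _ HD'); auto.
    - intros z Hz. apply G3, (H_closure _ _ _ _ _ HD), Sub; auto.
    - apply (H_closure _ _ _ _ _ HD'); auto. }
  destruct L as [w1 [v [gam [l1 [l2 [P1 [P2 [P3 [P4 [P5 P6]]]]]]]]]].
  exists w1, v, gam, l1, l2. split; auto. split; auto. split; auto. split; [|split; auto].
  - intros t Ht. apply (H_closure _ _ _ _ _ HD), Sub; auto.
  - intros t Ht. apply (H_closure _ _ _ _ _ HD), Sub; auto.
Qed.

(** * Operators of the form kap g + sig rect_sum *)

Section SumOperator.
Variables (H : C -> Prop) (r : R -> R) (c k A : R).
Hypothesis HD : log_domain H r c k A.
Variables (I : R -> Prop) (b1 b2 d : R).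
Hypothesis HI : open_R I.
Hypothesis Hb : b1 < b2.
Hypothesis Hd : 0 < d.
Hypothesis O1 : forall x, Rabs (x - b1) <= d -> with_negative I x.
Hypothesis O2 : forall x, Rabs (x - b2) <= d -> with_negative I x.
Hypothesis crossing : forall beta, I beta -> 0 <= beta -> exists b1' b2', b1' <= b2' /\ (beta < b1' \/ b2' < beta) /\
  (forall x, Rmin b1 b1' <= x <= Rmax b1 b1' -> with_negative I x) /\ (forall x, Rmin b2 b2' <= x <= Rmax b2 b2' -> with_negative I x).

Notation H' := (translate (-1) H).
Notation base := (RtoC (r 0 - 1)).

Lemma closure_translate_subset z : closure H' z -> H z.
Proof.
  intros Hz. apply closure_translate in Hz. pose proof (closure_shift _ _ _ _ _ HD _ 1 Hz ltac:(lra)) as Q.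
  replace (z - RtoC (-1) - RtoC 1)%C with z in Q by cring. exact Q.
Qed.

Lemma base_in : H base.
Proof. apply (H_iff _ _ _ _ _ HD). simpl. lra. Qed.

Lemma across_exists g M w0 : E0_I I H g -> regular H (extend r g) M -> H w0 ->
  exists f, is_Laplace_across H I (extend r g) w0 f.
Proof.
  intros [HE Hs] [G1 [G2 G3]] Hw. apply Laplace_across_exists; auto.
  - intros p Hp. apply (Laplace_differentiable H r c k A HD _ M G1 G2 G3); auto. apply (H_closure _ _ _ _ _ HD); auto.
  - intros b Ib Pb. apply NNPP. intros N. apply (Hs b Ib). split; auto. exists w0. split; auto.
    intros [e [f [F1 F2]]]. apply N. exists e, f. split; auto. intros p Hp Hsl.
    rewrite <- (Laplace_extend H r c k A HD). auto.
Qed.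

Lemma E0_bounded g : E0 H g -> exists M, regular H (extend r g) M.
Proof. intros HE. destruct HE as [E1 [[M HM] E3]]. exists M. apply (extend_regular H r c k A HD); auto. split; eauto. Qed.

Variables (kap sig : C) (S : (C -> C) -> C -> C).
Hypothesis HS : forall g f M w, E0_I I H g -> regular H (extend r g) M -> is_Laplace_across H I (extend r g) base f -> closure H' w ->
  S g w = (kap * extend r g w + sig * rect_sum f b1 b2 w)%C.

Lemma punctured_ends : with_negative I b1 /\ with_negative I b2.
Proof. split; [apply O1|apply O2]; rewrite Rminus_diag, Rabs_R0; lra. Qed.

(** Both parts are bounded and continuous, and both transforms extend across the gaps: that of [g]
    by hypothesis, that of the rectangle sum because [crossing] lets the sides be moved past the
    given point. *)
Lemma sum_operator_maps g : E0_I I H g -> E0_I I H' (S g).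
Proof.
  intros Hg. destruct (E0_bounded g (proj1 Hg)) as [M HM].
  destruct (across_exists g M base Hg HM base_in) as [f Hf].
  pose proof (log_domain_translate _ _ _ _ _ HD) as HD'.
  destruct punctured_ends as [P1 P2].
  assert (Df : forall p, punctured (with_negative I) p -> differentiable f p) by (apply (across_differentiable H I _ base f Hf)).
  destruct (rect_sum_bound H r c k A _ b1 b2 d HD Hb Hd O1 O2) as [K [HK BK]].
  assert (HV : regular H' (rect_sum f b1 b2) (K * M)).
  { assert (DV : forall z, differentiable (rect_sum f b1 b2) z).
    { intros z. eexists. apply (rect_sum_cder (with_negative I)); auto. intros; apply differentiable_cont; auto. }
    split; [|split]; auto.
    - intros z. apply differentiable_cont; auto.
    - intros z Hz. apply (BK (extend r g) M f base); auto.
      + apply base_in.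
      + intros p Hp. apply (proj2 Hf), nonreal_slit; auto.
      + apply (H_closure _ _ _ _ _ HD), closure_translate_subset; auto. }
  assert (HG : regular H' (extend r g) M).
  { destruct HM as [G1 [G2 G3]]. split; [|split]; auto.
    - intros z Hz. apply G2, closure_translate_subset, (H_closure _ _ _ _ _ HD'); auto.
    - intros z Hz. apply G3, (H_closure _ _ _ _ _ HD), closure_translate_subset; auto. }
  set (U := fun w => (kap * extend r g w + sig * rect_sum f b1 b2 w)%C).
  pose proof (regular_linear H' _ _ _ _ kap sig HG HV) as [U1 [U2 U3]]. fold U in U1, U2, U3.
  assert (EU : forall w, closure H' w -> U w = S g w) by (intros; symmetry; eapply HS; eauto).
  split; [split; [|split]|].
  - intros w Hw. apply holomorphic_at_cder. destruct (U2 w Hw) as [l Hl]. exists l.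
    destruct (H_open _ _ _ _ _ HD' w Hw) as [e [He B]]. apply cder_ext_loc with U e; auto.
    intros z Hz. apply EU. apply (H_closure _ _ _ _ _ HD'); auto.
  - eexists. intros w Hw. rewrite <- EU by (apply (H_closure _ _ _ _ _ HD'); auto). apply U3. apply (H_closure _ _ _ _ _ HD'); auto.
  - apply continuous_on_ext with U; auto. apply continuous_on_forall. intros z _. apply U1.
  - intros beta Ib [Pb [w0 [Hw0 N]]]. apply N.
    assert (X : Laplace_extends_at H' U w0 beta).
    { apply (Laplace_extends_linear H' _ _ _ _ HD' _ _ _ _ kap sig HG HV); [apply (H_closure _ _ _ _ _ HD'); auto| |].
      - pose proof (closure_translate_subset _ (H_closure _ _ _ _ _ HD' _ Hw0)) as Hw0H.
        destruct (across_exists g M w0 Hg HM Hw0H) as [f0 [F1 F2]].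
        destruct (HI beta Ib) as [e [He Be]].
        exists (mkposreal e He), f0. simpl. split.
        + intros p Hp. apply F1. destruct (classic (slit p)) as [Sp|Sp]; [left; auto|right].
          apply NNPP in Sp. exists (Re p). split; [|apply C_ext; simpl; tauto].
          apply Be. apply Cmod_lt_parts in Hp. apply Hp.
        + intros p Hp Sp. rewrite F2 by auto. symmetry. apply (Laplace_translate H r c k A _ M); auto.
      - destruct (crossing beta Ib Pb) as [b1' [b2' [Q1 [Q2 [Q3 Q4]]]]].
        eapply rect_sum_extends with (O := with_negative I) (b1' := b1') (b2' := b2'); eauto. }
    destruct X as [e [f0 [X1 X2]]]. exists e, f0. split; auto. intros p Hp Sp. rewrite X2 by auto. apply Laplace_ext; auto.
Qed.

(** Every construction is linear, so the difference of the images is the image of [u = h - g]; the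
    central estimate, applied to [u] with its own sup norm as bound, gives a Lipschitz constant
    [N]. *)
Lemma sum_operator_continuous : continuous_E0_I I H H' S.
Proof.
  split; [exact sum_operator_maps|]. intros g Hg eps Heps.
  destruct (rect_sum_bound H r c k A _ b1 b2 d HD Hb Hd O1 O2) as [K [HK BK]].
  destruct punctured_ends as [P1 P2].
  pose proof (log_domain_translate _ _ _ _ _ HD) as HD'.
  pose proof (Cmod_ge_0 kap) as Hk0. pose proof (Cmod_ge_0 sig) as Hs0.
  set (N := Cmod kap + Cmod sig * K). assert (HN : 0 <= N) by (unfold N; pose proof (Rmult_le_pos _ _ Hs0 HK); lra).
  exists (eps / (N + 1)). split; [pos|]. intros h Hh Hdist.
  destruct (E0_bounded g (proj1 Hg)) as [Mg HMg]. destruct (E0_bounded h (proj1 Hh)) as [Mh HMh].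
  destruct (across_exists g Mg base Hg HMg base_in) as [fg Hfg]. destruct (across_exists h Mh base Hh HMh base_in) as [fh Hfh].
  pose proof (across_differentiable H I _ base fg Hfg) as Dg. pose proof (across_differentiable H I _ base fh Hfh) as Dh.
  set (D := norm_sup H (fun w => h w - g w)%C) in *.
  set (u := fun w => (1 * extend r h w + - (1) * extend r g w)%C).
  pose proof (regular_linear H _ _ _ _ 1%C (- (1))%C HMh HMg) as [U1 [U2 U3]]. fold u in U1, U2, U3.
  assert (Hu : regular H u D).
  { split; [|split]; auto. apply (closure_bound H r c k A HD); auto. intros w Hw.
    assert (E : forall z, H z -> u z = (h z - g z)%C).
    { intros z Hz. unfold u. rewrite !(extend_closure H r c k A HD) by (apply (H_closure _ _ _ _ _ HD); auto). ring. }
    rewrite E by auto. apply (norm_sup_ub H (fun w => h w - g w)%C (Cmod 1 * Mh + Cmod (- (1)) * Mg)); auto.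
    intros z Hz. rewrite <- E by auto. apply U3, (H_closure _ _ _ _ _ HD); auto. }
  assert (HD0 : 0 <= D) by (apply (M_nonneg H r c k A HD u D), Hu).
  set (f := fun p => (1 * fh p + - (1) * fg p)%C).
  assert (Bd : forall w, H' w -> Cmod (S h w - S g w) <= N * D).
  { intros w Hw. pose proof (H_closure _ _ _ _ _ HD' _ Hw) as Cw. pose proof (closure_translate_subset _ Cw) as HwH.
    rewrite (HS h fh Mh), (HS g fg Mg) by auto.
    assert (E : (kap * extend r h w + sig * rect_sum fh b1 b2 w - (kap * extend r g w + sig * rect_sum fg b1 b2 w) = kap * u w + sig * rect_sum f b1 b2 w)%C).
    { unfold f. rewrite (rect_sum_linear (with_negative I)) by auto. unfold u. ring. }
    rewrite E. tri. rewrite !Cmod_mult. unfold N. rewrite Rmult_plus_distr_r, Rmult_assoc.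
    apply Rplus_le_compat; apply Rmult_le_compat_l; auto.
    - apply Hu, (H_closure _ _ _ _ _ HD); auto.
    - apply (BK u D f base); auto.
      + apply base_in.
      + intros p Hp. apply differentiable_plus; apply differentiable_mult; auto; eexists; apply cder_const.
      + intros p Hp. pose proof (nonreal_slit p Hp) as Sp. unfold f. rewrite (proj2 Hfh), (proj2 Hfg) by auto.
        unfold u. rewrite (Laplace_linear H r c k A HD _ _ _ _ 1%C (- (1))%C HMh HMg); auto. apply (H_closure _ _ _ _ _ HD), base_in.
      + apply (H_closure _ _ _ _ _ HD); auto. }
  eapply Rle_lt_trans; [apply norm_sup_le; [|exact Bd]; pos|].
  apply Rle_lt_trans with (N * (eps / (N + 1))).
  - apply Rmult_le_compat_l; auto. lra.
  - apply Rmult_lt_reg_r with (N + 1); [lra|]. replace (N * (eps / (N + 1)) * (N + 1)) with (N * eps) by (field; lra). nra.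
Qed.
End SumOperator.

(** * The two partial sums and the conclusion *)

Lemma partial_sum_extend H r c k A I b1 b2 g w : log_domain H r c k A ->
  partial_sum H I b1 b2 g w = partial_sum H I b1 b2 (extend r g) w.
Proof.
  intros HD. assert (E : Laplace H g = Laplace H (extend r g)).
  { do 2 (apply functional_extensionality; intro). apply (Laplace_extend H r c k A HD). }
  unfold partial_sum, is_partial_sum, is_Laplace_across. rewrite E. reflexivity.
Qed.

Lemma partial_sum_infty_extend H r c k A I b g w : log_domain H r c k A ->
  partial_sum_infty H I b g w = partial_sum_infty H I b (extend r g) w.
Proof.
  intros HD. assert (E : Laplace H g = Laplace H (extend r g)).
  { do 2 (apply functional_extensionality; intro). apply (Laplace_extend H r c k A HD). }
  unfold partial_sum_infty, is_partial_sum_infty, is_Laplace_across. rewrite E. reflexivity.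
Qed.

(** Every convergent choice of base point and angle gives this value by [wedge_inversion], and
    [wedge_converges] supplies one such choice, so that [iota] is determined. *)
Lemma partial_sum_infty_value H r c k A I b g M w0 f w : log_domain H r c k A -> cone_exhausted H -> open_R I -> I b -> 0 <= b ->
  regular H g M -> (forall w0, H w0 -> exists f, is_Laplace_across H I g w0 f) ->
  H w0 -> is_Laplace_across H I g w0 f -> H w ->
  partial_sum_infty H I b g w = (g w - rect_sum f (-1) b w)%C.
Proof.
  intros HD HC HI Ib Hb Hg Hex Hw0 Hf Hw.
  assert (Om1 : with_negative I (-1)) by (right; lra). assert (Ob : with_negative I b) by (left; auto).
  assert (Legs : forall w1 f1 tau, H w1 -> is_Laplace_across H I g w1 f1 -> 0 < tau -> forall sg, sg = 1 \/ sg = -1 ->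
    first_leg (fun p => f1 p * Cexp (p * w))%C (b + 1) (1, (- (sg * tau))%R) = first_leg (fun p => Laplace H g w1 p * Cexp (p * w))%C (b + 1) (1, (- (sg * tau))%R) /\
    forall S, 0 <= S -> second_leg (fun p => f1 p * Cexp (p * w))%C (b + 1) (1, (- (sg * tau))%R) S = second_leg (fun p => Laplace H g w1 p * Cexp (p * w))%C (b + 1) (1, (- (sg * tau))%R) S).
  { intros w1 f1 tau Hw1 Hf1 Htau sg Hsg. split.
    - apply CInt_ext. intros t Ht. ordered in Ht. f_equal. f_equal. apply (proj2 Hf1), first_leg_slit; auto. lra.
    - intros S HS. apply CInt_ext. intros t Ht. rewrite Rmin_left in Ht by lra. f_equal. f_equal. apply (proj2 Hf1), upper_slit; auto; lra. }
  assert (DF : forall w1 f1, is_Laplace_across H I g w1 f1 -> forall p, punctured (with_negative I) p -> differentiable (fun p => f1 p * Cexp (p * w))%C p).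
  { intros w1 f1 Hf1 p Hp. apply differentiable_mult; [|apply differentiable_Cexp_mult]. apply (across_differentiable H I g w1 f1 Hf1); auto. }
  assert (Val : forall w1 f1 theta J, H w1 -> is_Laplace_across H I g w1 f1 -> 0 < theta < PI / 2 ->
    is_wedge_integral (fun p => f1 p * Cexp (p * w))%C b theta J -> (J / (2 * Ci * RtoC PI))%C = (g w - rect_sum f (-1) b w)%C).
  { intros w1 f1 theta J Hw1 Hf1 Hth HJ.
    assert (Htau : 0 < tan theta) by (apply tan_gt_0; lra).
    destruct (wedge_integral_legs (with_negative I) (fun p => f1 p * Cexp (p * w))%C b (tan theta) (with_negative_open I HI) (DF w1 f1 Hf1) Om1 Ob Hb Htau theta eq_refl J HJ) as [l [Hl E]].
    rewrite (proj1 (Legs w1 f1 _ Hw1 Hf1 Htau 1 ltac:(auto))), (proj1 (Legs w1 f1 _ Hw1 Hf1 Htau (-1) ltac:(auto))) in E.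
    rewrite (wedge_inversion H r c k A HD g M Hg w1 w (tan theta) (b + 1) Hw1 Hw Htau ltac:(lra) l) in E.
    - rewrite (across_rect_sum_unique H r c k A HD I g M Hg w0 w1 f f1 (-1) b w); auto.
      unfold rect_sum. replace J with (2 * Ci * RtoC PI * g w - rectint (fun p => f1 p * Cexp (p * w)) (-1) b (-1) 1)%C by (rewrite <- E; ring).
      pose proof two_pi_i_neq_0 as Np. set (P := (2 * Ci * RtoC PI)%C) in *. field. exact Np.
    - intros sg Hsg. eapply clim_ext_ge with (T1 := 0); [|apply Hl; exact Hsg]. intros T HT. apply (proj2 (Legs w1 f1 _ Hw1 Hf1 Htau sg Hsg)). lra. }
  destruct (wedge_converges H r c k A HD HC g M Hg w b Hw Hb) as [w1 [theta [l [Hw1 [Hth Hl]]]]].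
  assert (Htau : 0 < tan theta) by (apply tan_gt_0; lra).
  destruct (Hex w1 Hw1) as [f1 Hf1].
  destruct (wedge_integral_exists (with_negative I) (fun p => f1 p * Cexp (p * w))%C b (tan theta) (with_negative_open I HI) (DF w1 f1 Hf1) Ob Hb Htau theta eq_refl l) as [J HJ].
  { intros sg Hsg. eapply clim_ext_ge with (T1 := 0); [|apply Hl; exact Hsg]. intros T HT. symmetry. apply (proj2 (Legs w1 f1 _ Hw1 Hf1 Htau sg Hsg)). lra. }
  apply (iota_unique (V := C_R_CompleteNormedModule)).
  - intros s [w2 [f2 [th2 [J2 [Q1 [Q2 [Q3 [Q4 ->]]]]]]]]. apply (Val w2 f2 th2); auto.
  - exists w1, f1, theta, J. split; auto. split; auto. split; auto. split; auto. symmetry. apply (Val w1 f1 theta); auto.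
Qed.

Lemma ball_set_open x r : open_R (ball_set x r).
Proof.
  intros y Hy. unfold ball_set in *. exists (Rmin (y - (x - r)) (x + r - y)). split; [apply Rmin_pos; lra|].
  intros z Hz. pose proof (Rmin_l (y - (x - r)) (x + r - y)). pose proof (Rmin_r (y - (x - r)) (x + r - y)). apply Rabs_def2 in Hz. lra.
Qed.

Lemma between_ball x r y z : ball_set x r y -> 0 < r -> Rmin x y <= z <= Rmax x y -> ball_set x r z.
Proof. unfold ball_set, Rmin, Rmax. destruct (Rle_dec x y); lra. Qed.

Theorem theorem2 (H : C -> Prop)
    (Hlog : logarithmic_neighborhood H)
    (Hleft : forall w : C, H w -> Re w <= 0) :
  (forall beta1 beta2 r : R, beta1 < beta2 -> 0 < r ->
     let I := fun x : R => ball_set beta1 r x \/ ball_set beta2 r x in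
     continuous_E0_I I H (translate (-1) H) (partial_sum H I beta1 beta2)) /\
  (forall beta3 r : R, 0 <= beta3 -> 0 < r ->
     let I := ball_set beta3 r in
     continuous_E0_I I H (translate (-1) H) (partial_sum_infty H I beta3)).
Proof.
  destruct (logarithmic_log_domain H Hlog Hleft) as [HC [r0 [c [k [A HD]]]]].
  split.
  - intros b1 b2 r Hb Hr I.
    assert (HI : open_R I).
    { intros x [Hx|Hx]; destruct (ball_set_open _ _ x Hx) as [d [Hd B]]; exists d; (split; [auto|]); intros y Hy; [left|right]; auto. }
    (* Half of the radius is kept so that the closed intervals used by the averaging stay inside the
       open gaps. *)
    apply (sum_operator_continuous H r0 c k A HD I b1 b2 (r / 2)) with (kap := RtoC 0) (sig := RtoC 1); auto; try lra.
    + intros x Hx. left. left. unfold ball_set. apply Rabs_le_between in Hx. lra.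
    + intros x Hx. left. right. unfold ball_set. apply Rabs_le_between in Hx. lra.
    + intros beta [Ib|Ib] _; unfold ball_set in Ib.
      (* For [beta] in the first gap both sides move right by the same amount, less than [r]: each
         stays in its own gap, their order is preserved, and [beta] is left outside. The second gap
         is symmetric, with a move to the left. *)
      * exists ((Rmax beta b1 + (b1 + r)) / 2), ((Rmax beta b1 + (b1 + r)) / 2 + (b2 - b1)).
        pose proof (Rmax_l beta b1) as Q1. pose proof (Rmax_r beta b1) as Q2. assert (Q3 : Rmax beta b1 < b1 + r) by (apply Rmax_lub_lt; lra).
        split; [lra|]. split; [left; lra|]. split; intros x Hx; left; [left|right]; refine (between_ball _ r _ _ _ Hr Hx); unfold ball_set; lra.
      * exists ((Rmin beta b2 + (b2 - r)) / 2 - (b2 - b1)), ((Rmin beta b2 + (b2 - r)) / 2).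
        pose proof (Rmin_l beta b2) as Q1. pose proof (Rmin_r beta b2) as Q2. assert (Q3 : b2 - r < Rmin beta b2) by (apply Rmin_glb_lt; lra).
        split; [lra|]. split; [right; lra|]. split; intros x Hx; left; [left|right]; refine (between_ball _ r _ _ _ Hr Hx); unfold ball_set; lra.
    + intros g f M w Hg HM Hf Hw. rewrite (partial_sum_extend H r0 c k A) by auto.
      rewrite (partial_sum_rect H r0 c k A HD I HI (extend r0 g) M HM (RtoC (r0 0 - 1)) f b1 b2 w); auto.
      * ring.
      * apply (base_in H r0 c k A HD).
      * left; unfold ball_set; lra.
      * right; unfold ball_set; lra.
  - intros b r Hb Hr I. assert (HI : open_R I) by apply ball_set_open.
    assert (Ib : I b) by (unfold I, ball_set; lra).
    (* The bound [1 / 2] keeps the interval around the left crossing point [-1] on the negative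
       axis. *)
    apply (sum_operator_continuous H r0 c k A HD I (-1) b (Rmin (r / 2) (1 / 2))) with (kap := RtoC 1) (sig := RtoC (-1)); auto; try lra.
    + apply Rmin_pos; lra.
    + intros x Hx. right. pose proof (Rmin_r (r / 2) (1 / 2)). apply Rabs_le_between in Hx. lra.
    + intros x Hx. left. unfold I, ball_set. pose proof (Rmin_l (r / 2) (1 / 2)). apply Rabs_le_between in Hx. lra.
    + intros beta Hbeta Pbeta. unfold I, ball_set in Hbeta. set (m := Rmax (b - r) (-1)).
      assert (Q1 : b - r <= m) by apply Rmax_l. assert (Q2 : -1 <= m) by apply Rmax_r. assert (Q3 : m < Rmin beta b) by (apply Rmin_glb_lt; apply Rmax_lub_lt; lra).
      pose proof (Rmin_l beta b) as Q4. pose proof (Rmin_r beta b) as Q5.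
      (* Only the right side moves, to a point of the gap left of [beta] and right of [-1]; the
         maximum with [-1] in [m] matters when the gap reaches further left than [-1]. *)
      exists (-1), ((m + Rmin beta b) / 2). split; [lra|]. split; [right; lra|]. split; intros x Hx.
      * right. rewrite Rmin_left, Rmax_left in Hx by lra. lra.
      * left. refine (between_ball _ r _ _ _ Hr Hx). unfold ball_set; lra.
    + intros g f M w Hg HM Hf Hw. rewrite (partial_sum_infty_extend H r0 c k A) by auto.
      rewrite (partial_sum_infty_value H r0 c k A I b (extend r0 g) M (RtoC (r0 0 - 1)) f w); auto.
      * replace (RtoC (-1)) with (- (1))%C by cring. ring.
      * intros w0 Hw0. eapply across_exists; eauto.
      * apply (base_in H r0 c k A HD).
      * eapply closure_translate_subset; eauto.
Qed.
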